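(* Define $J_0^{(0)}:L^2(\Omega;\mathbb{R}^2)\times L^2(\Omega;\mathbb{R}^2)\to[0,\infty]$ by $$J_0^{(0)}[U,W]=\int_\Omega\tfrac12\left(C|\nabla v_u|^2+K|\nabla v_w|^2+2R\,\nabla v_u\cdot\nabla v_w\right)dx\,dy+\sum_{i=1}^N\frac{C(b_u^i)^2+K(b_w^i)^2+2R\,b_u^ib_w^i}{4\pi}$$ if $(U,W)=(\nabla v_u,\nabla v_w)$ for some $v_u,v_w\in H^1(\Omega)$, and $J_0^{(0)}[U,W]=\infty$ otherwise. Then, for every $(U,W)\in L^2(\Omega;\mathbb{R}^2)\times L^2(\Omega;\mathbb{R}^2)$: (1) for any family $(U_\varepsilon,W_\varepsilon)\in L^2(\Omega;\mathbb{R}^2)\times L^2(\Omega;\mathbb{R}^2)$ with $(U_\varepsilon,W_\varepsilon)\rightharpoonup(U,W)$ weakly in $L^2(\Omega)$ as $\varepsilon\to0$, one has $\liminf_{\varepsilon\to0}J_\varepsilon^{(0)}[U_\varepsilon,W_\varepsilon]\ge J_0^{(0)}[U,W]$; (2) there exists a family $(U_\varepsilon,W_\varepsilon)\in L^2(\Omega;\mathbb{R}^2)\times L^2(\Omega;\mathbb{R}^2)$ with $(U_\varepsilon,W_\varepsilon)\rightharpoonup(U,W)$ weakly in $L^2(\Omega)$ as $\varepsilon\to0$ and $\limsup_{\varepsilon\to0}J_\varepsilon^{(0)}[U_\varepsilon,W_\varepsilon]\le J_0^{(0)}[U,W]$. That is, $J_\varepsilon^{(0)}$ $\Gamma$-converges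 to $J_0^{(0)}$ with respect to weak $L^2(\Omega)$ convergence.
   Context: $\Omega\subset\mathbb{R}^2$ is bounded, open and simply connected, with Lipschitz boundary. $d_1,\dots,d_N\in\Omega$ ($N\ge1$) are distinct points, and $b_u^i,b_w^i\in\mathbb{R}$ ($i=1,\dots,N$). $C,R,K\in\mathbb{R}$ satisfy $C,K>0$ and $CK>R^2$. $B_\rho(d)=\{z\in\mathbb{R}^2:|z-d|\le\rho\}$. The parameter $\varepsilon$ ranges over $(0,\varepsilon_0)$ with $\varepsilon_0<1$ so small that the balls $B_{\varepsilon_0}(d_i)$ are pairwise disjoint and contained in $\Omega$. $\Omega_\varepsilon=\Omega\setminus\bigcup_{i=1}^N B_\varepsilon(d_i)$. $\nabla\times f=\partial_xf_y-\partial_yf_x$. The set $H_0^\varepsilon$ consists of pairs $(f,g)$ with $f,g\in L^2(\Omega_\varepsilon;\mathbb{R}^2)$, $\nabla\times f=\nabla\times g=0$ in $\Omega_\varepsilon$, and $\int_{\partial B_\varepsilon(d_i)}f\cdot t\,ds=b_u^i$, $\int_{\partial B_\varepsilon(d_i)}g\cdot t\,ds=b_w^i$ for all $i$, where $t$ is the counterclockwise unit tangent and $f\cdot t,g\cdot t$ are tangential traces (well defined for $L^2$ curl-free fields). $J_\varepsilon^{(0)}:L^2(\Omega;\mathbb{R}^2)\times L^2(\Omega;\mathbb{R}^2)\to[0,\infty]$ is defined by $$J_\varepsilon^{(0)}[f,g]=\int_{\Omega_\varepsilon}\tfrac12\left(C|f|^2+K|g|^2+2R\,f\cdot g\right)dx\,dy$$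 if $(f,g)=\left(|\ln\varepsilon|^{-1/2}\tilde f,\ |\ln\varepsilon|^{-1/2}\tilde g\right)$ on $\Omega_\varepsilon$ for some $(\tilde f,\tilde g)\in H_0^\varepsilon$, and $J_\varepsilon^{(0)}[f,g]=\infty$ otherwise. *)

(* Defs.v *)
From mathcomp Require Import all_boot all_order all_algebra.
From mathcomp Require Import all_classical all_reals all_analysis.
Set Implicit Arguments.
Unset Strict Implicit.
Unset Printing Implicit Defensive.
Import Order.TTheory GRing.Theory Num.Theory.
Import numFieldTopology.Exports numFieldNormedType.Exports.
Local Open Scope classical_set_scope.
Local Open Scope ring_scope.

Section Plane.
Context {R : realType}.
Local Notation area := (@lebesgue_measure R \x @lebesgue_measure R)%E.
Implicit Types (p q z : R * R) (D O : set (R * R)) (r : R).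

Definition dot p q : R := p.1 * q.1 + p.2 * q.2.

(* The norm carried by the product type [R * R] is the sup norm, so Euclidean
   balls are written out. *)
Definition disk p r : set (R * R) := [set z | Num.sqrt (dot (z - p) (z - p)) <= r].

Definition unit_square : set (R * R) := `[0, 1]%classic `*` `[0, 1]%classic.

Definition path_connected D : Prop :=
  forall p q, D p -> D q -> exists g : R -> R * R,
    [/\ {within `[0, 1]%classic, continuous g}, g @` `[0, 1]%classic `<=` D,
        g 0 = p & g 1 = q].

Definition null_homotopic_in D (g : R -> R * R) : Prop :=
  exists H : R * R -> R * R,
    [/\ {within unit_square, continuous H}, H @` unit_square `<=` D,
        forall t, t \in `[0, 1] -> H (t, 0) = g t /\ H (t, 1) = g 0
      & forall s, s \in `[0, 1] -> H (0, s) = g 0 /\ H (1, s) = g 0].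

Definition simply_connected D : Prop :=
  path_connected D /\
  forall g : R -> R * R, {within `[0, 1]%classic, continuous g} ->
    g @` `[0, 1]%classic `<=` D -> g 0 = g 1 -> null_homotopic_in D g.

(* Near each boundary point, in coordinates rotated by the angle whose cosine
   and sine are [a] and [b], the set lies strictly above a Lipschitz graph. *)
Definition lipschitz_boundary O : Prop :=
  forall p, (closure O `\` interior O) p ->
  exists (r a b k : R) (h : R -> R),
    [/\ 0 < r, a ^+ 2 + b ^+ 2 = 1, k.-lipschitz h
      & forall z, disk p r z ->
          O z <-> h (a * z.1 + b * z.2) < a * z.2 - b * z.1].

Definition dx (f : R * R -> R) z : R := 'D_((1, 0) : R * R) f z.
Definition dy (f : R * R -> R) z : R := 'D_((0, 1) : R * R) f z.

Fixpoint Ck (k : nat) (f : R * R -> R) : Prop :=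
  continuous f /\
  if k is j.+1 then
    [/\ forall z, derivable f z ((1, 0) : R * R),
        forall z, derivable f z ((0, 1) : R * R),
        Ck j (dx f) & Ck j (dy f)]
  else True.

Definition test_fun D (f : R * R -> R) : Prop :=
  [/\ forall k, Ck k f, compact (closure [set z | f z != 0])
    & closure [set z | f z != 0] `<=` D].

(* Functions are defined on the whole plane; only their values on [D] matter. *)
Definition L2 D (f : R * R -> R) : Prop := (f \_ D) \in Lfun area 2%:E.

Definition L2v D (f : R * R -> R * R) : Prop :=
  L2 D (fst \o f) /\ L2 D (snd \o f).

Definition weak_cvg D (F : R -> R * R -> R * R) (G : R * R -> R * R) : Prop :=
  forall Phi : R * R -> R * R, L2v D Phi ->
    (\int[area]_(z in D) dot (F eps z) (Phi z))%R @[eps --> 0^'+]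
      --> (\int[area]_(z in D) dot (G z) (Phi z))%R.

(* [v] is in H^1(D), with gradient (almost everywhere) equal to [G]. *)
Definition H1_gradient D (v : R * R -> R) (G : R * R -> R * R) : Prop :=
  [/\ L2 D v, L2v D G
    & forall phi, test_fun D phi ->
        \int[area]_(z in D) (v z * dx phi z)
          = - (\int[area]_(z in D) ((G z).1 * phi z)) /\
        \int[area]_(z in D) (v z * dy phi z)
          = - (\int[area]_(z in D) ((G z).2 * phi z))].

(* Green's formula: for a smooth curl-free [f] and the positively oriented unit
   tangent tau of the boundary of [D],
     int_{boundary of D} phi (f . tau) ds = int_D (f_y dx phi - f_x dy phi).
   For a curl-free [f] that is only L^2, the right-hand side defines the
   tangential trace f . tau as a functional of the boundary values of [phi]. *)
Definition tangential_trace D (f : R * R -> R * R) (phi : R * R -> R) : R :=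
  \int[area]_(z in D) ((f z).2 * dx phi z - (f z).1 * dy phi z).

(* Distributionally: the functional above vanishes on test functions of [D]. *)
Definition curl_free D (f : R * R -> R * R) : Prop :=
  forall phi, test_fun D phi -> tangential_trace D f phi = 0.

Section Dislocations.
Variables (Omega : set (R * R)) (N : nat) (d : 'I_N -> R * R).
Variables (bu bw : 'I_N -> R) (Cc Rc Kc : R).

Definition perforated (eps : R) : set (R * R) :=
  Omega `\` \bigcup_(i in [set: 'I_N]) disk (d i) eps.

(* The tangential trace of [f] is evaluated on the function equal to 1 on the
   i-th circle and 0 on the rest of the boundary of the perforated domain,
   extended to a smooth cutoff; the value does not depend on the cutoff.  The
   sign is there because the counterclockwise tangent of the circle is opposite
   to the positive orientation of the boundary of the perforated domain. *)
Definition circulation_eq (eps : R) (i : 'I_N) (f : R * R -> R * R) (b : R)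
    : Prop :=
  forall phi, test_fun Omega phi ->
    (exists2 r, eps < r & forall j z, disk (d j) r z -> phi z = (j == i)%:R) ->
    - tangential_trace (perforated eps) f phi = b.

Definition H0 (eps : R) (f g : R * R -> R * R) : Prop :=
  [/\ L2v (perforated eps) f /\ L2v (perforated eps) g,
      curl_free (perforated eps) f /\ curl_free (perforated eps) g
    & forall i, circulation_eq eps i f (bu i) /\ circulation_eq eps i g (bw i)].

Definition energy_density p q : R :=
  2^-1 * (Cc * dot p p + Kc * dot q q + 2 * Rc * dot p q).

Definition Jeps (eps : R) (f g : R * R -> R * R) : \bar R :=
  if `[< exists ft gt : R * R -> R * R, H0 eps ft gt /\
         {ae area, forall z, perforated eps z ->
            f z = `|ln eps| `^ (- 2^-1) *: ft z /\
            g z = `|ln eps| `^ (- 2^-1) *: gt z} >]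
  then (\int[area]_(z in perforated eps) (energy_density (f z) (g z))%:E)%E
  else +oo%E.

Definition J0 (U W : R * R -> R * R) : \bar R :=
  if `[< exists vu vw : R * R -> R,
           H1_gradient Omega vu U /\ H1_gradient Omega vw W >]
  then (\int[area]_(z in Omega) (energy_density (U z) (W z))%:E
        + (\sum_(i < N) (Cc * bu i ^+ 2 + Kc * bw i ^+ 2
                         + 2 * Rc * bu i * bw i) / (4 * pi))%R%:E)%E
  else +oo%E.

End Dislocations.
End Plane.

(* Main.v *)
(* Upper bound.  Let v_i be the gradient of the angle about d_i divided by 2 pi, so that v_i is curl-free
   with circulation 1 and |v_i|^2 = 1/(4 pi^2 r^2).  The recovery sequence is
   U + |ln eps|^(-1/2) sum_i b_i v_i on the perforated domain.  In its energy the integrals of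
   |ln eps|^(-1) |v_i|^2 tend to 1/(2 pi), and all other terms vanish, because |ln eps|^(-1/2) v_i is
   bounded in L^2 and concentrates at d_i.

   Lower bound.  The energy density e is convex, so e(F) >= B(F0, F) - e(F0) with B its polar form.  Take
   for F0 the limit (U, W) outside the disks of radius del, and a multiple of (b_u^i, b_w^i) k_i around d_i,
   where k_i is the rotated gradient of a logarithmic cutoff at d_i: the integral of k_i . F is exactly the
   circulation of F, and optimising the multiple yields the term of d_i.

   Limits are gradients.  A test function can be made constant near each d_i at a vanishing cost in H^1,
   so the weak limit is curl-free on the whole of Omega.  A curl-free field is orthogonal to every
   divergence-free test field: the stream function of the latter vanishes off Omega, as is seen by
   integrating it against the angle about an outer point, which is single-valued on the simply connected
   Omega.  A potential v is then determined by int v phi = - int U . psi with div psi = phi - (int phi) rho;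
   such psi are found on small balls by averaging along segments, and near the boundary by translating into
   Omega, which stays above a Lipschitz graph. *)

From HB Require Import structures.
Require Import Defs.
From mathcomp Require Import all_boot all_order all_algebra.
From mathcomp Require Import all_classical all_reals all_analysis.
From mathcomp Require Import measurable_realfun.
From mathcomp Require Import ring lra.
Import Order.TTheory GRing.Theory Num.Theory.
Import numFieldTopology.Exports numFieldNormedType.Exports.
Set Implicit Arguments.
Unset Strict Implicit.
Unset Printing Implicit Defensive.
Local Open Scope classical_set_scope.
Local Open Scope ring_scope.

(** * Integration on the plane *)

Section PlaneMeasure.
Context {R : realType}.
Local Notation area := (@lebesgue_measure R \x @lebesgue_measure R)%E.

(** Traces and circulations are known only through Green's formula, so each use of them is a pairing
    with a test function. An admissible cutoff must equal 1 slightly beyond radius [eps], whence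
    radii such as [2 * eps].

    The constant 1/(4 pi) is a capacity. The logarithmic cutoff between [eps] and [del] has
    Dirichlet integral about 2 pi / |ln eps|, so the tangent inequality gains t lam - t^2 pi / |ln
    eps| per unit of the quadratic form; with lam^2 = 1 / |ln eps| the maximum over t is 1/(4 pi).

    The obstacle on the side of the potential is square-integrability up to the boundary for a field
    without pointwise values. The potential is therefore read off as the density representing phi
    |-> int U . psi. Each psi is built from averages of translates, whose transposes produce
    square-integrable functions, and orthogonality makes the value independent of the choice of psi.

    Radial integrals need no polar coordinates: the divergence theorem determines them up to one
    factor, which the Gaussian integral identifies as pi. No compactness of families is needed: the
    weak limit is given, and the lower bound is tested along sequences whose energy stays below a
    level. *)

Lemma ball_prodE (p : R * R) (e : R) : ball p e = ball p.1 e `*` ball p.2 e.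
Proof. by apply/seteqP; split => -[x y] []. Qed.

(** Measurability refers to the product sigma-algebra, which is generated by rectangles; an open set
    is a countable union of square balls with rational centres and radii 1/(n+1). *)
Lemma open_measurable_plane (A : set (R * R)) : open A ->
  measurable (A : set (measurableTypeR R * measurableTypeR R)).
Proof.
move=> oA.
pose F (q : rat * rat * nat) : set (R * R) :=
  let p := (ratr q.1.1, ratr q.1.2) : R * R in
  if `[< ball p q.2.+1%:R^-1 `<=` A >] then ball p q.2.+1%:R^-1 else set0.
have -> : A = \bigcup_q F q.
  apply/seteqP; split => [p Ap|p [q _]]; last first.
    by rewrite /F; case: asboolP => // H; exact: H.
  have /nbhs_ballP[e /= e0 eA] : nbhs p A by apply: open_nbhs_nbhs; split.
  have [n ne] : exists n : nat, n.+1%:R^-1 < e / 2.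
    have [n _ /(_ n (leqnn _))] := near_infty_natSinv_lt (PosNum (divr_gt0 e0 (ltr0n _ 2))).
    by exists n.
  have rat_close (x : R) : exists q : rat, ball (ratr q : R) n.+1%:R^-1 x.
    have xlt : x < x + n.+1%:R^-1 by rewrite ltrDl invr_gt0.
    have [q] := rat_in_itvoo xlt.
    rewrite in_itv/= => /andP[q1 q2]; exists q.
    rewrite /ball/= ltr_distl; move: (_^-1) q1 q2 => t q1 q2.
    apply/andP; split; lra.
  have [q1 hq1] := rat_close p.1; have [q2 hq2] := rat_close p.2.
  exists (q1, q2, n) => //; rewrite /F /=.
  have pq : ball (ratr q1 : R, ratr q2 : R) n.+1%:R^-1 p by split.
  case: asboolP => // -[] z qz; apply: eA.
  have := ball_triangle (ball_sym pq) qz; apply: le_ball.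
  by move: (n.+1%:R^-1) ne => t; lra.
apply: countable_bigcupT_measurable; first exact: countableP.
move=> q; rewrite /F; case: asboolP => _; last exact: measurable0.
by rewrite ball_prodE; apply: measurableX; apply: open_measurable; exact: ball_open.
Qed.

Lemma continuous_measurable_plane (f : R * R -> R) : continuous f ->
  measurable_fun setT (f : measurableTypeR R * measurableTypeR R -> measurableTypeR R).
Proof.
move=> /continuousP cf; apply: (measurability _ (RGenOpens.measurableE R)).
move=> _ [_ [a [b ->] <-]]; rewrite setTI; apply: open_measurable_plane.
exact/cf/interval_open.
Qed.

Lemma closed_measurable_plane (A : set (R * R)) : closed A ->
  measurable (A : set (measurableTypeR R * measurableTypeR R)).
Proof. by move/closed_openC/open_measurable_plane/measurableC; rewrite setCK. Qed.

End PlaneMeasure.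

(** * Real-valued integrals and square-integrable functions *)

Section L1.
Context d (T : measurableType d) (R : realType) (mu : {measure set T -> \bar R}).
Implicit Types f g h : T -> R.

Definition L1 f := mu.-integrable setT (EFin \o f).
(** The working form of membership in [Lfun] with exponent 2 ([sqint_Lfun]): it is stable under
    pointwise bounds and keeps all integrals real-valued. *)
Definition sqint f := measurable_fun setT f /\ L1 (fun z => f z ^+ 2).

Lemma L1_measurable f : L1 f -> measurable_fun setT f.
Proof. by move=> /integrableP[/measurable_EFinP]. Qed.

Lemma L1_le f g : measurable_fun setT f -> (forall z, `|f z| <= g z) -> L1 g -> L1 f.
Proof.
move=> mf fg; apply: le_integrable => //; first exact/measurable_EFinP.
by move=> z _ /=; rewrite lee_fin (le_trans (fg z))// ler_norm.
Qed.

Lemma L1D f g : L1 f -> L1 g -> L1 (fun z => f z + g z).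
Proof. by move=> Lf Lg; exact: (integrableD measurableT Lf Lg). Qed.

Lemma L1N f : L1 f -> L1 (fun z => - f z).
Proof. by move=> Lf; exact: (integrableN Lf). Qed.

Lemma L1B f g : L1 f -> L1 g -> L1 (fun z => f z - g z).
Proof. by move=> Lf Lg; apply: L1D => //; exact: L1N. Qed.

Lemma L1Z k f : L1 f -> L1 (fun z => k * f z).
Proof. by move=> Lf; exact: (integrableZl measurableT k Lf). Qed.

Lemma L1_0 : L1 (fun=> 0).
Proof. exact: (integrable0 mu setT). Qed.

Lemma L1_indic (A : set T) : measurable A -> (mu A < +oo)%E -> L1 (\1_A : T -> R).
Proof.
move=> mA Aoo; apply/integrableP; split; first exact/measurable_EFinP.
rewrite (eq_integral (fun x => (\1_A x)%:E)); last first.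
  by move=> t _; rewrite gee0_abs// lee_fin.
by rewrite integral_indic// setIT.
Qed.

Lemma L1_norm f : L1 f -> L1 (fun z => `|f z|).
Proof. by move=> Lf; exact: (integrable_norm Lf). Qed.

Lemma L1_sum (I : Type) (s : seq I) (F : I -> T -> R) :
  (forall i, L1 (F i)) -> L1 (fun z => \sum_(i <- s) F i z).
Proof.
move=> LF; elim: s => [|i s IH].
  by apply: eq_integrable L1_0 => // z _ /=; rewrite big_nil.
apply: eq_integrable (L1D (LF i) IH) => //.
by move=> z _ /=; rewrite big_cons.
Qed.

Lemma eq_L1 f g : (forall z, f z = g z) -> L1 f -> L1 g.
Proof. by move=> /funext ->. Qed.

Local Notation I f := (\int[mu]_z f z).

Lemma eq_int f g : (forall z, f z = g z) -> I f = I g.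
Proof. by move=> fg; apply: eq_Rintegral => z _. Qed.

Lemma intD f g : L1 f -> L1 g -> I (fun z => f z + g z) = I f + I g.
Proof. exact: RintegralD. Qed.

Lemma intB f g : L1 f -> L1 g -> I (fun z => f z - g z) = I f - I g.
Proof. exact: RintegralB. Qed.

Lemma intZ k f : L1 f -> I (fun z => k * f z) = k * I f.
Proof. by move=> Lf; apply: RintegralZl. Qed.

Lemma intN f : L1 f -> I (fun z => - f z) = - I f.
Proof.
move=> Lf; rewrite -mulN1r -intZ//; apply: eq_Rintegral => z _.
by rewrite mulN1r.
Qed.

Lemma int0 : I (fun=> 0) = 0.
Proof. by rewrite /Rintegral integral0. Qed.

Lemma int_sum (J : Type) (s : seq J) (F : J -> T -> R) :
  (forall i, L1 (F i)) -> I (fun z => \sum_(i <- s) F i z) = \sum_(i <- s) I (F i).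
Proof.
move=> LF; elim: s => [|i s IH].
  by rewrite big_nil -[RHS]int0; apply: eq_int => z; rewrite big_nil.
rewrite big_cons -IH -intD//; last exact: L1_sum.
by apply: eq_int => z; rewrite big_cons.
Qed.

Lemma int_ge0 f : (forall z, 0 <= f z) -> 0 <= I f.
Proof. by move=> f0; apply: Rintegral_ge0. Qed.

Lemma int_le f g : L1 f -> L1 g -> (forall z, f z <= g z) -> I f <= I g.
Proof. by move=> Lf Lg fg; apply: le_Rintegral. Qed.

Lemma int_norm f : L1 f -> `|I f| <= I (fun z => `|f z|).
Proof. by move=> Lf; apply: le_normr_Rintegral. Qed.

Lemma int_EFin f : L1 f -> (\int[mu]_z (f z)%:E)%E = (I f)%:E.
Proof. by move=> Lf; rewrite /Rintegral fineK//; exact: integrable_fin_num. Qed.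

Lemma int_dct (F : nat -> T -> R) f g : (forall n, measurable_fun setT (F n)) ->
  (forall z, F n z @[n --> \oo] --> f z) -> (forall n z, `|F n z| <= g z) -> L1 g ->
  L1 f /\ I (F n) @[n --> \oo] --> I f.
Proof.
move=> mF Ff Fg Lg.
have mf : measurable_fun setT f by apply: (measurable_fun_cvg (h := F)) => // z _; exact: Ff.
have := @dominated_convergence _ _ _ mu setT measurableT (fun n => EFin \o F n)
   (EFin \o f) (EFin \o g).
case.
- by move=> n; exact/measurable_EFinP.
- exact/measurable_EFinP.
- by apply/aeW => z _; apply: cvg_EFin (Ff z); exact: nearW.
- exact: Lg.
- by apply/aeW => z n _; rewrite /= lee_fin.
move=> Lf _ Icv; split=> //.
have : fine (\int[mu]_x (EFin \o F n) x)%E @[n --> \oo] --> I f.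
  by apply: fine_cvg; rewrite fineK//; exact: integrable_fin_num.
by [].
Qed.

Lemma sqint_measurable f : sqint f -> measurable_fun setT f.
Proof. by case. Qed.

Lemma sqint_mul f g : sqint f -> sqint g -> L1 (fun z => f z * g z).
Proof.
move=> [mf Lf] [mg Lg]; apply: (L1_le _ _ (L1D Lf Lg)).
  exact: measurable_funM.
move=> z; rewrite normrM -[f z ^+ 2]real_normK ?num_real//.
rewrite -[g z ^+ 2]real_normK ?num_real//.
have := sqr_ge0 (`|f z| - `|g z|); have := normr_ge0 (f z); have := normr_ge0 (g z).
nra.
Qed.

Lemma sqint_le f g : measurable_fun setT f -> (forall z, `|f z| <= `|g z|) ->
  sqint g -> sqint f.
Proof.
move=> mf fg [mg Lg]; split=> //; apply: L1_le Lg.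
  exact: measurable_funX.
move=> z; rewrite normrX -[g z ^+ 2]real_normK ?num_real//.
by rewrite lerXn2r ?nnegrE.
Qed.

Lemma sqintD f g : sqint f -> sqint g -> sqint (fun z => f z + g z).
Proof.
move=> Sf Sg; split; first by apply: measurable_funD; [case: Sf|case: Sg].
have L := L1D (L1D (proj2 Sf) (proj2 Sg)) (L1Z 2 (sqint_mul Sf Sg)).
by apply: eq_L1 L => z /=; ring.
Qed.

Lemma sqintZ k f : sqint f -> sqint (fun z => k * f z).
Proof.
move=> [mf Lf]; split; first exact: measurable_funM.
by apply: eq_L1 (L1Z (k ^+ 2) Lf) => z; ring.
Qed.

Lemma sqintB f g : sqint f -> sqint g -> sqint (fun z => f z - g z).
Proof.
move=> Sf Sg; have := sqintD Sf (sqintZ (-1) Sg).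
by congr sqint; apply/funext => z; rewrite mulN1r.
Qed.

Lemma sqint0 : sqint (fun=> 0).
Proof. by split; [exact: measurable_cst|apply: eq_L1 L1_0 => z; rewrite expr0n]. Qed.

Lemma sqint_sum (J : Type) (s : seq J) (F : J -> T -> R) :
  (forall i, sqint (F i)) -> sqint (fun z => \sum_(i <- s) F i z).
Proof.
move=> SF; elim: s => [|i s IH].
  by have := sqint0; congr sqint; apply/funext => z; rewrite big_nil.
have := sqintD (SF i) IH.
by congr sqint; apply/funext => z; rewrite big_cons.
Qed.

Lemma sqint_bounded f g (M : R) : measurable_fun setT g -> (forall z, `|g z| <= M) ->
  sqint f -> sqint (fun z => g z * f z).
Proof.
move=> mg gM Sf; apply: sqint_le (sqintZ M Sf).
  by apply: measurable_funM => //; case: Sf.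
by move=> z; rewrite !normrM ler_wpM2r// (le_trans (gM z))// ler_norm.
Qed.

Lemma L1_bounded f g (M : R) : measurable_fun setT g -> (forall z, `|g z| <= M) ->
  L1 f -> L1 (fun z => g z * f z).
Proof.
move=> mg gM Lf; apply: (L1_le _ _ (L1Z M (L1_norm Lf))).
  by apply: measurable_funM => //; exact: L1_measurable.
by move=> z; rewrite normrM ler_wpM2r.
Qed.

Lemma sqint_Lfun f : (f \in Lfun mu 2%:E) <-> sqint f.
Proof.
split=> [Lf|[mf Lf]].
  by split; [move: Lf; rewrite inE => /andP[/[!inE]]|exact: Lfun2_integrable_sqr].
rewrite inE; apply/andP; split; rewrite inE//= /finite_norm unlock /=.
rewrite poweR_lty//.
move: Lf => /integrableP[_]; apply: le_lt_trans.
apply: ge0_le_integral => //=.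
- apply/measurable_EFinP.
  apply: (measurableT_comp (measurable_powR _)) => //.
  exact: measurableT_comp.
- apply/measurable_EFinP; apply: measurableT_comp => //.
  exact: measurable_funX.
- by move=> z _; rewrite lee_fin normrX powR_mulrn.
Qed.

End L1.

Section ProductSigmaFinite.
Local Open Scope ereal_scope.
Context d1 d2 (T1 : measurableType d1) (T2 : measurableType d2) (R : realType).
Variable m1 : {sigma_finite_measure set T1 -> \bar R}.
Variable m2 : {sigma_finite_measure set T2 -> \bar R}.

(* [m1 \x m2] under an alias: the library attaches to the product itself a
   sigma-finite structure which is only inferred for subprobabilities. *)
Definition prodm : set (T1 * T2) -> \bar R := m1 \x m2.

HB.instance Definition _ := Measure.copy prodm (m1 \x m2).

Let prodm_sigma_finite : sigma_finite setT prodm.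
Proof.
have /sigma_finiteP[F [TF ndF F_fin]] := sigma_finiteT m1.
have /sigma_finiteP[G [TG ndG G_fin]] := sigma_finiteT m2.
exists (fun n => F n `*` G n) => [|n].
  apply/seteqP; split => // -[x y] _.
  have [n _ Fx] : (\bigcup_n F n) x by rewrite -TF.
  have [k _ Gy] : (\bigcup_n G n) y by rewrite -TG.
  exists (maxn n k) => //; split => /=.
    by have /subsetPset := ndF _ _ (leq_maxl n k); apply.
  by have /subsetPset := ndG _ _ (leq_maxr n k); apply.
have [mF Ffin] := F_fin n; have [mG Gfin] := G_fin n.
split; first exact: measurableX.
by rewrite /prodm product_measure1E// lte_mul_pinfty// ge0_fin_numE.
Qed.

HB.instance Definition _ := Measure_isSigmaFinite.Build _ _ _ prodm prodm_sigma_finite.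

End ProductSigmaFinite.

(** * Translation invariance of the area, and functions supported in boxes *)

Section Pushforward.
Context d1 d2 (X : measurableType d1) (Y : measurableType d2) (R : realType).

(** Packaging the push-forward as a measure lets the uniqueness theorems for Lebesgue and product
    measures apply to translates. *)
Lemma pushforward_measure (phi : X -> Y) (mu : {measure set X -> \bar R}) :
  measurable_fun setT phi ->
  exists m : {measure set Y -> \bar R}, m = pushforward mu phi :> (set Y -> \bar R).
Proof. by move=> mphi; unshelve eexists (pushforward mu phi). Qed.

End Pushforward.

Section PlaneInt.
Context {R : realType}.
Local Notation leb := (@lebesgue_measure R).
Local Notation area := (@lebesgue_measure R \x @lebesgue_measure R)%E.
Local Notation P := (measurableTypeR R * measurableTypeR R)%type.

(** By uniqueness of Lebesgue measure it suffices to compare both measures on half-open intervals.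
    The plane version below compares them on rectangles in the same way. *)
Lemma lebesgue_measure_shift (c : R) (A : set (measurableTypeR R)) : measurable A ->
  pushforward leb (fun x => x + c : measurableTypeR R) A = leb A.
Proof.
move=> mA.
have mc : measurable_fun setT ((fun x => x + c) : measurableTypeR R -> measurableTypeR R).
  exact: measurable_funD.
have [m mE] := pushforward_measure leb mc.
rewrite -mE; apply/esym/lebesgue_measure_unique => //= _ [[a b]] _ <-.
rewrite mE /pushforward (_ : _ @^-1` _ = `]a - c, b - c]%classic); last first.
  by apply/seteqP; split => x /=; rewrite !in_itv/= ltrBlDr lerBrDr.
rewrite lebesgue_measure_itv; apply: etrans (esym (lebesgue_measure_itv `]a - c, b - c])).
rewrite /= !lte_fin ltrD2r.
by case: ifPn => // _; rewrite -?EFinD; congr EFin; ring.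
Qed.

Lemma measurable_shift (c : R * R) : measurable_fun setT ((fun z => z + c) : P -> P).
Proof.
apply/measurable_fun_pairP; split.
- rewrite [X in measurable_fun _ X](_ : _ = (fun z : P => z.1 + c.1)) //.
  by apply: measurable_funD => //; exact: measurable_fst.
- rewrite [X in measurable_fun _ X](_ : _ = (fun z : P => z.2 + c.2)) //.
  by apply: measurable_funD => //; exact: measurable_snd.
Qed.

Lemma area_shift (c : R * R) (A : set P) : measurable A ->
  pushforward area ((fun z => z + c) : P -> P) A = area A.
Proof.
move=> mA.
have [m mE] := pushforward_measure area (measurable_shift c).
rewrite -mE; apply/esym/product_measure_unique => //= B C mB mC.
rewrite mE /pushforward.
rewrite (_ : _ @^-1` _ = ((fun x => x + c.1) @^-1` B) `*` ((fun x => x + c.2) @^-1` C)) //.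
have mp (e : R) (D : set (measurableTypeR R)) : measurable D ->
    measurable (((fun x => x + e) : measurableTypeR R -> measurableTypeR R) @^-1` D).
  move=> mD; rewrite -[X in measurable X]setTI.
  by have : measurable_fun setT ((fun x => x + e) : measurableTypeR R -> measurableTypeR R)
    by [exact: measurable_funD]; apply.
apply: etrans; first by apply: product_measure1E; exact: mp.
by congr (_ * _)%E; exact: lebesgue_measure_shift.
Qed.

Lemma ge0_integral_shift (c : R * R) (f : P -> \bar R) :
  measurable_fun setT f -> (forall z, (0 <= f z)%E) ->
  (\int[area]_z f (z + c)%R = \int[area]_z f z)%E.
Proof.
move=> mf f0.
have := @ge0_integral_pushforward _ _ _ _ _ _ (measurable_shift c) area setT f measurableT mf (fun z _ => f0 z).
rewrite preimage_setT => <-.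
apply: eq_measure_integral; first exact: measurable_shift.
by move=> ? A mA _; exact: area_shift.
Qed.

Lemma L1_shift (c : R * R) (f : P -> R) : L1 area f -> L1 area (fun z => f (z + c)).
Proof.
move=> Lf; have mf := L1_measurable Lf.
move: Lf => /integrableP[_ Lf]; apply/integrableP; split.
  by apply/measurable_EFinP; apply: (measurableT_comp mf); exact: measurable_shift.
apply: le_lt_trans Lf; rewrite le_eqVlt; apply/orP; left; apply/eqP.
apply: (ge0_integral_shift c (f := fun z => `|(f z)%:E|%E)) => //.
by apply: measurableT_comp => //; exact/measurable_EFinP.
Qed.

Lemma int_shift (c : R * R) (f : P -> R) : L1 area f ->
  \int[area]_z f (z + c) = \int[area]_z f z.
Proof.
move=> Lf; have mf : measurable_fun setT (EFin \o f) by apply/measurable_EFinP; exact: L1_measurable Lf.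
rewrite /Rintegral; congr fine; rewrite integralE [RHS]integralE; congr (_ - _)%E.
- rewrite -(ge0_integral_shift c (f := (EFin \o f)^\+%E)) //; last first.
    exact: measurable_funepos.
  by apply: eq_integral => z _; rewrite unlock.
- rewrite -(ge0_integral_shift c (f := (EFin \o f)^\-%E)) //; last first.
    exact: measurable_funeneg.
  by apply: eq_integral => z _; rewrite unlock.
Qed.

Definition box (c : R) : set (R * R) := `[- c, c]%classic `*` `[- c, c]%classic.

Lemma measurable_box c : measurable (box c : set P).
Proof. by apply: measurableX; exact: measurable_itv. Qed.

Lemma area_box_lty c : (area (box c) < +oo)%E.
Proof.
have E : leb `[- c, c] = _ := lebesgue_measure_itv `[- c, c].
have lt : (leb `[(- c)%R, c] < +oo)%E by rewrite E; case: ifP => _; rewrite ?ltry// -EFinB ltry.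
rewrite /box (product_measure1E leb leb (measurable_itv _) (measurable_itv _)).
by apply: lte_mul_pinfty => //; rewrite ge0_fin_numE.
Qed.

Lemma L1_indic_box c : L1 area (\1_(box c) : P -> R).
Proof.
by apply: L1_indic; [exact: measurable_box|exact: area_box_lty].
Qed.

Lemma L1_bounded_support (f : P -> R) (M c : R) : measurable_fun setT f ->
  (forall z, `|f z| <= M) -> (forall z, ~ box c z -> f z = 0) -> L1 area f.
Proof.
move=> mf fM f0; apply: (L1_le mf _ (L1Z M (L1_indic_box c))) => z.
rewrite indicE; case: (boolP (z \in _)) => [_|]; first by rewrite mulr1.
by rewrite notin_setE => /f0 ->; rewrite normr0 mulr0.
Qed.

Lemma sqint_bounded_support (f : P -> R) (M c : R) : measurable_fun setT f ->
  (forall z, `|f z| <= M) -> (forall z, ~ box c z -> f z = 0) -> sqint area f.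
Proof.
move=> mf fM f0; split=> //; apply: (L1_bounded_support (M := M ^+ 2) (c := c)).
- exact: measurable_funX.
- by move=> z; rewrite normrX lerXn2r ?nnegrE// (le_trans _ (fM z)).
- by move=> z /f0 ->; rewrite expr0n.
Qed.

(** Pointwise |f| <= f^2 + 1, and the 1 is only needed on the box, which has finite area. *)
Lemma sqint_L1 (f : P -> R) (c : R) : sqint area f ->
  (forall z, ~ box c z -> f z = 0) -> L1 area f.
Proof.
move=> [mf Lf] f0; apply: (L1_le mf _ (L1D Lf (L1_indic_box c))) => z.
rewrite indicE; case: (boolP (z \in _)) => [_|]; last first.
  by rewrite notin_setE => /f0 ->; rewrite normr0 expr0n addr0.
rewrite -[f z ^+ 2]real_normK ?num_real//.
have := normr_ge0 (f z); have := sqr_ge0 (`|f z| - 1).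
by move: (`|f z|) => t /=; nra.
Qed.

End PlaneInt.

(** * Fubini's theorem for real-valued integrals *)

Section Fubini.
Context d1 d2 (T1 : measurableType d1) (T2 : measurableType d2) (R : realType).
Variable m1 : {sigma_finite_measure set T1 -> \bar R}.
Variable m2 : {sigma_finite_measure set T2 -> \bar R}.

Lemma fine_measurable_int (f : T1 * T2 -> R) : L1 (m1 \x m2)%E f ->
  measurable_fun setT (fun x => \int[m2]_y f (x, y)).
Proof.
move=> Lf; have := measurable_fubini_F Lf; rewrite /fubini_F => mF.
by apply: (measurableT_comp (fine_measurable measurableT)).
Qed.

Lemma L1_fubini (f : T1 * T2 -> R) : L1 (m1 \x m2)%E f ->
  L1 m1 (fun x => \int[m2]_y f (x, y)).
Proof.
move=> Lf; have := integrable_fubini_F Lf; rewrite /fubini_F => /integrableP[mF iF].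
apply/integrableP; split; first by apply/measurable_EFinP/fine_measurable_int.
apply: le_lt_trans iF; apply: ge0_le_integral => //.
- by apply: measurableT_comp => //; apply/measurable_EFinP/fine_measurable_int.
- exact: measurableT_comp.
- move=> x _; rewrite /Rintegral /=.
  by case: (\int[m2]_y _)%E => [r| |] //=; rewrite normr0 leey.
Qed.

(** The real inner integral can differ from the extended one only where the section is not
    integrable, and those points form a null set. *)
Lemma int_fubini (f : T1 * T2 -> R) : L1 (m1 \x m2)%E f ->
  \int[m1]_x \int[m2]_y f (x, y) = \int[(m1 \x m2)%E]_z f z.
Proof.
move=> Lf; rewrite /Rintegral -(integral12_prod_meas1 Lf) /fubini_F.
have mF := measurable_fubini_F Lf; rewrite /fubini_F in mF.
congr fine; apply: ae_eq_integral => //.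
- by apply/measurable_EFinP/fine_measurable_int.
- apply: filterS (ae_integrable1 Lf) => x Lx _ /=.
  by rewrite fineK//; exact: integrable_fin_num.
Qed.

Lemma fine_measurable_int2 (f : T1 * T2 -> R) : L1 (m1 \x m2)%E f ->
  measurable_fun setT (fun y => \int[m1]_x f (x, y)).
Proof.
move=> Lf; have := measurable_fubini_G Lf; rewrite /fubini_G => mF.
by apply: (measurableT_comp (fine_measurable measurableT)).
Qed.

Lemma int_fubini2 (f : T1 * T2 -> R) : L1 (m1 \x m2)%E f ->
  \int[m2]_y \int[m1]_x f (x, y) = \int[(m1 \x m2)%E]_z f z.
Proof.
move=> Lf; rewrite /Rintegral -(integral21_prod_meas1 Lf) /fubini_G.
have mF := measurable_fubini_G Lf; rewrite /fubini_G in mF.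
congr fine; apply: ae_eq_integral => //.
- by apply/measurable_EFinP/fine_measurable_int2.
- apply: filterS (ae_integrable2 Lf) => x Lx _ /=.
  by rewrite fineK//; exact: integrable_fin_num.
Qed.

End Fubini.

(** * Smooth functions and cutoffs *)

Section Smooth.
Context {R : realType}.
Implicit Types V : normedModType R.

Lemma derive_alongE V (f : V -> R) (z v : V) :
  'D_v f z = 'D_1 (fun h : R => f (h *: v + z)) 0.
Proof.
rewrite /derive; set g1 := fun h => h^-1 *: _; set g2 := fun h => h^-1 *: _.
suff -> : g1 = g2 by [].
by rewrite funeqE /g1 /g2 => h /=; rewrite addr0 scale0r add0r [_%:A]mulr1.
Qed.

Lemma is_derive_alongP V (f : V -> R) (z v : V) (df : R) :
  is_derive z v f df <-> is_derive (0 : R) 1 (fun h : R => f (h *: v + z)) df.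
Proof.
split=> -[H <-].
- by split; [exact: (iffLR (derivable1P _ _ _) H)|rewrite -derive_alongE].
- by split; [exact: (iffRL (derivable1P _ _ _) H)|rewrite -derive_alongE].
Qed.

Lemma is_derive_comp_dir V (f : V -> R) (h : R -> R) (z v : V) (df dh : R) :
  is_derive z v f df -> is_derive (f z) 1 h dh -> is_derive z v (h \o f) (dh * df).
Proof.
move=> /is_derive_alongP f' h'; apply/is_derive_alongP.
apply: (@is_derive1_comp _ h (fun t : R => f (t *: v + z))) => //.
by rewrite scale0r add0r.
Qed.

Lemma is_derive_continuous1 (f : R -> R) (x df : R) : is_derive x 1 f df ->
  {for x, continuous f}.
Proof. by move=> [/derivable1_diffP/differentiable_continuous]. Qed.

(** The list of directions lets one development serve the line ([[:: 1]]) and the plane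
    ([[:: e1; e2]]); the latter case is the [Ck] of the statement, by [CkE]. *)
Fixpoint CkG V (ds : seq V) (k : nat) (f : V -> R) : Prop :=
  continuous f /\
  if k is j.+1 then
    forall v, v \in ds -> (forall z, derivable f z v) /\ CkG ds j ('D_v f)
  else True.

Definition smoothG V (ds : seq V) (f : V -> R) := forall k, CkG ds k f.

Lemma CkG_pred V (ds : seq V) k f : CkG ds k.+1 f -> CkG ds k f.
Proof.
elim: k f => [|k IH] f [cf df] //; split=> // v vd.
by have [df1 df2] := df v vd; split=> //; exact: IH.
Qed.

(** Smoothness by coinduction: exhibiting a class of continuous functions closed under the chosen
    derivatives replaces any formula for the k-th derivative. *)
Lemma smoothG_coind V (ds : seq V) (S : (V -> R) -> Prop) :
  (forall f, S f -> continuous f /\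
     forall v, v \in ds -> (forall z, derivable f z v) /\ S ('D_v f)) ->
  forall f, S f -> smoothG ds f.
Proof.
move=> H f Sf k; elim: k f Sf => [|k IH] f /H[cf df]; first by split.
by split=> // v /df[d1 d2]; split=> //; exact: IH.
Qed.

Lemma smoothG_continuous V (ds : seq V) f : smoothG ds f -> continuous f.
Proof. by move=> /(_ 0%N)[]. Qed.

Lemma smoothG_derivable V (ds : seq V) f v : smoothG ds f -> v \in ds ->
  forall z, derivable f z v.
Proof. by move=> /(_ 1%N)[_ H] /H[]. Qed.

Lemma smoothG_derive V (ds : seq V) f v : smoothG ds f -> v \in ds ->
  smoothG ds ('D_v f).
Proof. by move=> sf vd k; have [_ /(_ v vd)[]] := sf k.+1. Qed.

Lemma smoothG_intro V (ds : seq V) f : continuous f ->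
  (forall v, v \in ds -> (forall z, derivable f z v) /\ smoothG ds ('D_v f)) ->
  smoothG ds f.
Proof.
move=> cf df [|k]; split=> // v /df[d1 d2]; split=> //; exact: d2.
Qed.

Lemma CkGD V (ds : seq V) k f g : CkG ds k f -> CkG ds k g ->
  CkG ds k (fun z => f z + g z).
Proof.
elim: k f g => [|k IH] f g [cf df] [cg dg].
  by split=> // z; apply: continuousD; [exact: cf|exact: cg].
split=> [z|v vd]; first by apply: continuousD; [exact: cf|exact: cg].
have [df1 df2] := df v vd; have [dg1 dg2] := dg v vd.
split=> [z|]; first exact: derivableD.
rewrite (_ : 'D_v _ = fun z => 'D_v f z + 'D_v g z); first exact: IH.
by apply/funext => z; rewrite -deriveD.
Qed.

Lemma CkGM V (ds : seq V) k f g : CkG ds k f -> CkG ds k g ->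
  CkG ds k (fun z => f z * g z).
Proof.
elim: k f g => [|k IH] f g [cf df] [cg dg].
  by split=> // z; apply: continuousM; [exact: cf|exact: cg].
split=> [z|v vd]; first by apply: continuousM; [exact: cf|exact: cg].
have [df1 df2] := df v vd; have [dg1 dg2] := dg v vd.
split=> [z|]; first exact: derivableM.
rewrite (_ : 'D_v _ = fun z => f z * 'D_v g z + g z * 'D_v f z).
  by apply: CkGD; apply: IH => //; apply: CkG_pred; split.
by apply/funext => z; rewrite (deriveM (df1 z) (dg1 z)).
Qed.

Lemma CkG_cst V (ds : seq V) k (c : R) : CkG ds k (fun=> c).
Proof.
elim: k c => [|k IH] c; split=> // ; try by move=> z; exact: cvg_cst.
move=> v _; split=> [z|]; first exact: derivable_cst.
by rewrite (_ : 'D_v _ = fun=> 0)//; apply/funext => z; rewrite derive_cst.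
Qed.

Lemma CkG_comp V (ds : seq V) k (h : R -> R) f : CkG [:: 1 : R] k h -> CkG ds k f ->
  CkG ds k (fun z => h (f z)).
Proof.
elim: k h f => [|k IH] h f Hh Hf; have [ch dh] := Hh; have [cf df] := Hf.
  by split=> // z; apply: continuous_comp; [exact: cf|exact: ch].
split=> [z|v vd]; first by apply: continuous_comp; [exact: cf|exact: ch].
have [df1 df2] := df v vd; have [dh1 dh2] := dh 1 (mem_head _ _).
have H z : is_derive z v (h \o f) ('D_1 h (f z) * 'D_v f z).
  by apply: is_derive_comp_dir; exact/derivableP.
split=> [z|]; first by case: (H z).
rewrite (_ : 'D_v _ = fun z => 'D_1 h (f z) * 'D_v f z).
  exact: (CkGM (IH _ _ dh2 (CkG_pred Hf)) df2).
by apply/funext => z; exact: (@derive_val _ _ _ _ _ _ _ (H z)).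
Qed.

Lemma smoothGD V (ds : seq V) f g : smoothG ds f -> smoothG ds g ->
  smoothG ds (fun z => f z + g z).
Proof. by move=> sf sg k; exact: CkGD. Qed.

Lemma smoothGM V (ds : seq V) f g : smoothG ds f -> smoothG ds g ->
  smoothG ds (fun z => f z * g z).
Proof. by move=> sf sg k; exact: CkGM. Qed.

Lemma smoothG_cst V (ds : seq V) (c : R) : smoothG ds (fun=> c).
Proof. by move=> k; exact: CkG_cst. Qed.

Lemma smoothG_comp V (ds : seq V) (h : R -> R) f : smoothG [:: 1 : R] h -> smoothG ds f ->
  smoothG ds (fun z => h (f z)).
Proof. by move=> sh sf k; exact: CkG_comp. Qed.

Lemma smoothGZ V (ds : seq V) (c : R) f : smoothG ds f -> smoothG ds (fun z => c * f z).
Proof. by move=> sf; apply: smoothGM => //; exact: smoothG_cst. Qed.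

Lemma smoothGB V (ds : seq V) f g : smoothG ds f -> smoothG ds g ->
  smoothG ds (fun z => f z - g z).
Proof.
move=> sf sg; have := smoothGD sf (smoothGZ (-1) sg).
by congr smoothG; apply/funext => z; rewrite mulN1r.
Qed.

Lemma smoothG_linear V (ds : seq V) (f : V -> R) (df : V -> R) : continuous f ->
  (forall z v, is_derive z v f (df v)) -> smoothG ds f.
Proof.
move=> cf f'; apply: smoothG_intro => // v _; split=> [z|]; first by case: (f' z v).
rewrite (_ : 'D_v f = fun=> df v); first exact: smoothG_cst.
by apply/funext => z; case: (f' z v).
Qed.

Definition smooth1 (f : R -> R) := smoothG [:: 1 : R] f.

Lemma smooth1_id : smooth1 id.
Proof. by apply: (@smoothG_linear _ _ _ id) => // z; exact: cvg_id. Qed.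

Lemma smooth1_intro f df : (forall x : R, is_derive x 1 f (df x)) -> smooth1 df -> smooth1 f.
Proof.
move=> f' sdf; apply: smoothG_intro => [x|v]; first exact: is_derive_continuous1.
rewrite inE => /eqP ->; split=> [z|]; first by case: (f' z).
by rewrite (_ : 'D_1 f = df)//; apply/funext => z; case: (f' z).
Qed.

Lemma smooth1_expR : smooth1 expR.
Proof.
apply: (@smoothG_coind _ _ (fun f => f = expR)) => // _ ->.
split=> [|v]; first exact: continuous_expR.
by rewrite inE => /eqP ->; split=> [z|]; [exact: derivable_expR|rewrite derive_expR].
Qed.

End Smooth.

(** * Flat functions, a smooth bump and its primitive *)

Section Bump.
Context {R : realType}.

(** The usual exp(-1/t), with all powers of 1/t carried along because its derivatives are
    combinations of these functions. *)
Definition flat (n : nat) (t : R) : R :=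
  if 0 < t then t^-1 ^+ n * expR (- t^-1) else 0.

Lemma flat_ge0 n t : 0 <= flat n t.
Proof.
rewrite /flat; case: ifP => // t0.
by rewrite mulr_ge0 ?expR_ge0// exprn_ge0// invr_ge0 ltW.
Qed.

Lemma flat_gt0 n t : 0 < t -> 0 < flat n t.
Proof. by move=> t0; rewrite /flat t0 mulr_gt0 ?expR_gt0// exprn_gt0// invr_gt0. Qed.

(** From exp(1/t) >= (1/t)^(n+1) / (n+1)!. This linear bound is what makes the functions and all
    their derivatives vanish at 0. *)
Lemma flat_le n t : flat n t <= n.+1`!%:R * `|t|.
Proof.
rewrite /flat; case: ifP => [t0|_]; last by rewrite mulr_ge0.
rewrite expRN ler_pdivrMr ?expR_gt0// gtr0_norm//.
have t1 : 0 < t^-1 by rewrite invr_gt0.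
have := expR_ge1Dxn n (ltW t1).
have f0 : 0 < n.+1`!%:R :> R by rewrite ltr0n fact_gt0.
move=> H; have : t^-1 ^+ n.+1 <= n.+1`!%:R * expR t^-1.
  rewrite mulrC -ler_pdivrMr//; apply: le_trans H.
  by rewrite lerDr.
rewrite exprS => {}H.
rewrite -mulrA (mulrCA _ t) mulrC -ler_pdivrMr// mulrC.
exact: H.
Qed.

Lemma is_derive_inv (t : R) : t != 0 -> is_derive t 1 (fun s : R => s^-1) (- t ^- 2).
Proof.
move=> t0; have := @derivableV _ _ id t 1 t0 (@derivable_id _ _ t 1).
move=> H; apply: DeriveDef; first exact: H.
have := @deriveV _ _ id t 1 t0 (@derivable_id _ _ t 1).
by rewrite derive_id => ->; rewrite /GRing.scale /= mulr1.
Qed.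

Lemma is_derive_flat n (t : R) :
  is_derive t 1 (flat n) (flat n.+2 t - n%:R * flat n.+1 t).
Proof.
have [t0|t0|->] := ltgtP t 0.
- have Et m : flat m t = 0 by rewrite /flat ltNge (ltW t0).
  rewrite !Et mulr0 subrr.
  apply: (near_eq_is_derive (f := cst 0)).
  near=> s; rewrite /flat ltNge [s <= 0]ltW//.
  by near: s; exact: lt_nbhsl.
- rewrite [X in is_derive _ _ _ X](_ : _ = t^-1 ^+ n * (expR (- t^-1) * t ^- 2)
     + expR (- t^-1) * (n%:R * t^-1 ^+ n.-1 * - t ^- 2)); last first.
    rewrite /flat t0 -!exprVn; case: n => [|n] /=; rewrite !exprS; ring.
  apply: (near_eq_is_derive (f := fun s : R => s^-1 ^+ n * expR (- s^-1))).
    near=> s; rewrite /flat ifT//.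
    by near: s; exact: lt_nbhsr.
  have tn : t != 0 by rewrite gt_eqF.
  have dV := is_derive_inv tn.
  have dX : is_derive t 1 (fun s : R => s^-1 ^+ n) (n%:R * t^-1 ^+ n.-1 * - t ^- 2).
    rewrite (_ : (fun s => _) = (fun s : R => s^-1) ^+ n); first exact: is_deriveX.
    by apply/funext => s; rewrite exprfctE.
  have dE : is_derive t 1 (fun s : R => expR (- s^-1)) (expR (- t^-1) * t ^- 2).
    apply: (@is_derive_comp_dir _ _ (fun s : R => - s^-1) expR) => //.
    by rewrite -[X in is_derive _ _ _ X]opprK; exact: is_deriveN.
  rewrite (_ : (fun s => _) = (fun s : R => s^-1 ^+ n) * (fun s : R => expR (- s^-1))) //.
  exact: is_deriveM.
- have f0 m : flat m 0 = 0 by rewrite /flat ltxx.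
  rewrite !f0 mulr0 subrr.
  have C : h^-1 *: (flat n (h *: 1 + 0) - flat n 0) @[h --> 0^'] --> (0 : R).
    apply/cvgrPdist_le => e e0; near=> h.
    rewrite sub0r normrN f0 subr0 addr0 [_%:A]mulr1 normrM.
    (* The difference quotient at 0 is again a flat function, one index higher, so [flat_le] sends
       it to 0. *)
    have -> : `|h^-1| * `|flat n h| = flat n.+1 h.
      rewrite (ger0_norm (flat_ge0 _ _)) /flat; case: ifP => [h0|]; last by rewrite mulr0.
      by rewrite gtr0_norm ?invr_gt0// exprS mulrA.
    apply: le_trans (flat_le _ _) _.
    rewrite -ler_pdivlMl ?ltr0n ?fact_gt0//.
    near: h; apply: dnbhs0_le.
    by rewrite mulr_gt0// invr_gt0 ltr0n fact_gt0.
  by apply: DeriveDef; [apply/cvg_ex; exists 0|apply/cvg_lim].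
Unshelve. all: end_near.
Qed.

(** Finite linear combinations of the functions [flat] form a class closed under differentiation;
    the list [s'] replaces each term by the two terms of its derivative. *)
Lemma smooth1_flat n : smooth1 (flat n).
Proof.
pose S (f : R -> R) := exists s : seq (nat * R), f = fun t => \sum_(p <- s) p.2 * flat p.1 t.
apply: (@smoothG_coind _ _ _ S) => [_ [s ->]|]; last first.
  exists [:: (n, 1)]; apply/funext => t; by rewrite big_seq1 mul1r.
pose s' := flatten [seq [:: (p.1.+2, p.2); (p.1.+1, - (p.2 * p.1%:R))] | p <- s].
have H (t : R) : is_derive t 1 (fun t => \sum_(p <- s) p.2 * flat p.1 t)
    (\sum_(p <- s') p.2 * flat p.1 t).
  rewrite /s'; elim: s {s'} => [|p s IH] /=.
    under [X in is_derive _ _ X _]eq_fun do rewrite big_nil.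
    by rewrite big_nil; exact: is_derive_cst.
  under [X in is_derive _ _ X _]eq_fun do rewrite big_cons.
  rewrite !big_cons /= addrA.
  apply: is_derive_eq.
    apply: is_deriveD IH.
    exact: (is_deriveZ p.2 (is_derive_flat p.1 t)).
  by congr (_ + _); rewrite /GRing.scale /=; ring.
split=> [x|v]; first exact: is_derive_continuous1 (H x).
rewrite inE => /eqP ->; split=> [z|]; first by case: (H z).
by exists s'; apply/funext => z; case: (H z).
Qed.

Definition hat (t : R) := flat 0 t * flat 0 (1 - t).

Lemma smooth1_hat : smooth1 hat.
Proof.
apply: smoothGM; first exact: smooth1_flat.
apply: smoothG_comp; first exact: smooth1_flat.
by apply: smoothGB; [exact: smoothG_cst|exact: smooth1_id].
Qed.

Lemma hat_ge0 t : 0 <= hat t. Proof. by rewrite mulr_ge0 ?flat_ge0. Qed.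

Lemma hat_gt0 t : 0 < t < 1 -> 0 < hat t.
Proof. by move=> /andP[t0 t1]; rewrite mulr_gt0// flat_gt0// subr_gt0. Qed.

Lemma hat_eq0 t : ~~ (0 < t < 1) -> hat t = 0.
Proof.
rewrite negb_and -!leNgt => /orP[t0|t1]; rewrite /hat /flat.
  by rewrite ltNge t0 mul0r.
by rewrite [X in _ * X]ifF ?mulr0// subr_gt0 ltNge t1.
Qed.

Lemma hat_le1 t : hat t <= 1.
Proof.
have flat_le1 u : flat 0 u <= 1.
  by rewrite /flat; case: ifP => // u0; rewrite expr0 mul1r expR_le1 oppr_le0 invr_ge0 ltW.
by rewrite /hat mulr_ile1 ?flat_ge0.
Qed.

Definition primitive (g : R -> R) (x : R) : R :=
  \int[@lebesgue_measure R]_(t in `]-oo, x]) g t.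

Section Primitive.
Variables (g : R -> R) (a b : R).
Hypotheses (sg : smooth1 g) (ab : a < b) (g0 : forall t, ~~ (a < t < b) -> g t = 0).

Lemma compact_support_L1 : L1 (@lebesgue_measure R) g.
Proof.
have cg := smoothG_continuous sg.
have Hi : (@lebesgue_measure R).-integrable `[a, b] (EFin \o g).
  apply: continuous_compact_integrable; first exact: segment_compact.
  by apply: continuous_subspaceT => x; exact: cg.
rewrite /L1; rewrite (_ : EFin \o g = (EFin \o g) \_ `[a, b]).
  exact: ((integrable_mkcond (mu := @lebesgue_measure R) (EFin \o g) (measurable_itv `[a, b])).1 Hi).
apply/funext => t; rewrite patchE; case: ifPn => //; rewrite notin_setE /= in_itv/= => H.
rewrite g0//; apply/negP => /andP[ta tb]; apply: H.
by rewrite !ltW.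
Qed.

Lemma is_derive_primitive (x : R) : is_derive x 1 (primitive g) (g x).
Proof.
have x1 : x < x + 1 by rewrite ltrDl.
have [|||H1 H2] := @continuous_FTC1 R g -oo%O x (x + 1) x1.
- apply: integrableS compact_support_L1 => //; exact: measurable_itv.
- exact: ltNyr.
- exact: (smoothG_continuous sg).
- by split => //; rewrite -derive1E.
Qed.

Lemma smooth1_primitive : smooth1 (primitive g).
Proof. exact: smooth1_intro is_derive_primitive sg. Qed.

Lemma primitive_lt x : x <= a -> primitive g x = 0.
Proof.
move=> xa; rewrite /primitive /Rintegral integral0_eq// => t /=.
rewrite in_itv/= => tx; rewrite g0// negb_and -leNgt.
by rewrite (le_trans tx xa).
Qed.

Lemma primitive_gt x : b <= x -> primitive g x = \int[@lebesgue_measure R]_t g t.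
Proof.
move=> bx; rewrite /primitive Rintegral_mkcond; apply: eq_Rintegral => t _.
rewrite patchE; case: ifPn => //; rewrite notin_setE /= in_itv/= => /negP.
rewrite -ltNge => xt; rewrite g0// negb_and -[~~ (t < b)]leNgt.
by rewrite (le_trans bx (ltW xt)) orbT.
Qed.

End Primitive.

End Bump.

(** * Partial derivatives and mean value estimates in the plane *)

Section PlaneCalculus.
Context {R : realType}.
Local Notation leb := (@lebesgue_measure R).
Local Notation area := (@lebesgue_measure R \x @lebesgue_measure R)%E.
Local Notation P := (measurableTypeR R * measurableTypeR R)%type.
Local Notation e1 := ((1, 0) : R * R).
Local Notation e2 := ((0, 1) : R * R).

Definition smooth2 (f : R * R -> R) := smoothG [:: e1; e2] f.

Lemma CkE k (f : R * R -> R) : Ck k f <-> CkG [:: e1; e2] k f.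
Proof.
elim: k f => [|k IH] f; first by [].
split=> [[cf [d1 d2 c1 c2]]|[cf df]].
  split; first exact: cf.
  move=> v; rewrite !inE => /orP[]/eqP ->.
    by split; [exact: d1|exact: (iffLR (IH _) c1)].
  by split; [exact: d2|exact: (iffLR (IH _) c2)].
have [d1 c1] := df e1 (mem_head _ _).
have [d2 c2] : (forall z, derivable f z e2) /\ CkG [:: e1; e2] k ('D_e2 f).
  by apply: df; rewrite !inE eqxx orbT.
split; first exact: cf.
by split; [exact: d1|exact: d2|exact: (iffRL (IH _) c1)|exact: (iffRL (IH _) c2)].
Qed.

Lemma smooth2P (f : R * R -> R) : (forall k, Ck k f) <-> smooth2 f.
Proof. by split=> H k; [exact: (iffLR (CkE k f) (H k))|exact: (iffRL (CkE k f) (H k))]. Qed.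

Lemma smooth2_intro (f d1 d2 : R * R -> R) : continuous f ->
  (forall z, is_derive z e1 f (d1 z)) -> (forall z, is_derive z e2 f (d2 z)) ->
  smooth2 d1 -> smooth2 d2 -> smooth2 f.
Proof.
move=> cf f1 f2 s1 s2; apply: smoothG_intro => // v.
rewrite !inE => /orP[]/eqP ->; split.
- by move=> z; case: (f1 z).
- by rewrite (_ : 'D_e1 f = d1)//; apply/funext => z; case: (f1 z).
- by move=> z; case: (f2 z).
- by rewrite (_ : 'D_e2 f = d2)//; apply/funext => z; case: (f2 z).
Qed.

Lemma smooth2_coind (S : (R * R -> R) -> Prop) :
  (forall f, S f -> exists d1 d2, [/\ continuous f,
     forall z, is_derive z e1 f (d1 z), forall z, is_derive z e2 f (d2 z), S d1 & S d2]) ->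
  forall f, S f -> smooth2 f.
Proof.
move=> H; apply: smoothG_coind => f /H[d1 [d2 [cf f1 f2 S1 S2]]]; split=> // v.
rewrite !inE => /orP[]/eqP ->; split.
- by move=> z; case: (f1 z).
- by rewrite (_ : 'D_e1 f = d1)//; apply/funext => z; case: (f1 z).
- by move=> z; case: (f2 z).
- by rewrite (_ : 'D_e2 f = d2)//; apply/funext => z; case: (f2 z).
Qed.

Lemma smooth2_dx f : smooth2 f -> smooth2 (dx f).
Proof. by move=> sf; apply: smoothG_derive => //; rewrite mem_head. Qed.

Lemma smooth2_dy f : smooth2 f -> smooth2 (dy f).
Proof. by move=> sf; apply: smoothG_derive => //; rewrite !inE eqxx orbT. Qed.

Lemma is_derive_dx f z : smooth2 f -> is_derive z e1 f (dx f z).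
Proof. by move=> /smoothG_derivable H; apply/derivableP/H; rewrite mem_head. Qed.

Lemma is_derive_dy f z : smooth2 f -> is_derive z e2 f (dy f z).
Proof. by move=> /smoothG_derivable H; apply/derivableP/H; rewrite !inE eqxx orbT. Qed.

Lemma is_derive_line (f : R * R -> R) (v w : R * R) (t : R) df :
  is_derive (t *: v + w) v f df -> is_derive t 1 (fun h : R => f (h *: v + w)) df.
Proof.
move=> /is_derive_alongP H; apply/is_derive_alongP.
apply: is_derive_eq; last by [].
rewrite (_ : (fun h : R => f ((h *: 1 + t) *: v + w)) = (fun h : R => f (h *: v + (t *: v + w)))) //.
by apply/funext => h; rewrite addrA -scalerDl [_ *: 1]mulr1.
Qed.

Lemma le_MVT (f df : R -> R) (a b M : R) :
  (forall t, (Num.min a b <= t <= Num.max a b) -> is_derive t 1 f (df t)) ->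
  (forall t, (Num.min a b <= t <= Num.max a b) -> `|df t| <= M) ->
  `|f b - f a| <= M * `|b - a|.
Proof.
wlog ab : a b / a <= b.
  move=> H fd dM; have [ab|/ltW ba] := leP a b; first exact: H.
  rewrite distrC [`|b - a|]distrC; apply: H => // t; rewrite minC maxC; [exact: fd|exact: dM].
rewrite min_l// max_r// => fd dM.
have [|x|c] := @MVT_segment R f df a b ab.
- by move=> t; rewrite in_itv/= => /andP[/ltW ? /ltW ?]; apply: fd; apply/andP.
- by apply: derivable_within_continuous => t; rewrite in_itv/= => /fd[].
rewrite in_itv/= => /dM cM ->.
by rewrite normrM ler_wpM2r.
Qed.

Lemma pairZD (t a b c d : R) : t *: ((a, b) : R * R) + (c, d) = (t * a + c, t * b + d).
Proof. by []. Qed.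

(** The route from [z] to [w] turns at the corner [(w.1, z.2)], which lies in the ball because balls
    of the product norm are squares. Only the two partial derivatives are used. *)
Lemma le_MVT_plane (f : R * R -> R) (d1 d2 : R * R -> R) z (r M : R) w :
  (forall u, ball z r u -> is_derive u e1 f (d1 u) /\ is_derive u e2 f (d2 u)) ->
  (forall u, ball z r u -> `|d1 u| <= M /\ `|d2 u| <= M) -> ball z r w ->
  `|f w - f z| <= M * (`|w.1 - z.1| + `|w.2 - z.2|).
Proof.
move=> fd dM [b1 b2].
have between (a b t : R) : Num.min a b <= t <= Num.max a b -> `|a - t| <= `|a - b|.
  case: (leP a b) => ab /andP[h1 h2].
    by rewrite distrC [leRHS]distrC !ger0_norm ?subr_ge0// lerD2r.
  by rewrite !ger0_norm ?subr_ge0// ?(ltW ab)// lerD2l lerN2.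
have r0 : 0 < r by apply: le_lt_trans b1; exact: normr_ge0.
have -> : f w - f z = (f (w.1, z.2) - f (z.1, z.2)) + (f (w.1, w.2) - f (w.1, z.2)).
  by rewrite -!surjective_pairing; ring.
rewrite mulrDr; apply: le_trans (ler_normD _ _) _; apply: lerD.
- have E (t : R) : t *: e1 + (0, z.2) = (t, z.2).
    by rewrite pairZD !(mulr0, mulr1, add0r, addr0).
  have B t : Num.min z.1 w.1 <= t <= Num.max z.1 w.1 -> ball z r (t, z.2).
    move=> /between H; split; last exact: ballxx.
    exact: le_lt_trans H b1.
  apply: (@le_MVT (fun t => f (t, z.2)) (fun t => d1 (t, z.2))) => t /B Bt.
  + have := @is_derive_line f e1 (0, z.2) t (d1 (t, z.2)); rewrite E.
    move=> /(_ (proj1 (fd _ Bt))).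
    by under eq_fun do rewrite E.
  + by case: (dM _ Bt).
- have E (t : R) : t *: e2 + (w.1, 0) = (w.1, t).
    by rewrite pairZD !(mulr0, mulr1, add0r, addr0).
  have B t : Num.min z.2 w.2 <= t <= Num.max z.2 w.2 -> ball z r (w.1, t).
    move=> /between H; split => //.
    exact: le_lt_trans H b2.
  apply: (@le_MVT (fun t => f (w.1, t)) (fun t => d2 (w.1, t))) => t /B Bt.
  + have := @is_derive_line f e2 (w.1, 0) t (d2 (w.1, t)); rewrite E.
    move=> /(_ (proj2 (fd _ Bt))).
    by under eq_fun do rewrite E.
  + by case: (dM _ Bt).
Qed.

Lemma lipschitz_continuous_plane (f : R * R -> R) (M : R) :
  (forall z w, `|f w - f z| <= M * (`|w.1 - z.1| + `|w.2 - z.2|)) -> continuous f.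
Proof.
move=> fM z; apply/cvgrPdist_le => e e0.
suff : nbhs (z : R * R) (fun w : R * R => `|f z - f w| <= e) by [].
have M1 : 0 < 2 * (`|M| + 1) by rewrite mulr_gt0// ltr_wpDl.
apply/nbhs_ballP; exists (e / (2 * (`|M| + 1))) => /=; first exact: divr_gt0.
move=> w [b1 b2]; rewrite distrC; apply: le_trans (fM _ _) _.
apply: (@le_trans _ _ ((`|M| + 1) * (`|w.1 - z.1| + `|w.2 - z.2|))).
  by rewrite ler_wpM2r// ?addr_ge0// (le_trans (ler_norm _))// lerDl.
have H (x : R) : x < e / (2 * (`|M| + 1)) -> (`|M| + 1) * x <= e / 2.
  by rewrite ltr_pdivlMr// => /ltW; lra.
have := H _ b1; have := H _ b2; rewrite /= distrC [`|z.1 - _|]distrC; lra.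
Qed.

Lemma is_derive_affine (c d t : R) : is_derive t 1 (fun h : R => c * h + d) c.
Proof.
have H : is_derive t 1 (c *: (id : R -> R) + cst d) (c *: 1 + 0).
  by apply: is_deriveD; apply: is_deriveZ.
by apply: is_derive_eq H _; rewrite addr0 [_ *: 1]mulr1.
Qed.

(** Subtracting the linear part at [z] leaves a function whose partial derivatives are small near
    [z], to which [le_MVT_plane] applies. *)
Lemma is_derive_plane (f d1 d2 : R * R -> R) (z v : R * R) :
  nbhs z (fun u => is_derive u e1 f (d1 u) /\ is_derive u e2 f (d2 u)) ->
  {for z, continuous d1} -> {for z, continuous d2} ->
  is_derive z v f (v.1 * d1 z + v.2 * d2 z).
Proof.
move=> fd c1 c2.
pose p := d1 z; pose q := d2 z.
have C : h^-1 *: (f (h *: v + z) - f z) @[h --> 0^'] --> (v.1 * p + v.2 * q).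
  apply/cvgrPdist_le => e e0.
  pose e' := e / (`|v.1| + `|v.2| + 1).
  have V0 : 0 < `|v.1| + `|v.2| + 1 by rewrite ltr_wpDl ?addr_ge0.
  have e'0 : 0 < e' by rewrite divr_gt0.
  have N : \forall u \near z, [/\ is_derive u e1 f (d1 u), is_derive u e2 f (d2 u),
      `|p - d1 u| <= e' & `|q - d2 u| <= e'].
    near=> u; split.
    - by have [] : is_derive u e1 f (d1 u) /\ is_derive u e2 f (d2 u) by near: u.
    - by have [] : is_derive u e1 f (d1 u) /\ is_derive u e2 f (d2 u) by near: u.
    - by near: u; move/cvgrPdist_le : c1; exact.
    - by near: u; move/cvgrPdist_le : c2; exact.
  move: N => /nbhs_ballP[r /= r0 rN].
  have hb : \forall h \near (0 : R)^', ball z r (h *: v + z).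
    near=> h.
    have hr : `|h| * (`|v.1| + `|v.2| + 1) < r.
      rewrite -ltr_pdivlMr//; near: h; apply: dnbhs0_lt; exact: divr_gt0.
    have := normr_ge0 v.1; have := normr_ge0 v.2; have := normr_ge0 h => ? ? ?.
    by split; rewrite /ball/= opprD addrCA subrr addr0 normrN normrM; nra.
  near=> h.
  have hbh : ball z r (h *: v + z) by near: h.
  have h0 : h != 0 by near: h; exact: nbhs_dnbhs_neq.
  pose k u := f u - (p * u.1 + q * u.2).
  have kd u : ball z r u -> is_derive u e1 k (d1 u - p) /\ is_derive u e2 k (d2 u - q).
    move=> /rN[u1 u2 _ _].
    have lin (w : R * R) : is_derive u w (fun u : R * R => p * u.1 + q * u.2) (p * w.1 + q * w.2).
      apply/is_derive_alongP.
      rewrite (_ : (fun h => _) = (fun h : R => (p * w.1 + q * w.2) * h + (p * u.1 + q * u.2))).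
        exact: is_derive_affine.
      apply/funext => h1; have -> : (h1 *: w + u).1 = h1 * w.1 + u.1 by [].
      have -> : (h1 *: w + u).2 = h1 * w.2 + u.2 by [].
      ring.
    split.
      have := is_deriveB u1 (lin e1); rewrite /= mulr1 mulr0 addr0; exact.
    have := is_deriveB u2 (lin e2); rewrite /= mulr1 mulr0 add0r; exact.
  have kM u : ball z r u -> `|d1 u - p| <= e' /\ `|d2 u - q| <= e'.
    by move=> /rN[_ _ ? ?]; rewrite distrC [`|d2 u - q|]distrC.
  have := le_MVT_plane kd kM hbh.
  rewrite /k /= !addrK => H.
  have -> : v.1 * p + v.2 * q - h^-1 *: (f (h *: v + z) - f z) =
    - (h^-1 * (f (h *: v + z) - (p * (h * v.1 + z.1) + q * (h * v.2 + z.2)) -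
        (f z - (p * z.1 + q * z.2)))).
    by rewrite /GRing.scale/=; field.
  rewrite normrN normrM normfV ler_pdivrMl ?normr_gt0//.
  apply: le_trans H _; rewrite !normrM -mulrDr mulrCA ler_wpM2l//.
  rewrite /e' -mulrA ger_pMr// ler_pdivrMl// mulr1 lerDl.
  exact: ler01.
by split; [apply/cvg_ex; exists (v.1 * p + v.2 * q)|apply/cvg_lim].
Unshelve. all: end_near. Qed.

Lemma smooth2_is_derive f (z v : R * R) : smooth2 f ->
  is_derive z v f (v.1 * dx f z + v.2 * dy f z).
Proof.
move=> sf; apply: is_derive_plane.
- by apply: filterE => u; split; [exact: is_derive_dx|exact: is_derive_dy].
- exact: (smoothG_continuous (smooth2_dx sf)).
- exact: (smoothG_continuous (smooth2_dy sf)).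
Qed.

Lemma smooth2_fst : smooth2 fst.
Proof.
apply: (smooth2_intro (d1 := fun=> 1) (d2 := fun=> 0)); last 2 first.
- exact: smoothG_cst.
- exact: smoothG_cst.
- by move=> z; exact: cvg_fst.
- move=> z; apply/is_derive_alongP => /=.
  rewrite (_ : (fun h => _) = (fun h : R => h + z.1)); last by apply/funext => h; rewrite /GRing.scale/= mulr1.
  by apply: is_derive_eq; rewrite addr0.
- move=> z; apply/is_derive_alongP => /=.
  rewrite (_ : (fun h => _) = (fun h : R => z.1)); last by apply/funext => h; rewrite /GRing.scale/= mulr0 add0r.
  exact: is_derive_cst.
Qed.

Lemma smooth2_snd : smooth2 snd.
Proof.
apply: (smooth2_intro (d1 := fun=> 0) (d2 := fun=> 1)); last 2 first.
- exact: smoothG_cst.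
- exact: smoothG_cst.
- by move=> z; exact: cvg_snd.
- move=> z; apply/is_derive_alongP => /=.
  rewrite (_ : (fun h => _) = (fun h : R => z.2)); last by apply/funext => h; rewrite /GRing.scale/= mulr0 add0r.
  exact: is_derive_cst.
- move=> z; apply/is_derive_alongP => /=.
  rewrite (_ : (fun h => _) = (fun h : R => h + z.2)); last by apply/funext => h; rewrite /GRing.scale/= mulr1.
  by apply: is_derive_eq; rewrite addr0.
Qed.

End PlaneCalculus.

(** * Test functions and integration by parts *)

Section TestFun.
Context {R : realType}.
Local Notation leb := (@lebesgue_measure R).
Local Notation area := (@lebesgue_measure R \x @lebesgue_measure R)%E.
Local Notation P := (measurableTypeR R * measurableTypeR R)%type.
Local Notation e1 := ((1, 0) : R * R).
Local Notation e2 := ((0, 1) : R * R).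
Implicit Types (f g phi : R * R -> R) (D : set (R * R)).

Lemma box_compact (c : R) : compact (box c : set (R * R)).
Proof. by apply: compact_setX; exact: segment_compact. Qed.

Lemma box_closed (c : R) : closed (box c : set (R * R)).
Proof.
have -> : box c = (fst @^-1` `[- c, c]%classic) `&` (snd @^-1` `[- c, c]%classic) by [].
apply: closedI; apply: closed_comp.
- by move=> z _; exact: cvg_fst.
- exact: interval_closed.
- by move=> z _; exact: cvg_snd.
- exact: interval_closed.
Qed.

Lemma box_le (c c' : R) : c <= c' -> (box c : set (R * R)) `<=` box c'.
Proof.
move=> cc z [/= ]; rewrite !in_itv/= => /andP[? ?] /andP[? ?].
by split; rewrite /= in_itv/=; apply/andP; split; lra.
Qed.

Definition bsupp f := exists c : R, forall z, ~ box c z -> f z = 0.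

(** The condition on the closed support becomes a local one, vanishing near every point outside [D],
    which passes at once to sums, products and derivatives. *)
Lemma test_funP D f : test_fun D f <->
  [/\ smooth2 f, bsupp f & forall p, ~ D p -> nbhs p (fun z => f z = 0)].
Proof.
split=> [[/smooth2P sf cf fD]|[sf [c fc] fD]]; split.
- exact: sf.
- have [M [_ HM]] := compact_bounded cf.
  exists (M + 1) => z zb; apply: contra_notP zb => /eqP fz.
  have : `|z| <= M + 1 by apply: (HM (M + 1)); [rewrite ltrDl|exact: subset_closure].
  rewrite prod_normE ge_max => /andP[h1 h2].
  by split; rewrite /= in_itv/= -ler_norml.
- move=> p Dp.
  have : nbhs p (~` closure [set z | f z != 0]).
    apply: open_nbhs_nbhs; split; last by move=> /fD.
    by rewrite openC; exact: closed_closure.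
  apply: filterS => z /= H; apply: contra_notP H => /eqP fz.
  exact: subset_closure.
- exact/smooth2P.
- apply: (@subclosed_compact _ _ (box c)); [exact: closed_closure|exact: box_compact|].
  rewrite closureE => z; apply; split; last first.
    by move=> w /= fw; apply: contra_notP (negP fw) => /fc ->.
  exact: box_closed.
- move=> p pc; apply: contrapT => /fD /pc [z /= [fz]].
  by move=> E; rewrite E eqxx in fz.
Qed.

Lemma test_fun_smooth D f : test_fun D f -> smooth2 f.
Proof. by move=> /test_funP[]. Qed.

Lemma test_fun_out D f z : test_fun D f -> ~ D z -> f z = 0.
Proof. by move=> /test_funP[_ _ H] /H/nbhs_singleton. Qed.

Lemma test_fun_subset D D' f : D `<=` D' -> test_fun D f -> test_fun D' f.
Proof.
by move=> DD /test_funP[sf bf fD]; apply/test_funP; split => // p Dp; apply: fD => /DD.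
Qed.

Lemma near0_dx f (p : R * R) : nbhs p (fun z => f z = 0) ->
  nbhs p (fun z => dx f z = 0 /\ dy f z = 0).
Proof.
move=> /nbhs_interior; apply: filterS => z fz.
by split; rewrite /dx /dy (near_eq_derive _ (g := cst 0)) ?derive_cst//; exact: nbhs_singleton fz.
Qed.

Lemma bsupp_dx f : bsupp f -> bsupp (dx f) /\ bsupp (dy f).
Proof.
move=> [c fc].
have H z : ~ box c z -> dx f z = 0 /\ dy f z = 0.
  move=> zc.
  have N : nbhs z (~` box c).
    by apply: open_nbhs_nbhs; split => //; rewrite openC; exact: box_closed.
  have N0 : nbhs z (fun z => f z = 0) by apply: filterS N => w; exact: fc.
  exact: (nbhs_singleton (near0_dx N0)).
by split; exists c => z /H[].
Qed.

Lemma test_fun_dx D f : test_fun D f -> test_fun D (dx f).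
Proof.
move=> /test_funP[sf bf fD]; apply/test_funP; split.
- exact: smooth2_dx.
- by have [] := bsupp_dx bf.
- by move=> p /fD /near0_dx; apply: filterS => z [].
Qed.

Lemma test_fun_dy D f : test_fun D f -> test_fun D (dy f).
Proof.
move=> /test_funP[sf bf fD]; apply/test_funP; split.
- exact: smooth2_dy.
- by have [] := bsupp_dx bf.
- by move=> p /fD /near0_dx; apply: filterS => z [].
Qed.

Lemma test_funM D f g : test_fun D f -> smooth2 g -> test_fun D (fun z => g z * f z).
Proof.
move=> /test_funP[sf [c fc] fD] sg; apply/test_funP; split.
- exact: smoothGM.
- by exists c => z /fc ->; rewrite mulr0.
- by move=> p /fD; apply: filterS => z ->; rewrite mulr0.
Qed.

Lemma test_funZ D f (k : R) : test_fun D f -> test_fun D (fun z => k * f z).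
Proof. by move=> tf; apply: test_funM => //; exact: smoothG_cst. Qed.

Lemma test_funD D f g : test_fun D f -> test_fun D g -> test_fun D (fun z => f z + g z).
Proof.
move=> /test_funP[sf [c fc] fD] /test_funP[sg [c' gc] gD]; apply/test_funP; split.
- exact: smoothGD.
- exists (Num.max c c') => z zc; rewrite fc ?gc ?addr0//.
    by move=> H; apply: zc; apply: box_le H; rewrite le_max lexx orbT.
  by move=> H; apply: zc; apply: box_le H; rewrite le_max lexx.
- move=> p Dp; apply: filterS2 (fD p Dp) (gD p Dp) => z -> ->; exact: addr0.
Qed.

Lemma test_funB D f g : test_fun D f -> test_fun D g -> test_fun D (fun z => f z - g z).
Proof.
move=> tf tg; have := test_funD tf (test_funZ (-1) tg).
by congr test_fun; apply/funext => z; rewrite mulN1r.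
Qed.

Lemma test_fun0 D : test_fun D (fun=> 0).
Proof.
apply/test_funP; split; first exact: smoothG_cst.
  by exists 0.
by move=> p _; apply: filterE.
Qed.

Lemma test_fun_sum D (I : Type) (s : seq I) (F : I -> R * R -> R) :
  (forall i, test_fun D (F i)) -> test_fun D (fun z => \sum_(i <- s) F i z).
Proof.
move=> H; elim: s => [|i s IH].
  by have := test_fun0 D; congr test_fun; apply/funext => z; rewrite big_nil.
have := test_funD (H i) IH; congr test_fun.
by apply/funext => z; rewrite big_cons.
Qed.

Lemma dxD f g z : smooth2 f -> smooth2 g -> dx (fun z => f z + g z) z = dx f z + dx g z.
Proof. by move=> sf sg; have [_] := is_deriveD (is_derive_dx z sf) (is_derive_dx z sg). Qed.

Lemma dyD f g z : smooth2 f -> smooth2 g -> dy (fun z => f z + g z) z = dy f z + dy g z.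
Proof. by move=> sf sg; have [_] := is_deriveD (is_derive_dy z sf) (is_derive_dy z sg). Qed.

Lemma dxB f g z : smooth2 f -> smooth2 g -> dx (fun z => f z - g z) z = dx f z - dx g z.
Proof. by move=> sf sg; have [_] := is_deriveB (is_derive_dx z sf) (is_derive_dx z sg). Qed.

Lemma dyB f g z : smooth2 f -> smooth2 g -> dy (fun z => f z - g z) z = dy f z - dy g z.
Proof. by move=> sf sg; have [_] := is_deriveB (is_derive_dy z sf) (is_derive_dy z sg). Qed.

Lemma dxM f g z : smooth2 f -> smooth2 g ->
  dx (fun z => f z * g z) z = f z * dx g z + g z * dx f z.
Proof. by move=> sf sg; have [_] := is_deriveM (is_derive_dx z sf) (is_derive_dx z sg). Qed.

Lemma dyM f g z : smooth2 f -> smooth2 g ->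
  dy (fun z => f z * g z) z = f z * dy g z + g z * dy f z.
Proof. by move=> sf sg; have [_] := is_deriveM (is_derive_dy z sf) (is_derive_dy z sg). Qed.

Lemma dxZ f (k : R) z : smooth2 f -> dx (fun z => k * f z) z = k * dx f z.
Proof. by move=> sf; have [_] := is_deriveZ k (is_derive_dx z sf). Qed.

Lemma dyZ f (k : R) z : smooth2 f -> dy (fun z => k * f z) z = k * dy f z.
Proof. by move=> sf; have [_] := is_deriveZ k (is_derive_dy z sf). Qed.

Lemma dx_cst (k : R) z : dx (fun=> k) z = 0.
Proof. exact: derive_cst. Qed.

Lemma dy_cst (k : R) z : dy (fun=> k) z = 0.
Proof. exact: derive_cst. Qed.

Lemma dx_sum (I : Type) (s : seq I) (F : I -> R * R -> R) z :
  (forall i, smooth2 (F i)) -> dx (fun z => \sum_(i <- s) F i z) z = \sum_(i <- s) dx (F i) z.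
Proof.
move=> H; elim: s => [|i s IH].
  by rewrite big_nil -[RHS](dx_cst 0 z); congr dx; apply/funext => w; rewrite big_nil.
rewrite big_cons -IH -dxD//; last first.
  elim: s {IH} => [|j s IH].
    by have := @smoothG_cst R _ [:: e1; e2] 0; congr smoothG; apply/funext => w; rewrite big_nil.
  have := smoothGD (H j) IH; congr smoothG.
  by apply/funext => w; rewrite big_cons.
by congr dx; apply/funext => w; rewrite big_cons.
Qed.

Lemma continuous_bounded_support f : continuous f -> bsupp f ->
  exists M, 0 <= M /\ forall z, `|f z| <= M.
Proof.
move=> cf [c fc].
have cK : compact (f @` box c).
  apply: continuous_compact; last exact: box_compact.
  exact: continuous_subspaceT.
have [M [_ HM]] := compact_bounded cK.
exists (Num.max 0 (M + 1)); split; first by rewrite le_max lexx.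
move=> z; rewrite le_max; apply/orP.
have [zc|/fc ->] := pselect (box c z); last by left; rewrite normr0.
by right; apply: (HM (M + 1)); [rewrite ltrDl|exists z].
Qed.

Lemma bsupp_L1 f : continuous f -> bsupp f -> L1 area (f : P -> R).
Proof.
move=> cf bf; have [M [_ fM]] := continuous_bounded_support cf bf.
have [c fc] := bf; apply: (L1_bounded_support _ fM fc).
exact: continuous_measurable_plane.
Qed.

Lemma bsupp_sqint f : continuous f -> bsupp f -> sqint area (f : P -> R).
Proof.
move=> cf bf; have [M [_ fM]] := continuous_bounded_support cf bf.
have [c fc] := bf; apply: (sqint_bounded_support _ fM fc).
exact: continuous_measurable_plane.
Qed.

Lemma test_fun_bsupp D f : test_fun D f -> bsupp f.
Proof. by move=> /test_funP[]. Qed.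

Lemma test_fun_continuous D f : test_fun D f -> continuous f.
Proof. by move=> /test_fun_smooth/smoothG_continuous. Qed.

Lemma test_fun_bounded D f : test_fun D f -> exists M, 0 <= M /\ forall z, `|f z| <= M.
Proof.
by move=> tf; apply: continuous_bounded_support; [exact: test_fun_continuous tf|exact: test_fun_bsupp tf].
Qed.

Lemma test_fun_L1 D f : test_fun D f -> L1 area (f : P -> R).
Proof.
by move=> tf; apply: bsupp_L1; [exact: test_fun_continuous tf|exact: test_fun_bsupp tf].
Qed.

Lemma test_fun_sqint D f : test_fun D f -> sqint area (f : P -> R).
Proof.
by move=> tf; apply: bsupp_sqint; [exact: test_fun_continuous tf|exact: test_fun_bsupp tf].
Qed.

Lemma int_FTC (G g : R -> R) (a b : R) : a < b -> (forall t : R, is_derive t 1 G (g t)) ->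
  continuous g -> \int[leb]_(t in `[a, b]) g t = G b - G a.
Proof.
move=> ab Gg cg.
have cG (x : R) : {for x, continuous G} by exact: is_derive_continuous1 (Gg x).
rewrite /Rintegral (@continuous_FTC2 R g G a b ab)//.
- exact: continuous_subspaceT.
- split.
  + by move=> t _; case: (Gg t).
  + exact: cvg_at_right_filter (cG a).
  + exact: cvg_at_left_filter (cG b).
- by move=> t _; rewrite derive1E; case: (Gg t).
Qed.

Lemma int_derive_bsupp (G g : R -> R) (c : R) : (forall t : R, is_derive t 1 G (g t)) ->
  continuous g -> (forall t, c < `|t| -> G t = 0) -> \int[leb]_t g t = 0.
Proof.
move=> Gg cg Gc.
pose b := `|c| + 1.
have cb : c < b by rewrite /b (le_lt_trans (ler_norm c))// ltrDl.
have b0 : 0 < b by rewrite ltr_wpDl.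
have g0 t : c < `|t| -> g t = 0.
  move=> ct; have [_ <-] := Gg t.
  rewrite (near_eq_derive _ (g := cst 0)) ?derive_cst//.
  near=> s; apply: Gc; near: s.
  by apply: (@cvgr_gt _ _ _ _ (fun s : R => `|s|)) ct; exact: norm_continuous.
have -> : \int[leb]_t g t = \int[leb]_(t in `[- b, b]) g t.
  rewrite [RHS]Rintegral_mkcond; apply: eq_Rintegral => t _.
  rewrite patchE; case: ifPn => //; rewrite notin_setE /= in_itv/= -ler_norml => /negP.
  by rewrite -ltNge => bt; rewrite g0// (lt_trans cb).
rewrite (@int_FTC G g)// ?gtrN//.
by rewrite !Gc ?subrr// ?normrN gtr0_norm.
Unshelve. all: end_near. Qed.

Lemma continuous_pairl (y : R) : continuous (fun x : R => (x, y)).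
Proof. by move=> t; exact: (cvg_pair (@cvg_id _ (nbhs t)) (cvg_cst y)). Qed.

Lemma continuous_pairr (x : R) : continuous (fun y : R => (x, y)).
Proof. by move=> t; exact: (cvg_pair (cvg_cst x) (@cvg_id _ (nbhs t))). Qed.

Lemma int_dx f : smooth2 f -> bsupp f -> \int[area]_z (dx f z) = 0.
Proof.
move=> sf bf; have [c fc] := bf.
have L : L1 area (dx f : P -> R).
  by apply: bsupp_L1; [exact: smoothG_continuous (smooth2_dx sf)|exact: (bsupp_dx bf).1].
rewrite -(int_fubini2 L) -[RHS](int0 leb); apply: eq_int => y.
apply: (@int_derive_bsupp (fun x => f (x, y)) (fun x => dx f (x, y)) c).
- move=> t.
  have E (s : R) : s *: e1 + (0, y) = (s, y) by rewrite pairZD !(mulr0, mulr1, add0r, addr0).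
  have := @is_derive_line R f e1 (0, y) t (dx f (t, y)); rewrite E.
  move=> /(_ (is_derive_dx _ sf)).
  by under eq_fun do rewrite E.
- move=> t; apply: (continuous_comp (f := fun x => (x, y)) (g := dx f)).
    exact: (@continuous_pairl y t).
  exact: (smoothG_continuous (smooth2_dx sf)).
- move=> t ct; apply: fc => -[/= + _]; rewrite in_itv/= -ler_norml.
  by rewrite leNgt ct.
Qed.

Lemma int_dy f : smooth2 f -> bsupp f -> \int[area]_z (dy f z) = 0.
Proof.
move=> sf bf; have [c fc] := bf.
have L : L1 area (dy f : P -> R).
  by apply: bsupp_L1; [exact: smoothG_continuous (smooth2_dy sf)|exact: (bsupp_dx bf).2].
rewrite -(int_fubini L) -[RHS](int0 leb); apply: eq_int => x.
apply: (@int_derive_bsupp (fun y => f (x, y)) (fun y => dy f (x, y)) c).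
- move=> t.
  have E (s : R) : s *: e2 + (x, 0) = (x, s) by rewrite pairZD !(mulr0, mulr1, add0r, addr0).
  have := @is_derive_line R f e2 (x, 0) t (dy f (x, t)); rewrite E.
  move=> /(_ (is_derive_dy _ sf)).
  by under eq_fun do rewrite E.
- move=> t; apply: (continuous_comp (f := fun y => (x, y)) (g := dy f)).
    exact: (@continuous_pairr x t).
  exact: (smoothG_continuous (smooth2_dy sf)).
- move=> t ct; apply: fc => -[/= _]; rewrite in_itv/= -ler_norml.
  by rewrite leNgt ct.
Qed.

End TestFun.

(** * Averaging kernels and the divergence equation *)

Section ProductL1.
Context d1 d2 (T1 : measurableType d1) (T2 : measurableType d2) (R : realType).
Variable m1 : {sigma_finite_measure set T1 -> \bar R}.
Variable m2 : {sigma_finite_measure set T2 -> \bar R}.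

(** Tonelli's criterion with a majorant for the inner integrals; it supplies the hypothesis of
    Fubini's theorem for all kernels below. *)
Lemma L1_prod_le (F : T1 * T2 -> R) (a : T1 -> R) (C : R) : measurable_fun setT F ->
  L1 m1 a -> (forall x, (\int[m2]_y `|(F (x, y))%:E| <= C%:E * `|(a x)%:E|)%E) ->
  L1 (m1 \x m2)%E F.
Proof.
move=> mF La HF; have mF' : measurable_fun setT (EFin \o F) by exact/measurable_EFinP.
apply/(integrable12ltyP m1 m2 mF').
move: La => /integrableP[ma La].
have C0 x : (0 <= C%:E * `|(a x)%:E|)%E.
  by apply: le_trans (HF x); apply: integral_ge0.
apply: (@le_lt_trans _ _ (\int[m1]_x (C%:E * `|(a x)%:E|))%E).
  apply: ge0_le_integral => //.
  - by move=> x _; apply: integral_ge0.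
  - apply: (measurable_fun_fubini_tonelli_F (fun z => `|(F z)%:E|)%E) => //.
    by apply: measurableT_comp => //; exact/measurable_EFinP.
  - apply: measurable_funeM; exact: measurableT_comp.
  - by move=> x _; exact: HF.
have [C1|C1] := leP 0 C.
  rewrite ge0_integralZl//; last exact: measurableT_comp.
  by apply: lte_mul_pinfty.
rewrite integral0_eq ?ltry// => x _; apply/eqP; rewrite eq_le C0 andbT.
by rewrite mule_le0_ge0// lee_fin ltW.
Qed.

End ProductL1.

(** * Superpositions of translates and their transposes *)

Section Average.
Context {R : realType} dX (X : measurableType dX) (mu : {sigma_finite_measure set X -> \bar R}).
Local Notation leb := (@lebesgue_measure R).
Local Notation area := (@lebesgue_measure R \x @lebesgue_measure R)%E.
Local Notation areaS := (prodm (@lebesgue_measure R) (@lebesgue_measure R)).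
Local Notation P := (measurableTypeR R * measurableTypeR R)%type.
Local Notation e1 := ((1, 0) : R * R).
Local Notation e2 := ((0, 1) : R * R).
Variables (a : X -> R) (m : X -> P).
Hypotheses (La : L1 mu a) (mm : measurable_fun setT m).

(** A superposition of translates with signed weight [a]. The parameter space stays abstract: it is
    the real line, with a weight on a segment, when translating along a fixed vector, and the plane
    times the line when displacements are averaged too. *)
Definition average (g : R * R -> R) (z : R * R) : R := \int[mu]_x (a x * g (z - m x)).
(** The transpose of [average] for the integral pairing ([int_average]); it acts on functions that
    are merely square-integrable. *)
Definition adj_average (U : R * R -> R) (w : R * R) : R := \int[mu]_x (a x * U (w + m x)).

Let ma : measurable_fun setT a := L1_measurable La.

Lemma average_measurable (g : R * R -> R) z : continuous g ->
  measurable_fun setT (fun x => g (z - m x)).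
Proof.
move=> cg; apply: (measurableT_comp (f := fun w : P => g (z - w))) => //.
apply: continuous_measurable_plane => w; apply: continuous_comp; last exact: cg.
by apply: cvgB; [exact: cvg_cst|exact: cvg_id].
Qed.

Lemma average_L1 (g : R * R -> R) M z : continuous g -> (forall z, `|g z| <= M) ->
  L1 mu (fun x => a x * g (z - m x)).
Proof.
move=> cg gM.
have := L1_bounded (average_measurable z cg) (fun x => gM (z - m x)) La.
by apply: eq_L1 => x; exact: mulrC.
Qed.

Lemma average_is_derive (g dg : R * R -> R) (v : R * R) M z : continuous g ->
  (forall z, `|g z| <= M) -> (forall z, is_derive z v g (dg z)) ->
  (forall z, `|dg z| <= M) ->
  is_derive z v (average g) (average dg z).
Proof.
move=> cg gM gd dM; apply/is_derive_alongP.
pose f (h : R) (x : X) := a x * g (h *: v + z - m x).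
have fE (h : R) x : is_derive h 1 (f ^~ x) (a x * dg (h *: v + z - m x)).
  have H : is_derive h 1 (fun h : R => g (h *: v + (z - m x))) (dg (h *: v + z - m x)).
    by apply: is_derive_line; rewrite addrA; exact: gd.
  have := is_deriveZ (a x) H.
  rewrite (_ : a x \*: _ = f ^~ x) //.
  by apply/funext => t; rewrite /f -addrA.
have I0 : `](-1 : R), 1[%classic 0 by rewrite /= in_itv/= ltrN10 ltr01.
have d1E h x : partial1of2 f h x = a x * dg (h *: v + z - m x).
  by rewrite partial1of2E; have [_ ->] := fE h x.
have intf h : `](-1 : R), 1[%classic h -> mu.-integrable setT (EFin \o f h).
  by move=> _; exact: (average_L1 (h *: v + z) cg gM).
have derf h x : `](-1 : R), 1[%classic h -> [set: X] x -> derivable (f ^~ x) h 1.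
  by move=> _ _; case: (fE h x).
pose G x := M * `|a x|.
have M0 : 0 <= M by apply: le_trans (gM z); exact: normr_ge0.
have G0 x : 0 <= G x by rewrite mulr_ge0.
have LG : mu.-integrable setT (EFin \o G) by exact: L1Z (L1_norm La).
have GU h x : `](-1 : R), 1[%classic h -> [set: X] x -> `|partial1of2 f h x| <= G x.
  by move=> _ _; rewrite d1E normrM mulrC ler_wpM2r.
apply: DeriveDef.
- exact: (derivable_under_integral measurableT I0 intf derf G0 LG GU).
- have := differentiation_under_integral measurableT I0 intf derf G0 LG GU.
  rewrite derive1E => ->; apply: eq_int => x.
  by rewrite d1E scale0r add0r.
Qed.

(** Derivatives fall on [g], so averages of smooth functions of bounded support form a class closed
    under differentiation; their continuity comes from a Lipschitz bound. *)
Lemma average_smooth (g : R * R -> R) : smooth2 g -> bsupp g -> smooth2 (average g).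
Proof.
move=> sg bg.
pose S (F : R * R -> R) := exists g, [/\ smooth2 g, bsupp g & F = average g].
apply: (@smooth2_coind _ S); last by exists g.
move=> _ [{sg bg}g [sg bg ->]].
have [M [M0 gM]] := continuous_bounded_support (smoothG_continuous sg) bg.
have [b1 b2] := bsupp_dx bg.
have s1 := smooth2_dx sg; have s2 := smooth2_dy sg.
have [M1 [M10 gM1]] := continuous_bounded_support (smoothG_continuous s1) b1.
have [M2 [M20 gM2]] := continuous_bounded_support (smoothG_continuous s2) b2.
pose K := Num.max M (Num.max M1 M2).
have K0 z : `|g z| <= K by rewrite le_max gM.
have K1 z : `|dx g z| <= K by rewrite !le_max gM1 orbT.
have K2 z : `|dy g z| <= K by rewrite !le_max gM2 !orbT.
have D1 z : is_derive z e1 (average g) (average (dx g) z).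
  by apply: (average_is_derive (M := K)) => //; [exact: smoothG_continuous sg|move=> w; exact: is_derive_dx].
have D2 z : is_derive z e2 (average g) (average (dy g) z).
  by apply: (average_is_derive (M := K)) => //; [exact: smoothG_continuous sg|move=> w; exact: is_derive_dy].
exists (average (dx g)), (average (dy g)); split => //.
- have B z (h : R * R -> R) : continuous h -> (forall z, `|h z| <= K) ->
      `|average h z| <= K * \int[mu]_x `|a x|.
    move=> ch hK; apply: le_trans (int_norm (average_L1 z ch hK)) _.
    rewrite -intZ; last exact: L1_norm.
    apply: int_le.
    - exact: L1_norm (average_L1 z ch hK).
    - exact: L1Z (L1_norm La).
    - by move=> x; rewrite normrM mulrC ler_wpM2r.
  apply: (@lipschitz_continuous_plane _ _ (K * \int[mu]_x `|a x|)) => z w.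
  apply: (@le_MVT_plane _ _ (average (dx g)) (average (dy g)) z (`|z - w| + 1)).
  + by move=> u _; split.
  + move=> u _; split; apply: B => //; exact: smoothG_continuous.
  + by rewrite -ball_normE /ball_/= ltrDl.
- by exists (dx g).
- by exists (dy g).
Qed.

Lemma dx_average (g : R * R -> R) z : smooth2 g -> bsupp g ->
  dx (average g) z = average (dx g) z.
Proof.
move=> sg bg.
have [M [M0 gM]] := continuous_bounded_support (smoothG_continuous sg) bg.
have [b1 _] := bsupp_dx bg; have s1 := smooth2_dx sg.
have [M1 [M10 gM1]] := continuous_bounded_support (smoothG_continuous s1) b1.
have [] := @average_is_derive g (dx g) e1 (Num.max M M1) z => //.
- exact: smoothG_continuous sg.
- by move=> w; rewrite le_max gM.
- by move=> w; exact: is_derive_dx.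
- by move=> w; rewrite le_max gM1 orbT.
Qed.

Lemma dy_average (g : R * R -> R) z : smooth2 g -> bsupp g ->
  dy (average g) z = average (dy g) z.
Proof.
move=> sg bg.
have [M [M0 gM]] := continuous_bounded_support (smoothG_continuous sg) bg.
have [_ b1] := bsupp_dx bg; have s1 := smooth2_dy sg.
have [M1 [M10 gM1]] := continuous_bounded_support (smoothG_continuous s1) b1.
have [] := @average_is_derive g (dy g) e2 (Num.max M M1) z => //.
- exact: smoothG_continuous sg.
- by move=> w; rewrite le_max gM.
- by move=> w; exact: is_derive_dy.
- by move=> w; rewrite le_max gM1 orbT.
Qed.

Let mshift (V : P -> R) : measurable_fun setT V ->
  measurable_fun setT (fun q : X * P => a q.1 * V (q.2 + m q.1)).
Proof.
move=> mV; apply: measurable_funM; first exact: measurableT_comp.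
apply: (measurableT_comp mV).
have m1 : measurable_fun setT (fun q : X * P => m q.1) by exact: measurableT_comp.
apply/measurable_fun_pairP; split.
- rewrite [X in measurable_fun _ X](_ : _ = (fun q : X * P => q.2.1 + (m q.1).1)) //.
  by apply: measurable_funD; apply: measurableT_comp => //; exact: measurableT_comp.
- rewrite [X in measurable_fun _ X](_ : _ = (fun q : X * P => q.2.2 + (m q.1).2)) //.
  by apply: measurable_funD; apply: measurableT_comp => //; exact: measurableT_comp.
Qed.

Lemma L1_shift_prod (V : P -> R) : L1 area V ->
  L1 (mu \x areaS)%E (fun q : X * P => a q.1 * V (q.2 + m q.1)).
Proof.
move=> LV; have mV := L1_measurable LV.
apply: (@L1_prod_le _ _ _ _ _ _ _ _ a (\int[area]_z `|V z|)) => //; first exact: mshift.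
move=> x /=.
have mabs : measurable_fun setT (fun z : P => `|(V z)%:E|%E).
  by apply: measurableT_comp => //; exact/measurable_EFinP.
rewrite (eq_integral (fun z : P => `|(a x)%:E| * `|(V (z + m x))%:E|)%E); last first.
  by move=> z _; rewrite /= normrM EFinM.
rewrite ge0_integralZl//; last first.
  by apply: (measurableT_comp mabs); exact: measurable_shift.
rewrite (ge0_integral_shift (m x) (f := fun z => `|(V z)%:E|%E))//.
by rewrite muleC -int_EFin//; exact: L1_norm.
Qed.

Let mpair (f : X * P -> P) : measurable_fun setT (fun q => (f q).1) ->
  measurable_fun setT (fun q => (f q).2) -> measurable_fun setT f.
Proof. by move=> m1 m2; apply/measurable_fun_pairP. Qed.

Lemma L1_kernel (U phi : R * R -> R) M : L1 area (U : P -> R) -> continuous phi ->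
  (forall z, `|phi z| <= M) ->
  L1 (mu \x areaS)%E (fun q : X * P => U q.2 * (a q.1 * phi (q.2 - m q.1))).
Proof.
move=> LU cphi phiM; have mU := L1_measurable LU.
have M0 : 0 <= M by apply: le_trans (phiM 0); exact: normr_ge0.
apply: (@L1_prod_le _ _ _ _ _ _ _ _ a (M * \int[area]_z `|U z|)) => //.
  apply: measurable_funM; first exact: (measurableT_comp mU).
  apply: measurable_funM; first exact: measurableT_comp.
  apply: (measurableT_comp (f := (phi : P -> R))).
    exact: continuous_measurable_plane.
  have m1 : measurable_fun setT (fun q : X * P => m q.1) by exact: measurableT_comp.
  apply: mpair => /=.
  + by apply: measurable_funB; [apply: (measurableT_comp measurable_fst)|apply: (measurableT_comp measurable_fst)].
  + by apply: measurable_funB; [apply: (measurableT_comp measurable_snd)|apply: (measurableT_comp measurable_snd)].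
move=> x /=.
have mabs : measurable_fun setT (fun z : P => `|(U z)%:E|%E).
  by apply: measurableT_comp => //; exact/measurable_EFinP.
apply: (@le_trans _ _ (\int[area]_y ((M * `|a x|)%:E * `|(U y)%:E|))%E).
  apply: ge0_le_integral => //=.
  - apply/measurable_EFinP; apply: measurableT_comp => //.
    apply: measurable_funM; first exact: mU.
    apply: measurable_funM; first exact: measurable_cst.
    apply: (measurableT_comp (f := (phi : P -> R))).
      exact: continuous_measurable_plane.
    exact: measurable_shift.
  - exact: measurable_funeM.
  - move=> y _; rewrite -EFinM lee_fin !normrM mulrC ler_wpM2r// mulrC.
    by rewrite ler_wpM2r.
rewrite ge0_integralZl// ?lee_fin ?mulr_ge0//.
have -> : (\int[area]_y `|(U y)%:E| = (\int[area]_z `|U z|)%:E)%E.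
  by rewrite -int_EFin//; exact: L1_norm.
by rewrite -!EFinM /= lee_fin mulrAC.
Qed.

Lemma int_average_fubini (U phi : R * R -> R) M : L1 area (U : P -> R) ->
  continuous phi -> (forall z, `|phi z| <= M) ->
  \int[area]_z (U z * average phi z) =
  \int[mu]_x \int[area]_z (U z * (a x * phi (z - m x))).
Proof.
move=> LU cphi phiM; have LK := L1_kernel LU cphi phiM.
transitivity (\int[areaS]_z \int[mu]_x (U z * (a x * phi (z - m x)))).
  by apply: eq_int => z; rewrite intZ//; exact: average_L1 phiM.
by rewrite (int_fubini2 LK) -(int_fubini LK).
Qed.

Lemma int_average (U phi : R * R -> R) : L1 area (U : P -> R) -> continuous phi ->
  bsupp phi ->
  \int[area]_z (U z * average phi z) = \int[area]_w (phi w * adj_average U w).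
Proof.
move=> LU cphi bphi.
have [M [M0 phiM]] := continuous_bounded_support cphi bphi.
have mU := L1_measurable LU.
have LK := L1_kernel LU cphi phiM.
have LK2 : L1 (mu \x areaS)%E (fun q : X * P => phi q.2 * (a q.1 * U (q.2 + m q.1))).
  apply: (L1_bounded (M := M)); last exact: L1_shift_prod.
    apply: (measurableT_comp (f := (phi : P -> R))) => //.
    exact: continuous_measurable_plane.
  by move=> q; exact: phiM.
rewrite (int_average_fubini LU cphi phiM).
have LKU := L1_shift_prod LU.
transitivity (\int[mu]_x \int[areaS]_w (phi w * (a x * U (w + m x)))).
  apply: eq_int => x.
  have Lx : L1 area (fun z : P => U z * (a x * phi (z - m x))).
    have mp : measurable_fun setT (fun z : P => a x * phi (z - m x)).
      apply: measurable_funM; first exact: measurable_cst.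
      apply: (measurableT_comp (f := (phi : P -> R))).
        exact: continuous_measurable_plane.
      exact: measurable_shift.
    have := @L1_bounded _ _ _ area _ _ (`|a x| * M) mp _ LU.
    have bp z : `|a x * phi (z - m x)| <= `|a x| * M by rewrite normrM ler_wpM2l.
    by move=> /(_ bp); apply: eq_L1 => z; exact: mulrC.
  have := int_shift (m x) Lx.
  rewrite /= => <-; apply: eq_int => w; rewrite addrK; ring.
rewrite (int_fubini LK2) -(int_fubini2 LK2).
rewrite /Rintegral; congr fine; apply: ae_eq_integral => //.
- by apply/measurable_EFinP; exact: (fine_measurable_int2 LK2).
- apply/measurable_EFinP; apply: measurable_funM; first exact: continuous_measurable_plane.
  exact: (fine_measurable_int2 LKU).
- apply: filterS (ae_integrable2 LKU) => w Lw _; congr EFin.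
  exact: (intZ (phi w) Lw).
Qed.

(** Young's inequality for a weight of finite mass: at each point |int a U|^2 <= A int |a| U^2, and
    the right-hand side is integrable by Fubini and translation invariance. *)
Lemma sqint_adj_average (U : R * R -> R) (c : R) : sqint area (U : P -> R) ->
  (forall z, ~ box c z -> U z = 0) -> sqint area (adj_average U : P -> R).
Proof.
move=> SU Uc; have LU := sqint_L1 SU Uc.
have LK := L1_shift_prod LU; have LK2 := L1_shift_prod (proj2 SU).
have madj : measurable_fun setT (adj_average U : P -> R) := fine_measurable_int2 LK.
split=> //; apply/integrableP; split.
  by apply/measurable_EFinP; exact: measurable_funX.
(* The added 1 keeps [A] positive when [a] vanishes almost everywhere, so that it can be divided
   by. *)
pose A := \int[mu]_x `|a x| + 1.
have A0 : 0 < A by rewrite ltr_wpDl// int_ge0.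
have mK2 := L1_measurable LK2.
have mF : measurable_fun setT (fun w : P => \int[mu]_x `|(a x * U (w + m x) ^+ 2)%:E|)%E.
  apply: (measurable_fun_fubini_tonelli_G (fun q : X * P => `|(a q.1 * U (q.2 + m q.1) ^+ 2)%:E|)%E) => //.
  by apply: measurableT_comp => //; exact/measurable_EFinP.
apply: (@le_lt_trans _ _ (\int[area]_w (A%:E * \int[mu]_x `|(a x * U (w + m x) ^+ 2)%:E|))%E).
  apply: ge0_le_integral => //.
  - by apply: measurableT_comp => //; apply/measurable_EFinP; exact: measurable_funX.
  - exact: measurable_funeM.
  move=> w _ /=; rewrite ger0_norm ?sqr_ge0//.
  (* Where the section is not integrable the bound is infinite and there is nothing to prove. *)
  have [S|] := pselect (L1 mu (fun x => a x * U (w + m x) ^+ 2)); last first.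
    move=> nL.
    have -> : (\int[mu]_x `|(a x * U (w + m x) ^+ 2)%:E| = +oo)%E.
      apply/eqP; rewrite -leye_eq leNgt; apply/negP => H; apply: nL; apply/integrableP; split => //.
      apply/measurable_EFinP.
      exact: (measurableT_comp mK2 (measurable_pair2 w)).
    by rewrite gt0_muley ?lte_fin// leey.
  have mUw : measurable_fun setT (fun x => U (w + m x)).
    apply: (measurableT_comp (sqint_measurable SU)).
    have -> : (fun x => w + m x) = (fun x => m x + w) by apply/funext => x; rewrite addrC.
    exact: (measurableT_comp (measurable_shift w)).
  have L1aU : L1 mu (fun x => a x * U (w + m x)).
    apply: (L1_le _ _ (L1D (L1_norm La) (L1_norm S))).
      exact: measurable_funM.
    move=> x; rewrite !normrM -[X in _ <= X + _]mulr1 -mulrDr ler_wpM2l//.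
    have := sqr_ge0 (`|U (w + m x)| - 1); have := normr_ge0 (U (w + m x)).
    by move: (`|U _|) => t; nra.
  have -> : (\int[mu]_x `|(a x * U (w + m x) ^+ 2)%:E| =
    (\int[mu]_x `|a x * U (w + m x) ^+ 2|)%:E)%E.
    by rewrite -int_EFin//; exact: L1_norm.
  rewrite -EFinM lee_fin.
  set J := adj_average U w.
  (* Cauchy-Schwarz, from [0 <= \int |a| (|U| - |J| / A)^2] *)
  have LN := L1_norm L1aU.
  have JJ : `|J| <= \int[mu]_x `|a x * U (w + m x)| by exact: int_norm.
  have : 0 <= \int[mu]_x (`|a x * U (w + m x) ^+ 2| + ((`|J| / A) ^+ 2 * `|a x| -
     2 * (`|J| / A) * `|a x * U (w + m x)|)).
    apply: int_ge0 => x; rewrite !normrM.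
    have := mulr_ge0 (normr_ge0 (a x)) (sqr_ge0 (`|U (w + m x)| - `|J| / A)).
    by congr (_ <= _); ring.
  rewrite intD; [|exact: L1_norm|by apply: L1B; apply: L1Z => //; exact: L1_norm].
  rewrite intB; [|by apply: L1Z; exact: L1_norm|exact: L1Z].
  rewrite !intZ//; last exact: L1_norm.
  have J0 : 0 <= `|J| / A by rewrite divr_ge0// ltW.
  have -> : \int[mu]_x `|a x| = A - 1 by rewrite /A addrK.
  rewrite -[J ^+ 2]real_normK ?num_real//.
  have E : `|J| = A * (`|J| / A) by field; rewrite gt_eqF.
  move: (\int[mu]_x `|a x * U (w + m x)|) (\int[mu]_x `|a x * U (w + m x) ^+ 2|) JJ => j s JJ H.
  move: (`|J| / A) E J0 H JJ => t -> t0 H JJ.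
  have h1 : t * (A * t) <= t * j by rewrite ler_wpM2l.
  have h2 : A * (t * (A * t)) <= A * s by rewrite ler_wpM2l ?(ltW A0)//; nra.
  apply: le_trans h2; rewrite exprMn expr2; rewrite le_eqVlt; apply/orP; left; apply/eqP; ring.
rewrite ge0_integralZl// ?lee_fin ?(ltW A0)//; last by move=> w _; exact: integral_ge0.
apply: lte_mul_pinfty; rewrite ?lee_fin ?(ltW A0)//.
by have /(integrable21ltyP mu areaS (iffRL (measurable_EFinP _ _) mK2)) := LK2.
Qed.

Lemma test_fun_average (D C : set (R * R)) (g : R * R -> R) : smooth2 g -> bsupp g ->
  compact C -> C `<=` D -> (forall x z, a x != 0 -> g (z - m x) != 0 -> C z) ->
  test_fun D (average g).
Proof.
move=> sg bg cC CD H.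
have z0 z : ~ C z -> average g z = 0.
  move=> nC; rewrite -[RHS](int0 mu); apply: eq_int => x.
  have [->|a0] := eqVneq (a x) 0; first by rewrite mul0r.
  have [->|g0] := eqVneq (g (z - m x)) 0; first by rewrite mulr0.
  by case: nC; exact: H a0 g0.
apply/test_funP; split; first exact: average_smooth.
  have [M [_ HM]] := compact_bounded cC.
  exists (M + 1) => z zb; apply: z0 => Cz; apply: zb.
  have : `|z| <= M + 1 by apply: (HM (M + 1)); rewrite ?ltrDl.
  rewrite prod_normE ge_max => /andP[h1 h2].
  by split; rewrite /= in_itv/= -ler_norml.
move=> p Dp; have : nbhs p (~` C).
  apply: open_nbhs_nbhs; split; last by move=> /CD.
  by rewrite openC; apply: compact_closed cC; exact: norm_hausdorff.
by apply: filterS => z; exact: z0.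
Qed.

End Average.

(** * Smooth steps, cutoffs and mollifiers *)

Section Cutoff.
Context {R : realType}.
Local Notation leb := (@lebesgue_measure R).
Local Notation area := (@lebesgue_measure R \x @lebesgue_measure R)%E.
Local Notation P := (measurableTypeR R * measurableTypeR R)%type.

Lemma int_indic d (T : measurableType d) (mu : {measure set T -> \bar R}) (A : set T) :
  measurable A -> \int[mu]_z \1_A z = fine (mu A).
Proof. by move=> mA; rewrite /Rintegral integral_indic// setIT. Qed.

Lemma int_gt0_leb (f : R -> R) (x : R) : continuous f -> (forall t, 0 <= f t) -> L1 leb f ->
  0 < f x -> 0 < \int[leb]_t f t.
Proof.
move=> cf f0 Lf fx.
have : \forall t \near x, f x / 2 < f t.
  by apply: (cvgr_gt _ (cf x)); rewrite ltr_pdivrMr// ltr_pMr// ltr1n.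
move=> /nbhs_ballP[r /= r0 rf].
have mb : measurable (ball x r : set (measurableTypeR R)) by exact: measurable_ball.
have fin : (leb (ball x r) < +oo)%E by rewrite lebesgue_measure_ball ?ltry// ltW.
have Lb := L1_indic mb fin.
apply: (@lt_le_trans _ _ (\int[leb]_t (f x / 2 * \1_(ball x r) t))).
  rewrite intZ//; apply: mulr_gt0; first by rewrite divr_gt0.
  have -> : \int[leb]_z \1_(ball x r) z = r *+ 2.
    exact: (etrans (int_indic leb mb) (congr1 fine (lebesgue_measure_ball x (ltW r0)))).
  by rewrite mulrn_wgt0.
apply: int_le => //; first exact: L1Z.
move=> t; rewrite indicE; case: (boolP (t \in _)) => [|_].
  by rewrite inE => /rf /ltW; rewrite mulr1.
by rewrite mulr0.
Qed.

Definition step (t : R) : R := primitive hat t / \int[leb]_t hat t.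

Lemma hat_mass_gt0 : 0 < \int[leb]_t hat t.
Proof.
apply: (@int_gt0_leb _ (2^-1)).
- exact: smoothG_continuous smooth1_hat.
- by move=> t; exact: hat_ge0.
- exact: compact_support_L1 smooth1_hat hat_eq0.
- by apply: hat_gt0; apply/andP; split; lra.
Qed.

Lemma smooth1_step : smooth1 step.
Proof.
have : smooth1 (fun t => (\int[leb]_t hat t)^-1 * primitive hat t).
  by apply: smoothGZ; exact: smooth1_primitive smooth1_hat hat_eq0.
by congr smoothG; apply/funext => t; rewrite mulrC.
Qed.

Lemma is_derive_step (t : R) : is_derive t 1 step (hat t / \int[leb]_t hat t).
Proof.
have := is_deriveZ (\int[leb]_t hat t)^-1 (is_derive_primitive smooth1_hat hat_eq0 t).
rewrite /GRing.scale /= mulrC.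
by congr (is_derive _ _ _ _); apply/funext => s /=; rewrite /step mulrC.
Qed.

Lemma step_le0 t : t <= 0 -> step t = 0.
Proof. by move=> t0; rewrite /step (primitive_lt hat_eq0)// mul0r. Qed.

Lemma step_ge1 t : 1 <= t -> step t = 1.
Proof. by move=> t1; rewrite /step (primitive_gt hat_eq0)// divff// gt_eqF// hat_mass_gt0. Qed.

Lemma step_ge0 t : 0 <= step t.
Proof.
rewrite /step divr_ge0//; last exact: ltW hat_mass_gt0.
by rewrite /primitive; apply: Rintegral_ge0 => s _; exact: hat_ge0.
Qed.

Lemma step_le1 t : step t <= 1.
Proof.
rewrite /step ler_pdivrMr ?hat_mass_gt0// mul1r /primitive Rintegral_mkcond.
have L : L1 leb hat := compact_support_L1 smooth1_hat hat_eq0.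
apply: int_le => //.
  apply: (L1_le _ _ L).
    by apply: (measurable_restrictT _ _).1 => //; apply: measurable_funS (L1_measurable L).
  move=> s; rewrite patchE; case: ifP => _; rewrite ?normr0 ?hat_ge0//.
  by rewrite ger0_norm// hat_ge0.
by move=> s; rewrite patchE; case: ifP => _ //; exact: hat_ge0.
Qed.

(** Comparing squares instead of absolute values keeps the function smooth at 0. *)
Definition cut1 (a b x : R) : R := step ((a ^+ 2 - x ^+ 2) / (a ^+ 2 - b ^+ 2)).

Lemma smooth1_cut1 a b : smooth1 (cut1 a b).
Proof.
apply: smoothG_comp; first exact: smooth1_step.
have : smooth1 (fun x : R => (a ^+ 2 - b ^+ 2)^-1 * (a ^+ 2 - x * x)).
  apply: smoothGZ; apply: smoothGB; first exact: smoothG_cst.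
  by apply: smoothGM; exact: smooth1_id.
by congr smoothG; apply/funext => x; rewrite mulrC expr2.
Qed.

Lemma cut1_eq1 a b x : 0 <= b -> b < a -> `|x| <= b -> cut1 a b x = 1.
Proof.
move=> b0' ba xb; apply: step_ge1.
have D : 0 < a ^+ 2 - b ^+ 2 by rewrite subr_gt0 ltrXn2r ?nnegrE// (ltW (le_lt_trans b0' ba)).
rewrite ler_pdivlMr// mul1r lerD2l lerN2 -[x ^+ 2]real_normK ?num_real//.
by rewrite lerXn2r ?nnegrE.
Qed.

Lemma cut1_eq0 a b x : 0 <= b -> b < a -> a <= `|x| -> cut1 a b x = 0.
Proof.
move=> b0' ba xa; apply: step_le0.
have a0 : 0 <= a by exact: ltW (le_lt_trans b0' ba).
have D : 0 < a ^+ 2 - b ^+ 2 by rewrite subr_gt0 ltrXn2r ?nnegrE.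
rewrite pmulr_lle0 ?invr_gt0// subr_le0 -[x ^+ 2]real_normK ?num_real//.
by rewrite lerXn2r ?nnegrE.
Qed.

Lemma smooth2_shift f (p : R * R) : smooth2 f -> smooth2 (fun z => f (z - p)).
Proof.
move=> sf; pose S (F : R * R -> R) := exists2 f, smooth2 f & F = (fun z => f (z - p)).
apply: (@smooth2_coind _ S); last by exists f.
move=> _ [{sf}f sf ->].
exists (fun z => dx f (z - p)), (fun z => dy f (z - p)); split.
- have cs : continuous (fun z : R * R => z - p).
    by move=> z; apply: cvgB; [exact: cvg_id|exact: cvg_cst].
  by move=> z; apply: continuous_comp; [exact: cs|exact: (smoothG_continuous sf)].
- move=> z; apply/is_derive_alongP; have /is_derive_alongP := is_derive_dx (z - p) sf.
  by under eq_fun do rewrite addrA.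
- move=> z; apply/is_derive_alongP; have /is_derive_alongP := is_derive_dy (z - p) sf.
  by under eq_fun do rewrite addrA.
- by exists (dx f) => //; exact: smooth2_dx.
- by exists (dy f) => //; exact: smooth2_dy.
Qed.

Definition cutbox (p : R * R) (a b : R) (z : R * R) : R :=
  cut1 a b (z.1 - p.1) * cut1 a b (z.2 - p.2).

Lemma smooth2_cutbox p a b : smooth2 (cutbox p a b).
Proof.
have H1 : smooth2 (fun z => cut1 a b (z.1 - p.1)).
  apply: smoothG_comp; first exact: smooth1_cut1.
  by apply: smoothGB; [exact: smooth2_fst|exact: smoothG_cst].
have H2 : smooth2 (fun z => cut1 a b (z.2 - p.2)).
  apply: smoothG_comp; first exact: smooth1_cut1.
  by apply: smoothGB; [exact: smooth2_snd|exact: smoothG_cst].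
exact: smoothGM.
Qed.

Lemma cutbox_eq1 p a b z : 0 <= b -> b < a -> ball p b z -> cutbox p a b z = 1.
Proof.
move=> b0' ba [h1 h2].
by rewrite /cutbox !cut1_eq1 ?mulr1// distrC ltW.
Qed.

Definition cbox (p : R * R) (r : R) : set (R * R) :=
  `[p.1 - r, p.1 + r]%classic `*` `[p.2 - r, p.2 + r]%classic.

Lemma cboxP p r z : cbox p r z <-> `|z.1 - p.1| <= r /\ `|z.2 - p.2| <= r.
Proof.
rewrite /cbox /= !in_itv/= !ler_distl; split=> [[/andP[? ?] /andP[? ?]]|[/andP[? ?] /andP[? ?]]].
  by split; apply/andP; split.
by split; apply/andP; split.
Qed.

Lemma cbox_compact p r : compact (cbox p r).
Proof. by apply: compact_setX; exact: segment_compact. Qed.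

Lemma cutbox_eq0 p a b z : 0 <= b -> b < a -> ~ cbox p a z -> cutbox p a b z = 0.
Proof.
move=> b0' ba; rewrite cboxP => /not_andP[]/negP; rewrite -ltNge => /ltW h.
  by rewrite /cutbox (cut1_eq0 _ _ h)// mul0r.
by rewrite /cutbox [X in _ * X](cut1_eq0 _ _ h)// mulr0.
Qed.

Lemma compact_bounded_box (C : set (R * R)) : compact C -> exists c, C `<=` box c.
Proof.
move=> cC; have [M [_ HM]] := compact_bounded cC.
exists (M + 1) => z Cz.
have : `|z| <= M + 1 by apply: (HM (M + 1)); rewrite ?ltrDl.
rewrite prod_normE ge_max => /andP[h1 h2].
by split; rewrite /= in_itv/= -ler_norml.
Qed.

Lemma compact_closed_plane (C : set (R * R)) : compact C -> closed C.
Proof. by apply: compact_closed; exact: norm_hausdorff. Qed.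

Lemma test_fun_compact D (C : set (R * R)) f : smooth2 f -> compact C -> C `<=` D ->
  (forall z, ~ C z -> f z = 0) -> test_fun D f.
Proof.
move=> sf cC CD fC; apply/test_funP; split => //.
  have [c Cc] := compact_bounded_box cC.
  by exists c => z zc; apply: fC => /Cc.
move=> p Dp; have : nbhs p (~` C).
  apply: open_nbhs_nbhs; split; last by move=> /CD.
  by rewrite openC; exact: compact_closed_plane.
by apply: filterS => z; exact: fC.
Qed.

Lemma int_gt0_area (f : R * R -> R) (p : R * R) : continuous f -> (forall t, 0 <= f t) ->
  L1 area (f : P -> R) -> 0 < f p -> 0 < \int[area]_t f t.
Proof.
move=> cf f0 Lf fx.
have : nbhs p (fun t => f p / 2 < f t).
  by apply: (cvgr_gt _ (cf p)); rewrite ltr_pdivrMr// ltr_pMr// ltr1n.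
move=> /nbhs_ballP[r /= r0 rf].
have mb : measurable (ball p r : set P).
  by apply: open_measurable_plane; exact: ball_open.
have areab : area (ball p r) = ((r *+ 2) * (r *+ 2))%:E.
  rewrite ball_prodE; apply: etrans; first by apply: product_measure1E; exact: measurable_ball.
  rewrite EFinM; congr (_ * _)%E; exact: (lebesgue_measure_ball _ (ltW r0)).
have fin : (area (ball p r) < +oo)%E by rewrite areab ltry.
have Lb := L1_indic mb fin.
apply: (@lt_le_trans _ _ (\int[area]_t (f p / 2 * \1_(ball p r) t))).
  rewrite intZ//; apply: mulr_gt0; first by rewrite divr_gt0.
  have -> : \int[area]_z \1_(ball p r) z = r *+ 2 * (r *+ 2).
    exact: (etrans (int_indic _ mb) (congr1 fine areab)).
  by rewrite mulr_gt0// mulrn_wgt0.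
apply: int_le => //; first exact: L1Z.
move=> t; rewrite indicE; case: (boolP (t \in _)) => [|_].
  by rewrite inE => /rf /ltW; rewrite mulr1.
by rewrite mulr0.
Qed.

(** Evenness is recorded for [local_solve], where the same function serves as a weight on
    displacements and, translated, as the function being displaced. *)
Lemma mollifier (r : R) : 0 < r -> exists rho : R * R -> R,
  [/\ smooth2 rho, forall z, ~ cbox 0 r z -> rho z = 0,
      forall z, rho (- z) = rho z & \int[area]_z rho z = 1].
Proof.
move=> r0; have r2 : r / 2 < r by rewrite ltr_pdivrMr// ltr_pMr// ltr1n.
have r20 : 0 < r / 2 by rewrite divr_gt0.
pose k := cutbox 0 r (r / 2).
have kc z : ~ cbox 0 r z -> k z = 0 by move=> /cutbox_eq0; apply => //; exact: ltW.
have sk : smooth2 k := smooth2_cutbox _ _ _.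
have bk : bsupp k.
  have [c cc] := compact_bounded_box (@cbox_compact 0 r).
  by exists c => z zc; apply: kc => /cc.
have ck := smoothG_continuous sk.
have I0 : 0 < \int[area]_z k z.
  apply: (@int_gt0_area k 0) => //.
  - by move=> z; rewrite mulr_ge0// step_ge0.
  - exact: bsupp_L1.
  - by rewrite /k cutbox_eq1// ?(ltW r20)//; exact: ballxx.
exists (fun z => (\int[area]_z k z)^-1 * k z); split.
- exact: smoothGZ.
- by move=> z /kc ->; rewrite mulr0.
- by move=> z; rewrite /k /cutbox /cut1 /= !subr0 !sqrrN.
- by rewrite intZ ?mulVf ?gt_eqF//; exact: bsupp_L1.
Qed.

End Cutoff.

(** * Transport along segments and the local divergence equation *)

Section Transport.
Context {R : realType}.
Local Notation leb := (@lebesgue_measure R).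
Local Notation area := (@lebesgue_measure R \x @lebesgue_measure R)%E.
Local Notation areaS := (prodm (@lebesgue_measure R) (@lebesgue_measure R)).
Local Notation P := (measurableTypeR R * measurableTypeR R)%type.
Local Notation X := (P * measurableTypeR R)%type.
Local Notation muX := (prodm areaS leb).

Definition ind01 (t : R) : R := \1_(`[0, 1]%classic) t.

Lemma L1_ind01 : L1 leb ind01.
Proof.
apply: L1_indic; first exact: measurable_itv.
apply: le_lt_trans (ltry (1 : R)); rewrite le_eqVlt; apply/orP; left; apply/eqP.
by apply: etrans (lebesgue_measure_itv `[0, 1]) _; rewrite /= lte_fin ltr01 sube0.
Qed.

Lemma L1_restrict_itv (h : R -> R) (a b : R) : continuous h -> L1 leb (h \_ `[a, b]).
Proof.
move=> ch.
have Hi : leb.-integrable `[a, b] (EFin \o h).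
  apply: continuous_compact_integrable; first exact: segment_compact.
  exact: continuous_subspaceT.
have := (integrable_mkcond (mu := leb) (EFin \o h) (measurable_itv `[a, b])).1 Hi.
by apply: eq_integrable => // t _; rewrite /= !patchE; case: ifP.
Qed.

Lemma ind01_neq0 t : ind01 t != 0 -> 0 <= t <= 1.
Proof.
rewrite /ind01 indicE; case: (boolP (t \in _)); last by rewrite eqxx.
by rewrite inE /= in_itv.
Qed.

Lemma L1_prod (f : P -> R) (g : measurableTypeR R -> R) : L1 area f -> L1 leb g ->
  L1 muX (fun x : X => f x.1 * g x.2).
Proof.
move=> Lf Lg; have mf := L1_measurable Lf; have mg := L1_measurable Lg.
apply: (@L1_prod_le _ _ _ _ _ areaS leb _ f (\int[leb]_t `|g t|)) => //.
  by apply: measurable_funM; [exact: (measurableT_comp mf)|exact: (measurableT_comp mg)].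
move=> x; rewrite (eq_integral (fun t => `|(f x)%:E| * `|(g t)%:E|)%E); last first.
  by move=> t _; rewrite /= normrM EFinM.
rewrite ge0_integralZl//; last by apply: measurableT_comp => //; exact/measurable_EFinP.
rewrite muleC -[X in (X * _ <= _)%E]/(\int[leb]_t (`|g t|)%:E)%E.
by rewrite int_EFin//; exact: L1_norm.
Qed.

Section Fields.
Variables (kappa : R * R -> R) (s : R).
Hypotheses (ckappa : continuous kappa) (bkappa : bsupp kappa).

(** A parameter is a displacement [x.1] together with a time [x.2] on the segment it spans; [s],
    which will be 1 or -1, is the direction of travel. *)
Definition tmap (x : X) : P := (x.2 * s) *: x.1.
Definition tweight1 (x : X) : R := kappa x.1 * (s * x.1.1) * ind01 x.2.
Definition tweight2 (x : X) : R := kappa x.1 * (s * x.1.2) * ind01 x.2.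

Lemma measurable_tmap : measurable_fun setT tmap.
Proof.
apply/measurable_fun_pairP; split.
- rewrite [X in measurable_fun _ X](_ : _ = (fun x : X => x.2 * s * x.1.1)) //.
  apply: measurable_funM; first by apply: measurable_funM => //; exact: measurable_snd.
  by apply: (measurableT_comp measurable_fst); exact: measurable_fst.
- rewrite [X in measurable_fun _ X](_ : _ = (fun x : X => x.2 * s * x.1.2)) //.
  apply: measurable_funM; first by apply: measurable_funM => //; exact: measurable_snd.
  by apply: (measurableT_comp measurable_snd); exact: measurable_fst.
Qed.

Lemma L1_tweight1 : L1 muX tweight1.
Proof.
apply: (L1_prod (f := (fun y : R * R => kappa y * (s * y.1)) : P -> R)); last exact: L1_ind01.
apply: (@bsupp_L1 R); last by have [c kc] := bkappa; exists c => z /kc ->; rewrite mul0r.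
move=> z; apply: cvgM; first exact: ckappa.
by apply: cvgM; [exact: cvg_cst|exact: cvg_fst].
Qed.

Lemma L1_tweight2 : L1 muX tweight2.
Proof.
apply: (L1_prod (f := (fun y : R * R => kappa y * (s * y.2)) : P -> R)); last exact: L1_ind01.
apply: (@bsupp_L1 R); last by have [c kc] := bkappa; exists c => z /kc ->; rewrite mul0r.
move=> z; apply: cvgM; first exact: ckappa.
by apply: cvgM; [exact: cvg_cst|exact: cvg_snd].
Qed.

(** For a fixed displacement y, integrating s y . grad g along the segment from z - s y to z gives
    g(z) - g(z - s y); the weight [kappa] then averages over y. *)
Lemma transport_div (g : R * R -> R) z : smooth2 g -> bsupp g ->
  dx (average muX tweight1 tmap g) z + dy (average muX tweight2 tmap g) z =
  \int[area]_y (kappa y * (g z - g (z - s *: y))).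
Proof.
move=> sg bg.
have [b1 b2] := bsupp_dx bg.
have c1 := smoothG_continuous (smooth2_dx sg); have c2 := smoothG_continuous (smooth2_dy sg).
have [M1 [_ H1]] := continuous_bounded_support c1 b1.
have [M2 [_ H2]] := continuous_bounded_support c2 b2.
have LA := average_L1 L1_tweight1 measurable_tmap z c1 H1.
have LB := average_L1 L1_tweight2 measurable_tmap z c2 H2.
rewrite (dx_average L1_tweight1 measurable_tmap z sg bg).
rewrite (dy_average L1_tweight2 measurable_tmap z sg bg).
rewrite /average -(intD LA LB).
have L : L1 muX (fun x : X => tweight1 x * dx g (z - tmap x) + tweight2 x * dy g (z - tmap x)).
  exact: (L1D LA LB).
rewrite -(int_fubini L); apply: eq_int => y.
have HD (t : R) : is_derive t 1 (fun t : R => - g (t *: (- (s *: y)) + z))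
    (s * y.1 * dx g (z - (t * s) *: y) + s * y.2 * dy g (z - (t * s) *: y)).
  have E : t *: (- (s *: y)) + z = z - (t * s) *: y by rewrite scalerN scalerA addrC.
  have := is_deriveN (is_derive_line (smooth2_is_derive (t *: (- (s *: y)) + z) (- (s *: y)) sg)).
  rewrite E; congr (is_derive _ _ _ _); rewrite opprD -!mulNr /=; congr (_ * _ + _ * _).
    by rewrite opprK.
  by rewrite opprK.
have ch : continuous (fun t : R => s * y.1 * dx g (z - (t * s) *: y) + s * y.2 * dy g (z - (t * s) *: y)).
  have ct : continuous (fun t : R => z - (t * s) *: y).
    move=> t; apply: cvgB; first exact: cvg_cst.
    by apply: cvgZr_tmp; apply: cvgM; [exact: cvg_id|exact: cvg_cst].
  move=> t; apply: cvgD; apply: cvgM; try exact: cvg_cst.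
    by apply: continuous_comp; [exact: ct|exact: c1].
  by apply: continuous_comp; [exact: ct|exact: c2].
rewrite [LHS](_ : _ = kappa y * \int[leb]_(t in `[0, 1])
    (s * y.1 * dx g (z - (t * s) *: y) + s * y.2 * dy g (z - (t * s) *: y))).
  rewrite (int_FTC ltr01 HD) //.
  by rewrite scale1r scale0r add0r opprK addrC [- _ + z]addrC addrC; congr (_ * _); ring.
rewrite [X in _ = _ * X]Rintegral_mkcond -intZ; last exact: L1_restrict_itv.
apply: eq_int => t; rewrite patchE /tweight1 /tweight2 /tmap /ind01 indicE /=.
(* Off its set a restricted function takes the value [point], which is 0 here. *)
have p0 : (point : R) = 0 by [].
case: (t \in _); rewrite /= ?p0 ?mulr1 ?mulr0; first by ring.
by rewrite !mul0r addr0.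
Qed.

Lemma tmap_le (x : X) r : 0 <= x.2 <= 1 -> `|s| <= 1 -> cbox 0 r x.1 -> cbox 0 r (tmap x).
Proof.
move=> /andP[t0 t1] s1 /cboxP[]; rewrite /= !subr0 => h1 h2; apply/cboxP; rewrite /= !subr0.
have ts : `|x.2 * s| <= 1 by rewrite normrM (ger0_norm t0) mulr_ile1.
by split; rewrite /GRing.scale /= normrM (le_trans (ler_piMl _ ts)).
Qed.

End Fields.

(** A relation rather than a function of [phi]: the field (psi1, psi2) is not unique, and without
    orthogonality the value [val] may depend on it. Subtracting the mass times [rho] is forced,
    since a compactly supported divergence has integral 0. *)
Definition solves (D : set (R * R)) (U1 U2 rho : R * R -> R) (val : R) (phi : R * R -> R) :=
  exists psi1 psi2 : R * R -> R, [/\ test_fun D psi1, test_fun D psi2,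
    forall z, dx psi1 z + dy psi2 z = phi z - (\int[area]_z phi z) * rho z &
    \int[area]_z (U1 z * psi1 z + U2 z * psi2 z) = val].

Lemma cbox_sub (p : R * R) r r' : r <= r' -> cbox p r `<=` cbox p r'.
Proof. by move=> rr z /cboxP[h1 h2]; apply/cboxP; split; exact: le_trans rr. Qed.

Lemma cboxD (p q z : R * R) r r' : cbox p r z -> cbox 0 r' q -> cbox p (r + r') (z + q).
Proof.
move=> /cboxP[h1 h2] /cboxP[]; rewrite /= !subr0 => h3 h4; apply/cboxP; split.
  by rewrite /= addrAC (le_trans (ler_normD _ _))// lerD.
by rewrite /= addrAC (le_trans (ler_normD _ _))// lerD.
Qed.

Lemma ball_cbox (p z : R * R) r : ball p r z -> cbox p r z.
Proof. by move=> [h1 h2]; apply/cboxP; split; rewrite distrC ltW. Qed.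

Lemma bsupp_cbox (p : R * R) r (f : R * R -> R) : (forall z, ~ cbox p r z -> f z = 0) -> bsupp f.
Proof.
move=> H; have [c cc] := compact_bounded_box (@cbox_compact R p r).
by exists c => z zc; apply: H => /cc.
Qed.

Section Kernel.
Variables (r : R) (g : R * R -> R).
Hypotheses (cg : continuous g) (bg : bsupp g).

(** The indicator of the box makes the kernel independent of [kappa], which is supported there. *)
Definition kweight (i : R * R -> R) (x : X) : R := (\1_(cbox 0 r) x.1 * i x.1) * ind01 x.2.

Let mcbox : measurable (cbox 0 r : set P).
Proof. by apply: closed_measurable_plane; apply: compact_closed_plane; exact: cbox_compact. Qed.

Variable i : R * R -> R.
Hypotheses (ci : continuous i) (ibd : forall y, cbox 0 r y -> `|i y| <= r).

Let wbd (y : R * R) : `|\1_(cbox 0 r) y * i y| <= Num.max 0 r.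
Proof.
rewrite indicE; case: (boolP (y \in _)); rewrite ?(inE, notin_setE) => yr.
  by rewrite mul1r le_max ibd ?orbT.
by rewrite mul0r normr0 le_max lexx.
Qed.

Let mw : measurable_fun setT ((fun y => \1_(cbox 0 r) y * i y) : P -> R).
Proof.
apply: measurable_funM; last exact: continuous_measurable_plane.
exact: (measurable_indic mcbox).
Qed.

Lemma L1_kweight : L1 muX (kweight i).
Proof.
apply: (L1_prod (f := (fun y => \1_(cbox 0 r) y * i y) : P -> R)); last exact: L1_ind01.
have [c cc] := compact_bounded_box (@cbox_compact R 0 r).
apply: (L1_bounded_support (c := c) mw wbd) => z zc.
by rewrite indicE memNset ?mul0r// => /cc.
Qed.

(** With [g] fixed the pairing is linear in the weight [kappa], and Fubini exhibits its density [v],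
    bounded because [g] is bounded and [U] integrable. In [local_solve] the weight is the translated
    datum, so this provides the transpose in that case. *)
Lemma transport_mass (U : R * R -> R) : L1 area (U : P -> R) ->
  exists v : R * R -> R, sqint area (v : P -> R) /\
  forall kappa : R * R -> R, continuous kappa -> (forall y, ~ cbox 0 r y -> kappa y = 0) ->
    \int[area]_z (U z * average muX (fun x : X => kappa x.1 * i x.1 * ind01 x.2) (tmap 1) g z) =
    \int[area]_y (kappa y * v y).
Proof.
move=> LU; have [M [M0 gM]] := continuous_bounded_support cg bg.
have mt := measurable_tmap 1.
have LK := L1_kernel L1_kweight mt LU cg gM.
pose h (x : X) := \int[area]_z (U z * (kweight i x * g (z - tmap 1 x))).
have Lh : L1 muX h := L1_fubini LK.
pose v (y : P) := \int[leb]_t h (y, t).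
have mv : measurable_fun setT v := fine_measurable_int Lh.
pose C := Num.max 0 r * (M * \int[area]_z `|U z|).
have LUk (x : X) : L1 area (fun z : P => U z * (kweight i x * g (z - tmap 1 x))).
  have mp : measurable_fun setT (fun z : P => kweight i x * g (z - tmap 1 x)).
    apply: measurable_funM; first exact: measurable_cst.
    apply: (measurableT_comp (f := (g : P -> R))); first exact: continuous_measurable_plane.
    exact: measurable_shift.
  have bp z : `|kweight i x * g (z - tmap 1 x)| <= `|kweight i x| * M.
    by rewrite normrM ler_wpM2l.
  by have := L1_bounded mp bp LU; apply: eq_L1 => z; exact: mulrC.
have hb (x : X) : `|h x| <= C * ind01 x.2.
  apply: le_trans (int_norm (LUk x)) _.
  have i0 : 0 <= ind01 x.2 by rewrite /ind01 indicE.
  apply: (@le_trans _ _ (\int[area]_z (Num.max 0 r * M * ind01 x.2 * `|U z|))).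
    apply: int_le; [exact: L1_norm|by apply: L1Z; exact: L1_norm|].
    move=> z; rewrite normrM mulrC ler_wpM2r// normrM /kweight normrM (ger0_norm i0).
    by rewrite mulrAC ler_wpM2r// ler_pM.
  by rewrite intZ; [rewrite /C le_eqVlt; apply/orP; left; apply/eqP; ring|exact: L1_norm].
have Lhy y : L1 leb (fun t => h (y, t)).
  apply: (L1_le _ _ (L1Z C L1_ind01)); last by move=> t; exact: hb.
  exact: (measurableT_comp (L1_measurable Lh) (measurable_pair1 y)).
have [c cc] := compact_bounded_box (@cbox_compact R 0 r).
have C0 : 0 <= C by rewrite mulr_ge0 ?le_max ?lexx// mulr_ge0// int_ge0.
exists v; split.
  apply: (sqint_bounded_support (M := C * \int[leb]_t ind01 t) (c := c) mv).
    move=> y; rewrite -intZ; last exact: L1_ind01.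
    apply: le_trans (int_norm (Lhy y)) _; apply: int_le.
    - exact: L1_norm (Lhy y).
    - by apply: L1Z; exact: L1_ind01.
    - by move=> t; exact: hb.
  move=> y yc; rewrite /v -[RHS](int0 leb); apply: eq_int => t.
  rewrite /h -[RHS](int0 area); apply: eq_int => z.
  by rewrite /kweight /= indicE memNset ?mul0r ?mulr0// => /cc.
move=> kappa ck k0.
have bk := bsupp_cbox k0.
have [N [N0 kN]] := continuous_bounded_support ck bk.
have La : L1 muX (fun x : X => kappa x.1 * i x.1 * ind01 x.2).
  apply: (L1_prod (f := (fun y : R * R => kappa y * i y) : P -> R)); last exact: L1_ind01.
  apply: (@bsupp_L1 R); last by have [e ke] := bk; exists e => z /ke ->; rewrite mul0r.
  by move=> z; apply: cvgM; [exact: ck|exact: ci].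
rewrite (int_average_fubini La mt LU cg gM).
transitivity (\int[muX]_x (kappa x.1 * h x)).
  apply: eq_int => x; rewrite /h -intZ//.
  apply: eq_int => z; rewrite /kweight indicE.
  have [xr|xr] := pselect (cbox 0 r x.1).
    rewrite mem_set//=; ring.
  rewrite k0//; ring.
have Lkh : L1 muX (fun x : X => kappa x.1 * h x).
  apply: (L1_bounded (M := N)) Lh.
    apply: (measurableT_comp (f := (kappa : P -> R))) => //.
    exact: continuous_measurable_plane.
  by move=> x; exact: kN.
rewrite -(int_fubini Lkh); apply: eq_int => y.
exact: (intZ (kappa y) (Lhy y)).
Qed.

End Kernel.

Lemma sqint_L1_test D (U psi : R * R -> R) : sqint area (U : P -> R) -> test_fun D psi ->
  L1 area (fun z => U z * psi z : R).
Proof. by move=> SU tp; apply: sqint_mul => //; exact: test_fun_sqint tp. Qed.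

Section Solve.
Variables (D : set (R * R)) (U1 U2 : R * R -> R) (c : R).
Hypotheses (S1 : sqint area (U1 : P -> R)) (S2 : sqint area (U2 : P -> R)).
Hypotheses (c1 : forall z, ~ box c z -> U1 z = 0) (c2 : forall z, ~ box c z -> U2 z = 0).

(** Both [phi] and its mass times the bump [g] at [p] are spread out to one and the same convolution
    of [phi] with [rho]: [phi] by displacements drawn from [rho], and [g] by displacements drawn
    from [phi] recentred at [p]. The difference of the two transport fields has the required
    divergence, and its support stays within [r + r] of [p]. *)
Lemma local_solve (p : R * R) (r : R) : 0 < r -> cbox p (r + r) `<=` D ->
  exists rho v, [/\ test_fun D rho, \int[area]_z rho z = 1, sqint area (v : P -> R) &
    forall phi, test_fun (ball p r) phi -> solves D U1 U2 rho (\int[area]_z (phi z * v z)) phi].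
Proof.
move=> r0 pD.
have LU1 := sqint_L1 S1 c1; have LU2 := sqint_L1 S2 c2.
have [rho [srho rho0 rhoN rho1]] := mollifier r0.
have crho := smoothG_continuous srho.
have brho := bsupp_cbox rho0.
have Lrho := bsupp_L1 crho brho.
pose g z := rho (z - p).
have sg : smooth2 g := smooth2_shift p srho.
have g0 z : ~ cbox p r z -> g z = 0.
  move=> zr; apply: rho0 => /cboxP[]; rewrite /= !subr0 => h1 h2; apply: zr.
  by apply/cboxP.
have bg := bsupp_cbox g0; have cg := smoothG_continuous sg.
have g1 : \int[area]_z g z = 1 by rewrite /g (int_shift (- p) Lrho).
have tg : test_fun D g.
  apply: (test_fun_compact sg (@cbox_compact R p r)) => //.
  by apply: subset_trans pD; apply: cbox_sub; rewrite lerDl ltW.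
pose i1 (y : R * R) := 1 * y.1; pose i2 (y : R * R) := 1 * y.2.
have ci1 : continuous i1 by move=> z; apply: cvgM; [exact: cvg_cst|exact: cvg_fst].
have ci2 : continuous i2 by move=> z; apply: cvgM; [exact: cvg_cst|exact: cvg_snd].
have ib1 y : cbox 0 r y -> `|i1 y| <= r by rewrite /i1 mul1r => /cboxP[]; rewrite /= !subr0.
have ib2 y : cbox 0 r y -> `|i2 y| <= r by rewrite /i2 mul1r => /cboxP[]; rewrite /= !subr0.
have [w1 [Sw1 Ew1]] := transport_mass cg bg ci1 ib1 LU1.
have [w2 [Sw2 Ew2]] := transport_mass cg bg ci2 ib2 LU2.
have La1 := L1_tweight1 (-1) crho brho; have La2 := L1_tweight2 (-1) crho brho.
have mtm := measurable_tmap (-1 : R).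
(* The first two terms transpose the averages of [phi]; the last two are the densities of the
   averages of [g], moved back from the origin to [p]. *)
pose v z := adj_average muX (tweight1 rho (-1)) (tmap (-1)) U1 z +
  adj_average muX (tweight2 rho (-1)) (tmap (-1)) U2 z - (w1 (z - p) + w2 (z - p)).
have sqs (w : R * R -> R) : sqint area (w : P -> R) -> sqint area (fun z => w (z - p) : R).
  move=> [mw Lw]; split; last exact: (L1_shift (- p) Lw).
  exact: (measurableT_comp mw (measurable_shift (- p))).
have Sa1 := sqint_adj_average La1 mtm S1 c1; have Sa2 := sqint_adj_average La2 mtm S2 c2.
have Sv : sqint area (v : P -> R).
  apply: sqintB; first exact: sqintD.
  by apply: sqintD; exact: sqs.
exists g, v; split=> // phi tphi.
have sphi := test_fun_smooth tphi; have bphi := test_fun_bsupp tphi.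
have cphi := smoothG_continuous sphi; have Lphi := test_fun_L1 tphi.
pose kap y := phi (y + p).
have skap : smooth2 kap.
  have := smooth2_shift (- p) sphi; congr smoothG.
  by apply/funext => z; rewrite opprK.
have ckap := smoothG_continuous skap.
have kap0 y : ~ cbox 0 r y -> kap y = 0.
  move=> yr; apply: (test_fun_out tphi) => /ball_cbox/cboxP[] /=; rewrite !addrK => h1 h2.
  by apply: yr; apply/cboxP; rewrite /= !subr0.
have bkap := bsupp_cbox kap0.
have Lb1 := L1_tweight1 1 ckap bkap; have Lb2 := L1_tweight2 1 ckap bkap.
have mt1 := measurable_tmap (1 : R).
pose A1 := average muX (tweight1 rho (-1)) (tmap (-1)) phi.
pose A2 := average muX (tweight2 rho (-1)) (tmap (-1)) phi.
pose B1 := average muX (tweight1 kap 1) (tmap 1) g.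
pose B2 := average muX (tweight2 kap 1) (tmap 1) g.
have n1 : `|(-1 : R)| <= 1 by rewrite normrN normr1.
have cC := @cbox_compact R p (r + r).
have supA (k : R * R) (x : X) z : rho x.1 != 0 -> ind01 x.2 != 0 -> phi (z - tmap (-1) x) != 0 ->
    cbox p (r + r) z.
  move=> r0' /ind01_neq0 t01 ph0.
  have xr : cbox 0 r x.1 by apply: contrapT => /rho0 E; rewrite E eqxx in r0'.
  have zr : cbox p r (z - tmap (-1) x).
    apply: ball_cbox; apply: contrapT => /(test_fun_out tphi) E; by rewrite E eqxx in ph0.
  by have := cboxD zr (tmap_le t01 n1 xr); rewrite subrK.
have supB (x : X) z : kap x.1 != 0 -> ind01 x.2 != 0 -> g (z - tmap 1 x) != 0 ->
    cbox p (r + r) z.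
  move=> r0' /ind01_neq0 t01 ph0.
  have xr : cbox 0 r x.1 by apply: contrapT => /kap0 E; rewrite E eqxx in r0'.
  have zr : cbox p r (z - tmap 1 x) by apply: contrapT => /g0 E; rewrite E eqxx in ph0.
  have n2 : `|(1 : R)| <= 1 by rewrite normr1.
  by have := cboxD zr (tmap_le t01 n2 xr); rewrite subrK.
have nz3 (a b d : R) : a * b * d != 0 -> a != 0 /\ d != 0.
  by rewrite !mulf_eq0 !negb_or => /andP[/andP[]].
have tA1 : test_fun D A1.
  apply: (test_fun_average La1 mtm sphi bphi cC pD) => x z /nz3[? ?]; exact: supA.
have tA2 : test_fun D A2.
  apply: (test_fun_average La2 mtm sphi bphi cC pD) => x z /nz3[? ?]; exact: supA.
have tB1 : test_fun D B1.
  apply: (test_fun_average Lb1 mt1 sg bg cC pD) => x z /nz3[? ?]; exact: supB.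
have tB2 : test_fun D B2.
  apply: (test_fun_average Lb2 mt1 sg bg cC pD) => x z /nz3[? ?]; exact: supB.
exists (fun z => A1 z - B1 z), (fun z => A2 z - B2 z); split.
- exact: test_funB.
- exact: test_funB.
- move=> z; rewrite dxB ?dyB; [|exact: test_fun_smooth tA2|exact: test_fun_smooth tB2|
    exact: test_fun_smooth tA1|exact: test_fun_smooth tB1].
  rewrite addrACA -opprD (transport_div (-1) crho brho z sphi bphi).
  rewrite (transport_div 1 ckap bkap z sg bg).
  have E1 : \int[area]_y (rho y * (phi z - phi (z - (-1) *: y))) =
      phi z - \int[area]_y (rho y * phi (y + z)).
    transitivity (\int[area]_y (phi z * rho y - rho y * phi (y + z))); last first.
      rewrite intB; first by rewrite intZ// rho1 mulr1.
        exact: L1Z.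
      apply: (@bsupp_L1 R); last by have [e ke] := brho; exists e => y /ke ->; rewrite mul0r.
      move=> y; apply: cvgM; first exact: crho.
      by apply: continuous_comp; [apply: cvgD; [exact: cvg_id|exact: cvg_cst]|exact: cphi].
    by apply: eq_int => y; rewrite scaleN1r opprK [z + y]addrC; ring.
  have E2 : \int[area]_y (kap y * (g z - g (z - 1 *: y))) =
      (\int[area]_z phi z) * g z - \int[area]_y (rho y * phi (y + z)).
    have Lk : L1 area (kap : P -> R) by exact: bsupp_L1.
    have Lrp : L1 area (fun y => rho y * phi (y + z) : R).
      apply: (@bsupp_L1 R); last by have [e ke] := brho; exists e => y /ke ->; rewrite mul0r.
      move=> y; apply: cvgM; first exact: crho.
      by apply: continuous_comp; [apply: cvgD; [exact: cvg_id|exact: cvg_cst]|exact: cphi].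
    (* The two convolutions agree after a translation and the reflection allowed by evenness of
       [rho], so they cancel in the divergence. *)
    have E : \int[area]_y (rho y * phi (y + z)) = \int[area]_y (kap y * g (z - y)).
      rewrite -(int_shift (p - z) Lrp); apply: eq_int => y.
      rewrite /kap /g mulrC; congr (_ * _); first by rewrite -addrA subrK.
      by rewrite -rhoN opprD opprB addrCA addrA.
    rewrite E -(int_shift p Lphi) mulrC -intZ// -intB.
    + by apply: eq_int => y; rewrite scale1r /kap; ring.
    + exact: L1Z.
    + have := L1_shift (p - z) Lrp; apply: eq_L1 => y.
      rewrite /kap /g mulrC; congr (_ * _); first by rewrite -addrA subrK.
      by rewrite -rhoN opprD opprB addrCA addrA.
  rewrite E1 E2; ring.
- have L4 (u w : R * R -> R) : sqint area (u : P -> R) -> test_fun D w ->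
      L1 area (fun z => u z * w z : R) by exact: sqint_L1_test.
  have -> : \int[area]_z (U1 z * (A1 z - B1 z) + U2 z * (A2 z - B2 z)) =
      (\int[area]_z (U1 z * A1 z) - \int[area]_z (U1 z * B1 z)) +
      (\int[area]_z (U2 z * A2 z) - \int[area]_z (U2 z * B2 z)).
    rewrite -!intB ?(L4 _ _ _ tA1) ?(L4 _ _ _ tB1) ?(L4 _ _ _ tA2) ?(L4 _ _ _ tB2)//.
    rewrite -intD.
    + by apply: eq_int => z; ring.
    + by apply: L1B; exact: L4.
    + by apply: L1B; exact: L4.
  rewrite (int_average La1 mtm LU1 cphi bphi) (int_average La2 mtm LU2 cphi bphi).
  rewrite (Ew1 kap ckap kap0) (Ew2 kap ckap kap0).
  have Sphi := test_fun_sqint tphi.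
  have Sh (w : R * R -> R) : sqint area (w : P -> R) ->
      \int[area]_y (kap y * w y) = \int[area]_z (phi z * w (z - p)).
    move=> Sw; rewrite -(int_shift p (sqint_mul Sphi (sqs _ Sw))).
    by apply: eq_int => y; rewrite /kap addrK.
  rewrite !Sh//.
  have P1' := sqint_mul Sphi Sa1; have P2' := sqint_mul Sphi Sa2.
  have P3' := sqint_mul Sphi (sqs _ Sw1); have P4' := sqint_mul Sphi (sqs _ Sw2).
  rewrite -(intB P1' P3') -(intB P2' P4') -intD; [|exact: L1B|exact: L1B].
  by apply: eq_int => z; rewrite /v; ring.
Qed.

End Solve.
End Transport.

(** * Existence of a potential *)

Section Potential.
Context {R : realType}.
Local Notation leb := (@lebesgue_measure R).
Local Notation area := (@lebesgue_measure R \x @lebesgue_measure R)%E.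
Local Notation P := (measurableTypeR R * measurableTypeR R)%type.
Variables (D : set (R * R)) (U1 U2 : R * R -> R) (c : R).
Hypotheses (oD : open D) (S1 : sqint area (U1 : P -> R)) (S2 : sqint area (U2 : P -> R)).
Hypotheses (c1 : forall z, ~ box c z -> U1 z = 0) (c2 : forall z, ~ box c z -> U2 z = 0).

Lemma int_lin2 (f1 f2 g1 g2 : R * R -> R) (k : R) :
  test_fun D f1 -> test_fun D f2 -> test_fun D g1 -> test_fun D g2 ->
  \int[area]_z (U1 z * (f1 z + k * g1 z) + U2 z * (f2 z + k * g2 z)) =
  \int[area]_z (U1 z * f1 z + U2 z * f2 z) + k * \int[area]_z (U1 z * g1 z + U2 z * g2 z).
Proof.
move=> tf1 tf2 tg1 tg2.
have L1' := sqint_L1_test S1 tf1; have L2' := sqint_L1_test S2 tf2.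
have L3' := sqint_L1_test S1 tg1; have L4' := sqint_L1_test S2 tg2.
rewrite -(intZ k (L1D L3' L4')) -(intD (L1D L1' L2') (L1Z k (L1D L3' L4'))).
by apply: eq_int => z; ring.
Qed.

Lemma dx_lin (f g : R * R -> R) (k : R) z : test_fun D f -> test_fun D g ->
  dx (fun z => f z + k * g z) z = dx f z + k * dx g z.
Proof.
move=> /test_fun_smooth sf /test_fun_smooth sg.
by rewrite dxD ?dxZ//; exact: smoothGZ.
Qed.

Lemma dy_lin (f g : R * R -> R) (k : R) z : test_fun D f -> test_fun D g ->
  dy (fun z => f z + k * g z) z = dy f z + k * dy g z.
Proof.
move=> /test_fun_smooth sf /test_fun_smooth sg.
by rewrite dyD ?dyZ//; exact: smoothGZ.
Qed.

Lemma solves_lin (rho phi1 phi2 : R * R -> R) (x1 x2 k : R) :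
  L1 area (phi1 : P -> R) -> L1 area (phi2 : P -> R) ->
  solves D U1 U2 rho x1 phi1 -> solves D U1 U2 rho x2 phi2 ->
  solves D U1 U2 rho (x1 + k * x2) (fun z => phi1 z + k * phi2 z).
Proof.
move=> Lp1 Lp2 [f1 [f2 [tf1 tf2 fd fv]]] [g1 [g2 [tg1 tg2 gd gv]]].
exists (fun z => f1 z + k * g1 z), (fun z => f2 z + k * g2 z).
have tkg1 := test_funZ k tg1; have tkg2 := test_funZ k tg2.
split; [exact: test_funD|exact: test_funD| |by rewrite int_lin2// fv gv].
move=> z; rewrite dx_lin// dy_lin//.
rewrite (intD Lp1 (L1Z k Lp2)) (intZ k Lp2).
have := fd z; have := gd z => Eg Ef.
transitivity ((dx f1 z + dy f2 z) + k * (dx g1 z + dy g2 z)); first by ring.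
by rewrite Eg Ef; ring.
Qed.

(** Replacing the reference density only adds the mass of [phi] times a constant: in terms of the
    potential, an additive constant. *)
Lemma solves_rho (rho rho' phi : R * R -> R) (x y : R) :
  \int[area]_z rho' z = 1 -> solves D U1 U2 rho' x phi -> solves D U1 U2 rho y rho' ->
  solves D U1 U2 rho (x + (\int[area]_z phi z) * y) phi.
Proof.
move=> r1 [f1 [f2 [tf1 tf2 fd fv]]] [g1 [g2 [tg1 tg2 gd gv]]].
set k := \int[area]_z phi z.
exists (fun z => f1 z + k * g1 z), (fun z => f2 z + k * g2 z).
have tkg1 := test_funZ k tg1; have tkg2 := test_funZ k tg2.
split; [exact: test_funD|exact: test_funD| |by rewrite int_lin2// fv gv].
move=> z; rewrite dx_lin// dy_lin//.
have := fd z; have := gd z => Eg Ef.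
transitivity ((dx f1 z + dy f2 z) + k * (dx g1 z + dy g2 z)); first by ring.
by rewrite Eg Ef r1 -/k; ring.
Qed.

(** A datum of mass 1 that is carried to both reference densities provides, by subtraction, a field
    carrying [rho'] to [rho]. *)
Lemma solves_swap (rho rho' phi : R * R -> R) (x y : R) :
  \int[area]_z phi z = 1 -> \int[area]_z rho' z = 1 ->
  solves D U1 U2 rho' x phi -> solves D U1 U2 rho y phi -> solves D U1 U2 rho (y - x) rho'.
Proof.
move=> p1 r1 [f1 [f2 [tf1 tf2 fd fv]]] [g1 [g2 [tg1 tg2 gd gv]]].
exists (fun z => g1 z + (-1) * f1 z), (fun z => g2 z + (-1) * f2 z).
have tkf1 := test_funZ (-1) tf1; have tkf2 := test_funZ (-1) tf2.
split; [exact: test_funD|exact: test_funD| |by rewrite int_lin2// fv gv mulN1r].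
move=> z; rewrite dx_lin// dy_lin//.
have := fd z; have := gd z => Eg Ef.
transitivity ((dx g1 z + dy g2 z) - (dx f1 z + dy f2 z)); first by ring.
by rewrite Eg Ef r1 p1; ring.
Qed.

Variable rho0 : R * R -> R.

(* When [(U1, U2)] is orthogonal to the divergence-free test fields, taking [phi = dx chi] and
   [phi = dy chi] shows that [- v] is a weak potential of [(U1, U2)] on [A]. *)
Definition good (A : set (R * R)) := exists v : R * R -> R, sqint area (v : P -> R) /\
  forall phi, test_fun A phi -> solves D U1 U2 rho0 (\int[area]_z (phi z * v z)) phi.

Lemma good_subset A B : A `<=` B -> good B -> good A.
Proof.
by move=> AB [v [Sv H]]; exists v; split => // phi tphi; apply: H; exact: test_fun_subset tphi.
Qed.

Lemma good0 : good set0.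
Proof.
exists (fun=> 0); split; first exact: sqint0.
move=> phi tphi; have p0 z : phi z = 0 by apply: (test_fun_out tphi).
have I0 : \int[area]_z phi z = 0 by rewrite -[RHS](int0 area); apply: eq_int.
exists (fun=> 0), (fun=> 0); split; try exact: test_fun0.
- by move=> z; rewrite dx_cst dy_cst p0 I0 mul0r subrr addr0.
- by apply: eq_int => z; rewrite p0 !mul0r !mulr0 addr0.
Qed.

(** The constant from [solves_rho] is added to [v] on a box containing [A]; the box keeps it
    square-integrable. *)
Lemma good_solves_rho (A : set (R * R)) (rho' v : R * R -> R) (y e : R) :
  A `<=` box e -> \int[area]_z rho' z = 1 -> sqint area (v : P -> R) ->
  (forall phi, test_fun A phi -> solves D U1 U2 rho' (\int[area]_z (phi z * v z)) phi) ->
  solves D U1 U2 rho0 y rho' -> good A.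
Proof.
move=> Ae r1 Sv H Hy.
have Sb : sqint area (fun z => y * \1_(box e) z : R).
  apply: (sqint_bounded_support (M := `|y|) (c := e)).
  - by apply: measurable_funM => //; exact: (measurable_indic (measurable_box e)).
  - by move=> z; rewrite normrM indicE ler_piMr//; case: (_ \in _); rewrite ?normr1 ?normr0.
  - by move=> z ze; rewrite indicE memNset ?mulr0.
exists (fun z => v z + y * \1_(box e) z); split; first exact: sqintD.
move=> phi tphi; have := solves_rho r1 (H _ tphi) Hy.
have Sp := test_fun_sqint tphi.
suff -> : \int[area]_z (phi z * (v z + y * \1_(box e) z)) =
   \int[area]_z (phi z * v z) + (\int[area]_z phi z) * y by [].
rewrite [X in _ = _ + X]mulrC -(intZ y (test_fun_L1 tphi)) -intD.
- apply: eq_int => z; rewrite mulrDr; congr (_ + _).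
  have [Az|nAz] := pselect (A z).
    by rewrite indicE mem_set ?mulr1 1?mulrC//; exact: Ae.
  by rewrite (test_fun_out tphi nAz) mul0r mulr0.
- exact: sqint_mul.
- exact: L1Z (test_fun_L1 tphi).
Qed.

Lemma box_ball (p : R * R) r : exists e, ball p r `<=` box e.
Proof.
have [e He] := compact_bounded_box (@cbox_compact R p r).
by exists e => z /ball_cbox; exact: He.
Qed.

(** Continuation across an overlap: a bump of mass 1 supported in the ball and in [B] is solved with
    respect to both reference densities, which by [solves_swap] ties the local density to [rho0]. *)
Lemma good_step (p b : R * R) (r : R) (B : set (R * R)) : 0 < r -> cbox p (r + r) `<=` D ->
  ball p r b -> open B -> B b -> good B -> good (ball p r).
Proof.
move=> r0 pD pb oB Bb [vB [SvB HB]].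
have [rho [v [trho rho1 Sv H]]] := local_solve S1 S2 c1 c2 r0 pD.
have : nbhs b (ball p r `&` B).
  by apply: open_nbhs_nbhs; split => //; apply: openI => //; exact: ball_open.
move=> /nbhs_ballP[e /= e0 eb].
have e20 : 0 < e / 2 by rewrite divr_gt0.
have [sg [ssg sg0 _ sg1]] := mollifier e20.
pose s z := sg (z - b).
have ss : smooth2 s := smooth2_shift b ssg.
have s0 z : ~ cbox b (e / 2) z -> s z = 0.
  move=> zr; apply: sg0 => /cboxP[]; rewrite /= !subr0 => h1 h2; apply: zr.
  by apply/cboxP.
have cb : cbox b (e / 2) `<=` ball b e.
  move=> z /cboxP[h1 h2]; split; rewrite /ball/= distrC; apply: le_lt_trans; eauto;
    by rewrite ltr_pdivrMr// ltr_pMr// ltr1n.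
have ts1 : test_fun (ball p r) s.
  apply: (test_fun_compact ss (@cbox_compact R b (e / 2))) => //.
  by move=> z /cb/eb[].
have ts2 : test_fun B s.
  apply: (test_fun_compact ss (@cbox_compact R b (e / 2))) => //.
  by move=> z /cb/eb[].
have Lsg : L1 area (sg : P -> R).
  by apply: bsupp_L1; [exact: smoothG_continuous|exact: bsupp_cbox sg0].
have si : \int[area]_z s z = 1 by rewrite /s (int_shift (- b) Lsg).
have K := solves_swap si rho1 (H _ ts1) (HB _ ts2).
have [e' He'] := box_ball p r.
exact: (good_solves_rho He' rho1 Sv H K).
Qed.

(** A partition of unity: [chi] is 1 on the ball of radius r/2 and supported within 3r/4 < r, so
    [chi * phi] is a test function of the larger piece, while [(1 - chi) * phi] is supported in
    [B]. *)
Lemma good_union (A B : set (R * R)) (p : R * R) (r : R) : 0 < r -> B `<=` A ->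
  good (A `&` ball p r) -> good B -> good ((A `&` ball p (r / 2)) `|` B).
Proof.
move=> r0 BA [vA [SA HA]] [vB [SB HB]].
have h1 : 0 < r / 2 by rewrite divr_gt0.
have h2 : r / 2 < r * (3 / 4) by lra.
have h3 : r * (3 / 4) < r by lra.
pose chi := cutbox p (r * (3 / 4)) (r / 2).
have schi : smooth2 chi := smooth2_cutbox _ _ _.
have s1chi : smooth2 (fun z => 1 - chi z) by apply: smoothGB => //; exact: smoothG_cst.
have cut1_01 (a b x : R) : 0 <= cut1 a b x <= 1 by rewrite /cut1 step_ge0 step_le1.
have chi01 z : 0 <= chi z <= 1.
  rewrite /chi /cutbox; have /andP[a0 a1] := cut1_01 (r * (3 / 4)) (r / 2) (z.1 - p.1).
  have /andP[b0 b1] := cut1_01 (r * (3 / 4)) (r / 2) (z.2 - p.2).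
  by rewrite mulr_ge0// mulr_ile1.
have mchi : measurable_fun setT (chi : P -> R).
  exact: continuous_measurable_plane (smoothG_continuous schi).
have m1chi : measurable_fun setT ((fun z => 1 - chi z) : P -> R).
  exact: continuous_measurable_plane (smoothG_continuous s1chi).
have bchi z : `|chi z| <= 1 by have /andP[? ?] := chi01 z; rewrite ger0_norm.
have b1chi z : `|1 - chi z| <= 1.
  by have /andP[? ?] := chi01 z; rewrite ger0_norm ?subr_ge0// lerBlDr lerDl.
exists (fun z => chi z * vA z + (1 - chi z) * vB z); split.
  by apply: sqintD; [exact: sqint_bounded mchi bchi SA|exact: sqint_bounded m1chi b1chi SB].
move=> phi tphi.
have [sphi bphi phi0] := (test_funP _ _).1 tphi.
have tA : test_fun (A `&` ball p r) (fun z => chi z * phi z).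
  apply/test_funP; split; first exact: smoothGM.
    by have [e he] := bphi; exists e => z /he ->; rewrite mulr0.
  move=> q nq.
  have [[Aq|Bq]|nAB] := pselect (((A `&` ball p (r / 2)) `|` B) q).
  - by case: nq; case: Aq => Aq pq; split => //; apply: le_ball pq; exact: ltW (lt_trans h2 h3).
  - have : nbhs q (~` cbox p (r * (3 / 4))).
    apply: open_nbhs_nbhs; split.
      by rewrite openC; apply: compact_closed_plane; exact: cbox_compact.
    move=> /cboxP[g1 g2]; apply: nq; split; first exact: BA.
    by split; rewrite /ball/= distrC; [exact: le_lt_trans g1 h3|exact: le_lt_trans g2 h3].
    by apply: filterS => z zq; rewrite /chi cutbox_eq0 ?mul0r//; exact: ltW.
  - by apply: filterS (phi0 _ nAB) => z ->; rewrite mulr0.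
have tB : test_fun B (fun z => (1 - chi z) * phi z).
  apply/test_funP; split; first exact: smoothGM.
    by have [e he] := bphi; exists e => z /he ->; rewrite mulr0.
  move=> q nq.
  have [pq|npq] := pselect (ball p (r / 2) q).
    have : nbhs q (ball p (r / 2)) by apply: open_nbhs_nbhs; split => //; exact: ball_open.
    apply: filterS => z pz; rewrite /chi cutbox_eq1 ?subrr ?mul0r//.
    exact: ltW.
  have nAB : ~ ((A `&` ball p (r / 2)) `|` B) q by case=> [[_ ?]|?].
  by apply: filterS (phi0 _ nAB) => z ->; rewrite mulr0.
have LA := test_fun_L1 tA; have LB := test_fun_L1 tB.
have := solves_lin 1 LA LB (HA _ tA) (HB _ tB).
have -> : (fun z => chi z * phi z + 1 * ((1 - chi z) * phi z)) = phi.
  by apply/funext => z; ring.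
suff -> : \int[area]_z (phi z * (chi z * vA z + (1 - chi z) * vB z)) =
  \int[area]_z (chi z * phi z * vA z) + 1 * \int[area]_z ((1 - chi z) * phi z * vB z) by [].
rewrite mul1r -intD.
- by apply: eq_int => z; ring.
- by apply: sqint_mul => //; exact: test_fun_sqint tA.
- by apply: sqint_mul => //; exact: test_fun_sqint tB.
Qed.

(** The difference phi - phi(. - e) is the divergence of the average of [phi] along the segment in
    the direction [e], and the translate of [phi] is a test function of [B]. Thus [A] may reach the
    boundary while [B] is an interior ball, and the density on [A] is square-integrable up to the
    boundary. *)
Lemma good_translate (A B : set (R * R)) (e : R * R) :
  A `<=` D -> (forall z t, A z -> 0 <= t <= 1 -> D (z + t *: e)) ->
  (forall z, A z -> B (z + e)) -> good B -> good A.
Proof.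
move=> AD Dt AB [vB [SvB HB]].
have LU1 := sqint_L1 S1 c1; have LU2 := sqint_L1 S2 c2.
pose m (t : measurableTypeR R) : P := t *: e.
have mm : measurable_fun setT m.
  apply/measurable_fun_pairP; split.
  - by rewrite [X in measurable_fun _ X](_ : _ = (fun t : R => t * e.1))//; apply: measurable_funM.
  - by rewrite [X in measurable_fun _ X](_ : _ = (fun t : R => t * e.2))//; apply: measurable_funM.
pose a1 (t : measurableTypeR R) := e.1 * ind01 t; pose a2 (t : measurableTypeR R) := e.2 * ind01 t.
have La1 : L1 leb a1 by apply: L1Z; exact: L1_ind01.
have La2 : L1 leb a2 by apply: L1Z; exact: L1_ind01.
have Sa1 := sqint_adj_average La1 mm S1 c1; have Sa2 := sqint_adj_average La2 mm S2 c2.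
have Ss : sqint area (fun z => vB (z + e) : R).
  have [mw Lw] := SvB; split; last exact: (L1_shift e Lw).
  exact: (measurableT_comp mw (measurable_shift e)).
exists (fun z => adj_average leb a1 m U1 z + adj_average leb a2 m U2 z + vB (z + e)); split.
  by apply: sqintD => //; exact: sqintD.
move=> phi tphi.
have sphi := test_fun_smooth tphi; have bphi := test_fun_bsupp tphi.
have cphi := smoothG_continuous sphi; have Lphi := test_fun_L1 tphi.
have Sphi := test_fun_sqint tphi.
have [_ cS SA] := tphi; set S := closure _ in cS SA.
have S0 z : phi z != 0 -> S z by move=> pz; exact: subset_closure.
pose tr (q : R * R * R) : R * R := q.1 + q.2 *: e.
have ctr : continuous tr.
  move=> q; apply: cvgD; first exact: cvg_fst.
  by apply: cvgZr_tmp; exact: cvg_snd.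
pose C := tr @` (S `*` `[0, 1]%classic).
have cC : compact C.
  apply: continuous_compact; first exact: continuous_subspaceT.
  by apply: compact_setX => //; exact: segment_compact.
have CD : C `<=` D.
  by move=> _ [[z t] [/= Sz t01] <-]; apply: Dt; [exact: SA|rewrite in_itv in t01].
have H (x : measurableTypeR R) z : ind01 x != 0 -> phi (z - m x) != 0 -> C z.
  move=> /ind01_neq0 x01 pz; exists (z - m x, x : R); last by rewrite /tr /m /= subrK.
  by split => /=; [exact: S0|rewrite in_itv].
have nz2 (a b : R) : a * b != 0 -> b != 0 by rewrite mulf_eq0 negb_or => /andP[].
pose psi1 := average leb a1 m phi; pose psi2 := average leb a2 m phi.
have t1 : test_fun D psi1.
  by apply: (test_fun_average La1 mm sphi bphi cC CD) => x z /nz2; exact: H.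
have t2 : test_fun D psi2.
  by apply: (test_fun_average La2 mm sphi bphi cC CD) => x z /nz2; exact: H.
have E z : dx psi1 z + dy psi2 z = phi z - phi (z - e).
  have [b1 b2] := bsupp_dx bphi.
  have k1 := smoothG_continuous (smooth2_dx sphi); have k2 := smoothG_continuous (smooth2_dy sphi).
  have [M1 [_ H1]] := continuous_bounded_support k1 b1.
  have [M2 [_ H2]] := continuous_bounded_support k2 b2.
  have LA := average_L1 La1 mm z k1 H1; have LB := average_L1 La2 mm z k2 H2.
  rewrite (dx_average La1 mm z sphi bphi) (dy_average La2 mm z sphi bphi).
  rewrite /average -(intD LA LB).
  have HD (t : R) : is_derive t 1 (fun t : R => - phi (t *: (- e) + z))
      (e.1 * dx phi (z - t *: e) + e.2 * dy phi (z - t *: e)).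
    have E : t *: (- e) + z = z - t *: e by rewrite scalerN addrC.
    have := is_deriveN (is_derive_line (smooth2_is_derive (t *: (- e) + z) (- e) sphi)).
    by rewrite E; congr (is_derive _ _ _ _); rewrite opprD -!mulNr /= !opprK.
  have ch : continuous (fun t : R => e.1 * dx phi (z - t *: e) + e.2 * dy phi (z - t *: e)).
    have ct : continuous (fun t : R => z - t *: e).
      move=> t; apply: cvgB; first exact: cvg_cst.
      by apply: cvgZr_tmp; exact: cvg_id.
    move=> t; apply: cvgD; (apply: cvgM; first exact: cvg_cst).
      by apply: continuous_comp; [exact: ct|exact: k1].
    by apply: continuous_comp; [exact: ct|exact: k2].
  transitivity (\int[leb]_(t in `[0, 1]) (e.1 * dx phi (z - t *: e) + e.2 * dy phi (z - t *: e))).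
    rewrite [RHS]Rintegral_mkcond; apply: eq_int => t; rewrite patchE /a1 /a2 /m /ind01 indicE.
    have p0 : (point : R) = 0 by [].
    by case: (t \in _); rewrite /= ?p0 ?mulr1 ?mulr0 ?mul0r ?addr0.
  rewrite (int_FTC ltr01 HD) // scale1r scale0r add0r opprK addrC.
  by rewrite [- e + z]addrC.
pose phie z := phi (z - e).
have Lphie : L1 area (phie : P -> R) := L1_shift (- e) Lphi.
have tphie : test_fun B phie.
  have cS' : continuous (fun z : R * R => z + e).
    by move=> z; apply: cvgD; [exact: cvg_id|exact: cvg_cst].
  apply: (@test_fun_compact _ _ ((fun z => z + e) @` S)).
  - exact: smooth2_shift.
  - by apply: continuous_compact cS; exact: continuous_subspaceT.
  - by move=> _ [z Sz <-]; apply: AB; exact: SA.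
  - move=> z nz; apply/eqP; apply: contrapT => /negP pz; apply: nz.
    by exists (z - e); [exact: S0|rewrite subrK].
have ie : \int[area]_z phie z = \int[area]_z phi z := int_shift (- e) Lphi.
have [g1 [g2 [tg1 tg2 gd gv]]] := HB _ tphie.
exists (fun z => psi1 z + 1 * g1 z), (fun z => psi2 z + 1 * g2 z).
have tkg1 := test_funZ 1 tg1; have tkg2 := test_funZ 1 tg2.
split; [exact: test_funD|exact: test_funD| |].
  move=> z; rewrite dx_lin// dy_lin//.
  transitivity ((dx psi1 z + dy psi2 z) + (dx g1 z + dy g2 z)); first by ring.
  by rewrite E gd ie /phie; ring.
rewrite int_lin2// gv mul1r.
have Q1 := sqint_L1_test S1 t1; have Q2 := sqint_L1_test S2 t2.
rewrite (intD Q1 Q2) (int_average La1 mm LU1 cphi bphi) (int_average La2 mm LU2 cphi bphi).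
have -> : \int[area]_z (phie z * vB z) = \int[area]_z (phi z * vB (z + e)).
  rewrite -(int_shift e (sqint_mul (test_fun_sqint tphie) SvB)).
  by apply: eq_int => z; rewrite /phie addrK.
have W1 := sqint_mul Sphi Sa1; have W2 := sqint_mul Sphi Sa2; have W3 := sqint_mul Sphi Ss.
rewrite -(intD W1 W2) -(intD (L1D W1 W2) W3).
by apply: eq_int => z; ring.
Qed.

End Potential.

(** * From local to global: paths inside the domain, compactness of its closure *)

Section PotentialExists.
Context {R : realType}.
Local Notation leb := (@lebesgue_measure R).
Local Notation area := (@lebesgue_measure R \x @lebesgue_measure R)%E.
Local Notation P := (measurableTypeR R * measurableTypeR R)%type.
Lemma compact_cover_plane (K : set (R * R)) : compact K -> cover_compact K.
Proof.
move=> cK.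
pose T : ptopologicalType := HB.pack (R * R)%type (isPointed.Build (R * R)%type 0).
have E := @compact_cover T.
have : @compact T K by exact: cK.
by rewrite E.
Qed.

Variables (D : set (R * R)).
Hypotheses (oD : open D) (bD : bounded_set D) (pcD : path_connected D) (lipD : lipschitz_boundary D).

Lemma open_cbox p : D p -> exists2 r, 0 < r & cbox p (r + r) `<=` D.
Proof.
move=> Dp; have /nbhs_ballP[e /= e0 eD] : nbhs p D by apply: open_nbhs_nbhs.
exists (e / 4); first by rewrite divr_gt0.
move=> z /cboxP[h1 h2]; apply: eD; split; rewrite /ball/= distrC.
  by apply: le_lt_trans h1 _; lra.
by apply: le_lt_trans h2 _; lra.
Qed.

Lemma bounded_box : exists c, closure D `<=` box c.
Proof.
have [M [_ HM]] := bD; exists (M + 1).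
rewrite closureE => z; apply; split; first exact: box_closed.
move=> w Dw; have : `|w| <= M + 1 by apply: (HM (M + 1)); rewrite ?ltrDl.
rewrite prod_normE ge_max => /andP[h1 h2].
by split; rewrite /= in_itv/= -ler_norml.
Qed.

(** The image of a path from [p0] to [p] is connected, and [S] is open and closed in it. *)
Lemma path_connected_ind (S : set (R * R)) p0 p : open S -> S p0 -> D p0 -> D p ->
  (forall q, D q -> ~ S q -> nbhs q (~` S)) -> S p.
Proof.
move=> oS Sp0 Dp0 Dp nS; have [g [cg gD g0 g1]] := pcD Dp0 Dp.
pose K := g @` `[0, 1]%classic.
have cK : connected K by apply: connected_continuous_connected => //; exact: segment_connected.
have oN : open (D `&` ~` S).
  rewrite openE => q [Dq Sq]; apply: filterI; last exact: nS.
  by apply: open_nbhs_nbhs.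
have : K `&` S = K.
  apply: cK.
  - by exists p0; split => //; exists 0 => //; rewrite /= in_itv/= lexx ler01.
  - by exists S.
  - exists (~` (D `&` ~` S)); first exact: open_closedC.
    apply/seteqP; split => q [Kq Sq]; split => //; first by case.
    by apply: contrapT => nSq; apply: Sq; split => //; apply: gD.
move=> KS; have : K p by exists 1 => //; rewrite /= in_itv/= ler01 lexx.
by rewrite -KS => -[].
Qed.

Lemma disk_cbox (p : R * R) r : cbox p (r / 2) `<=` disk p r.
Proof.
move=> z /cboxP[h1 h2]; rewrite /disk /= /dot /=.
have r0 : 0 <= r / 2 := le_trans (normr_ge0 _) h1.
have r0' : 0 <= r by lra.
rewrite -[X in _ <= X](ger0_norm r0') -sqrtr_sqr ler_wsqrtr// -!expr2.
rewrite -[(z.1 - p.1) ^+ 2]real_normK ?num_real// -[(z.2 - p.2) ^+ 2]real_normK ?num_real//.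
have : `|z.1 - p.1| ^+ 2 <= (r / 2) ^+ 2 by rewrite lerXn2r ?nnegrE.
have : `|z.2 - p.2| ^+ 2 <= (r / 2) ^+ 2 by rewrite lerXn2r ?nnegrE.
have := sqr_ge0 r; have -> : (r / 2) ^+ 2 = r ^+ 2 / 4 by field.
by move: (_ ^+ 2) (_ ^+ 2) (r ^+ 2) => x y w; lra.
Qed.

(** The vector [e] has length r/4 and points along the axis of the graph, so moving along it keeps
    the abscissa and raises the height. Starting within r/4 of [p] one stays in the box of half-side
    r/2, which is contained in the disk where the graph describes [D]. *)
Lemma boundary_translate p : closure D p -> ~ D p ->
  exists (e : R * R) (r : R), [/\ 0 < r, D (p + e) &
    forall z t, (D `&` ball p r) z -> 0 <= t <= 1 -> D (z + t *: e)].
Proof.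
move=> clp nDp.
have bp : (closure D `\` interior D) p by split => // /interior_subset.
have [r [a [b [k [h [r0 ab hl hD]]]]]] := lipD bp.
have ch : continuous h.
  move=> x; apply/cvgrPdist_le => e e0.
  have K0 : 0 < `|k| + 1 by rewrite ltr_wpDl.
  near=> y; have := hl (x, y) (conj I I); rewrite /self_sub /= => H.
  apply: le_trans H _; apply: (@le_trans _ _ ((`|k| + 1) * `|x - y|)).
    by rewrite ler_wpM2r// (le_trans (ler_norm _))// lerDl.
  rewrite -ler_pdivlMl// mulrC; near: y; apply: cvgr_dist_le; first exact: cvg_id.
  by rewrite divr_gt0.
pose s (z : R * R) := a * z.1 + b * z.2.
pose ht (z : R * R) := a * z.2 - b * z.1.
have cs : continuous s.
  by move=> z; apply: cvgD; (apply: cvgM; first exact: cvg_cst); [exact: cvg_fst|exact: cvg_snd].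
have cht : continuous ht.
  by move=> z; apply: cvgB; (apply: cvgM; first exact: cvg_cst); [exact: cvg_snd|exact: cvg_fst].
pose u (z : R * R) := ht z - h (s z).
have cu : continuous u.
  move=> z; apply: cvgB; first exact: cht.
  by apply: continuous_comp; [exact: cs|exact: ch].
have pu : 0 <= u p.
  (* Points of [D] accumulate at [p], so [p] cannot lie strictly below the graph. *)
  rewrite leNgt; apply/negP => up.
  have N1 : nbhs p (fun z => u z < 0) by exact: (cvgr_lt _ (cu p)).
  have N2 : nbhs p (ball p (r / 2)) by apply: nbhsx_ballx; rewrite divr_gt0.
  have [z [Dz [uz bz]]] := clp _ (filterI N1 N2).
  have /hD := disk_cbox (ball_cbox bz); move=> /iffLR /(_ Dz).
  by rewrite -subr_gt0 ltNge (ltW uz).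
pose e := ((r / 4) * - b, (r / 4) * a).
have le1 (x y : R) : x ^+ 2 + y ^+ 2 = 1 -> `|x| <= 1.
  move=> xy; rewrite -(@ler_sqr _ `|x|) ?nnegrE// real_normK ?num_real// expr1n -xy.
  by rewrite lerDl sqr_ge0.
have a1 := le1 _ _ ab; have b1 := le1 b a (etrans (addrC _ _) ab).
have ecb t : 0 <= t <= 1 -> cbox 0 (r / 4) (t *: e).
  move=> /andP[t0 t1]; apply/cboxP; rewrite /= !subr0.
  have tr : `|t * (r / 4)| <= r / 4 by rewrite normrM !ger0_norm ?ler_piMl// divr_ge0// ltW.
  have r40 : 0 <= r / 4 by rewrite divr_ge0// ltW.
  split; rewrite /GRing.scale/= mulrA normrM ?normrN; apply: le_trans tr; exact: ler_piMr.
have sE z t : s (z + t *: e) = s z.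
  by rewrite /s /e /= /GRing.scale /=; ring.
have htE z t : ht (z + t *: e) = ht z + t * (r / 4).
  rewrite /ht /e /= /GRing.scale /=; transitivity (a * z.2 - b * z.1 + t * (r / 4) * (a ^+ 2 + b ^+ 2)); first by ring.
  by rewrite ab mulr1.
have inD z t : cbox p (r / 4) z -> 0 <= t <= 1 -> 0 < u z + t * (r / 4) -> D (z + t *: e).
  move=> zp t01 ut.
  have : disk p r (z + t *: e).
    apply: disk_cbox; have := cboxD zp (ecb t t01).
    by congr cbox; lra.
  move=> /hD/iffRL; apply; move: ut; rewrite /u -/(s _) -/(ht _) sE htE; lra.
exists e, (r / 4); split; first by rewrite divr_gt0.
- rewrite -[e]scale1r; apply: inD.
  + by apply/cboxP; rewrite !subrr normr0 divr_ge0// ltW.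
  + by rewrite ler01 lexx.
  + by rewrite mul1r ltr_wpDl// divr_gt0.
- move=> z t [Dz pz] t01; apply: inD => //; first exact: ball_cbox.
  apply: ltr_pwDl; last by case/andP: t01 => ? _; rewrite mulr_ge0// divr_ge0// ltW.
  have pz2 : cbox p (r / 2) z by apply: cbox_sub (ball_cbox pz); lra.
  by rewrite subr_gt0; exact: (iffLR (hD _ (disk_cbox pz2)) Dz).
Unshelve. all: end_near. Qed.

Variables (U1 U2 : R * R -> R) (p0 : R * R).
Hypotheses (S1 : sqint area (U1 : P -> R)) (S2 : sqint area (U2 : P -> R)).
Hypotheses (D1 : forall z, ~ D z -> U1 z = 0) (D2 : forall z, ~ D z -> U2 z = 0).
Hypothesis Dp0 : D p0.
Hypothesis orth : forall psi1 psi2, test_fun D psi1 -> test_fun D psi2 ->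
  (forall z, dx psi1 z + dy psi2 z = 0) ->
  \int[area]_z (U1 z * psi1 z + U2 z * psi2 z) = 0.

Lemma potential_exists : exists v : R * R -> R, sqint area (v : P -> R) /\
  forall chi, test_fun D chi ->
    \int[area]_z (v z * dx chi z) = - (\int[area]_z (U1 z * chi z)) /\
    \int[area]_z (v z * dy chi z) = - (\int[area]_z (U2 z * chi z)).
Proof.
have [c Dc] := bounded_box.
have c1 z : ~ box c z -> U1 z = 0 by move=> zc; apply: D1 => /subset_closure/Dc.
have c2 z : ~ box c z -> U2 z = 0 by move=> zc; apply: D2 => /subset_closure/Dc.
have [r0 r00 r0D] := open_cbox Dp0.
have [rho0 [v0 [trho rho1 Sv0 H0]]] := local_solve S1 S2 c1 c2 r00 r0D.
pose G := good D U1 U2 rho0.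
have inner p : D p -> exists2 r, 0 < r & G (ball p r).
  move=> Dp.
  (* The points having a good neighbourhood tied to [rho0]. If one point of the ball about [q]
     belongs to this set, [good_step] makes the whole ball good, so the complement is open in
     [D]. *)
  pose T := [set q | exists B : set (R * R), [/\ open B, B q & G B]].
  have Tp : T p.
    apply: (@path_connected_ind T p0) => //.
    - rewrite openE => q [B [oB Bq GB]].
      have : nbhs q B by apply: open_nbhs_nbhs.
      by apply: filterS => w Bw; exists B.
    - exists (ball p0 r0); split; [exact: ball_open|exact: ballxx|].
      by exists v0.
    - move=> q Dq nTq; have [r r_gt0 rD] := open_cbox Dq.
      have : nbhs q (ball q r) by exact: nbhsx_ballx.
      apply: filterS => w qw [B [oB Bw GB]]; apply: nTq.
      exists (ball q r); split; [exact: ball_open|exact: ballxx|].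
      exact: (good_step S1 S2 c1 c2 r_gt0 rD qw oB Bw GB).
  have [B [oB Bp GB]] := Tp.
  have /nbhs_ballP[r /= r_gt0 rB] : nbhs p B by apply: open_nbhs_nbhs.
  by exists r => //; exact: good_subset rB GB.
have local p : closure D p -> exists r, 0 < r /\ G (D `&` ball p r).
  move=> clp; have [Dp|nDp] := pselect (D p).
    by have [r r_gt0 Gr] := inner p Dp; exists r; split => //; apply: good_subset Gr => z [].
  have [e [r [r_gt0 Dpe He]]] := boundary_translate clp nDp.
  have [r' r'0 Gr'] := inner _ Dpe.
  have m0 : 0 < Num.min r r' by rewrite lt_min r_gt0.
  exists (Num.min r r'); split => //.
  apply: (good_translate S1 S2 c1 c2 _ _ _ Gr').
  - by move=> z [].
  - move=> z t [Dz pz]; apply: He; split => //.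
    by apply: le_ball pz; rewrite ge_min lexx.
  - move=> z [Dz [pz1 pz2]]; split; rewrite /ball /= opprD addrACA subrr addr0.
      by apply: lt_le_trans pz1 _; rewrite ge_min lexx orbT.
    by apply: lt_le_trans pz2 _; rewrite ge_min lexx orbT.
have [rr Hrr] : exists rr : R * R -> R, forall p, closure D p -> 0 < rr p /\ G (D `&` ball p (rr p)).
  have : forall p, exists r, closure D p -> 0 < r /\ G (D `&` ball p r).
    move=> p; have [/local[r Hr]|n] := pselect (closure D p); first by exists r.
    by exists 0.
  by move=> /choice[rr Hrr]; exists rr.
have cD : compact (closure D).
  by apply: (@subclosed_compact _ _ (box c)); [exact: closed_closure|exact: box_compact|].
have GD : G D.
  have seqG (s : seq (R * R)) : (forall p, p \in s -> closure D p) ->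
      G (D `&` [set z | exists2 p, p \in s & ball p (rr p / 2) z]).
    elim: s => [|p s IH] sD.
      by apply: good_subset (good0 _ _ _ _) => z [_ [p]].
    have [rp Gp] := Hrr p (sD p (mem_head _ _)).
    have IH' : G (D `&` [set z | exists2 p, p \in s & ball p (rr p / 2) z]).
      by apply: IH => q qs; apply: sD; rewrite inE qs orbT.
    apply: good_subset (good_union S1 S2 rp _ Gp IH'); last by move=> z [].
    move=> z [Dz [q]]; rewrite inE => /predU1P[->|qs] qz; first by left.
    by right; split => //; exists q.
  have [] := (compact_cover_plane cD : forall (I : choiceType) (D0 : set I), _) (R * R)%type (closure D) (fun p => ball p (rr p / 2)).
  - by move=> p _; exact: ball_open.
  - move=> z clz; exists z => //; apply: ballxx; have [rz _] := Hrr z clz.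
    by rewrite divr_gt0.
  - move=> F FD cov'.
    apply: good_subset (seqG (finmap.enum_fset F) _).
      move=> z Dz; split => //; have [p pF pz] := cov' z (subset_closure Dz).
      by exists p.
    by move=> p pF; have := FD p pF; rewrite inE.
have [v [Sv Hv]] := GD.
(* The density pairs with the divergence of psi without a sign, while the weak gradient carries a
   minus sign. *)
exists (fun z => - v z); split.
  by have := sqintZ (-1) Sv; congr sqint; apply/funext => z; rewrite mulN1r.
move=> chi tchi.
(* The field provided by [good] and the explicit field (f, g) have the same divergence, since [phi]
   has mass 0. Their difference is divergence-free, and orthogonality identifies the two values. *)
have key (phi f g : R * R -> R) : test_fun D phi -> \int[area]_z phi z = 0 ->
    test_fun D f -> test_fun D g -> (forall z, dx f z + dy g z = phi z) ->
    \int[area]_z (- v z * phi z) = - \int[area]_z (U1 z * f z + U2 z * g z).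
  move=> tphi i0 tf tg E.
  have [f' [g' [tf' tg' E' V']]] := Hv _ tphi.
  have := @orth (fun z => f' z + (-1) * f z) (fun z => g' z + (-1) * g z).
  rewrite (int_lin2 S1 S2 (-1) tf' tg' tf tg) V' mulN1r => H.
  have Lv := sqint_mul (test_fun_sqint tphi) Sv.
  transitivity (\int[area]_z (- (phi z * v z))); first by apply: eq_int => z; ring.
  rewrite (intN Lv); congr (- _); apply/eqP; rewrite -subr_eq0; apply/eqP; apply: H.
  - by apply: test_funD => //; exact: test_funZ.
  - by apply: test_funD => //; exact: test_funZ.
  - move=> z; rewrite (dx_lin _ _ tf' tf) (dy_lin _ _ tg' tg).
    transitivity ((dx f' z + dy g' z) - (dx f z + dy g z)); first by ring.
    by rewrite E' E i0; ring.
have [schi bchi _] := (test_funP _ _).1 tchi.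
split.
- rewrite (key _ chi (fun=> 0)) //; [|exact: test_fun_dx|exact: int_dx|exact: test_fun0|].
    by congr (- _); apply: eq_int => z; rewrite mulr0 addr0.
  by move=> z; rewrite dy_cst addr0.
- rewrite (key _ (fun=> 0) chi) //; [|exact: test_fun_dy|exact: int_dy|exact: test_fun0|].
    by congr (- _); apply: eq_int => z; rewrite mulr0 add0r.
  by move=> z; rewrite dx_cst add0r.
Qed.

End PotentialExists.

(** * Radial integrals *)

Section AeInt.
Context d (T : measurableType d) (R : realType) (mu : {measure set T -> \bar R}).

Lemma ae_eq_int (f g : T -> R) : measurable_fun setT f -> measurable_fun setT g ->
  {ae mu, forall z, f z = g z} -> \int[mu]_z f z = \int[mu]_z g z.
Proof.
move=> mf mg fg; rewrite /Rintegral; congr fine; apply: ae_eq_integral => //.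
- exact/measurable_EFinP.
- exact/measurable_EFinP.
- by move: fg; apply: filterS => z /= -> _.
Qed.

Lemma ae_int (Q : T -> Prop) (f g : T -> R) : measurable_fun setT f -> measurable_fun setT g ->
  {ae mu, forall z, Q z} -> (forall z, Q z -> f z = g z) -> \int[mu]_z f z = \int[mu]_z g z.
Proof.
by move=> mf mg aeQ QE; apply: ae_eq_int => //; move: aeQ; apply: filterS => z /QE.
Qed.

End AeInt.

Section Radial.
Context {R : realType}.
Local Notation leb := (@lebesgue_measure R).
Local Notation area := (@lebesgue_measure R \x @lebesgue_measure R)%E.
Local Notation P := (measurableTypeR R * measurableTypeR R)%type.
Local Notation e1 := ((1, 0) : R * R).
Local Notation e2 := ((0, 1) : R * R).
Implicit Types (H : R -> R) (phi : R * R -> R) (z p : R * R) (a b : R).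

Lemma nondecreasing_derive (f df : R -> R) a b : a <= b ->
  (forall t, a <= t <= b -> is_derive t 1 f (df t)) ->
  (forall t, a <= t <= b -> 0 <= df t) -> f a <= f b.
Proof.
move=> ab Hf Hdf.
have cf : {within `[a, b]%classic, continuous f}.
  apply: continuous_in_subspaceT => t; rewrite inE /= in_itv /= => tab.
  exact: is_derive_continuous1 (Hf t tab).
have [t||t tab] := @MVT_segment R f df a b ab.
- by rewrite in_itv /= => /andP[at_ tb]; apply: Hf; rewrite !ltW.
- exact: cf.
move=> E; rewrite -subr_ge0 E mulr_ge0 ?subr_ge0//; apply: Hdf.
by move: tab; rewrite in_itv.
Qed.

Lemma smooth1_is_derive H (t : R) : smooth1 H -> is_derive t 1 H ('D_1 H t).
Proof.
by move=> sH; apply: DeriveDef => //; apply: (smoothG_derivable sH); rewrite mem_seq1.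
Qed.

Lemma smooth1_derive H : smooth1 H -> smooth1 ('D_1 H).
Proof. by move=> sH; apply: smoothG_derive => //; rewrite mem_seq1. Qed.

Lemma near0_is_derive H (t : R) : (\forall s \near t, H s = 0) -> is_derive t 1 H 0.
Proof.
move=> H0; have E : \forall s \near t, cst 0 s = H s by move: H0; apply: filterS => s ->.
exact: (near_eq_is_derive E (is_derive_cst _ _ _)).
Qed.

Lemma derive_lt0 H a : (forall s, s < a -> H s = 0) -> forall s, s < a -> 'D_1 H s = 0.
Proof.
move=> H0 s sa; have /@derive_val -> // : is_derive s 1 H 0.
by apply: near0_is_derive; near=> u; apply: H0; near: u; exact: lt_nbhsl.
Unshelve. all: by end_near. Qed.

Lemma derive_gt0 H b (c : R) : smooth1 H -> (forall s, b < s -> H s = c) ->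
  forall s, b < s -> 'D_1 H s = 0.
Proof.
move=> sH H0 s sa.
have /@derive_val E : is_derive s 1 (fun u => H u - c) 0.
  by apply: near0_is_derive; near=> u; rewrite H0 ?subrr//; near: u; exact: lt_nbhsr.
have H1 := smooth1_is_derive s sH.
have /@derive_val : is_derive s 1 (fun u => H u - c) ('D_1 H s - 0).
  by apply: is_deriveB.
by rewrite E subr0 => ->.
Unshelve. all: by end_near. Qed.

Lemma smooth1_divX H a (j : nat) : 0 < a -> smooth1 H -> (forall s, s < a -> H s = 0) ->
  smooth1 (fun s => H s * s^-1 ^+ j).
Proof.
move=> a0 sH H0.
pose S (f : R -> R) := exists H j, [/\ smooth1 H, forall s, s < a -> H s = 0 &
  f = fun s => H s * s^-1 ^+ j].
apply: (@smoothG_coind _ _ _ S); last by exists H, j.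
move=> f [{}H [{}j [{}sH {}H0 ->]]].
pose K s := 'D_1 H s * s - j%:R * H s.
have dK s : is_derive (s : R) 1 (fun s : R => H s * s^-1 ^+ j) (K s * s^-1 ^+ j.+1).
  have [sa|sa] := ltP s a.
    rewrite /K (derive_lt0 H0)// H0// !(mulr0, mul0r) subr0 mul0r.
    apply: near0_is_derive; near=> u; rewrite H0 ?mul0r//; near: u; exact: lt_nbhsl.
  have s0 : s != 0 by rewrite gt_eqF// (lt_le_trans a0).
  have dH := smooth1_is_derive s sH; have di := is_derive_inv s0.
  rewrite /K {K}; case: j => [|j].
    have -> : (fun s : R => H s * s^-1 ^+ 0) = H by apply/funext => u; rewrite expr0 mulr1.
    by have -> : ('D_1 H s * s - 0 * H s) * s^-1 ^+ 1 = 'D_1 H s by rewrite expr1; field.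
  have dX : is_derive s 1 (fun u : R => u^-1 ^+ j.+1) (- (j.+1%:R * s^-1 ^+ j.+2)).
    elim: j => [|j IH].
      by rewrite mul1r [_ ^+ 2]exprVn.
    have -> : (fun u : R => u^-1 ^+ j.+2) = (fun u => u^-1 * u^-1 ^+ j.+1).
      by apply/funext => u; rewrite exprS.
    apply: (is_derive_eq (is_deriveM di IH)); rewrite /GRing.scale /=.
    by rewrite !exprS -[j.+2%:R]natr1; field.
  have := is_deriveM dH dX; rewrite /GRing.scale /=; move=> dM.
  apply: (is_derive_eq dM).
  by rewrite /GRing.scale /= !exprS -natr1; field.
split.
  by move=> s; have := dK s; apply: is_derive_continuous1.
move=> v; rewrite mem_seq1 => /eqP ->; split; first by move=> s; have [] := dK s.
exists K, j.+1; split.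
- apply: smoothGB.
    by apply: smoothGM; [exact: smooth1_derive|exact: smooth1_id].
  exact: smoothGZ.
- by move=> s sa; rewrite /K (derive_lt0 H0)// H0// mul0r mulr0 subrr.
- by apply/funext => s; rewrite derive_val.
Unshelve. all: by end_near. Qed.

Lemma smooth1_div H a : 0 < a -> smooth1 H -> (forall s, s < a -> H s = 0) ->
  smooth1 (fun s => H s / s).
Proof. by move=> a0 sH H0; exact: (smooth1_divX 1 a0 sH H0). Qed.

Lemma derive_div H a s : 0 < a -> smooth1 H -> (forall s, s < a -> H s = 0) ->
  s * 'D_1 (fun s => H s / s) s = 'D_1 H s - H s / s.
Proof.
move=> a0 sH H0; have [sa|sa] := ltP s a.
  rewrite (derive_lt0 H0)// H0// mul0r subr0 (@derive_lt0 _ a) ?mulr0// => u ua.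
  by rewrite H0 ?mul0r.
have s0 : s != 0 by rewrite gt_eqF// (lt_le_trans a0).
have dH := smooth1_is_derive s sH; have di := is_derive_inv s0.
have /@derive_val -> : is_derive s 1 (fun s => H s / s) ('D_1 H s / s - H s / s ^+ 2).
  by apply: is_derive_eq; rewrite /GRing.scale /=; field.
by field.
Qed.

Definition nrm2 z : R := z.1 ^+ 2 + z.2 ^+ 2.

Lemma nrm2_ge0 z : 0 <= nrm2 z.
Proof. by rewrite addr_ge0 ?sqr_ge0. Qed.

Lemma nrm2_gt0 (c : R * R) : c != 0 -> 0 < nrm2 c.
Proof.
move=> c0; rewrite lt0r nrm2_ge0 andbT; apply: contra c0.
rewrite /nrm2 paddr_eq0 ?sqr_ge0// !sqrf_eq0 => /andP[/eqP z1 /eqP z2].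
by apply/eqP; rewrite [c]surjective_pairing z1 z2.
Qed.

Lemma nrm2_sub_gt0 z (p : R * R) : z != p -> 0 < nrm2 (z - p).
Proof. by move=> zp; rewrite nrm2_gt0// subr_eq0. Qed.

Lemma smooth2_nrm2 : smooth2 nrm2.
Proof.
by apply: smoothGD; apply: smoothGM; (exact: smooth2_fst || exact: smooth2_snd).
Qed.

Lemma nrm2_is_derive z (v : R * R) : is_derive z v nrm2 (2 * (v.1 * z.1 + v.2 * z.2)).
Proof.
apply/is_derive_alongP.
have -> : (fun h : R => nrm2 (h *: v + z)) =
    fun h => (h * v.1 + z.1) ^+ 2 + (h * v.2 + z.2) ^+ 2 by [].
by apply: is_derive_eq; rewrite /GRing.scale /=; ring.
Qed.

Lemma smooth2_radial H : smooth1 H -> smooth2 (fun z => H (nrm2 z)).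
Proof. by move=> sH; apply: smoothG_comp => //; exact: smooth2_nrm2. Qed.

Lemma dx_radial H z : smooth1 H -> dx (fun z => H (nrm2 z)) z = 2 * z.1 * 'D_1 H (nrm2 z).
Proof.
move=> sH; have := is_derive_comp_dir (nrm2_is_derive z e1) (smooth1_is_derive _ sH).
by move=> /@derive_val; rewrite /dx => -> /=; ring.
Qed.

Lemma dy_radial H z : smooth1 H -> dy (fun z => H (nrm2 z)) z = 2 * z.2 * 'D_1 H (nrm2 z).
Proof.
move=> sH; have := is_derive_comp_dir (nrm2_is_derive z e2) (smooth1_is_derive _ sH).
by move=> /@derive_val; rewrite /dy => -> /=; ring.
Qed.

Lemma dx_fst z : dx (fst : R * R -> R) z = 1.
Proof.
suff /@derive_val : is_derive z e1 (fst : R * R -> R) 1 by [].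
apply/is_derive_alongP.
have -> : (fun h : R => (h *: e1 + z).1) = fun h => 1 * h + z.1.
  by apply/funext => h /=; rewrite /GRing.scale /= mulrC.
exact: is_derive_affine.
Qed.

Lemma dy_snd z : dy (snd : R * R -> R) z = 1.
Proof.
suff /@derive_val : is_derive z e2 (snd : R * R -> R) 1 by [].
apply/is_derive_alongP.
have -> : (fun h : R => (h *: e2 + z).2) = fun h => 1 * h + z.2.
  by apply/funext => h /=; rewrite /GRing.scale /= mulrC.
exact: is_derive_affine.
Qed.

Lemma bsuppM f phi : bsupp phi -> bsupp (fun z => phi z * f z : R).
Proof. by move=> [c Hc]; exists c => z zc; rewrite Hc// mul0r. Qed.

Lemma bsuppMl f phi : bsupp phi -> bsupp (fun z => f z * phi z : R).
Proof. by move=> [c Hc]; exists c => z zc; rewrite Hc// mulr0. Qed.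

Lemma bsuppD f g : bsupp f -> bsupp g -> bsupp (fun z => f z + g z : R).
Proof.
move=> [c Hc] [c' Hc']; exists (Num.max c c') => z zc.
by rewrite Hc ?Hc' ?addr0// => zb; apply: zc; apply: box_le zb; rewrite le_max lexx ?orbT.
Qed.

(* div (z H(s)/s) = 2 H'(s) for s = |z|^2 *)
Lemma radial_parts phi H a : smooth2 phi -> bsupp phi -> 0 < a -> smooth1 H ->
  (forall s, s < a -> H s = 0) ->
  \int[area]_z ((z.1 * dx phi z + z.2 * dy phi z) * (H (nrm2 z) / nrm2 z)) =
  - (2 * \int[area]_z (phi z * 'D_1 H (nrm2 z))).
Proof.
move=> sphi bphi a0 sH H0.
have sh := smooth1_div a0 sH H0.
pose h s := H s / s.
have shn : smooth2 (fun z => h (nrm2 z)) by exact: (smooth2_radial sh).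
have s1 : smooth2 (fun z => z.1 * h (nrm2 z)) by apply: smoothGM => //; exact: smooth2_fst.
have s2 : smooth2 (fun z => z.2 * h (nrm2 z)) by apply: smoothGM => //; exact: smooth2_snd.
have sp1 : smooth2 (fun z => phi z * (z.1 * h (nrm2 z))) by exact: smoothGM.
have sp2 : smooth2 (fun z => phi z * (z.2 * h (nrm2 z))) by exact: smoothGM.
have b1 : bsupp (fun z => phi z * (z.1 * h (nrm2 z))) by exact: bsuppM.
have b2 : bsupp (fun z => phi z * (z.2 * h (nrm2 z))) by exact: bsuppM.
have I1 : L1 area (dx (fun z => phi z * (z.1 * h (nrm2 z))) : P -> R).
  by apply: bsupp_L1; [exact: smoothG_continuous (smooth2_dx sp1)|exact: (bsupp_dx b1).1].
have I2 : L1 area (dy (fun z => phi z * (z.2 * h (nrm2 z))) : P -> R).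
  by apply: bsupp_L1; [exact: smoothG_continuous (smooth2_dy sp2)|exact: (bsupp_dx b2).2].
have E : \int[area]_z (dx (fun z => phi z * (z.1 * h (nrm2 z))) z +
                       dy (fun z => phi z * (z.2 * h (nrm2 z))) z) = 0.
  by rewrite (intD I1 I2) int_dx// int_dy// addr0.
have Lp : L1 area (fun z : P => phi z * 'D_1 H (nrm2 z)).
  apply: bsupp_L1; last exact: bsuppM.
  by apply: smoothG_continuous (smoothGM sphi (smooth2_radial (smooth1_derive sH))).
have L3 : L1 area (fun z : P => 2 * (phi z * 'D_1 H (nrm2 z))) by exact: L1Z.
rewrite -(intZ 2 Lp) -[LHS]addr0 -[in LHS](subrr (\int[area]_z (2 * (phi z * 'D_1 H (nrm2 z))))).
rewrite addrA; apply/eqP; rewrite subr_eq addNr; apply/eqP; rewrite -[RHS]E -intD//; last first.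
  apply: bsupp_L1.
    exact: (smoothG_continuous (smoothGM (smoothGD (smoothGM smooth2_fst (smooth2_dx sphi))
      (smoothGM smooth2_snd (smooth2_dy sphi))) shn)).
  have [bx by_] := bsupp_dx bphi.
  by apply: bsuppM; apply: bsuppD; [exact: bsuppMl|exact: bsuppMl].
apply: eq_int => z.
rewrite dxM// dyM// dxM//; last exact: smooth2_fst.
rewrite dyM//; last exact: smooth2_snd.
rewrite dx_radial// dy_radial// dx_fst dy_snd.
have := derive_div (nrm2 z) a0 sH H0; rewrite -/h.
set D := 'D_1 (fun s => H s / s) _ => HD.
transitivity ((z.1 * dx phi z + z.2 * dy phi z) * h (nrm2 z) +
  2 * phi z * (nrm2 z * D + h (nrm2 z))).
  by rewrite HD /h; ring.
rewrite -/D /nrm2; ring.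
Qed.

Lemma nrm2_box b z : nrm2 z <= b -> ball 0 (1 + `|b|) z.
Proof.
move=> zb; have bb := ler_norm b.
have sq x y : x ^+ 2 + y ^+ 2 <= b -> `|x| < 1 + `|b|.
  move=> xy; have b0 := normr_ge0 b; have := sqr_ge0 y.
  rewrite -real_normK ?num_real// => y0.
  have x2 : `|x| ^+ 2 = x ^+ 2 by rewrite real_normK ?num_real.
  have := normr_ge0 x; nra.
rewrite /nrm2 in zb.
by split; rewrite /ball/= sub0r normrN; [apply: sq zb|rewrite addrC in zb; apply: sq zb].
Qed.

Lemma cutbox_near1 c z : 0 <= c -> ball 0 c z ->
  nbhs z (fun w => cutbox (0 : R * R) (c + 1) c w = 1).
Proof.
move=> c0 zc; have : nbhs z (ball (0 : R * R) c) by apply: open_nbhs_nbhs; split; [exact: ball_open|].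
by apply: filterS => w wc; rewrite cutbox_eq1// ltrDl.
Qed.

Lemma near1_dx phi (c : R) z : smooth2 phi -> nbhs z (fun w => phi w = c) -> dx phi z = 0 /\ dy phi z = 0.
Proof.
move=> sphi phi1; have := @near0_dx _ (fun w => phi w - c) z.
have h : nbhs z (fun w => phi w - c = 0) by move: phi1; apply: filterS => w ->; rewrite subrr.
move=> /(_ h) /nbhs_singleton.
by rewrite dxB ?dyB ?dx_cst ?dy_cst ?subr0//; exact: smoothG_cst.
Qed.

Lemma bsupp_radial H b : (forall s, b < s -> H s = 0) -> bsupp (fun z => H (nrm2 z)).
Proof.
move=> H0; exists (1 + `|b|) => z zc; apply: H0; rewrite ltNge; apply/negP => /nrm2_box [h1 h2].
apply: zc; move: h1 h2; rewrite /ball/= !sub0r !normrN /box => h1 h2.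
by split; rewrite /= in_itv /= -ler_norml ltW.
Qed.

(** [radial_parts] tested with a cutoff equal to 1 wherever [H] and its derivative live; the
    gradient of the cutoff never meets [H]. *)
Lemma int_radial0 H a b : 0 < a -> smooth1 H -> (forall s, s < a -> H s = 0) ->
  (forall s, b < s -> H s = 0) -> \int[area]_z ('D_1 H (nrm2 z)) = 0.
Proof.
move=> a0 sH Ha Hb; have Hb' := derive_gt0 sH Hb.
pose c := 1 + `|b|; have c0 : 0 <= c by rewrite addr_ge0.
pose phi := cutbox (0 : R * R) (c + 1) c.
have sphi : smooth2 phi := smooth2_cutbox _ _ _.
have bphi : bsupp phi by apply: (@bsupp_cbox _ 0 (c + 1)) => z; apply: cutbox_eq0; rewrite ?ltrDl.
have := radial_parts sphi bphi a0 sH Ha.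
have -> : \int[area]_z ((z.1 * dx phi z + z.2 * dy phi z) * (H (nrm2 z) / nrm2 z)) = 0.
  rewrite -[RHS](int0 area).
  apply: eq_int => z; have [zb|zb] := leP (nrm2 z) b; last by rewrite Hb// mul0r mulr0.
  have [-> ->] := near1_dx sphi (cutbox_near1 c0 (nrm2_box zb)).
  by rewrite !mulr0 addr0 mul0r.
have -> : \int[area]_z (phi z * 'D_1 H (nrm2 z)) = \int[area]_z ('D_1 H (nrm2 z)).
  apply: eq_int => z; have [zb|zb] := leP (nrm2 z) b; last by rewrite Hb'// mulr0.
  by rewrite /phi (nbhs_singleton (cutbox_near1 c0 (nrm2_box zb))) mul1r.
by move=> E; lra.
Qed.

(** The variable is a squared radius. The function is a smooth indicator, equal to 1 on [2a, b] and
    supported in [a, 2b]. *)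
Definition annular a b (s : R) : R := step (s / a - 1) * (1 - step (s / b - 1)).

Lemma smooth1_annular a b : smooth1 (annular a b).
Proof.
have aff (c : R) : smooth1 (fun s : R => step (s / c - 1)).
  apply: smoothG_comp; first exact: smooth1_step.
  by apply: smoothGB; [apply: smoothGM; [exact: smooth1_id|exact: smoothG_cst]|exact: smoothG_cst].
apply: smoothGM; first exact: aff.
by apply: smoothGB; [exact: smoothG_cst|exact: aff].
Qed.

Lemma annular_ge0 a b s : 0 <= annular a b s.
Proof. by rewrite mulr_ge0 ?step_ge0// subr_ge0 step_le1. Qed.

Lemma annular_le1 a b s : annular a b s <= 1.
Proof.
have h1 := @step_le1 R (s / a - 1); have h2 := @step_le1 R (s / b - 1).
have h3 := @step_ge0 R (s / a - 1); have h4 := @step_ge0 R (s / b - 1).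
by rewrite /annular; nra.
Qed.

Lemma annular_low a b s : 0 < a -> s <= a -> annular a b s = 0.
Proof.
by move=> a0 sa; rewrite /annular step_le0 ?mul0r// subr_le0 ler_pdivrMr// mul1r.
Qed.

Lemma annular_high a b s : 0 < b -> 2 * b <= s -> annular a b s = 0.
Proof.
move=> b0 sb; rewrite /annular [X in 1 - X]step_ge1 ?subrr ?mulr0//.
by rewrite lerBrDr ler_pdivlMr//; lra.
Qed.

Lemma annular_eq1 a b s : 0 < a -> 0 < b -> 2 * a <= s <= b -> annular a b s = 1.
Proof.
move=> a0 b0 /andP[as_ sb]; rewrite /annular step_ge1 ?step_le0 ?subr0 ?mulr1//.
  by rewrite subr_le0 ler_pdivrMr// mul1r.
by rewrite lerBrDr ler_pdivlMr//; lra.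
Qed.

Section Weighted.
Variables (a b : R) (w : R -> R).
Hypotheses (a0 : 0 < a) (ab : 2 * a <= b) (sw : smooth1 (fun s => annular a b s * w s)).

Definition wprim : R -> R := primitive (fun s => annular a b s * w s).

Let gt : forall t : R, ~~ (a < t < 2 * b) -> annular a b t * w t = 0.
Proof.
move=> t; rewrite negb_and -!leNgt => /orP[ta|tb].
  by rewrite annular_low// mul0r.
rewrite annular_high ?mul0r//; have := a0; have := ab; lra.
Qed.

Lemma wprim_derive (s : R) : is_derive s 1 wprim (annular a b s * w s).
Proof. exact: (is_derive_primitive sw gt). Qed.

Lemma smooth1_wprim : smooth1 wprim.
Proof. exact: (smooth1_primitive sw gt). Qed.

Lemma wprim_low s : s <= a -> wprim s = 0.
Proof. exact: (primitive_lt gt). Qed.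

Lemma wprim_high s : 2 * b <= s -> wprim s = wprim (2 * b).
Proof.
by move=> sb; rewrite /wprim (primitive_gt gt sb) (primitive_gt gt (lexx _)).
Qed.

(** The smooth indicator lies between the sharp ones of [2a, b] and [a, 2b], so its weighted
    primitive lies between the corresponding increments of [V]. *)
Lemma wprim_bounds (V : R -> R) : (forall s : R, 0 < s -> is_derive s 1 V (w s)) ->
  (forall s, 0 < s -> 0 <= w s) ->
  V b - V (2 * a) <= wprim (2 * b) <= V (2 * b) - V a.
Proof.
move=> dV w0; have a0' := a0; have ab' := ab; apply/andP; split.
  have h1 : wprim (2 * a) - V (2 * a) <= wprim b - V b.
    apply: (@nondecreasing_derive (fun s => wprim s - V s) (fun s => annular a b s * w s - w s) _ _ ab).
      move=> t /andP[at_ tb]; have dt := wprim_derive t.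
      have dVt : is_derive t 1 V (w t) by apply: dV; lra.
      exact: is_deriveB.
    by move=> t tab; rewrite annular_eq1 ?mul1r ?subrr//; lra.
  have mono x y : a <= x -> x <= y -> wprim x <= wprim y.
    move=> ax xy; apply: (nondecreasing_derive xy (fun t _ => wprim_derive t)) => t /andP[xt _].
    by rewrite mulr_ge0 ?annular_ge0// w0//; lra.
  have h2 : wprim a <= wprim (2 * a) by apply: mono; lra.
  have h3 : wprim b <= wprim (2 * b) by apply: mono; lra.
  by rewrite (wprim_low (lexx a)) in h2; lra.
have : V a - wprim a <= V (2 * b) - wprim (2 * b).
  apply: (@nondecreasing_derive (fun s => V s - wprim s) (fun s => w s - annular a b s * w s)).
  - by lra.
  - move=> t /andP[at_ tb]; have dt := wprim_derive t.
    have dVt : is_derive t 1 V (w t) by apply: dV; lra.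
    exact: is_deriveB.
  - move=> t /andP[at_ _]; rewrite subr_ge0 ler_piMl ?annular_le1// w0//; lra.
by rewrite (wprim_low (lexx a)) subr0; lra.
Qed.

End Weighted.

Lemma L1_radial H b : smooth1 H -> (forall s, b < s -> H s = 0) ->
  L1 area (fun z : P => H (nrm2 z)).
Proof.
move=> sH H0; apply: bsupp_L1; last exact: bsupp_radial H0.
exact: smoothG_continuous (smooth2_radial sH).
Qed.

(** Since H - c G vanishes near 0 and at infinity, [int_radial0] applies to it. This leaves a single
    undetermined factor in all radial integrals. *)
Lemma int_radial_proportional H G a b (c : R) : 0 < a -> smooth1 H -> smooth1 G ->
  (forall s, s < a -> H s = 0) -> (forall s, s < a -> G s = 0) ->
  (forall s, b < s -> H s = c) -> (forall s, b < s -> G s = 1) ->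
  \int[area]_z 'D_1 H (nrm2 z) = c * \int[area]_z 'D_1 G (nrm2 z).
Proof.
move=> a0 sH sG Ha Ga Hb Gb.
have LH := L1_radial (smooth1_derive sH) (derive_gt0 sH Hb).
have LG := L1_radial (smooth1_derive sG) (derive_gt0 sG Gb).
have dK (s : R) : 'D_1 (fun s => H s - c * G s) s = 'D_1 H s - c * 'D_1 G s.
  have dH := smooth1_is_derive s sH; have dG := smooth1_is_derive s sG.
  have /@derive_val // : is_derive s 1 (fun s => H s - c * G s) ('D_1 H s - c * 'D_1 G s).
  by apply: is_derive_eq; rewrite /GRing.scale /=; ring.
have := @int_radial0 (fun s => H s - c * G s) a b a0.
rewrite (eq_int area (g := fun z : P => 'D_1 H (nrm2 z) - c * 'D_1 G (nrm2 z))); last first.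
  by move=> z; rewrite dK.
rewrite intB//; last exact: L1Z.
rewrite intZ// => E; apply/eqP; rewrite -subr_eq0; apply/eqP; apply: E.
- by apply: smoothGB => //; exact: smoothGZ.
- by move=> s sa; rewrite Ha// Ga// mulr0 subrr.
- by move=> s sb; rewrite Hb// Gb// mulr1 subrr.
Qed.

Lemma area_point (p : P) : area [set p] = 0%E.
Proof.
have -> : [set p] = [set p.1] `*` [set p.2] :> set P.
  by apply/seteqP; split => z /=; [move=> ->|case: z p => ? ? [? ?] [/= -> ->]].
apply: (etrans (product_measure1E leb leb (measurable_set1 _) (measurable_set1 _))).
apply: (etrans (congr2 mule (lebesgue_measure_set1 p.1) (lebesgue_measure_set1 p.2))).
exact: mule0.
Qed.

Lemma smooth1_expN : smooth1 (fun s : R => expR (- s)).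
Proof.
have -> : (fun s : R => expR (- s)) = fun s => expR (-1 * s).
  by apply/funext => s; rewrite mulN1r.
by apply: smoothG_comp; [exact: smooth1_expR|exact: smoothGZ smooth1_id].
Qed.

Lemma gauss_area : L1 area (fun z : P => expR (- nrm2 z)) /\
  \int[area]_z expR (- nrm2 z) = pi :> R.
Proof.
have m1 : measurable_fun setT (fun x : measurableTypeR R => (gauss_fun x)%:E).
  by apply/measurable_EFinP; exact: measurable_gauss_fun.
have E z : expR (- nrm2 z) = gauss_fun z.1 * gauss_fun z.2 :> R.
  by rewrite /gauss_fun -expRD; congr expR; rewrite /nrm2; ring.
have cg : continuous (fun z : R * R => expR (- nrm2 z)).
  exact: smoothG_continuous (smooth2_radial smooth1_expN).
have mg0 := continuous_measurable_plane cg.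
have mg : measurable_fun setT (fun z : P => (expR (- nrm2 z))%:E).
  by apply/measurable_EFinP; exact: mg0.
have I : (\int[area]_z (expR (- nrm2 z))%:E = pi%:E)%E.
  have nn (z : P) : (0 <= (expR (- nrm2 z))%:E)%E by rewrite lee_fin expR_ge0.
  apply: (etrans (fubini_tonelli1 _ mg nn)); rewrite /fubini_F /=.
  transitivity (\int[leb]_x ((gauss_fun x)%:E * (Num.sqrt pi)%:E)%E)%E.
    apply: eq_integral => x _; rewrite -integralT_gauss -ge0_integralZl//.
    - by apply: eq_integral => y _; rewrite E EFinM.
    - by move=> y _; rewrite lee_fin gauss_fun_ge0.
    - by rewrite lee_fin gauss_fun_ge0.
  rewrite ge0_integralZr// ?lee_fin ?sqrtr_ge0//; last by move=> y _; rewrite lee_fin gauss_fun_ge0.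
  by rewrite integralT_gauss -EFinM -expr2 sqr_sqrtr// pi_ge0.
split; last by rewrite /Rintegral I.
apply/integrableP; split; first exact: mg.
under eq_integral do rewrite /= ger0_norm ?expR_ge0//.
by rewrite I ltry.
Qed.

(** The substitute for polar coordinates. The factor left open by proportionality to the profile [G]
    is found with truncated Gaussians: their integrals tend to pi, their radial primitives to 1. *)
Lemma int_radial H a b (c : R) : 0 < a -> smooth1 H -> (forall s, s < a -> H s = 0) ->
  (forall s, b < s -> H s = c) -> \int[area]_z 'D_1 H (nrm2 z) = pi * c.
Proof.
pose G (s : R) := step (s - 1).
have sG : smooth1 G.
  apply: smoothG_comp; first exact: smooth1_step.
  by apply: smoothGB; [exact: smooth1_id|exact: smoothG_cst].
have Ga s : s < 1 -> G s = 0 by move=> s1; rewrite /G step_le0//; lra.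
have Gb s : 2 < s -> G s = 1 by move=> s1; rewrite /G step_ge1//; lra.
have prop K a' b' (c' : R) : 0 < a' -> smooth1 K -> (forall s, s < a' -> K s = 0) ->
    (forall s, b' < s -> K s = c') ->
    \int[area]_z 'D_1 K (nrm2 z) = c' * \int[area]_z 'D_1 G (nrm2 z).
  move=> a0 sK Ka Kb; apply: (@int_radial_proportional _ _ (Num.min a' 1) (Num.max b' 2)) => //.
  - by rewrite lt_min a0 ltr01.
  - by move=> s; rewrite lt_min => /andP[? _]; exact: Ka.
  - by move=> s; rewrite lt_min => /andP[_ ?]; exact: Ga.
  - by move=> s; rewrite gt_max => /andP[? _]; exact: Kb.
  - by move=> s; rewrite gt_max => /andP[_ ?]; exact: Gb.
move=> a0 sH Ha Hb; rewrite (prop H a b c)// mulrC; congr (_ * _).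
move: (\int[area]_z 'D_1 G (nrm2 z)) prop => c0 prop.
pose w (s : R) : R := expR (- s).
have sw : smooth1 w := smooth1_expN.
(* With index n + 2 the inner cut satisfies 2 al <= 1 and the outer one be >= 2, so the annulus has
   a plateau for every n. *)
pose al n : R := n.+2%:R^-1; pose be n : R := n.+2%:R.
have al0 n : 0 < al n by rewrite invr_gt0.
have be0 n : 0 < be n by rewrite ltr0n.
have albe n : 2 * al n <= be n.
  have h1 : al n <= 2^-1 by rewrite lef_pV2 ?posrE// ler_nat.
  have h2 : 2 <= be n by rewrite ler_nat.
  lra.
have sg n : smooth1 (fun s => annular (al n) (be n) s * w s).
  by apply: smoothGM => //; exact: smooth1_annular.
pose I n := wprim (al n) (be n) w (2 * be n).
have dV (s : R) : 0 < s -> is_derive s 1 (fun s => - w s) (w s).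
  move=> _; have dN := is_derive_affine (-1 : R) 0 s.
  rewrite /w.
  have -> : (fun s : R => - expR (- s)) = fun s => - expR (-1 * s + 0).
    by apply/funext => u; rewrite addr0 mulN1r.
  apply: is_derive_eq; rewrite /GRing.scale /= addr0 mulN1r; ring.
have IE n : \int[area]_z (annular (al n) (be n) (nrm2 z) * w (nrm2 z)) = I n * c0.
  rewrite -(prop (wprim (al n) (be n) w) (al n) (2 * be n))//.
  - apply: eq_int => z; have dW := wprim_derive (al0 n) (albe n) (sg n) (nrm2 z).
    by rewrite derive_val.
  - exact: smooth1_wprim.
  - by move=> s sa; rewrite wprim_low// ltW.
  - by move=> s sb; rewrite wprim_high// ltW.
have alc : al n @[n --> \oo] --> (0 : R).
  have -> : al = fun n => harmonic (n + 1)%N by apply/funext => n; rewrite /harmonic /al addn1.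
  by rewrite cvg_shiftn; exact: cvg_harmonic.
have bec : w (be n) @[n --> \oo] --> (0 : R).
  apply: (@squeeze_cvgr _ _ _ _ (fun=> 0) al).
  - near=> n; rewrite expR_ge0 /= /w expRN lef_pV2 ?posrE ?expR_gt0//.
    by apply: le_trans (expR_ge1Dx _); rewrite lerDr.
  - exact: cvg_cst.
  - exact: alc.
have Ic : I n @[n --> \oo] --> (1 : R).
  have bnd n := wprim_bounds (al0 n) (albe n) (sg n) dV (fun s _ => expR_ge0 (- s)).
  apply: (@squeeze_cvgr _ _ _ _ (fun n => w (2 * al n) - w (be n)) (fun=> 1)).
  - near=> n; have /andP[b1 b2] := bnd n; rewrite -/(I n) in b1 b2.
    have h1 : w (al n) <= 1 by rewrite -expR0 ler_expR oppr_le0 ltW.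
    have h2 : 0 <= w (2 * be n) by exact: expR_ge0.
    apply/andP; split; lra.
  - rewrite -[X in _ --> X]subr0; apply: cvgB => //.
    rewrite -[X in _ --> X](_ : w (2 * 0) = 1); last by rewrite /w mulr0 oppr0 expR0.
    apply: (@cvg_comp _ _ _ (fun n => 2 * al n) w).
      by apply: cvgMr; exact: alc.
    exact: (smoothG_continuous sw).
  - exact: cvg_cst.
have [Lg pig] := gauss_area.
(* The truncated Gaussians all vanish at the origin, so the pointwise limit is 0 there; one point
   does not affect the integral. *)
pose f (z : P) := if nrm2 z == 0 then 0 else expR (- nrm2 z) : R.
have [|||Lf cf] := @int_dct _ _ _ area (fun n z => annular (al n) (be n) (nrm2 z) * w (nrm2 z)) f
    (fun z : P => expR (- nrm2 z)) _ _ _ Lg.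
- move=> n; apply: continuous_measurable_plane.
  exact: smoothG_continuous (smooth2_radial (sg n)).
- move=> z; rewrite /f; case: eqP => [->|/eqP z0].
    rewrite (_ : (fun n => _) = fun=> 0); first exact: cvg_cst.
    by apply/funext => n; rewrite annular_low ?mul0r// ltW.
  have zp : 0 < nrm2 z by rewrite lt0r z0 nrm2_ge0.
  apply: cvg_near_cst; near=> n; rewrite annular_eq1 ?mul1r//.
  apply/andP; split.
    have : al n <= nrm2 z / 2; last by lra.
    near: n; apply: (cvgr_le 0); [exact: alc|by rewrite divr_gt0].
  have : nrm2 z <= n%:R; last by move=> /le_trans; apply; rewrite ler_nat leqW.
  by near: n; exact: nbhs_infty_ger.
- move=> n z; rewrite ger0_norm; last first.
    by apply: mulr_ge0; [exact: annular_ge0|exact: expR_ge0].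
  by apply: ler_piMl; [exact: expR_ge0|exact: annular_le1].
have fE : \int[area]_z f z = pi.
  rewrite -pig; apply: ae_eq_int.
  - exact: L1_measurable Lf.
  - exact: L1_measurable Lg.
  exists [set (0 : P)]; split; [|exact: area_point|].
    by apply: closed_measurable_plane; apply: compact_closed_plane; exact: compact_set1.
  move=> z /= fz; apply/eqP; apply: contrapT => /negP z0; apply: fz; rewrite /f ifN//.
  apply: contra z0; rewrite paddr_eq0 ?sqr_ge0// !sqrf_eq0 => /andP[/eqP z1 /eqP z2].
  by case: z z1 z2 => ? ? /= -> ->.
have : I n * c0 @[n --> \oo] --> 1 * c0 by apply: cvgM => //; exact: cvg_cst.
rewrite mul1r => c1.
rewrite fE in cf.
have E : (fun n => \int[area]_z (annular (al n) (be n) (nrm2 z) * w (nrm2 z))) = fun n => I n * c0.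
  by apply/funext => n; exact: IE.
rewrite E in cf.
exact: (cvg_unique (@norm_hausdorff _ _) c1 cf).
Unshelve. all: by end_near. Qed.

Lemma nrm2_near (z : R * R) r : nrm2 z < r -> nbhs z (fun w => nrm2 w < r).
Proof.
move=> zr; have c : {for z, continuous nrm2} by apply: (smoothG_continuous smooth2_nrm2).
have := c _ (lt_nbhsl zr); exact.
Qed.

(* The flux through a small circle of the field z/|z|^2. *)
Lemma int_flux phi (r c : R) : smooth2 phi -> bsupp phi -> 0 < r ->
  (forall z, nrm2 z < r -> phi z = c) ->
  \int[area]_z ((z.1 * dx phi z + z.2 * dy phi z) / nrm2 z) = - (2 * pi * c).
Proof.
move=> sphi bphi r0 phic.
(* This profile is 0 for s < r/4 and 1 for s > r/2, hence equal to 1 wherever [phi] can vary. *)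
pose H (s : R) := step (s / (r / 4) - 1).
have sH : smooth1 H.
  apply: smoothG_comp; first exact: smooth1_step.
  by apply: smoothGB; [apply: smoothGM; [exact: smooth1_id|exact: smoothG_cst]|exact: smoothG_cst].
have r4 : 0 < r / 4 by rewrite divr_gt0.
have Ha s : s < r / 4 -> H s = 0.
  by move=> sr; rewrite /H step_le0// subr_le0 ler_pdivrMr// mul1r ltW.
have Hb s : r / 2 < s -> H s = 1.
  by move=> sr; rewrite /H step_ge1// lerBrDr ler_pdivlMr//; lra.
have Hb' := derive_gt0 sH Hb.
transitivity (\int[area]_z ((z.1 * dx phi z + z.2 * dy phi z) * (H (nrm2 z) / nrm2 z))).
  apply: eq_int => z; have [zr|zr] := ltP (nrm2 z) r.
    have [-> ->] : dx phi z = 0 /\ dy phi z = 0.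
      by apply: (@near1_dx _ c) => //; move: (nrm2_near zr); apply: filterS => w; exact: phic.
    by rewrite !mulr0 addr0 !mul0r.
  by rewrite Hb ?mul1r//; lra.
rewrite (radial_parts sphi bphi r4 sH Ha); congr (- _); rewrite -mulrA; congr (_ * _).
have LH := L1_radial (smooth1_derive sH) Hb'.
transitivity (\int[area]_z (c * 'D_1 H (nrm2 z))).
  apply: eq_int => z; have [zr|zr] := ltP (nrm2 z) r; first by rewrite phic.
  by rewrite Hb' ?mulr0//; lra.
by rewrite intZ// (int_radial r4 sH Ha Hb) mulr1 mulrC.
Qed.

End Radial.

(** * The angle function of a simply connected domain *)

Section Angle.
Context {R : realType}.
Local Notation e1 := ((1, 0) : R * R).
Local Notation e2 := ((0, 1) : R * R).
Implicit Types (a b c v z : R * R).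

Definition cross a b : R := a.1 * b.2 - a.2 * b.1.

(* The oriented angle from [a] to [b] when [dot a b > 0]. *)
Definition angle a b : R := atan (cross a b / dot a b).

Lemma dotC a b : dot a b = dot b a. Proof. by rewrite /dot; ring. Qed.

Lemma lagrange_identity a b : dot a b ^+ 2 + cross a b ^+ 2 = nrm2 a * nrm2 b.
Proof. by rewrite /dot /cross /nrm2; ring. Qed.

(** By [lagrange_identity] the reference vector [a] cancels from the derivative of the arctangent,
    which leaves the form d(theta). *)
Lemma angle_line a b v (t : R) : 0 < dot a (t *: v + b) ->
  is_derive t 1 (fun h : R => angle a (h *: v + b))
    (cross (t *: v + b) v / nrm2 (t *: v + b)).
Proof.
set q := t *: v + b => d0.
have dn : is_derive t 1 (fun h : R => cross a v * h + cross a b) (cross a v) by exact: is_derive_affine.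
have dd : is_derive t 1 (fun h : R => dot a v * h + dot a b) (dot a v) by exact: is_derive_affine.
have En h : cross a (h *: v + b) = cross a v * h + cross a b.
  by rewrite /cross /= /GRing.scale /=; ring.
have Ed h : dot a (h *: v + b) = dot a v * h + dot a b.
  by rewrite /dot /= /GRing.scale /=; ring.
have d0' : dot a v * t + dot a b != 0 by rewrite -Ed gt_eqF.
have di := is_derive_inv d0'.
have di' : is_derive t 1 (fun h : R => (dot a v * h + dot a b)^-1)
    (- (dot a v * t + dot a b) ^- 2 * dot a v).
  exact: (is_derive_comp_dir dd di).
have dm : is_derive t 1 (fun h : R => (cross a v * h + cross a b) * (dot a v * h + dot a b)^-1) _ :=
  is_deriveM dn di'.
have da := is_derive_comp_dir dm (is_derive1_atan _).
have -> : (fun h : R => angle a (h *: v + b)) = atan \o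
    (fun h => (cross a v * h + cross a b) * (dot a v * h + dot a b)^-1).
  by apply/funext => h /=; rewrite /angle En Ed.
apply: is_derive_eq da _; rewrite /GRing.scale /= -En -Ed -/q.
have d0n : dot a q != 0 by rewrite gt_eqF.
have L := lagrange_identity a q.
have n0 : nrm2 a * nrm2 q != 0 by rewrite -L gt_eqF// ltr_pwDl ?exprn_gt0 ?sqr_ge0.
have := n0; rewrite mulf_eq0 negb_or => /andP[na nq].
have C : cross a v * dot a q - cross a q * dot a v = nrm2 a * cross q v.
  by rewrite /cross /dot /nrm2; ring.
transitivity ((cross a v * dot a q - cross a q * dot a v) / (dot a q ^+ 2 + cross a q ^+ 2)).
  rewrite -L in n0; move: (dot a q) (cross a q) (dot a v) (cross a v) d0n n0 => D X D' X' D0 n0'.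
  by field; rewrite D0 n0'.
rewrite C L; move: (nrm2 a) (nrm2 q) (cross q v) na nq => A Q X A0 Q0.
by field; rewrite A0 Q0.
Qed.

(** Along the segment from [b] to [c] the angles measured from [a] and from [b] have the same
    derivative; half-planes are convex, so both stay defined. *)
Lemma angle_add a b c : 0 < dot a b -> 0 < dot a c -> 0 < dot b c ->
  angle a c = angle a b + angle b c.
Proof.
move=> ab ac bc.
have bb : 0 < dot b b.
  rewrite lt0r; apply/andP; split; last by rewrite /dot addr_ge0// -expr2 sqr_ge0.
  apply: contraTneq bc; rewrite /dot => b0.
  have : b.1 ^+ 2 + b.2 ^+ 2 == 0 by rewrite !expr2 b0.
  rewrite paddr_eq0 ?sqr_ge0// !sqrf_eq0 => /andP[/eqP -> /eqP ->].
  by rewrite !mul0r addr0 ltxx.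
pose q t := t *: (c - b) + b.
have Hq d t : 0 < dot d b -> 0 < dot d c -> 0 <= t <= 1 -> 0 < dot d (q t).
  move=> db dc /andP[t0 t1].
  have -> : dot d (q t) = (1 - t) * dot d b + t * dot d c.
    by rewrite /dot /q /= /GRing.scale /=; ring.
  have [->|t0'] := eqVneq t 0; first by lra.
  have tp : 0 < t by rewrite lt0r t0'.
  by rewrite ltr_wpDl// ?mulr_gt0// mulr_ge0 ?subr_ge0// ltW.
pose f t := angle a (q t) - angle b (q t).
have df (t : R) : Num.min 0 1 <= t <= Num.max 0 1 -> is_derive t 1 f 0.
  rewrite (min_idPl _) ?(max_idPr _) ?ler01// => t01.
  have d1 := angle_line (Hq _ _ ab ac t01); have d2 := angle_line (Hq _ _ bb bc t01).
  by apply: is_derive_eq; rewrite subrr.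
have := le_MVT df (M := 0); rewrite mul0r => /(_ _) H.
have : `|f 1 - f 0| <= 0 by apply: H => t _; rewrite normr0.
rewrite normr_le0 subr_eq0 => /eqP; rewrite /f /q scale1r scale0r subrK add0r.
have -> : angle b b = 0 by rewrite /angle /cross [X in X - _]mulrC subrr mul0r atan0.
by move=> E; lra.
Qed.

Lemma angle0 a : angle a a = 0.
Proof. by rewrite /angle /cross [X in X - _]mulrC subrr mul0r atan0. Qed.

Lemma dot_gt0_near c : c != 0 -> exists2 e : R, 0 < e &
  forall a b, ball c e a -> ball c e b -> 0 < dot a b.
Proof.
move=> c0; pose S := nrm2 c.
have S0 : 0 < S := nrm2_gt0 c0.
pose B := `|c.1| + `|c.2| + 1.
have B0 : 0 < B by rewrite ltr_wpDl ?addr_ge0.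
(* The inner product of two vectors within [e] of [c] exceeds S - 2 e B, and this choice makes 2 e B
   at most S/2. *)
pose e := Num.min 1 (S / (4 * B)).
have e0 : 0 < e by rewrite lt_min ltr01 divr_gt0// mulr_gt0.
have e1' : e <= 1 by rewrite ge_min lexx.
have eB : e * B <= S / 4.
  have : e <= S / (4 * B) by rewrite ge_min lexx orbT.
  by rewrite ler_pdivlMr ?mulr_gt0// => h; lra.
exists e => // a b [a1 a2] [b1 b2]; rewrite /dot.
have bnd (x y w : R) : `|x - y| < e -> `|x - w| < e -> x ^+ 2 - 2 * e * `|x| - e ^+ 2 < y * w.
  move=> xy xw.
  have -> : y * w = x ^+ 2 - x * ((x - y) + (x - w)) + (x - y) * (x - w) by ring.
  have h1 : x * ((x - y) + (x - w)) <= `|x| * (2 * e).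
    apply: le_trans (ler_norm _) _; rewrite normrM ler_wpM2l//.
    by apply: le_trans (ler_normD _ _) _; lra.
  have h2 : - e ^+ 2 < (x - y) * (x - w).
    have : `|(x - y) * (x - w)| < e ^+ 2 by rewrite normrM expr2 ltr_pM.
    by rewrite ltr_norml => /andP[].
  lra.
have h1 := bnd _ _ _ a1 b1; have h2 := bnd _ _ _ a2 b2.
have ee : e ^+ 2 <= e by rewrite expr2 ler_piMl// ltW.
rewrite /S /nrm2 in eB S0; rewrite /B in eB; nra.
Qed.

Lemma unit_squareP z : unit_square z <-> 0 <= z.1 <= 1 /\ 0 <= z.2 <= 1.
Proof. by rewrite /unit_square; split => -[] /=; rewrite !in_itv. Qed.

Lemma unit_square_compact : compact (unit_square : set (R * R)).
Proof. by apply: compact_setX; exact: segment_compact. Qed.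

Lemma dot_gt0_uniform (G : R * R -> R * R) : {within unit_square, continuous G} ->
  (forall z, unit_square z -> G z != 0) ->
  exists2 e : R, 0 < e & forall x y, unit_square x -> unit_square y -> ball x e y ->
    0 < dot (G x) (G y).
Proof.
move=> cG G0.
have /compact_near_coveringP/(_ R 0^'+ (fun e x => forall y, unit_square x -> unit_square y ->
  ball x e y -> 0 < dot (G x) (G y)) _) := unit_square_compact.
move=> H; have [|e /= e0 He] := H.
  move=> x Kx; have [e e0 He] := dot_gt0_near (G0 x Kx).
  have /subspace_continuousP/(_ x Kx) cx := cG.
  have /cx : nbhs (G x) (ball (G x) e) by exact: nbhsx_ballx.
  move=> /nbhs_ballP [r /= r0 Hr].
  exists (ball x (r / 2), [set d | 0 < d < r / 2]) => /=.
    split; first by apply: nbhsx_ballx; rewrite divr_gt0.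
    by near=> d; apply/andP; split; near: d; [exact: nbhs_right_gt|apply: nbhs_right_lt; rewrite divr_gt0].
  move=> [u d] [/= xu /andP[d0 dr]] y Ku Ky uy; apply: He.
    by apply: Hr => //; apply: le_ball xu; lra.
  apply: Hr => //; have := ball_triangle xu uy; apply: le_ball; lra.
exists (e / 2); first by rewrite divr_gt0.
move=> x y Kx Ky; apply: He => //=; last by rewrite divr_gt0.
by rewrite sub0r normrN gtr0_norm ?divr_gt0//; lra.
Unshelve. all: by end_near. Qed.

(** The argument of G at x is obtained along the segment from the origin to x, cut into n pieces so
    short that consecutive values make acute angles. When x moves to a nearby y, going round each
    small quadrilateral shows that the sum changes by a telescoping amount. *)
Lemma lift_square (G : R * R -> R * R) : {within unit_square, continuous G} ->
  (forall z, unit_square z -> G z != 0) ->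
  exists (Theta : R * R -> R) (e : R), 0 < e /\
    forall x y, unit_square x -> unit_square y -> ball x e y ->
      Theta y - Theta x = angle (G x) (G y).
Proof.
move=> cG G0; have [r r0 Hr] := dot_gt0_uniform cG G0.
(* This gives 1/n < r/2: consecutive samples differ by less than r/2, and passing from x to y costs
   less than another r/2. *)
pose n := (Num.trunc (2 / r)).+1.
have n0 : 0 < n%:R :> R by rewrite ltr0n.
have nr : n%:R^-1 < r / 2.
  rewrite invf_plt ?posrE ?divr_gt0// invf_div; exact: truncnS_gt.
pose Gk k x := G ((k%:R / n%:R) *: x).
have k01 k : (k <= n)%N -> 0 <= (k%:R / n%:R : R) <= 1.
  by move=> kn; rewrite divr_ge0//= ler_pdivrMr// mul1r ler_nat.
have Ksc k (x : R * R) : (k <= n)%N -> unit_square x -> unit_square ((k%:R / n%:R) *: x).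
  move=> /k01 /andP[s0 s1] /unit_squareP[/andP[x0 x1] /andP[y0 y1]].
  by apply/unit_squareP; split; apply/andP; split; rewrite /GRing.scale /= ?mulr_ge0// mulr_ile1.
exists (fun x => \sum_(0 <= k < n) angle (Gk k x) (Gk k.+1 x)), (r / 2).
split; first by rewrite divr_gt0.
move=> x y Kx Ky xy; rewrite -sumrB.
have coord (k j : nat) (u w : R) : (k <= n)%N -> (j <= n)%N -> (k <= j.+1)%N -> (j <= k.+1)%N ->
    0 <= u <= 1 -> 0 <= w <= 1 -> `|u - w| < r / 2 ->
    `|k%:R / n%:R * u - j%:R / n%:R * w| < r.
  move=> kn jn kj jk u01 w01 uw.
  have -> : k%:R / n%:R * u - j%:R / n%:R * w = k%:R / n%:R * (u - w) + (k%:R - j%:R) / n%:R * w by ring.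
  have h1 : `|k%:R / n%:R * (u - w)| < r / 2.
    have /andP[s0 s1] := k01 k kn; rewrite normrM ger0_norm//.
    by apply: le_lt_trans uw; rewrite ler_piMl.
  have h2 : `|(k%:R - j%:R) / n%:R * w| < r / 2.
    rewrite !normrM normfV [ `|n%:R| ]ger0_norm ?ler0n// -mulrA.
    apply: le_lt_trans nr.
    have w1 : `|w| <= 1 by rewrite ger0_norm; case/andP: w01.
    have kj1 : `|k%:R - j%:R| <= 1 :> R.
      have k1 : k%:R <= j.+1%:R :> R by rewrite ler_nat.
      have k2 : j%:R <= k.+1%:R :> R by rewrite ler_nat.
      by rewrite -!natr1 in k1 k2; rewrite ler_norml; apply/andP; split; lra.
    apply: (@le_trans _ _ (1 * (n%:R^-1 * 1))); last by rewrite mul1r mulr1.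
    have ni : 0 <= n%:R^-1 :> R by rewrite invr_ge0 ltW.
    by apply: ler_pM => //; rewrite ler_wpM2l.
  by apply: le_lt_trans (ler_normD _ _) _; lra.
have pos k j u w : (k <= n)%N -> (j <= n)%N -> (k <= j.+1)%N -> (j <= k.+1)%N ->
    unit_square u -> unit_square w -> ball u (r / 2) w -> 0 < dot (Gk k u) (Gk j w).
  move=> kn jn kj jk Ku Kw [uw1 uw2]; apply: Hr; [exact: Ksc|exact: Ksc|].
  have /unit_squareP[u1 u2] := Ku; have /unit_squareP[w1 w2] := Kw.
  by split; rewrite /ball /= /GRing.scale /=; apply: coord.
have r2 : 0 < r / 2 by rewrite divr_gt0.
have step_eq k : (0 <= k < n)%N -> angle (Gk k y) (Gk k.+1 y) - angle (Gk k x) (Gk k.+1 x) =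
    angle (Gk k.+1 x) (Gk k.+1 y) - angle (Gk k x) (Gk k y).
  move=> /andP[_ kn]; have kn' := ltnW kn.
  have yx : ball y (r / 2) x by exact: ball_sym.
  have A1 := angle_add (pos k k x y kn' kn' (leqnSn _) (leqnSn _) Kx Ky xy)
    (pos k k.+1 x y kn' kn (leqW (leqnSn _)) (leqnn _) Kx Ky xy)
    (pos k k.+1 y y kn' kn (leqW (leqnSn _)) (leqnn _) Ky Ky (ballxx _ r2)).
  have A2 := angle_add (pos k k.+1 x x kn' kn (leqW (leqnSn _)) (leqnn _) Kx Kx (ballxx _ r2))
    (pos k k.+1 x y kn' kn (leqW (leqnSn _)) (leqnn _) Kx Ky xy)
    (pos k.+1 k.+1 x y kn kn (leqnSn _) (leqnSn _) Kx Ky xy).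
  by rewrite A1 in A2; lra.
rewrite (eq_big_nat _ _ step_eq) telescope_sumr//.
by rewrite /Gk divff ?gt_eqF// !scale1r mul0r !scale0r angle0 subr0.
Qed.

Lemma chain_const (f : R -> R) (e : R) : 0 < e ->
  (forall s t, 0 <= s <= 1 -> 0 <= t <= 1 -> `|s - t| < e -> f s = f t) -> f 0 = f 1.
Proof.
move=> e0 Hf.
pose n := (Num.trunc (1 / e)).+1.
have n0 : 0 < n%:R :> R by rewrite ltr0n.
have ne : n%:R^-1 < e by rewrite invf_plt ?posrE// -[e^-1]mul1r; exact: truncnS_gt.
have k01 k : (k <= n)%N -> 0 <= (k%:R / n%:R : R) <= 1.
  by move=> kn; rewrite divr_ge0//= ler_pdivrMr// mul1r ler_nat.
have H k : (k <= n)%N -> f 0 = f (k%:R / n%:R).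
  elim: k => [|k IH] kn; first by rewrite mul0r.
  rewrite IH ?(ltnW kn)//; apply: Hf; [exact/k01/ltnW|exact: k01|].
  by rewrite -mulrBl -natr1 opprD addrA subrr sub0r mulN1r normrN ger0_norm.
by rewrite (H n (leqnn n)) divff// gt_eqF.
Qed.

(** A continuous argument described by its increments over uniformly short times; no exponential and
    no continuity of [L] need be mentioned. *)
Definition is_lift (g : R -> R * R) (L : R -> R) := exists2 e : R, 0 < e &
  forall s t, 0 <= s <= 1 -> 0 <= t <= 1 -> `|s - t| < e -> L t - L s = angle (g s) (g t).

Lemma lift_unique g L L' : is_lift g L -> is_lift g L' -> L 1 - L 0 = L' 1 - L' 0.
Proof.
move=> [e e0 He] [e' e'0 He'].
suff : L 0 - L' 0 = L 1 - L' 1 by move=> ?; lra.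
apply: (@chain_const (fun t => L t - L' t) (Num.min e e')); first by rewrite lt_min e0.
move=> s t s01 t01; rewrite lt_min => /andP[h h'].
by have := He s t s01 t01 h; have := He' s t s01 t01 h'; move=> ? ?; lra.
Qed.

(** The other three sides of the homotopy square are constant at [g 0], so the argument lifted to
    the square is constant along them and has equal values at the two ends of the loop. *)
Lemma lift_loop (g : R -> R * R) (H : R * R -> R * R) : {within unit_square, continuous H} ->
  (forall z, unit_square z -> H z != 0) ->
  (forall t, 0 <= t <= 1 -> H (t, 0) = g t /\ H (t, 1) = g 0) ->
  (forall s, 0 <= s <= 1 -> H (0, s) = g 0 /\ H (1, s) = g 0) ->
  exists2 L, is_lift g L & L 0 = L 1.
Proof.
move=> cH H0 Hh Hv; have [T [e [e0 HT]]] := lift_square cH H0.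
have i0 : 0 <= (0 : R) <= 1 by rewrite lexx ler01.
have i1 : 0 <= (1 : R) <= 1 by rewrite lexx ler01.
have sq (s t : R) : 0 <= s <= 1 -> 0 <= t <= 1 -> unit_square (s, t) by move=> s01 t01; apply/unit_squareP; split.
exists (fun t => T (t, 0)).
  exists e => // s t s01 t01 st; rewrite HT; [|exact: sq|exact: sq|by split => //; apply: ballxx].
  by rewrite (Hh s s01).1 (Hh t t01).1.
have c1 : T (0, 0) = T (0, 1).
  apply: (@chain_const (fun s => T (0, s)) e e0) => s t s01 t01 st.
  apply/esym/eqP; rewrite -subr_eq0 HT; [|exact: sq|exact: sq|by split => //; apply: ballxx].
  by rewrite (Hv s s01).1 (Hv t t01).1 angle0.
have c2 : T (0, 1) = T (1, 1).
  apply: (@chain_const (fun s => T (s, 1)) e e0) => s t s01 t01 st.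
  apply/esym/eqP; rewrite -subr_eq0 HT; [|exact: sq|exact: sq|by split => //; apply: ballxx].
  by rewrite (Hh s s01).2 (Hh t t01).2 angle0.
have c3 : T (1, 0) = T (1, 1).
  apply: (@chain_const (fun s => T (1, s)) e e0) => s t s01 t01 st.
  apply/esym/eqP; rewrite -subr_eq0 HT; [|exact: sq|exact: sq|by split => //; apply: ballxx].
  by rewrite (Hv s s01).2 (Hv t t01).2 angle0.
by rewrite c1 c2 -c3.
Qed.

Lemma lift_path (g : R -> R * R) : {within `[0, 1]%classic, continuous g} ->
  (forall t, 0 <= t <= 1 -> g t != 0) -> exists L, is_lift g L.
Proof.
move=> cg g0.
have cG : {within unit_square, continuous (fun z : R * R => g z.1)}.
  apply/subspace_continuousP => z /[dup] Kz /unit_squareP[z1 z2].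
  have /subspace_continuousP/(_ z.1 _) cz := cg.
  have z1' : `[0, 1]%classic z.1 by rewrite /= in_itv.
  move=> A /(cz z1') /nbhs_ballP[r /= r0 Hr].
  apply/nbhs_ballP; exists r => //= w [w1 _] /unit_squareP[w01 _].
  by apply: Hr => //=; rewrite in_itv.
have [|T [e [e0 HT]]] := lift_square cG; first by move=> z /unit_squareP[z1 _]; exact: g0.
have i0 : 0 <= (0 : R) <= 1 by rewrite lexx ler01.
exists (fun t => T (t, 0)), e => // s t s01 t01 st.
by apply: HT; [apply/unit_squareP; split|apply/unit_squareP; split|split => //; exact: ballxx].
Qed.

Definition clamp (t : R) : R := Num.max 0 (Num.min t 1).

Lemma clamp01 t : 0 <= clamp t <= 1.
Proof. by rewrite /clamp le_max lexx /= ge_max ler01 ge_min lexx orbT. Qed.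

Lemma clamp_id t : 0 <= t <= 1 -> clamp t = t.
Proof. by move=> /andP[t0 t1]; rewrite /clamp (min_idPl t1) (max_idPr t0). Qed.

Lemma clamp_le0 t : t <= 0 -> clamp t = 0.
Proof. by move=> t0; rewrite /clamp (min_idPl _) ?(max_idPl t0)// (le_trans t0). Qed.

Lemma clamp_ge1 t : 1 <= t -> clamp t = 1.
Proof. by move=> t1; rewrite /clamp (min_idPr t1) (max_idPr ler01). Qed.

Lemma clamp_dist s t : `|clamp s - clamp t| <= `|s - t|.
Proof.
have h1 := ler_norm (s - t); have h2 := ler_norm (t - s); rewrite distrC in h2.
rewrite ler_norml /clamp /Num.max /Num.min.
by case: (ltP s 1) => ?; case: (ltP t 1) => ?; do 2 ! case: ltP => ?; apply/andP; split; lra.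
Qed.

Lemma clamp_continuous (g : R -> R * R) (c d : R) : {within `[0, 1]%classic, continuous g} ->
  continuous (fun t => g (clamp (c * t + d))).
Proof.
move=> cg t.
have /subspace_continuousP/(_ (clamp (c * t + d)) _) cz := cg.
have tt : `[0, 1]%classic (clamp (c * t + d)) by rewrite /= in_itv; exact: clamp01.
move=> A /(cz tt) /nbhs_ballP[r /= r0 Hr].
apply/nbhs_ballP; have c0 : 0 < `|c| + 1 by rewrite ltr_wpDl.
exists (r / (`|c| + 1)) => /=; first by rewrite divr_gt0.
move=> u; rewrite /ball /= => tu; apply: Hr; last by rewrite /= in_itv; exact: clamp01.
rewrite /ball /=; apply: le_lt_trans (clamp_dist _ _) _.
have -> : c * t + d - (c * u + d) = c * (t - u) by ring.
rewrite normrM; rewrite ltr_pdivlMr// in tu; apply: le_lt_trans tu.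
by rewrite mulrC ler_wpM2l// lerDl.
Qed.

Section AngleFunction.
Variables (D : set (R * R)) (p : R * R).
Hypotheses (oD : open D) (scD : simply_connected D) (nDp : ~ D p).

Let neq z : D z -> z - p != 0.
Proof. by move=> Dz; rewrite subr_eq0; apply: contra_notN nDp => /eqP <-. Qed.

Lemma angle_loop (g : R -> R * R) : {within `[0, 1]%classic, continuous g} ->
  (forall t, 0 <= t <= 1 -> D (g t)) -> g 0 = g 1 ->
  exists2 L, is_lift (fun t => g t - p) L & L 0 = L 1.
Proof.
move=> cg Dg g01.
have gD : g @` `[0, 1]%classic `<=` D by move=> _ [t /= + <-]; rewrite in_itv /=; exact: Dg.
have [H [cH HD Hh Hv]] := scD.2 g cg gD g01.
apply: (@lift_loop _ (fun z => H z - p)).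
- by move=> z; apply: cvgB; [exact: cH|exact: cvg_cst].
- by move=> z Kz; apply/neq/HD; exists z.
- by move=> t t01; have := Hh t; rewrite in_itv /= => /(_ t01)[-> ->].
- by move=> t t01; have := Hv t; rewrite in_itv /= => /(_ t01)[-> ->].
Qed.

(** The value at z is the total angle along some chosen path from [p0]. For z near z0, the path to
    z0, the segment to z and the reversed path of z form a loop; it is null-homotopic away from [p],
    so its total angle is 0 and the two values differ by the angle of the segment. *)
Lemma angle_function : exists theta : R * R -> R, forall z0, D z0 ->
  exists2 r : R, 0 < r & forall z, ball z0 r z ->
    theta z = theta z0 + angle (z0 - p) (z - p).
Proof.
have [[p0 Dp0]|Dn] := pselect (exists p0, D p0); last first.
  by exists (fun=> 0) => z Dz; case: Dn; exists z.
have : forall z, exists gL : (R -> R * R) * (R -> R), D z ->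
    [/\ {within `[0, 1]%classic, continuous gL.1}, forall t, 0 <= t <= 1 -> D (gL.1 t),
      gL.1 0 = p0, gL.1 1 = z & is_lift (fun t => gL.1 t - p) gL.2].
  move=> z; have [Dz|nDz] := pselect (D z); last by exists (fun=> 0, fun=> 0).
  have [g [cg gD g0 g1]] := scD.1 p0 z Dp0 Dz.
  have gD' t : 0 <= t <= 1 -> D (g t) by move=> t01; apply: gD; exists t => //=; rewrite in_itv.
  have [||L HL] := @lift_path (fun t => g t - p).
  - by move=> t; apply: cvgB; [exact: cg|exact: cvg_cst].
  - by move=> t t01; exact/neq/gD'.
  by exists (g, L).
move=> /choice[gL HgL].
exists (fun z => (gL z).2 1 - (gL z).2 0) => z0 Dz0.
have [e e0 He] := dot_gt0_near (neq Dz0).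
have /nbhs_ballP[r /= r0 Hr] : nbhs z0 D by apply: open_nbhs_nbhs.
exists (Num.min e r); first by rewrite lt_min e0.
move=> z zr.
have zD w : ball z0 (Num.min e r) w -> D w.
  by move=> /le_ball h; apply: Hr; apply: h; rewrite ge_min lexx orbT.
have He' a b : ball z0 (Num.min e r) a -> ball z0 (Num.min e r) b -> 0 < dot (a - p) (b - p).
  move=> /(@le_ball _ _ _ _ e) h /(@le_ball _ _ _ _ e) h'.
  have le : Num.min e r <= e by rewrite ge_min lexx.
  by apply: He; [have [] := h le|have [] := h' le]; rewrite /ball /= => ? ?; split;
    rewrite /ball /= opprB addrA subrK.
have Dz := zD z zr.
have [c0 D0 s0 t0 L0] := HgL z0 Dz0; have [c1 D1 s1 t1 L1] := HgL z Dz.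
set g0 := (gL z0).1 in c0 D0 s0 t0 L0 *; set g1 := (gL z).1 in c1 D1 s1 t1 L1 *.
pose seg t := t *: (z - z0) + z0.
have segB t : 0 <= t <= 1 -> ball z0 (Num.min e r) (seg t).
  move=> /andP[tt0 tt1]; have [z1 z2] := zr.
  have E (x y : R) : `|x - (t * (y - x) + x)| <= `|x - y|.
    have -> : x - (t * (y - x) + x) = t * (x - y) by ring.
    by rewrite normrM ger0_norm// ler_piMl.
  by split; [exact: le_lt_trans (E _ _) z1|exact: le_lt_trans (E _ _) z2].
(* The three pieces of the loop are summed rather than juxtaposed: outside
   its own third of [0, 1] each piece is constant. *)
pose g t := g0 (clamp (3 * t + 0)) + (seg (clamp (3 * t + (-1))) - z0) + (g1 (clamp ((-3) * t + 3)) - z).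
have gA t : 0 <= t <= 1 -> g (t / 3) = g0 t.
  move=> /andP[tt0 tt1]; rewrite /g.
  rewrite [clamp (3 * _ + 0)](_ : _ = t); last by rewrite clamp_id; lra.
  rewrite [clamp (3 * _ + (-1))]clamp_le0; last by lra.
  rewrite [clamp (-3 * _ + 3)]clamp_ge1; last by lra.
  by rewrite /seg scale0r add0r subrr addr0 t1 subrr addr0.
have gB t : 0 <= t <= 1 -> g ((1 + t) / 3) = seg t.
  move=> /andP[tt0 tt1]; rewrite /g.
  rewrite [clamp (3 * _ + 0)]clamp_ge1; last by lra.
  rewrite [clamp (3 * _ + (-1))](_ : _ = t); last by rewrite clamp_id; lra.
  rewrite [clamp (-3 * _ + 3)]clamp_ge1; last by lra.
  by rewrite t0 t1 subrr addr0 addrC subrK.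
have gC t : 0 <= t <= 1 -> g (1 - t / 3) = g1 t.
  move=> /andP[tt0 tt1]; rewrite /g.
  rewrite [clamp (3 * _ + 0)]clamp_ge1; last by lra.
  rewrite [clamp (3 * _ + (-1))]clamp_ge1; last by lra.
  rewrite [clamp (-3 * _ + 3)](_ : _ = t); last by rewrite clamp_id; lra.
  by rewrite t0 /seg scale1r addrK [z0 + _]addrC subrK addrC subrK.
have i0 : 0 <= (0 : R) <= 1 by rewrite lexx ler01.
have i1 : 0 <= (1 : R) <= 1 by rewrite lexx ler01.
have g00 : g 0 = p0 by rewrite -[X in g X](mul0r 3^-1) gA.
have g11 : g 1 = p0 by rewrite -[X in g X](subr0 1) -[X in _ - X](mul0r 3^-1) gC.
have cg : {within `[0, 1]%classic, continuous g}.
  have cs : {within `[0, 1]%classic, continuous seg}.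
    apply: continuous_subspaceT => u; apply: cvgD; last exact: cvg_cst.
    by apply: cvgZr_tmp; exact: cvg_id.
  have H0 : continuous (fun t : R => g0 (clamp (3 * t + 0))) := clamp_continuous c0.
  have H1 : continuous (fun t : R => seg (clamp (3 * t + (-1)))) := clamp_continuous cs.
  have H2 : continuous (fun t : R => g1 (clamp ((-3) * t + 3))) := clamp_continuous c1.
  apply: continuous_subspaceT => t.
  exact: (cvgD (cvgD (H0 t) (cvgB (H1 t) (cvg_cst _))) (cvgB (H2 t) (cvg_cst _))).
have Dg t : 0 <= t <= 1 -> D (g t).
  move=> /andP[tt0 tt1]; have [t3|t3] := leP t 3^-1.
    have -> : t = (3 * t) / 3 by field.
    have h : 0 <= 3 * t <= 1 by lra.
    by rewrite gA//; exact: D0.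
  have [t3'|t3'] := leP t (2 / 3).
    have -> : t = (1 + (3 * t - 1)) / 3 by field.
    have h : 0 <= 3 * t - 1 <= 1 by lra.
    by rewrite gB//; apply/zD/segB.
  have -> : t = 1 - (3 - 3 * t) / 3 by field.
  have h : 0 <= 3 - 3 * t <= 1 by lra.
  by rewrite gC//; exact: D1.
have [|L [eL eL0 HL] L01] := angle_loop cg Dg; first by rewrite g00 g11.
(* Restricted to one third of the loop, the lift is a lift of that piece, and [lift_unique] then
   computes its increment. *)
have sub (f : R -> R) (h : R -> R * R) : (forall s t, `|f s - f t| <= `|s - t|) ->
    (forall t, 0 <= t <= 1 -> 0 <= f t <= 1 /\ g (f t) = h t) ->
    is_lift (fun t => h t - p) (fun t => L (f t)).
  move=> fd fg; exists eL => // s t s01 t01 st.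
  have [fs hs] := fg s s01; have [ft ht] := fg t t01.
  by rewrite HL// ?hs ?ht//; exact: le_lt_trans (fd _ _) st.
have E0 : L (1 / 3) - L (0 / 3) = (gL z0).2 1 - (gL z0).2 0.
  apply: (@lift_unique _ (fun t => L (t / 3)) _ _ L0); apply: sub.
    by move=> s t; rewrite -mulrBl normrM [ `|3^-1| ]ger0_norm ?ler_piMr//; lra.
  by move=> t t01; split; [lra|exact: gA].
have E1 : L (1 - 1 / 3) - L (1 - 0 / 3) = (gL z).2 1 - (gL z).2 0.
  apply: (@lift_unique _ (fun t => L (1 - t / 3)) _ _ L1); apply: sub.
    move=> s t; have -> : 1 - s / 3 - (1 - t / 3) = - ((s - t) / 3) by ring.
    by rewrite normrN normrM [ `|3^-1| ]ger0_norm ?ler_piMr//; lra.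
  by move=> t t01; split; [lra|exact: gC].
have E2 : L ((1 + 1) / 3) - L ((1 + 0) / 3) = angle (z0 - p) (seg 1 - p) - angle (z0 - p) (seg 0 - p).
  apply: (@lift_unique (fun t => seg t - p) (fun t => L ((1 + t) / 3)) (fun t => angle (z0 - p) (seg t - p))).
    apply: sub.
      move=> s t; have -> : (1 + s) / 3 - ((1 + t) / 3) = (s - t) / 3 by ring.
      by rewrite normrM [ `|3^-1| ]ger0_norm ?ler_piMr//; lra.
    by move=> t t01; split; [lra|exact: gB].
  have m0 : 0 < Num.min e r by rewrite lt_min e0.
  exists 1; first exact: ltr01.
  move=> s t s01 t01 _.
  have A := angle_add (He' _ _ (ballxx z0 m0) (segB s s01)) (He' _ _ (ballxx z0 m0) (segB t t01))
    (He' _ _ (segB s s01) (segB t t01)).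
  by rewrite A addrAC subrr add0r.
rewrite /seg scale1r scale0r add0r angle0 subrK subr0 in E2.
rewrite -E0 -E1.
have -> : 1 - 1 / 3 = (1 + 1) / 3 :> R by field.
rewrite !mul0r subr0 addr0 in E0 E1 E2 *; lra.
Qed.

End AngleFunction.
End Angle.

(** * Orthogonality to divergence-free test fields *)

Section Stream.
Context {R : realType}.
Local Notation leb := (@lebesgue_measure R).
Local Notation area := (@lebesgue_measure R \x @lebesgue_measure R)%E.
Local Notation P := (measurableTypeR R * measurableTypeR R)%type.
Local Notation e1 := ((1, 0) : R * R).
Local Notation e2 := ((0, 1) : R * R).
Implicit Types (f g : R * R -> R) (z w : R * R).

Lemma nrm2_ball p (r : R) : 0 < r -> exists2 e : R, 0 < e & forall z : R * R, nrm2 (z - p) < e -> ball p r z.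
Proof.
move=> r0; exists (r ^+ 2); first by rewrite exprn_gt0.
have H (x y : R) : x ^+ 2 + y ^+ 2 < r ^+ 2 -> `|x| < r.
  move=> h; rewrite -(ltr_pXn2r (n := 2))// ?nnegrE ?ltW// real_normK ?num_real//.
  by apply: le_lt_trans h; rewrite lerDl sqr_ge0.
move=> z h; rewrite /nrm2 /= in h; split; rewrite /ball /= distrC.
  exact: H h.
by rewrite addrC in h; exact: H h.
Qed.

Section Pole.
Variables (D : set (R * R)) (p : R * R).
Hypothesis nDp : ~ D p.

(** Together with [pole2] this is the gradient of the angle about [p]. *)
Definition pole1 z : R := - (z.2 - p.2) / nrm2 (z - p).
Definition pole2 z : R := (z.1 - p.1) / nrm2 (z - p).

(** A test function of [D] vanishes near the outer point [p], so the singular factor can be replaced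
    by one that is smooth on the plane. *)
Lemma test_fun_pole f (c : R * R -> R) : test_fun D f -> smooth2 c ->
  test_fun D (fun z => f z * (c z / nrm2 (z - p))).
Proof.
move=> tf sc; have [_ _ /(_ p nDp) /nbhs_ballP[r0 /= r00 Hr0]] := (test_funP _ _).1 tf.
have [r r_gt0 Hr] := nrm2_ball p r00.
pose H (s : R) := step (s / (r / 2) - 1).
have r2 : 0 < r / 2 by rewrite divr_gt0.
have sH : smooth1 H.
  apply: smoothG_comp; first exact: smooth1_step.
  by apply: smoothGB; [apply: smoothGM; [exact: smooth1_id|exact: smoothG_cst]|exact: smoothG_cst].
have Ha s : s < r / 2 -> H s = 0.
  by move=> sr; rewrite /H step_le0// subr_le0 ler_pdivrMr// mul1r ltW.
have sh := smooth1_div r2 sH Ha.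
have sg : smooth2 (fun z => c z * (H (nrm2 (z - p)) / nrm2 (z - p))).
  by apply: smoothGM => //; apply: (smooth2_shift p (smooth2_radial sh)).
have := test_funM tf sg; congr (test_fun _ _); apply/funext => z.
have [zr|zr] := ltP (nrm2 (z - p)) r; first by rewrite (Hr0 z (Hr z zr)) mulr0 mul0r.
rewrite [H _]step_ge1 ?mul1r; first by rewrite mulrC.
by rewrite lerBrDr ler_pdivlMr//; lra.
Qed.

Lemma test_fun_pole1 f : test_fun D f -> test_fun D (fun z => f z * pole1 z).
Proof.
move=> tf; apply: (test_fun_pole tf (c := fun z => - (z.2 - p.2))).
have -> : (fun z => - (z.2 - p.2)) = fun z => p.2 - z.2 by apply/funext => z; ring.
by apply: smoothGB; [exact: smoothG_cst|exact: smooth2_snd].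
Qed.

Lemma test_fun_pole2 f : test_fun D f -> test_fun D (fun z => f z * pole2 z).
Proof.
move=> tf; apply: (test_fun_pole tf (c := fun z => z.1 - p.1)).
by apply: smoothGB; [exact: smooth2_fst|exact: smoothG_cst].
Qed.

Variable theta : R * R -> R.
Hypothesis Htheta : forall z0, D z0 -> exists2 r : R, 0 < r & forall z, ball z0 r z ->
    theta z = theta z0 + angle (z0 - p) (z - p).

Let neq z : D z -> 0 < dot (z - p) (z - p).
Proof.
move=> Dz; have : z - p != 0 by rewrite subr_eq0; apply: contra_notN nDp => /eqP <-.
by move=> /dot_gt0_near[e e0 H]; apply: H; exact: ballxx.
Qed.

Lemma theta_is_derive z (v : R * R) : D z ->
  is_derive z v theta (cross (z - p) v / nrm2 (z - p)).
Proof.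
move=> Dz; have [r r0 Hr] := Htheta Dz.
apply: (@near_eq_is_derive _ _ _ (fun w => theta z + angle (z - p) (w - p))).
  have : nbhs z (ball z r) by exact: nbhsx_ballx.
  by apply: filterS => w zw; rewrite -Hr.
apply/is_derive_alongP.
have -> : (fun h : R => theta z + angle (z - p) (h *: v + z - p)) =
    fun h => theta z + angle (z - p) (h *: v + (z - p)).
  by apply/funext => h; rewrite addrA.
have := @angle_line R (z - p) (z - p) v 0; rewrite scale0r add0r => /(_ (neq Dz)) dA.
have := is_deriveD (is_derive_cst (theta z) (0 : R) (1 : R)) dA; rewrite add0r.
exact.
Qed.

Lemma theta_continuous z : D z -> {for z, continuous theta}.
Proof.
move=> Dz; have [r r0 Hr] := Htheta Dz.
have ca : {for z, continuous (fun w => theta z + angle (z - p) (w - p))}.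
  have cl (a b : R) : {for z, continuous (fun w : R * R => a * (w.1 - p.1) + b * (w.2 - p.2))}.
    apply: (@smoothG_continuous _ _ [:: e1; e2]).
    apply: smoothGD; apply: smoothGZ; apply: smoothGB; try exact: smoothG_cst.
      exact: smooth2_fst.
    exact: smooth2_snd.
  have cc : {for z, continuous (fun w : R * R => cross (z - p) (w - p))}.
    have -> : (fun w : R * R => cross (z - p) (w - p)) =
        fun w => - (z - p).2 * (w.1 - p.1) + (z - p).1 * (w.2 - p.2).
      by apply/funext => w; rewrite /cross /=; ring.
    exact: cl.
  have cd : {for z, continuous (fun w : R * R => dot (z - p) (w - p))} := cl (z - p).1 (z - p).2.
  apply: cvgD; first exact: cvg_cst.
  apply: (@continuous_comp _ _ _ (fun w => cross (z - p) (w - p) / dot (z - p) (w - p)) atan).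
    by apply: cvgM; [exact: cc|apply: cvgV; [rewrite gt_eqF// neq|exact: cd]].
  exact: continuous_atan.
have E : theta z = theta z + angle (z - p) (z - p) by rewrite angle0 addr0.
have ca' : theta z + angle (z - p) (w - p) @[w --> z] --> theta z by rewrite [X in _ --> X]E.
apply: cvg_trans ca'; apply: near_eq_cvg.
have : nbhs z (ball z r) by exact: nbhsx_ballx.
by apply: filterS => w zw /=; rewrite [RHS](Hr w zw).
Qed.

Lemma is_derive_theta f g z (v : R * R) (df dg : R) : test_fun D f -> test_fun D g ->
  is_derive z v f df -> is_derive z v g dg ->
  is_derive z v (fun z => f z * theta z + g z)
    (df * theta z + f z * (cross (z - p) v / nrm2 (z - p)) + dg).
Proof.
move=> tf tg hf hg; have [Dz|nDz] := pselect (D z).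
  have ht := theta_is_derive v Dz.
  by apply: is_derive_eq; rewrite /GRing.scale /=; ring.
have [_ _ /(_ z nDz) nf] := (test_funP _ _).1 tf.
have [_ _ /(_ z nDz) ng] := (test_funP _ _).1 tg.
have zero (h : R * R -> R) dh : nbhs z (fun w => h w = 0) -> is_derive z v h dh -> dh = 0.
  move=> nh hh; have /@derive_val <- := hh.
  by rewrite (near_eq_derive _ (g := cst 0)) ?derive_cst.
rewrite (zero _ _ nf hf) (zero _ _ ng hg) (nbhs_singleton nf) !mul0r !addr0.
have dc : is_derive z v (cst (0 : R) : R * R -> R) 0 := is_derive_cst _ _ _.
apply: (near_eq_is_derive _ dc).
by move: nf ng; apply: filterS2 => w -> ->; rewrite mul0r addr0.
Qed.

(** The angle function is smooth only inside [D], but products with test functions are smooth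
    everywhere. The class of f theta + g is closed under derivatives because grad theta is the pole
    field, which is absorbed into [g]. *)
Lemma smooth2_theta f g : test_fun D f -> test_fun D g -> smooth2 (fun z => f z * theta z + g z).
Proof.
move=> tf tg.
apply: (@smooth2_coind _ (fun h => exists f g, [/\ test_fun D f, test_fun D g &
  h = fun z => f z * theta z + g z])); last by exists f, g.
move=> _ [{}f [{}g [{}tf {}tg ->]]].
exists (fun z => dx f z * theta z + (f z * pole1 z + dx g z)),
  (fun z => dy f z * theta z + (f z * pole2 z + dy g z)); split.
- move=> z; have [Dz|nDz] := pselect (D z).
    apply: cvgD; last exact: test_fun_continuous tg _.
    by apply: cvgM; [exact: test_fun_continuous tf _|exact: theta_continuous].
  have [_ _ /(_ z nDz) nf] := (test_funP _ _).1 tf.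
  have [_ _ /(_ z nDz) ng] := (test_funP _ _).1 tg.
  have E : f z * theta z + g z = 0 by rewrite (nbhs_singleton nf) (nbhs_singleton ng) mul0r addr0.
  rewrite /continuous_at E; apply: cvg_near_cst; move: nf ng; apply: filterS2 => w -> ->.
  by rewrite mul0r addr0.
- move=> z; have := is_derive_theta tf tg (is_derive_dx z (test_fun_smooth tf)) (is_derive_dx z (test_fun_smooth tg)).
  by move=> h; apply: (is_derive_eq h); rewrite /pole1 /cross /=; ring.
- move=> z; have := is_derive_theta tf tg (is_derive_dy z (test_fun_smooth tf)) (is_derive_dy z (test_fun_smooth tg)).
  by move=> h; apply: (is_derive_eq h); rewrite /pole2 /cross /=; ring.
- exists (dx f), (fun z => f z * pole1 z + dx g z); split => //.
    exact: test_fun_dx.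
  by apply: test_funD; [exact: test_fun_pole1|exact: test_fun_dx].
- exists (dy f), (fun z => f z * pole2 z + dy g z); split => //.
    exact: test_fun_dy.
  by apply: test_funD; [exact: test_fun_pole2|exact: test_fun_dy].
Qed.

(** The divergence of theta (f, g) is theta div (f, g) plus the integrand, and its integral is 0. *)
Lemma int_pole f g : test_fun D f -> test_fun D g -> (forall z, dx f z + dy g z = 0) ->
  \int[area]_z (f z * pole1 z + g z * pole2 z) = 0.
Proof.
move=> tf tg dfg.
have H h : test_fun D h -> [/\ smooth2 (fun z => h z * theta z + 0), bsupp (fun z => h z * theta z + 0),
  forall z, dx (fun z => h z * theta z + 0) z = dx h z * theta z + h z * pole1 z &
  forall z, dy (fun z => h z * theta z + 0) z = dy h z * theta z + h z * pole2 z].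
  move=> th; have t0 := @test_fun0 R D.
  split.
  - exact: smooth2_theta.
  - by have [c Hc] := test_fun_bsupp th; exists c => z zc; rewrite Hc// mul0r addr0.
  - move=> z; have /@derive_val := is_derive_theta th t0 (is_derive_dx z (test_fun_smooth th)) (is_derive_cst _ _ _).
    by rewrite /dx => ->; rewrite /pole1 /cross /=; ring.
  - move=> z; have /@derive_val := is_derive_theta th t0 (is_derive_dy z (test_fun_smooth th)) (is_derive_cst _ _ _).
    by rewrite /dy => ->; rewrite /pole2 /cross /=; ring.
have [sf bf dxf _] := H f tf; have [sg bg _ dyg] := H g tg.
have L1f : L1 area (dx (fun z => f z * theta z + 0) : P -> R).
  by apply: bsupp_L1; [exact: smoothG_continuous (smooth2_dx sf)|exact: (bsupp_dx bf).1].
have L1g : L1 area (dy (fun z => g z * theta z + 0) : P -> R).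
  by apply: bsupp_L1; [exact: smoothG_continuous (smooth2_dy sg)|exact: (bsupp_dx bg).2].
have E := intD L1f L1g; rewrite int_dx// int_dy// addr0 in E.
rewrite -[RHS]E; apply: eq_int => z; rewrite dxf dyg.
transitivity ((dx f z + dy g z) * theta z + f z * pole1 z + g z * pole2 z); last by ring.
by rewrite dfg mul0r add0r.
Qed.

End Pole.

Lemma shift_average_x g (T : R) z : 0 < T -> smooth2 g -> bsupp g ->
  average leb (\1_(`[0, T]%classic) : R -> R) (fun s : measurableTypeR R => s *: e1 : P) (dx g) z =
  g z - g (z - T *: e1).
Proof.
move=> T0 sg bg; rewrite /average.
have dG (s : R) : is_derive s 1 (fun s : R => - g (s *: (- e1) + z)) (dx g (z - s *: e1)).
  have h : is_derive (s *: - e1 + z) (- e1) g (- dx g (z - s *: e1)).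
    apply: (is_derive_eq (@smooth2_is_derive _ g (s *: - e1 + z) (- e1) sg)).
    by rewrite scalerN [- _ + z]addrC /=; ring.
  by have := is_deriveN (is_derive_line h); rewrite opprK.
have ct : continuous (fun s : R => z - s *: e1).
  move=> s; apply: cvgB; first exact: cvg_cst.
  by apply: cvgZr_tmp; exact: cvg_id.
have cdx : continuous (fun s : R => dx g (z - s *: e1)).
  have cx := smoothG_continuous (smooth2_dx sg).
  by move=> s; apply: continuous_comp; [exact: ct|exact: cx].
have := int_FTC T0 dG cdx; rewrite scale0r add0r opprK scalerN [- (T *: _) + z]addrC [RHS]addrC => <-.
rewrite [RHS]Rintegral_mkcond; apply: eq_int => s; rewrite patchE indicE.
have p0 : (point : R) = 0 by [].
by case: (s \in _); rewrite /= ?p0 ?mul1r ?mul0r.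
Qed.

(** The stream function is the integral of [g] along the horizontal half-line to the left. Using a
    segment of length [T] makes it an [average], hence smooth, at the price of a second copy of the
    support shifted by [T], which [chi] removes. *)
Lemma stream_function D f g : test_fun D f -> test_fun D g ->
  (forall z, dx f z + dy g z = 0) ->
  exists psi : R * R -> R, [/\ smooth2 psi, bsupp psi, forall z, dx psi z = g z &
    forall z, dy psi z = - f z].
Proof.
move=> tf tg dfg.
have sf := test_fun_smooth tf; have sg := test_fun_smooth tg.
have bf := test_fun_bsupp tf; have bg := test_fun_bsupp tg.
have [c [c0 Hf Hg]] : exists c, [/\ 0 <= c, forall z, c < `|z.1| \/ c < `|z.2| -> f z = 0 &
    forall z, c < `|z.1| \/ c < `|z.2| -> g z = 0].
  have [c1 H1] := bf; have [c2 H2] := bg.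
  have out (c' : R) z : c' < `|z.1| \/ c' < `|z.2| -> ~ box c' z.
    by rewrite /box => h [/=]; rewrite !in_itv /= -!ler_norml => h1 h2; case: h; rewrite ltNge ?h1 ?h2.
  exists (Num.max 0 (Num.max c1 c2)); split; first by rewrite le_max lexx.
    move=> z; rewrite !gt_max => h; apply: H1; apply: out.
    by case: h => /and3P[_ h _]; [left|right].
  move=> z; rewrite !gt_max => h; apply: H2; apply: out.
  by case: h => /and3P[_ _ h]; [left|right].
(* This leaves a strip c < x < c + 4 between the supports, enough room for [chi] to fall from 1 at c
   + 1 to 0 at c + 2. *)
pose T := 2 * c + 4; have T0 : 0 < T by rewrite /T; lra.
pose a : R -> R := \1_(`[0, T]%classic).
pose m (s : measurableTypeR R) : P := s *: e1.
have La : L1 leb (a : measurableTypeR R -> R).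
  apply: L1_indic; first exact: measurable_itv.
  have E : leb `[0, T] = _ := lebesgue_measure_itv `[0, T].
  have lt : (leb `[0%R, T] < +oo)%E by rewrite E; case: ifP => _; rewrite ?ltry// -EFinB ltry.
  exact: lt.
have mm : measurable_fun setT m.
  apply/measurable_fun_pairP; split.
    rewrite [X in measurable_fun _ X](_ : _ = (id : measurableTypeR R -> measurableTypeR R)) //.
    by apply/funext => s; rewrite /m /= /GRing.scale /= mulr1.
  rewrite [X in measurable_fun _ X](_ : _ = (fun=> 0 : measurableTypeR R)) //.
  by apply/funext => s; rewrite /m /= /GRing.scale /= mulr0.
pose psi0 := average leb a m g.
have s0 : smooth2 psi0 by exact: average_smooth.
have dx0 z : dx psi0 z = g z - g (z - T *: e1).
  by rewrite /psi0 dx_average// shift_average_x.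
have dy0 z : dy psi0 z = - f z + f (z - T *: e1).
  rewrite /psi0 dy_average//.
  have -> : dy g = fun z => - dx f z.
    by apply/funext => w; apply/eqP; rewrite -addr_eq0 addrC dfg.
  have bd := (bsupp_dx bf).1; have cd := smoothG_continuous (smooth2_dx sf).
  have [M [_ HM]] := continuous_bounded_support cd bd.
  have LA := average_L1 La mm z cd HM.
  transitivity (- average leb a m (dx f) z).
    by rewrite /average -intN//; apply: eq_int => s; rewrite mulrN.
  by rewrite shift_average_x// opprB addrC.
(* psi0 vanishes on the strip c < x < T - c, where it is cut off. *)
have far z : c < `|z.2| \/ c < z.1 < T - c -> dx psi0 z = 0 /\ dy psi0 z = 0.
  move=> h; have h1 : g z = 0 /\ f z = 0.
    have h' : c < `|z.1| \/ c < `|z.2|.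
      by case: h => [h|/andP[h _]]; [right|left; apply: lt_le_trans h (ler_norm _)].
    by split; [exact: Hg|exact: Hf].
  have h2 : g (z - T *: e1) = 0 /\ f (z - T *: e1) = 0.
    have h' : c < `|(z - T *: e1).1| \/ c < `|(z - T *: e1).2|.
      case: h => [h|/andP[_ h]].
        by right; rewrite /= /GRing.scale /= mulr0 subr0.
      left; rewrite /= /GRing.scale /= mulr1 distrC.
      by apply: lt_le_trans (ler_norm _); lra.
    by split; [exact: Hg|exact: Hf].
  by rewrite dx0 dy0 h1.1 h1.2 h2.1 h2.2 subrr oppr0 addr0.
have avg0 z : (forall s, 0 <= s <= T -> g (z - s *: e1) = 0) -> psi0 z = 0.
  move=> H; rewrite -[RHS](int0 leb); apply: eq_int => s; rewrite /a indicE.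
  have [sT|_] := boolP (s \in `[0, T]%classic); last by rewrite mul0r.
  rewrite H ?mulr0//; move: sT; rewrite inE /= in_itv; exact.
have psi0_top z : c < `|z.2| -> psi0 z = 0.
  by move=> h; apply: avg0 => s _; apply: Hg; right; rewrite /= /GRing.scale /= mulr0 subr0.
have psi0_strip z : c < z.1 < T - c -> psi0 z = 0.
  (* Inside the strip the vertical derivative vanishes, and above height c so does [psi0]. *)
  move=> h; have top : psi0 (z.1, c + 1) = 0.
    by apply: psi0_top; rewrite ger0_norm /=; lra.
  have dl (t : R) : is_derive t 1 (fun t : R => psi0 (t *: e2 + (z.1, 0))) 0.
    have E : dy psi0 (t *: e2 + (z.1, 0)) = 0.
      by apply: (far _ _).2; right; rewrite /= /GRing.scale /= mulr0 add0r.
    by rewrite -[X in is_derive _ _ _ X]E; apply: is_derive_line; exact: is_derive_dy.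
  have L t : t *: e2 + (z.1, 0) = (z.1, t) :> R * R.
    by rewrite pairZD mulr0 add0r mulr1 addr0.
  have := @le_MVT _ _ (fun=> 0) (c + 1) z.2 0 (fun t _ => dl t) (fun t _ => ltac:(by rewrite normr0)).
  rewrite mul0r !L top subr0 normr_le0 => /eqP E.
  by rewrite -[RHS]E; congr psi0; case: (z).
pose chi (x : R) := 1 - step (x - c - 1).
have schi : smooth2 (fun z => chi z.1).
  apply: smoothGB; first exact: smoothG_cst.
  apply: smoothG_comp; first exact: smooth1_step.
  by apply: smoothGB; [apply: smoothGB; [exact: smooth2_fst|exact: smoothG_cst]|exact: smoothG_cst].
have cf := smoothG_continuous (@smooth2_fst R).
have psiE z : nbhs z (fun w => psi0 w * chi w.1 = psi0 w) /\ z.1 < c + 1 \/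
    nbhs z (fun w => psi0 w * chi w.1 = 0) /\ c < z.1.
  have [h|h] := ltP z.1 (c + 1).
    have n : nbhs z (fun w : R * R => w.1 < c + 1) by exact: (cf z _ (lt_nbhsl h)).
    left; split => //; move: n; apply: filterS => w wc.
    by rewrite /chi step_le0 ?subr0 ?mulr1//=; rewrite /= in wc; lra.
  right; split; last by lra.
  have [h'|h'] := ltP z.1 (T - c).
    have hc : c < z.1 by lra.
    have n1 : nbhs z (fun w : R * R => w.1 < T - c) by exact: (cf z _ (lt_nbhsl h')).
    have n2 : nbhs z (fun w : R * R => c < w.1) by exact: (cf z _ (lt_nbhsr hc)).
    by apply: filterS2 n1 n2 => w w1 w2; rewrite psi0_strip ?mul0r//; apply/andP.
  have h2 : c + 2 < z.1 by move: h'; rewrite /T; lra.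
  have n : nbhs z (fun w : R * R => c + 2 < w.1) by exact: (cf z _ (lt_nbhsr h2)).
  move: n; apply: filterS => w wc.
  by rewrite /chi step_ge1 ?subrr ?mulr0//; lra.
have farT z : z.1 < c + 1 -> g (z - T *: e1) = 0 /\ f (z - T *: e1) = 0.
  move=> h; have h' : c < `|(z - T *: e1).1| \/ c < `|(z - T *: e1).2|.
    left; rewrite /= /GRing.scale /= mulr1 distrC.
    by apply: lt_le_trans (ler_norm _); rewrite /T; lra.
  by split; [exact: Hg|exact: Hf].
exists (fun z => psi0 z * chi z.1); split.
- exact: smoothGM.
- exists (c + 2) => z zb; have [h|h] := ltP c `|z.2|; first by rewrite psi0_top ?mul0r.
  have [h1|h1] := leP (c + 2) z.1; first by rewrite /chi step_ge1 ?subrr ?mulr0//; lra.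
  rewrite avg0 ?mul0r// => s /andP[s0' sT]; apply: Hg; left.
  rewrite /= /GRing.scale /= mulr1 ltNge; apply/negP => h2; apply: zb.
  rewrite /box; split; rewrite /= in_itv /= -ler_norml; last by lra.
  by move: h2; rewrite !ler_norml => /andP[h2 _]; apply/andP; split; lra.
- move=> z; case: (psiE z) => -[n h]; rewrite /dx (near_eq_derive _ n).
    by have := dx0 z; rewrite /dx => ->; rewrite (farT z h).1 subr0.
  by rewrite derive_cst Hg//; left; apply: lt_le_trans h (ler_norm _).
- move=> z; case: (psiE z) => -[n h]; rewrite /dy (near_eq_derive _ n).
    by have := dy0 z; rewrite /dy => ->; rewrite (farT z h).2 addr0.
  by rewrite derive_cst Hf ?oppr0//; left; apply: lt_le_trans h (ler_norm _).
Qed.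

(** * Stream functions vanish off a simply connected domain *)

Section Orthogonality.
Variables (D : set (R * R)).
Hypotheses (oD : open D) (scD : simply_connected D).

(** Near the outer point the stream function is constant, since its gradient vanishes there. The
    integral of (f, g) against the pole field at [p] is 0 by [int_pole], while in terms of psi it is
    the flux -2 pi psi(p) of [int_flux]. *)
Lemma stream_zero psi f g p : test_fun D f -> test_fun D g ->
  (forall z, dx f z + dy g z = 0) -> smooth2 psi -> bsupp psi ->
  (forall z, dx psi z = g z) -> (forall z, dy psi z = - f z) -> ~ D p ->
  nbhs p (fun z => psi z = 0).
Proof.
move=> tf tg dfg sp bp dxp dyp nDp.
have [theta Ht] := angle_function oD scD nDp.
have I0 := int_pole nDp Ht tf tg dfg.
have [_ _ /(_ p nDp) nf] := (test_funP _ _).1 tf.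
have [_ _ /(_ p nDp) ng] := (test_funP _ _).1 tg.
have /nbhs_ballP[r /= r0 Hr] : nbhs p (fun z => f z = 0 /\ g z = 0).
  by apply: filterS2 nf ng.
have const z : ball p r z -> psi z = psi p.
  move=> pz; apply/eqP; rewrite -subr_eq0 -normr_le0.
  have := @le_MVT_plane _ psi (fun=> 0) (fun=> 0) p r 0 z _ _ pz.
  rewrite mul0r; apply => u pu; last by rewrite normr0.
  have [fu gu] := Hr u pu; split.
    by apply: (is_derive_eq (is_derive_dx u sp)); rewrite dxp gu.
  by apply: (is_derive_eq (is_derive_dy u sp)); rewrite dyp fu oppr0.
have [e e0 He] := nrm2_ball p r0.
have sps : smooth2 (fun z => psi (z + p)).
  have -> : (fun z => psi (z + p)) = fun z => psi (z - - p) by apply/funext => z; rewrite opprK.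
  exact: smooth2_shift.
have bps : bsupp (fun z => psi (z + p)).
  have [c Hc] := bp; exists (c + (`|p.1| + `|p.2|)) => z zb; apply: Hc => zpb; apply: zb.
  move: zpb; rewrite /box => -[/=]; rewrite !in_itv /= -!ler_norml => h1 h2.
  have k1 := lerB_normD z.1 p.1; have k2 := lerB_normD z.2 p.2.
  have n1 := normr_ge0 p.1; have n2 := normr_ge0 p.2.
  by split; lra.
have dsh (v : R * R) z : 'D_v (fun z => psi (z + p)) z = 'D_v psi (z + p).
  rewrite derive_alongE [RHS]derive_alongE.
  have -> : (fun h : R => psi (h *: v + z + p)) = fun h => psi (h *: v + (z + p)).
    by apply/funext => h; rewrite -addrA.
  by [].
have := @int_flux _ (fun z => psi (z + p)) e (psi p) sps bps e0.
rewrite (eq_int _ (g := fun z : P => f (z + p) * pole1 p (z + p) + g (z + p) * pole2 p (z + p))); last first.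
  move=> z; have := dsh e1 z; have := dsh e2 z; rewrite -/(dx psi _) -/(dy psi _) dxp dyp /dx /dy => -> ->.
  by rewrite /pole1 /pole2 (addrK p (z : R * R)) /=; ring.
have LF : L1 area (fun z : P => f z * pole1 p z + g z * pole2 p z).
  by apply: L1D; [exact: test_fun_L1 (test_fun_pole1 nDp tf)|exact: test_fun_L1 (test_fun_pole2 nDp tg)].
rewrite (int_shift p LF) I0 => H.
have : 0 = - (2 * pi * psi p) by apply: H => z h; apply: const; apply: He; rewrite addrK.
move=> /eqP; rewrite eq_sym oppr_eq0 mulf_eq0 mulf_eq0 pnatr_eq0 /= gt_eqF ?pi_gt0//= => /eqP p0.
have : nbhs p (ball p r) by exact: nbhsx_ballx.
by apply: filterS => w /const ->.
Qed.

Lemma curl_free_orthogonal (U1 U2 f g : R * R -> R) :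
  (forall phi, test_fun D phi -> \int[area]_z (U2 z * dx phi z - U1 z * dy phi z) = 0) ->
  test_fun D f -> test_fun D g -> (forall z, dx f z + dy g z = 0) ->
  \int[area]_z (U1 z * f z + U2 z * g z) = 0.
Proof.
move=> H tf tg dfg.
have [psi [sp bp dxp dyp]] := stream_function tf tg dfg.
have tp : test_fun D psi.
  apply/test_funP; split => // p nDp; exact: stream_zero tf tg dfg sp bp dxp dyp nDp.
rewrite -[RHS](H psi tp); apply: eq_int => z; rewrite dxp dyp; ring.
Qed.

End Orthogonality.
End Stream.

(** * Perforated domains *)

Section Clairaut.
Context {R : realType}.
Local Notation area := (@lebesgue_measure R \x @lebesgue_measure R)%E.
Local Notation P := (measurableTypeR R * measurableTypeR R)%type.
Local Notation e1 := ((1, 0) : R * R).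
Local Notation e2 := ((0, 1) : R * R).
Implicit Types (f g : R * R -> R) (z : R * R).

Lemma mean_value (f df : R -> R) (a b : R) : a < b ->
  (forall t : R, is_derive t 1 f (df t)) -> exists2 t, a < t < b & f b - f a = df t * (b - a).
Proof.
move=> ab Hf.
have cf : {within `[a, b]%classic, continuous f}.
  by apply: continuous_subspaceT => t; exact: is_derive_continuous1 (Hf t).
have [t tab E] := MVT ab (fun t _ => Hf t) cf.
by exists t => //; move: tab; rewrite in_itv.
Qed.

(* Both mixed derivatives are limits of the same second difference quotient. *)
Lemma mixed_difference f z (h : R) : smooth2 f -> 0 < h ->
  exists2 u, ball z (2 * h) u &
  f (z + (h, h)) - f (z + (h, 0)) - (f (z + (0, h)) - f z) = dy (dx f) u * (h * h).
Proof.
move=> sf h0.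
pose F (t : R) := f (t *: e1 + (z + (0, h))) - f (t *: e1 + z).
have dF (t : R) : is_derive t 1 F (dx f (t *: e1 + (z + (0, h))) - dx f (t *: e1 + z)).
  by apply: is_deriveB; apply: is_derive_line; exact: is_derive_dx.
have [t t0h Et] := mean_value h0 dF.
have dG (s : R) : is_derive s 1 (fun s => dx f (s *: e2 + (t *: e1 + z))) (dy (dx f) (s *: e2 + (t *: e1 + z))).
  by apply: is_derive_line; apply: is_derive_dy; exact: smooth2_dx.
have [s s0h Es] := mean_value h0 dG.
exists (s *: e2 + (t *: e1 + z)).
  move: t0h s0h => /andP[t0 th] /andP[s0 sh].
  split; rewrite /ball /= /GRing.scale /=.
    have -> : z.1 - (s * 0 + (t * 1 + z.1)) = - t by ring.
    by rewrite normrN gtr0_norm//; lra.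
  have -> : z.2 - (s * 1 + (t * 0 + z.2)) = - s by ring.
  by rewrite normrN gtr0_norm//; lra.
have p1 : h *: e1 + (z + (0, h)) = z + (h, h).
  by rewrite [z]surjective_pairing; congr pair; rewrite /= /GRing.scale /=; ring.
have p2 : h *: e1 + z = z + (h, 0).
  by rewrite [z]surjective_pairing; congr pair; rewrite /= /GRing.scale /=; ring.
have p3 : h *: e2 + (t *: e1 + z) = t *: e1 + (z + (0, h)).
  by rewrite [z]surjective_pairing; congr pair; rewrite /= /GRing.scale /=; ring.
rewrite scale0r add0r subr0 p3 in Es; rewrite /F !scale0r !add0r subr0 p1 p2 Es in Et.
by rewrite Et mulrA.
Qed.

Lemma mixed_difference' f z (h : R) : smooth2 f -> 0 < h ->
  exists2 u, ball z (2 * h) u &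
  f (z + (h, h)) - f (z + (h, 0)) - (f (z + (0, h)) - f z) = dx (dy f) u * (h * h).
Proof.
move=> sf h0.
pose F (t : R) := f (t *: e2 + (z + (h, 0))) - f (t *: e2 + z).
have dF (t : R) : is_derive t 1 F (dy f (t *: e2 + (z + (h, 0))) - dy f (t *: e2 + z)).
  by apply: is_deriveB; apply: is_derive_line; exact: is_derive_dy.
have [t t0h Et] := mean_value h0 dF.
have dG (s : R) : is_derive s 1 (fun s => dy f (s *: e1 + (t *: e2 + z))) (dx (dy f) (s *: e1 + (t *: e2 + z))).
  by apply: is_derive_line; apply: is_derive_dx; exact: smooth2_dy.
have [s s0h Es] := mean_value h0 dG.
exists (s *: e1 + (t *: e2 + z)).
  move: t0h s0h => /andP[t0 th] /andP[s0 sh].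
  split; rewrite /ball /= /GRing.scale /=.
    have -> : z.1 - (s * 1 + (t * 0 + z.1)) = - s by ring.
    by rewrite normrN gtr0_norm//; lra.
  have -> : z.2 - (s * 0 + (t * 1 + z.2)) = - t by ring.
  by rewrite normrN gtr0_norm//; lra.
have p1 : h *: e2 + (z + (h, 0)) = z + (h, h).
  by rewrite [z]surjective_pairing; congr pair; rewrite /= /GRing.scale /=; ring.
have p2 : h *: e2 + z = z + (0, h).
  by rewrite [z]surjective_pairing; congr pair; rewrite /= /GRing.scale /=; ring.
have p3 : h *: e1 + (t *: e2 + z) = t *: e2 + (z + (h, 0)).
  by rewrite [z]surjective_pairing; congr pair; rewrite /= /GRing.scale /=; ring.
rewrite scale0r add0r subr0 p3 in Es; rewrite /F !scale0r !add0r subr0 p1 p2 Es in Et.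
by rewrite mulrA -Et; ring.
Qed.

Lemma close_absurd (x y c : R) : `|x - c| < `|x - y| / 2 -> `|y - c| < `|x - y| / 2 -> False.
Proof.
move=> h1 h2; have : `|x - y| <= `|x - c| + `|y - c| by rewrite [`|y - c|]distrC; exact: ler_distD.
by lra.
Qed.

Lemma dx_dy f z : smooth2 f -> dx (dy f) z = dy (dx f) z.
Proof.
move=> sf; apply/eqP; rewrite -subr_eq0 -normr_le0 leNgt; apply/negP => n0.
set e := `|_| in n0.
have c1 : continuous (dx (dy f)) by exact: smoothG_continuous (smooth2_dx (smooth2_dy sf)).
have c2 : continuous (dy (dx f)) by exact: smoothG_continuous (smooth2_dy (smooth2_dx sf)).
have e2' : 0 < e / 2 by rewrite divr_gt0.
have n1 : nbhs z (fun u => `|dx (dy f) z - dx (dy f) u| < e / 2).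
  by have /cvgrPdist_lt/(_ _ e2') := c1 z.
have n2 : nbhs z (fun u => `|dy (dx f) z - dy (dx f) u| < e / 2).
  by have /cvgrPdist_lt/(_ _ e2') := c2 z.
have /nbhs_ballP[r /= r0 Hr] : nbhs z (fun u => `|dx (dy f) z - dx (dy f) u| < e / 2 /\
    `|dy (dx f) z - dy (dx f) u| < e / 2) by apply: filterS2 n1 n2.
have h0 : 0 < r / 2 by rewrite divr_gt0.
have r2 : 2 * (r / 2) = r by field.
have [u zu Eu] := mixed_difference z sf h0; have [w zw Ew] := mixed_difference' z sf h0.
rewrite r2 in zu zw.
have E : dy (dx f) u = dx (dy f) w.
  have hh : r / 2 * (r / 2) != 0 by rewrite mulf_neq0// gt_eqF.
  exact: (mulIf hh (etrans (esym Eu) Ew)).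
have [_ a2] := Hr u zu; have [b1 _] := Hr w zw; rewrite E in a2.
exact: (close_absurd b1 a2).
Qed.

End Clairaut.

(** * Integrals over sets as integrals against indicators; Euclidean disks *)

Section Conversions.
Context {R : realType}.
Local Notation area := (@lebesgue_measure R \x @lebesgue_measure R)%E.
Local Notation P := (measurableTypeR R * measurableTypeR R)%type.
Implicit Types (D : set (R * R)) (f g : R * R -> R) (F G : R * R -> R * R) (z p q : R * R).

Lemma smooth2_sum (I : Type) (s : seq I) (F : I -> R * R -> R) :
  (forall k, smooth2 (F k)) -> smooth2 (fun z => \sum_(i <- s) F i z).
Proof.
move=> sF; elim: s => [|i s IH].
  have -> : (fun z => \sum_(i <- [::]) F i z) = fun=> 0 by apply/funext => w; rewrite big_nil.
  exact: smoothG_cst.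
have -> : (fun z => \sum_(k <- i :: s) F k z) = fun z => F i z + \sum_(k <- s) F k z.
  by apply/funext => w; rewrite big_cons.
exact: (smoothGD (sF i) IH).
Qed.

Lemma dy_sum (I : Type) (s : seq I) (F : I -> R * R -> R) z :
  (forall k, smooth2 (F k)) -> dy (fun z => \sum_(i <- s) F i z) z = \sum_(i <- s) dy (F i) z.
Proof.
move=> sF; elim: s => [|i s IH].
  by rewrite big_nil -[RHS](dy_cst (0 : R) z); congr dy; apply/funext => w; rewrite big_nil.
have -> : (fun z => \sum_(k <- i :: s) F k z) = fun z => F i z + \sum_(k <- s) F k z.
  by apply/funext => w; rewrite big_cons.
by rewrite (dyD z (sF i) (smooth2_sum s sF)) IH big_cons.
Qed.

Lemma restrict_indic D f : f \_ D = fun z => \1_D z * f z.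
Proof.
apply/funext => z; rewrite patchE indicE; have p0 : (point : R) = 0 by [].
by case: (z \in D); rewrite ?mul1r ?mul0r.
Qed.

Lemma L2P D f : L2 D f <-> sqint area (fun z : P => \1_D z * f z).
Proof. by rewrite /L2 restrict_indic; exact: sqint_Lfun. Qed.

Lemma int_in D (h : P -> R) : \int[area]_(z in D) h z = \int[area]_z (\1_D z * h z).
Proof.
by rewrite Rintegral_mkcond; apply: eq_int => z; rewrite [LHS](congr1 (fun k => k z) (restrict_indic D h)).
Qed.

Lemma indic_sub D D' z : D `<=` D' -> \1_D z * \1_D' z = \1_D z :> R.
Proof.
move=> sDD; rewrite !indicE; have [/set_mem zD|_] := boolP (z \in D); last by rewrite mul0r.
by rewrite mem_set ?mulr1//; exact: sDD.
Qed.

Lemma indic01 D z : 0 <= (\1_D z : R) <= 1.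
Proof. by rewrite indicE; case: (z \in D); rewrite ?lexx ler01. Qed.

Lemma indicT D z : D z -> \1_D z = 1 :> R.
Proof. by move=> Dz; rewrite indicE mem_set. Qed.

Lemma indicF D z : ~ D z -> \1_D z = 0 :> R.
Proof. by move=> Dz; rewrite indicE memNset. Qed.

Lemma sqint_indic D (f : P -> R) : measurable (D : set P) -> sqint area f ->
  sqint area (fun z : P => \1_D z * f z).
Proof.
move=> mD; apply: (@sqint_bounded _ _ _ _ f (\1_D : P -> R) 1).
  exact: measurable_indic.
by move=> z; rewrite indicE; case: (z \in D); rewrite ?normr1 ?normr0.
Qed.

Lemma L1_indicM D (f : P -> R) : measurable (D : set P) -> L1 area f ->
  L1 area (fun z : P => \1_D z * f z).
Proof.
move=> mD; apply: (@L1_bounded _ _ _ _ f (\1_D : P -> R) 1).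
  exact: measurable_indic.
by move=> z; rewrite indicE; case: (z \in D); rewrite ?normr1 ?normr0.
Qed.

Lemma L2_subset D D' f : measurable (D : set P) -> D `<=` D' -> L2 D' f -> L2 D f.
Proof.
move=> mD sDD /L2P S; apply/L2P; have := sqint_indic mD S; congr (sqint _ _).
by apply/funext => z; rewrite mulrA indic_sub.
Qed.

Lemma diskP p (r : R) z : 0 <= r -> disk p r z <-> nrm2 (z - p) <= r ^+ 2.
Proof.
move=> r0; have -> : nrm2 (z - p) = dot (z - p) (z - p) by rewrite /nrm2 /dot !expr2.
have d0 : 0 <= dot (z - p) (z - p) by rewrite /dot addr_ge0// -expr2 sqr_ge0.
rewrite /disk /=; split => h.
  by rewrite -[leLHS]sqr_sqrtr// lerXn2r ?nnegrE ?sqrtr_ge0.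
by rewrite -[leRHS]ger0_norm// -sqrtr_sqr ler_wsqrtr.
Qed.

Lemma disk_center p (r : R) : 0 <= r -> disk p r p.
Proof. by move=> r0; apply/diskP => //; rewrite subrr /nrm2 /= expr0n /= addr0 sqr_ge0. Qed.

Lemma disk_le p (r r' : R) : r <= r' -> disk p r `<=` disk p r'.
Proof. by move=> rr z; rewrite /disk /= => /le_trans; apply. Qed.

Lemma nrm2_shift_continuous p : continuous (fun z : R * R => nrm2 (z - p)).
Proof. exact: smoothG_continuous (smooth2_shift p (@smooth2_nrm2 R)). Qed.

Lemma disk_closed p (r : R) : closed (disk p r).
Proof.
have [r0|r0] := leP 0 r; last first.
  have -> : disk p r = set0; last exact: closed0.
  apply/seteqP; split => z //; rewrite /disk /= => h.
  by have := le_trans (sqrtr_ge0 _) h; rewrite leNgt r0.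
have -> : disk p r = (fun z => nrm2 (z - p)) @^-1` [set x | x <= r ^+ 2].
  by apply/seteqP; split => z /diskP; apply.
apply: closed_comp; last exact: closed_le.
by move=> z _; exact: nrm2_shift_continuous.
Qed.

Lemma disk_compact p (r : R) : compact (disk p r).
Proof.
have [r0|r0] := leP 0 r; last first.
  have -> : disk p r = set0; last exact: compact0.
  apply/seteqP; split => z //; rewrite /disk /= => h.
  by have := le_trans (sqrtr_ge0 _) h; rewrite leNgt r0.
apply: (@subclosed_compact _ _ (cbox p r)); [exact: disk_closed|exact: cbox_compact|].
move=> z /diskP => /(_ r0) h; apply/cboxP.
have H (x y : R) : x ^+ 2 + y ^+ 2 <= r ^+ 2 -> `|x| <= r.
  move=> h'; rewrite -(ler_pXn2r (n := 2))// ?nnegrE// real_normK ?num_real//.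
  by apply: le_trans h'; rewrite lerDl sqr_ge0.
by split; [exact: H h|rewrite /nrm2 addrC in h; exact: H h].
Qed.

End Conversions.

(** * The energy density and its polar form *)

Section Energy.
Context {R : realType}.
Implicit Types (p q : R * R).
Variables (Cc Rc Kc : R).

(** Normalised so that its value on the diagonal is twice the density. *)
Definition polar_density (p q p' q' : R * R) : R :=
  Cc * dot p p' + Kc * dot q q' + Rc * (dot p q' + dot p' q).

Local Notation dens := (energy_density Cc Rc Kc).

Lemma energy_densityD p q p' q' (t : R) :
  dens (p + t *: p') (q + t *: q') = dens p q + t * polar_density p q p' q' + t ^+ 2 * dens p' q'.
Proof.
by rewrite /energy_density /polar_density /dot /= /GRing.scale /=; field.
Qed.

Lemma energy_density_scale p q (t : R) : dens (t *: p) (t *: q) = t ^+ 2 * dens p q.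
Proof. by rewrite /energy_density /dot /= /GRing.scale /=; ring. Qed.

Hypotheses (C0 : 0 < Cc) (CKR : Rc ^+ 2 < Cc * Kc).

(** Multiplication by [Cc] and completion of the square leave the coefficient Cc Kc - Rc^2 > 0. *)
Lemma quadratic_ge0 (x y : R) : 0 <= Cc * x ^+ 2 + Kc * y ^+ 2 + 2 * Rc * x * y.
Proof.
have h : Cc * (Cc * x ^+ 2 + Kc * y ^+ 2 + 2 * Rc * x * y) =
  (Cc * x + Rc * y) ^+ 2 + (Cc * Kc - Rc ^+ 2) * y ^+ 2 by ring.
have : 0 <= Cc * (Cc * x ^+ 2 + Kc * y ^+ 2 + 2 * Rc * x * y).
  by rewrite h addr_ge0 ?sqr_ge0// mulr_ge0 ?sqr_ge0// subr_ge0 ltW.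
by rewrite pmulr_rge0.
Qed.

Lemma energy_density_ge0 p q : 0 <= dens p q.
Proof.
rewrite /energy_density mulr_ge0//.
have -> : Cc * dot p p + Kc * dot q q + 2 * Rc * dot p q =
  (Cc * p.1 ^+ 2 + Kc * q.1 ^+ 2 + 2 * Rc * p.1 * q.1) +
  (Cc * p.2 ^+ 2 + Kc * q.2 ^+ 2 + 2 * Rc * p.2 * q.2) by rewrite /dot; ring.
by rewrite addr_ge0 ?quadratic_ge0.
Qed.

(* Convexity of the density. *)
Lemma energy_density_tangent p q p' q' :
  polar_density p' q' p q - dens p' q' <= dens p q.
Proof.
have := energy_density_ge0 (p + (-1) *: p') (q + (-1) *: q').
rewrite energy_densityD.
have -> : polar_density p q p' q' = polar_density p' q' p q.
  by rewrite /polar_density /dot; ring.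
by lra.
Qed.

End Energy.

Section RadialCutoff.
Context {R : realType}.
Local Notation area := (@lebesgue_measure R \x @lebesgue_measure R)%E.
Local Notation P := (measurableTypeR R * measurableTypeR R)%type.
Implicit Types (z p : R * R) (G : R -> R).

Definition radial_at p G z : R := G (nrm2 (z - p)).

Lemma smooth2_radial_at p G : smooth1 G -> smooth2 (radial_at p G).
Proof. by move=> sG; exact: (smooth2_shift p (smooth2_radial sG)). Qed.

Lemma d_shift f p (v : R * R) z : 'D_v (fun z => f (z - p)) z = 'D_v f (z - p) :> R.
Proof.
rewrite derive_alongE [RHS]derive_alongE.
have -> // : (fun h : R => f (h *: v + z - p)) = fun h => f (h *: v + (z - p)).
by apply/funext => h; rewrite addrA.
Qed.

Lemma dx_radial_at p G z : smooth1 G ->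
  dx (radial_at p G) z = 2 * (z.1 - p.1) * 'D_1 G (nrm2 (z - p)).
Proof.
move=> sG; have := dx_radial (z - p) sG; rewrite /dx /radial_at.
by rewrite (d_shift (fun z => G (nrm2 z))) => ->.
Qed.

Lemma dy_radial_at p G z : smooth1 G ->
  dy (radial_at p G) z = 2 * (z.2 - p.2) * 'D_1 G (nrm2 (z - p)).
Proof.
move=> sG; have := dy_radial (z - p) sG; rewrite /dy /radial_at.
by rewrite (d_shift (fun z => G (nrm2 z))) => ->.
Qed.

Lemma test_fun_radial_at D p G (b r : R) : smooth1 G -> 0 <= r -> b <= r ^+ 2 ->
  (forall s, b < s -> G s = 0) -> disk p r `<=` D -> test_fun D (radial_at p G).
Proof.
move=> sG r0 br Gb pD; apply: (test_fun_compact _ (@disk_compact _ p r)) => //.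
  exact: smooth2_radial_at.
move=> z nz; apply: Gb; apply: le_lt_trans br _; rewrite ltNge; apply/negP => h.
by apply: nz; apply/diskP.
Qed.

End RadialCutoff.

(** * The perforated domain and its tangential traces *)

Section Domain.
Context {R : realType}.
Local Notation area := (@lebesgue_measure R \x @lebesgue_measure R)%E.
Local Notation P := (measurableTypeR R * measurableTypeR R)%type.
Variables (Omega : set (R * R)) (N : nat) (d : 'I_N -> R * R) (eps0 : R).
Hypotheses (oO : open Omega) (eps0_gt0 : 0 < eps0).
Hypothesis disks_disjoint : forall i j, i != j -> disk (d i) eps0 `&` disk (d j) eps0 = set0.
Hypothesis disks_in : forall i, disk (d i) eps0 `<=` Omega.
Implicit Types (eps r b : R) (z : R * R) (i j : 'I_N) (f : R * R -> R * R) (phi : R * R -> R).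
Local Notation perf := (perforated Omega d).

Lemma perforatedP eps z : perf eps z <-> Omega z /\ forall i, ~ disk (d i) eps z.
Proof.
split=> [[Oz nz]|[Oz nz]]; split => //; first by move=> i di; apply: nz; exists i.
by move=> [i _ di]; apply: (nz i).
Qed.

Lemma perforated_open eps : open (perf eps).
Proof.
apply: openI => //; apply: closed_openC; apply: closed_bigcup; first exact: finite_finset.
by move=> i _; exact: disk_closed.
Qed.

Lemma perforated_measurable eps : measurable (perf eps : set P).
Proof. by apply: open_measurable_plane; exact: perforated_open. Qed.

Lemma perforated_sub eps : perf eps `<=` Omega.
Proof. by move=> z []. Qed.

Lemma perforated_le eps r : eps <= r -> perf r `<=` perf eps.
Proof.
move=> er z /perforatedP[Oz nz]; apply/perforatedP; split => // i di.
exact: nz (disk_le er di).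
Qed.

Lemma disk_eq i j z : disk (d i) eps0 z -> disk (d j) eps0 z -> i = j.
Proof.
move=> di dj; apply/eqP; apply: contraT => /disks_disjoint E.
by have : (disk (d i) eps0 `&` disk (d j) eps0) z by []; rewrite E.
Qed.

Lemma traceE D f phi : tangential_trace D f phi =
  \int[area]_z (\1_D z * (f z).2 * dx phi z - \1_D z * (f z).1 * dy phi z).
Proof.
by rewrite /tangential_trace int_in; apply: eq_int => z; ring.
Qed.

Lemma L1_trace D D' f phi : L2v D f -> test_fun D' phi ->
  L1 area (fun z : P => \1_D z * (f z).2 * dx phi z - \1_D z * (f z).1 * dy phi z).
Proof.
move=> [/L2P f1 /L2P f2] tp.
by apply: L1B; apply: sqint_L1_test; [exact: f2|exact: test_fun_dx tp|exact: f1|exact: test_fun_dy tp].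
Qed.

Lemma traceB D D' f phi psi : L2v D f -> test_fun D' phi -> test_fun D' psi ->
  tangential_trace D f (fun z => phi z - psi z) = tangential_trace D f phi - tangential_trace D f psi.
Proof.
move=> Lf tphi tpsi; rewrite !traceE -(intB (L1_trace Lf tphi) (L1_trace Lf tpsi)).
have sphi := test_fun_smooth tphi; have spsi := test_fun_smooth tpsi.
by apply: eq_int => z; rewrite dxB// dyB//; ring.
Qed.

Lemma traceZ D D' f phi (c : R) : L2v D f -> test_fun D' phi ->
  tangential_trace D f (fun z => c * phi z) = c * tangential_trace D f phi.
Proof.
move=> Lf tphi; rewrite !traceE -(intZ c (L1_trace Lf tphi)).
have sphi := test_fun_smooth tphi.
by apply: eq_int => z; rewrite dxZ// dyZ//; ring.
Qed.

Lemma trace_sum D D' f (F : 'I_N -> R * R -> R) : L2v D f -> (forall i, test_fun D' (F i)) ->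
  tangential_trace D f (fun z => \sum_(i < N) F i z) = \sum_(i < N) tangential_trace D f (F i).
Proof.
move=> Lf tF; rewrite traceE.
under [RHS]eq_bigr do rewrite traceE.
rewrite -int_sum; last by move=> i; exact: L1_trace Lf (tF i).
have sF i := test_fun_smooth (tF i).
apply: eq_int => z; rewrite dx_sum// dy_sum// !mulr_sumr -sumrB.
by [].
Qed.

Definition cutoff (a b s : R) : R := 1 - step ((s - a) / (b - a)).

Lemma smooth1_cutoff (a b : R) : smooth1 (cutoff a b).
Proof.
apply: smoothGB; first exact: smoothG_cst.
apply: smoothG_comp; first exact: smooth1_step.
by apply: smoothGM; [apply: smoothGB; [exact: smooth1_id|exact: smoothG_cst]|exact: smoothG_cst].
Qed.

Lemma cutoff1 (a b s : R) : a < b -> s <= a -> cutoff a b s = 1.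
Proof.
by move=> ab sa; rewrite /cutoff step_le0 ?subr0// pmulr_lle0 ?subr_le0// invr_gt0 subr_gt0.
Qed.

Lemma cutoff0 (a b s : R) : a < b -> b <= s -> cutoff a b s = 0.
Proof.
by move=> ab sb; rewrite /cutoff step_ge1 ?subrr// ler_pdivlMr ?subr_gt0// mul1r lerB.
Qed.

Lemma cutoff01 (a b s : R) : 0 <= cutoff a b s <= 1.
Proof. by rewrite /cutoff subr_ge0 step_le1 lerBlDr lerDl step_ge0. Qed.

(** The constant is uniform in the two radii because the bump is at most 1; this uniformity is what
    [bump_trace_vanishes] relies on. *)
Lemma cutoff_derive : exists2 S : R, 0 <= S & forall a b s : R, a < b ->
  `|'D_1 (cutoff a b) s| <= S / (b - a).
Proof.
pose I := \int[@lebesgue_measure R]_t (hat t : R).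
have I0 : 0 < I := hat_mass_gt0.
exists I^-1; first by rewrite invr_ge0 ltW.
move=> a b s ab.
have da : is_derive s 1 (fun s : R => (s - a) / (b - a)) (b - a)^-1.
  have -> : (fun s : R => (s - a) / (b - a)) = fun s => (b - a)^-1 * s + - a / (b - a).
    by apply/funext => u; ring.
  exact: is_derive_affine.
have ds := is_derive_comp_dir da (is_derive_step ((s - a) / (b - a))).
have /@derive_val -> : is_derive s 1 (cutoff a b) (- (hat ((s - a) / (b - a)) / I * (b - a)^-1)).
  by have := is_deriveB (is_derive_cst (1 : R) s (1 : R)) ds; rewrite sub0r; exact.
have b0 : 0 <= hat ((s - a) / (b - a)) := hat_ge0 _.
have b1 : hat ((s - a) / (b - a)) <= 1 := hat_le1 _.
have ba : 0 < b - a by rewrite subr_gt0.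
rewrite normrN ger0_norm.
  apply: ler_wpM2r; first by rewrite invr_ge0 ltW.
  by apply: ler_piMl b1; rewrite invr_ge0 ltW.
have I0' := ltW I0; have ba' := ltW ba.
by apply: divr_ge0 => //; exact: divr_ge0.
Qed.

Lemma radial_at_other G i j z : (forall s, eps0 ^+ 2 < s -> G s = 0) -> i != j ->
  disk (d j) eps0 z -> radial_at (d i) G z = 0.
Proof.
move=> Gb ij dj; apply: Gb; rewrite ltNge; apply/negP => h.
move/eqP: ij; apply; apply: (@disk_eq i j z) => //.
by apply/diskP => //; exact: ltW.
Qed.

(** A radial function about [d i] that is 1 out to [r > eps] and 0 beyond [eps0] is admissible in
    [circulation_eq]: the other disks lie where it vanishes. *)
Lemma circulation_radial G i eps r f b : smooth1 G -> 0 < eps -> eps < r -> r <= eps0 ->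
  (forall s, s <= r ^+ 2 -> G s = 1) -> (forall s, eps0 ^+ 2 < s -> G s = 0) ->
  circulation_eq Omega d eps i f b -> tangential_trace (perf eps) f (radial_at (d i) G) = - b.
Proof.
move=> sG e0 er re Ga Gb Hf; rewrite -(Hf (radial_at (d i) G)) ?opprK//.
  by apply: (test_fun_radial_at (r := eps0) sG _ (lexx _) Gb) => //; exact: ltW.
have r0 : 0 <= r by rewrite ltW// (lt_trans e0).
exists r; first exact: er.
move=> j z djr; case: (eqVneq j i) djr => [->|ji] djr; first last.
  by apply: (radial_at_other Gb); [rewrite eq_sym|exact: disk_le djr].
by rewrite /radial_at Ga//; apply/diskP.
Qed.

End Domain.

(** * Curl-freeness of the weak limit *)

Lemma cvg_bigsum {R : realType} (T I : Type) (F : set_system T) {FF : Filter F} (s : seq I)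
  (f : I -> T -> R) (l : I -> R) : (forall i, f i t @[t --> F] --> l i) ->
  \sum_(i <- s) f i t @[t --> F] --> \sum_(i <- s) l i.
Proof.
move=> H; elim: s => [|i s IH].
  by rewrite big_nil; apply: cvg_near_cst; near=> t; rewrite big_nil.
rewrite big_cons; have -> : (fun t => \sum_(j <- i :: s) f j t) = fun t => f i t + \sum_(j <- s) f j t.
  by apply/funext => t; rewrite big_cons.
exact: cvgD.
Unshelve. all: by end_near. Qed.

Section CurlFreeLimit.
Context {R : realType}.
Local Notation area := (@lebesgue_measure R \x @lebesgue_measure R)%E.
Local Notation P := (measurableTypeR R * measurableTypeR R)%type.
Variables (Omega : set (R * R)) (N : nat) (d : 'I_N -> R * R) (eps0 : R).
Hypotheses (oO : open Omega) (eps0_gt0 : 0 < eps0).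
Hypothesis disks_disjoint : forall i j, i != j -> disk (d i) eps0 `&` disk (d j) eps0 = set0.
Hypothesis disks_in : forall i, disk (d i) eps0 `<=` Omega.
Implicit Types (eps r b : R) (z : R * R) (i j : 'I_N) (f : R * R -> R * R) (phi : R * R -> R).
Local Notation perf := (perforated Omega d).

Lemma nrm2_at_near p (b : R) z : nrm2 (z - p) < b -> nbhs z (fun w : R * R => nrm2 (w - p) < b).
Proof. by move=> h; exact: (@nrm2_shift_continuous _ p z _ (lt_nbhsl h)). Qed.

Lemma nrm2_coord z r : 0 <= r -> nrm2 z <= r ^+ 2 -> `|z.1| <= r /\ `|z.2| <= r.
Proof.
move=> r0; have sq (u v : R) : u ^+ 2 + v ^+ 2 <= r ^+ 2 -> `|u| <= r.
  move=> h; rewrite -(ler_pXn2r (n := 2)) ?nnegrE// real_normK ?num_real//.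
  by apply: le_trans h; rewrite lerDl sqr_ge0.
by move=> h; split; [exact: sq h|rewrite /nrm2 addrC in h; exact: sq h].
Qed.

Lemma const_near_disk (h : R * R -> R) p r c z eps : 0 <= eps -> eps < r -> disk p eps z ->
  (forall w, disk p r w -> h w = c) -> nbhs z (fun w => h w = c).
Proof.
move=> e0 er pz hc; have zp := (diskP p z e0).1 pz.
have r0 : 0 <= r by rewrite (le_trans e0)// ltW.
have : nrm2 (z - p) < r ^+ 2 by apply: le_lt_trans zp _; rewrite ltrXn2r ?nnegrE.
move=> /nrm2_at_near; apply: filterS => w wr; apply: hc; apply/diskP => //.
exact: ltW.
Qed.

Lemma trace_ae D f F phi (lam : R) D' : L2v D f -> L2v D F -> test_fun D' phi ->
  {ae area, forall z, D z -> F z = lam *: f z} ->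
  tangential_trace D F phi = lam * tangential_trace D f phi.
Proof.
move=> Lf LF tp HF; have L1f := L1_trace Lf tp; have L1F := L1_trace LF tp.
rewrite !traceE -(intZ lam L1f); apply: (ae_int _ _ HF).
- exact: L1_measurable L1F.
- by apply: L1_measurable; exact: L1Z L1f.
move=> z HFz; have [Dz|nDz] := pselect (D z).
  by rewrite (HFz Dz) /= /GRing.scale /=; ring.
by rewrite !(indicF nDz); ring.
Qed.

(** Subtracting from [phi] the combination of radial cutoffs with coefficients [c] leaves a test
    function of the perforated domain, which curl-freeness annihilates; each cutoff contributes its
    circulation. *)
Lemma trace_const_near eps r f F phi (lam : R) (b c : 'I_N -> R) :
  0 < eps -> eps < r -> r <= eps0 -> L2v (perf eps) f -> curl_free (perf eps) f ->
  (forall i, circulation_eq Omega d eps i f (b i)) -> L2v (perf eps) F ->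
  {ae area, forall z, perf eps z -> F z = lam *: f z} ->
  test_fun Omega phi -> (forall j z, disk (d j) r z -> phi z = c j) ->
  tangential_trace (perf eps) F phi = - (lam * \sum_(j < N) c j * b j).
Proof.
move=> e0 er re Lf cf Hb LF HF tphi phic; rewrite (trace_ae Lf LF tphi HF) -mulrN; congr (_ * _).
(* The cutoffs must be 1 on disks strictly larger than those of radius [eps] and vanish beyond [r];
   the midpoint leaves room for both. *)
pose rho := (eps + r) / 2.
have rho1 : eps < rho by rewrite /rho; lra.
have rho2 : rho < r by rewrite /rho; lra.
have rho0 : 0 < rho by lra.
have sqlt : rho ^+ 2 < r ^+ 2 by rewrite ltrXn2r ?nnegrE ?ltW//; lra.
pose G := cutoff (rho ^+ 2) (r ^+ 2).
have sG : smooth1 G := smooth1_cutoff _ _.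
have Ga s : s <= rho ^+ 2 -> G s = 1 by exact: cutoff1.
have Gb0 s : r ^+ 2 < s -> G s = 0 by move=> /ltW; exact: cutoff0.
have Gb s : eps0 ^+ 2 < s -> G s = 0.
  move=> h; apply: Gb0; apply: le_lt_trans h.
  have h1 := ltW eps0_gt0; have h2 : 0 <= r by lra.
  by rewrite lerXn2r ?nnegrE.
pose chi j := radial_at (d j) G.
have tchi j : test_fun Omega (chi j).
  apply: (test_fun_radial_at (r := eps0) sG _ (lexx _) Gb) => //; exact: ltW.
pose S z := \sum_(j < N) c j * chi j z.
have tS : test_fun Omega S by apply: test_fun_sum => j; exact: test_funZ.
have tdiff : test_fun (perf eps) (fun z => phi z - S z).
  apply/test_funP; have [s1 b1 n1] := (test_funP _ _).1 tphi; have [s2 b2 n2] := (test_funP _ _).1 tS.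
  split.
  - exact: smoothGB.
  - by have [sd bd _] := (test_funP _ _).1 (test_funB tphi tS).
  move=> p nperf; have [Op|nOp] := pselect (Omega p); last first.
    by move: (n1 p nOp) (n2 p nOp); apply: filterS2 => w -> ->; rewrite subrr.
  have [i di] : exists i, disk (d i) eps p.
    apply: contrapT => nd; apply: nperf; apply/perforatedP; split => // i di.
    by apply: nd; exists i.
  have e0' := ltW e0.
  have n3 := const_near_disk e0' er di (phic i).
  have n4 : nbhs p (fun w => S w = c i).
    apply: (@const_near_disk S (d i) rho (c i) p eps) => // w dw.
    rewrite /S (bigD1 i)//= big1 => [|j ji].
      by rewrite addr0 /chi /radial_at Ga ?mulr1//; apply/diskP => //; exact: ltW.
    rewrite /chi (radial_at_other eps0_gt0 disks_disjoint Gb ji) ?mulr0//.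
    by apply: disk_le dw; lra.
  by move: n3 n4; apply: filterS2 => w -> ->; rewrite subrr.
have E1 := cf _ tdiff.
rewrite (traceB Lf tphi tS) in E1; move/eqP: E1; rewrite subr_eq0 => /eqP ->.
rewrite /S (trace_sum Lf (fun j => test_funZ (c j) (tchi j))) -sumrN.
apply: eq_bigr => j _; rewrite (traceZ _ Lf (tchi j)) -mulrN; congr (_ * _).
apply: (circulation_radial eps0_gt0 disks_disjoint disks_in sG e0 rho1 _ Ga Gb (Hb j)).
by lra.
Qed.

Lemma trace_perf eps r F phi (c : 'I_N -> R) : 0 <= eps -> eps < r ->
  smooth2 phi -> (forall j z, disk (d j) r z -> phi z = c j) ->
  tangential_trace (perf eps) F phi = tangential_trace Omega F phi.
Proof.
move=> e0 er sphi phic; rewrite !traceE; apply: eq_int => z.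
have [Oz|nOz] := pselect (Omega z); last first.
  by rewrite !(indicF nOz) !indicF// => /perforated_sub.
have [pz|npz] := pselect (perf eps z); first by rewrite !indicT.
have [i di] : exists i, disk (d i) eps z.
  apply: contrapT => nd; apply: npz; apply/perforatedP; split => // i di.
  by apply: nd; exists i.
have [-> ->] := near1_dx sphi (const_near_disk e0 er di (phic i)).
by rewrite !mulr0.
Qed.

Section Limit.
Variables (eps lam : nat -> R) (F : nat -> R * R -> R * R) (U : R * R -> R * R) (b : 'I_N -> R).
Hypotheses (eps_gt0 : forall n, 0 < eps n) (eps_cvg : eps n @[n --> \oo] --> (0 : R)).
Hypothesis lam_cvg : lam n @[n --> \oo] --> (0 : R).
Hypotheses (LF : forall n, L2v Omega (F n)) (LU : L2v Omega U).
Hypothesis wF : forall Phi : R * R -> R * R, L2v Omega Phi ->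
  (\int[area]_(z in Omega) dot (F n z) (Phi z))%R @[n --> \oo] --> \int[area]_(z in Omega) dot (U z) (Phi z).
Hypothesis HF : forall n, exists f, [/\ L2v (perf (eps n)) f, curl_free (perf (eps n)) f,
  forall i, circulation_eq Omega d (eps n) i f (b i) &
  {ae area, forall z, perf (eps n) z -> F n z = lam n *: f z}].

Lemma L2v_perf e f : L2v Omega f -> L2v (perf e) f.
Proof.
move=> [f1 f2]; have mp := perforated_measurable d oO e.
have sub : perf e `<=` Omega by exact: perforated_sub.
by split; [exact: L2_subset mp sub f1|exact: L2_subset mp sub f2].
Qed.

Lemma trace_weak_limit phi : test_fun Omega phi ->
  tangential_trace Omega (F n) phi @[n --> \oo] --> tangential_trace Omega U phi.
Proof.
move=> tphi; have tx := test_fun_dx tphi; have ty := test_fun_dy tphi.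
pose Phi z := (- dy phi z, dx phi z) : R * R.
have mO : measurable (Omega : set P) := open_measurable_plane oO.
have LPhi : L2v Omega Phi.
  split; apply/L2P; apply: sqint_indic => //; last exact: test_fun_sqint tx.
  have := sqintZ (-1) (test_fun_sqint ty); congr (sqint _ _).
  by apply/funext => z; rewrite mulN1r.
have E f : tangential_trace Omega f phi = \int[area]_(z in Omega) dot (f z) (Phi z).
  rewrite /tangential_trace int_in [RHS]int_in; apply: eq_int => z.
  by rewrite /dot /Phi /=; ring.
rewrite E; have := wF LPhi; apply: cvg_trans; apply: near_eq_cvg; near=> n.
by rewrite E.
Unshelve. all: by end_near. Qed.

(** Once [eps n < r] the trace is [lam n] times a fixed combination of the circulations, and [lam n]
    tends to 0: the scaling erases the circulations in the limit. *)
Lemma limit_trace_const phi r (c : 'I_N -> R) : test_fun Omega phi -> 0 < r -> r <= eps0 ->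
  (forall j z, disk (d j) r z -> phi z = c j) -> tangential_trace Omega U phi = 0.
Proof.
move=> tphi r0 re phic.
have c1 := trace_weak_limit tphi.
suff c2 : tangential_trace Omega (F n) phi @[n --> \oo] --> (0 : R).
  exact: (cvg_unique (@norm_hausdorff _ _) c1 c2).
have c3 : - (lam n * \sum_(j < N) c j * b j) @[n --> \oo] --> - (0 * \sum_(j < N) c j * b j).
  by apply: cvgN; apply: cvgM => //; exact: cvg_cst.
rewrite mul0r oppr0 in c3; apply: cvg_trans c3; apply: near_eq_cvg; near=> n.
have er : eps n < r by near: n; apply: (cvgr_lt 0).
have [f [Lf cf Hb ae]] := HF n.
rewrite -(trace_perf (F n) (ltW (eps_gt0 n)) er (test_fun_smooth tphi) phic).
rewrite (trace_const_near (eps_gt0 n) er re Lf cf Hb (L2v_perf _ (LF n)) ae tphi phic)//.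
Unshelve. all: by end_near. Qed.

(** On the disk of radius [del n] the factor phi - phi(d i) is of order [del n] and the gradient of
    the cutoff of order 1 / [del n], so the gradient of the product is bounded uniformly in n while
    its support shrinks to a point. *)
Lemma bump_trace_vanishes phi i : test_fun Omega phi ->
  tangential_trace Omega U (fun z => (phi z - phi (d i)) *
     radial_at (d i) (cutoff ((eps0 / n.+2%:R) ^+ 2 / 2) ((eps0 / n.+2%:R) ^+ 2)) z) @[n --> \oo] --> (0 : R).
Proof.
move=> tphi.
pose del n : R := eps0 / n.+2%:R.
have del0 n : 0 < del n by rewrite divr_gt0.
have delc : del n @[n --> \oo] --> (0 : R).
  have h : (n.+2%:R^-1 : R) @[n --> \oo] --> (0 : R).
    rewrite (_ : (fun n => _) = fun n => harmonic (n + 1)%N); last first.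
      by apply/funext => n; rewrite /harmonic addn1.
    by rewrite cvg_shiftn; exact: cvg_harmonic.
  by rewrite -[X in _ --> X](mulr0 eps0); apply: cvgM => //; exact: cvg_cst.
pose G n := cutoff (del n ^+ 2 / 2) (del n ^+ 2).
have ab n : del n ^+ 2 / 2 < del n ^+ 2.
  by have : 0 < del n ^+ 2 by [rewrite exprn_gt0]; lra.
have sG n : smooth1 (G n) := smooth1_cutoff _ _.
pose g n z := (phi z - phi (d i)) * radial_at (d i) (G n) z.
have sphi := test_fun_smooth tphi.
have sphi1 : smooth2 (fun z => phi z - phi (d i)) by apply: smoothGB => //; exact: smoothG_cst.
have schi n : smooth2 (radial_at (d i) (G n)) := smooth2_radial_at (d i) (sG n).
have [M1 [M10 HM1]] := test_fun_bounded (test_fun_dx tphi).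
have [M2 [M20 HM2]] := test_fun_bounded (test_fun_dy tphi).
pose M := Num.max M1 M2.
have M0 : 0 <= M by rewrite le_max M10.
have HMx z : `|dx phi z| <= M by rewrite (le_trans (HM1 z))// le_max lexx.
have HMy z : `|dy phi z| <= M by rewrite (le_trans (HM2 z))// le_max lexx orbT.
have lip z : `|phi z - phi (d i)| <= M * (`|z.1 - (d i).1| + `|z.2 - (d i).2|).
  pose r := `|z.1 - (d i).1| + `|z.2 - (d i).2| + 1.
  apply: (@le_MVT_plane _ phi (dx phi) (dy phi) (d i) r) => //.
  - by move=> u _; split; [exact: is_derive_dx|exact: is_derive_dy].
  - have n1 := normr_ge0 (z.1 - (d i).1); have n2 := normr_ge0 (z.2 - (d i).2).
    by split; rewrite /ball /= distrC /r; lra.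
have [S S0 HS] := @cutoff_derive R.
have dgx n z : dx (g n) z = (phi z - phi (d i)) * (2 * (z.1 - (d i).1) * 'D_1 (G n) (nrm2 (z - d i))) +
    radial_at (d i) (G n) z * dx phi z.
  by rewrite /g dxM// dx_radial_at// dxB ?dx_cst ?subr0//; exact: smoothG_cst.
have dgy n z : dy (g n) z = (phi z - phi (d i)) * (2 * (z.2 - (d i).2) * 'D_1 (G n) (nrm2 (z - d i))) +
    radial_at (d i) (G n) z * dy phi z.
  by rewrite /g dyM// dy_radial_at// dyB ?dy_cst ?subr0//; exact: smoothG_cst.
have G01 n s : `|G n s| <= 1.
  by have /andP[h0 h1] := cutoff01 (del n ^+ 2 / 2) (del n ^+ 2) s; rewrite ger0_norm.
have Dout n z : del n ^+ 2 < nrm2 (z - d i) -> 'D_1 (G n) (nrm2 (z - d i)) = 0.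
  by apply: derive_gt0 => // s sb; rewrite /G cutoff0// ltW.
have far n z : del n ^+ 2 < nrm2 (z - d i) -> dx (g n) z = 0 /\ dy (g n) z = 0.
  move=> h; rewrite dgx dgy Dout// /radial_at /G cutoff0 ?ltW//.
  by rewrite !mulr0 !mul0r addr0.
have bound n z (x m : R) : `|x| <= del n -> `|m| <= M -> nrm2 (z - d i) <= del n ^+ 2 ->
    `|(phi z - phi (d i)) * (2 * x * 'D_1 (G n) (nrm2 (z - d i))) +
      radial_at (d i) (G n) z * m| <= 8 * M * S + M.
  move=> xd mM zd.
  have dn := del0 n; have dn2 : 0 < del n ^+ 2 by rewrite exprn_gt0.
  have zb := (diskP (d i) z (ltW dn)).2 zd.
  have [z1 z2] := nrm2_coord (ltW dn) zd; rewrite /= in z1 z2.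
  have p1 : `|phi z - phi (d i)| <= M * (2 * del n).
    by apply: le_trans (lip z) _; rewrite ler_wpM2l//; lra.
  have p2 : `|'D_1 (G n) (nrm2 (z - d i))| <= S / (del n ^+ 2 / 2).
    have := HS _ _ (nrm2 (z - d i)) (ab n).
    by have -> : del n ^+ 2 - del n ^+ 2 / 2 = del n ^+ 2 / 2 by field.
  apply: le_trans (ler_normD _ _) _; apply: lerD.
    rewrite !normrM [ `|2| ]ger0_norm//.
    (* The factors are the oscillation 2 M del of [phi], the factor 2 del from differentiating the
       squared radius, and the slope 2 S / del^2 of the cutoff. *)
    have -> : 8 * M * S = (M * (2 * del n)) * (2 * del n * (S / (del n ^+ 2 / 2))).
      by field; rewrite gt_eqF.
    apply: ler_pM => //.
    by apply: ler_pM => //; rewrite ler_wpM2l.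
  rewrite normrM -[leRHS]mul1r; apply: ler_pM => //; exact: G01.
pose B := 8 * M * S + M.
have B0 : 0 <= B by rewrite addr_ge0// !mulr_ge0.
have dgb n z : `|dx (g n) z| <= B /\ `|dy (g n) z| <= B.
  have [h|h] := leP (nrm2 (z - d i)) (del n ^+ 2); last first.
    by have [-> ->] := far n z h; rewrite normr0.
  have [z1 z2] := nrm2_coord (ltW (del0 n)) h.
  by split; [rewrite dgx|rewrite dgy]; apply: bound.
(* All supports lie in this fixed disk; multiplying by its indicator turns the square-integrable [U]
   into an integrable majorant. *)
pose K := disk (d i) eps0.
have e0n := ltW eps0_gt0.
have SK : sqint area (\1_K : P -> R).
  have [c Kc] := compact_bounded_box (@disk_compact _ (d i) eps0).
  apply: (@sqint_bounded_support _ _ 1 c).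
  - by apply: measurable_indic; apply: closed_measurable_plane; exact: disk_closed.
  - by move=> z; have /andP[h0 h1] := indic01 K z; rewrite ger0_norm.
  - by move=> z zc; rewrite indicF// => /Kc.
have [/L2P LU1 /L2P LU2] := LU.
have LK1 := sqint_mul LU1 SK; have LK2 := sqint_mul LU2 SK.
pose f n (z : P) := \1_Omega z * (U z).2 * dx (g n) z - \1_Omega z * (U z).1 * dy (g n) z.
pose f0 (z : P) := if z == d i then \1_Omega z * (U z).2 * dx phi z - \1_Omega z * (U z).1 * dy phi z else 0.
pose dom (z : P) := B * (`|\1_Omega z * (U z).1 * \1_K z| + `|\1_Omega z * (U z).2 * \1_K z|).
have Ldom : L1 area dom by apply: L1Z; apply: L1D; apply: L1_norm.
have del1 n : del n <= eps0 by rewrite ler_pdivrMr// ler_peMr// ler1n.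
have mf n : measurable_fun setT (f n).
  have cx := continuous_measurable_plane (smoothG_continuous (smooth2_dx (smoothGM sphi1 (schi n)))).
  have cy := continuous_measurable_plane (smoothG_continuous (smooth2_dy (smoothGM sphi1 (schi n)))).
  apply: measurable_funB; apply: measurable_funM; [exact: sqint_measurable LU2|exact: cx|exact: sqint_measurable LU1|exact: cy].
have pf z : f n z @[n --> \oo] --> f0 z.
  rewrite /f0; case: eqP => [->|/eqP zd].
    apply: cvg_near_cst; near=> n.
    have r1 : radial_at (d i) (G n) (d i) = 1.
      rewrite /radial_at (subrr (d i)) /nrm2 expr0n addr0.
      by apply: cutoff1 => //; rewrite divr_ge0// sqr_ge0.
    have dxi : dx (g n) (d i) = dx phi (d i).
      by rewrite dgx (subrr (phi (d i))) mul0r add0r r1 mul1r.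
    have dyi : dy (g n) (d i) = dy phi (d i).
      by rewrite dgy (subrr (phi (d i))) mul0r add0r r1 mul1r.
    by rewrite /f dxi dyi.
  have n0 := nrm2_sub_gt0 zd.
  apply: cvg_near_cst; near=> n; rewrite /f.
  have [-> ->] : dx (g n) z = 0 /\ dy (g n) z = 0.
    apply: far; near: n; apply: (cvgr_lt 0) => //.
    rewrite -[X in _ --> X](mulr0 (0 : R)); rewrite (_ : (fun n => _) = fun n => del n * del n); last first.
      by apply/funext => n; rewrite expr2.
    exact: cvgM.
  by rewrite !mulr0 subrr.
have sc (u x : R) : `|x| <= B -> `|u * x| <= B * `|u|.
  by move=> h; rewrite normrM mulrC ler_wpM2r.
have bf n z : `|f n z| <= dom z.
  rewrite /f; have [Kz|nKz] := pselect (K z).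
    rewrite /dom (indicT Kz) !mulr1 mulrDr [leRHS]addrC.
    apply: le_trans (ler_normB _ _) _; have [h1 h2] := dgb n z.
    exact: lerD (sc _ _ h1) (sc _ _ h2).
  have [-> ->] : dx (g n) z = 0 /\ dy (g n) z = 0.
    apply: far; rewrite ltNge; apply/negP => h; apply: nKz; apply/diskP => //.
    have dn := ltW (del0 n).
    by apply: le_trans h _; rewrite lerXn2r ?nnegrE.
  by rewrite !mulr0 subrr normr0 mulr_ge0// addr_ge0.
have [Lf0 cvf] := int_dct mf pf bf Ldom.
have If0 : \int[area]_z f0 z = 0.
  rewrite -[RHS](int0 area); apply: ae_eq_int.
  - exact: L1_measurable Lf0.
  - exact: measurable_cst.
  exists [set (d i : P)]; split; [|exact: area_point|].
    by apply: closed_measurable_plane; apply: compact_closed_plane; exact: compact_set1.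
  by move=> z /= fz; apply: contrapT => /eqP zd; apply: fz; rewrite /f0 ifN.
rewrite If0 in cvf; apply: cvg_trans cvf; apply: near_eq_cvg; near=> n.
by rewrite traceE.
Unshelve. all: by end_near. Qed.

(** For every n, [phi] minus its n-th bumps is constant near each centre, so the trace of [phi]
    equals that of the bumps. The left-hand side does not depend on n and the right-hand side tends
    to 0. *)
Lemma curl_free_limit : curl_free Omega U.
Proof.
move=> phi tphi.
pose del n : R := eps0 / n.+2%:R.
have del0 n : 0 < del n by rewrite divr_gt0.
have e0n := ltW eps0_gt0.
have del1 n : del n <= eps0 by rewrite ler_pdivrMr// ler_peMr// ler1n.
pose G n := cutoff (del n ^+ 2 / 2) (del n ^+ 2).
have ab n : del n ^+ 2 / 2 < del n ^+ 2.
  by have : 0 < del n ^+ 2 by [rewrite exprn_gt0]; lra.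
have sG n : smooth1 (G n) := smooth1_cutoff _ _.
have Gb n s : eps0 ^+ 2 < s -> G n s = 0.
  move=> h; apply: cutoff0 => //; apply: le_trans _ (ltW h).
  by have dn := ltW (del0 n); rewrite lerXn2r ?nnegrE.
pose g n i z := (phi z - phi (d i)) * radial_at (d i) (G n) z.
have tg n i : test_fun Omega (g n i).
  apply: test_funM; last by apply: smoothGB; [exact: test_fun_smooth tphi|exact: smoothG_cst].
  apply: (test_fun_radial_at (r := eps0) (sG n) _ (lexx _) (Gb n)) => //; exact: ltW.
pose S n z := \sum_(i < N) g n i z.
have tS n : test_fun Omega (S n) by apply: test_fun_sum.
have E n : tangential_trace Omega U phi = \sum_(i < N) tangential_trace Omega U (g n i).
  rewrite -(trace_sum LU (tg n)); apply/eqP; rewrite -subr_eq0 -(traceB LU tphi (tS n)); apply/eqP.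
  (* On the disk of radius del/2 the squared distance is at most del^2/4, below del^2/2, where the
     cutoff is still 1. *)
  apply: (@limit_trace_const _ (del n / 2) (fun i => phi (d i))); first exact: test_funB.
  - by rewrite divr_gt0.
  - by have := del0 n; have := del1 n; lra.
  - move=> j z dz; have dj : disk (d j) eps0 z.
      by apply: disk_le dz; have := del0 n; have := del1 n; lra.
    rewrite /S (bigD1 j)//= big1 => [|i ij]; last first.
      by rewrite /g (radial_at_other eps0_gt0 disks_disjoint (Gb n) ij dj) mulr0.
    rewrite addr0 /g /radial_at /G cutoff1 ?mulr1//; first by ring.
    have h : 0 <= del n / 2 by rewrite divr_ge0// ltW.
    have {}dz := (diskP _ _ h).1 dz; apply: le_trans dz _.
    have -> : (del n / 2) ^+ 2 = del n ^+ 2 / 4 by field.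
    by have := sqr_ge0 (del n); lra.
have c0 : \sum_(i < N) tangential_trace Omega U (g n i) @[n --> \oo] --> \sum_(i < N) (0 : R).
  by apply: cvg_bigsum => i; exact: bump_trace_vanishes.
rewrite big1// in c0.
have c1 : \sum_(i < N) tangential_trace Omega U (g n i) @[n --> \oo] --> tangential_trace Omega U phi.
  rewrite (_ : (fun n => _) = fun=> tangential_trace Omega U phi); first exact: cvg_cst.
  by apply/funext => n; rewrite -E.
exact: (cvg_unique (@norm_hausdorff _ _) c1 c0).
Qed.

End Limit.
End CurlFreeLimit.

(** * Lower bound *)

Section LogCutoff.
Context {R : realType}.
Local Notation area := (@lebesgue_measure R \x @lebesgue_measure R)%E.
Local Notation P := (measurableTypeR R * measurableTypeR R)%type.

Lemma smooth1_annular_inv (a b : R) : 0 < a -> smooth1 (fun s => annular a b s * s^-1).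
Proof.
move=> a0; apply: (smooth1_div a0 (smooth1_annular a b)) => s sa.
by apply: annular_low => //; exact: ltW.
Qed.

Lemma is_derive_ln (s : R) : 0 < s -> is_derive s 1 (@ln R) s^-1.
Proof. exact: is_derive1_ln. Qed.

(* The capacity potential of the annulus, with [ln] of the squared radius smoothed at both ends. *)
Lemma log_cutoff (eps del : R) : 0 < eps -> 16 * eps ^+ 2 < del ^+ 2 ->
  exists G : R -> R, [/\ smooth1 G, forall s, s <= 4 * eps ^+ 2 -> G s = 1,
    forall s, del ^+ 2 <= s -> G s = 0 &
    forall p, \int[area]_z (dx (radial_at p G) z ^+ 2 + dy (radial_at p G) z ^+ 2) <=
      4 * pi / (ln (del ^+ 2 / 2) - ln (8 * eps ^+ 2))].
Proof.
move=> e0 ed.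
(* In squared radius: the cutoff stays 1 up to radius 2 eps, beyond the hole as [circulation_eq]
   requires, and reaches 0 at 2 b = del^2. The hypothesis 16 eps^2 < del^2 provides 2 a <= b. *)
pose a := 4 * eps ^+ 2; pose b := del ^+ 2 / 2.
have a0 : 0 < a by rewrite mulr_gt0// exprn_gt0.
have ab : 2 * a <= b by rewrite /a /b; lra.
have b0 : 0 < b by lra.
have sw := @smooth1_annular_inv a b a0.
pose H := wprim a b (fun s => s^-1); pose M := H (2 * b).
have dln (s : R) : 0 < s -> is_derive s 1 (@ln R) s^-1 by exact: is_derive_ln.
have winv (s : R) : 0 < s -> 0 <= s^-1 by move=> s0; rewrite invr_ge0 ltW.
have /andP[M1 _] := wprim_bounds a0 ab sw dln winv.
have a2 : 2 * a = 8 * eps ^+ 2 by rewrite /a; ring.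
rewrite a2 -/H -/M in M1.
have b2 : 2 * b = del ^+ 2 by rewrite /b; field.
set m := ln b - _ in M1.
have m0 : 0 < m by rewrite /m subr_gt0 ltr_ln ?posrE -?a2//; [rewrite /a /b; lra|lra].
have M0 : 0 < M by exact: lt_le_trans m0 M1.
have sH : smooth1 H := smooth1_wprim a0 ab sw.
have Hlow s : s < a -> H s = 0 by move=> /ltW; exact: wprim_low.
have Hhigh s : 2 * b < s -> H s = M by move=> /ltW; exact: wprim_high.
pose G s := 1 - M^-1 * H s.
have sG : smooth1 G by apply: smoothGB; [exact: smoothG_cst|exact: smoothGZ].
have dG (s : R) : 'D_1 G s = - (M^-1 * (annular a b s * s^-1)).
  have dH := wprim_derive a0 ab sw s.
  have := is_deriveB (is_derive_cst (1 : R) s (1 : R)) (is_deriveZ M^-1 dH).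
  by rewrite sub0r => /@derive_val.
have Ghigh s : del ^+ 2 <= s -> G s = 0.
  move=> sd; have Hs : H s = M by apply: wprim_high => //; rewrite b2.
  by rewrite /G Hs mulVf ?subrr// gt_eqF.
exists G; split => //.
- by move=> s sa; rewrite /G /H wprim_low// mulr0 subr0.
move=> p.
have LH : L1 area (fun z : P => 'D_1 H (nrm2 z)).
  exact: L1_radial (smooth1_derive sH) (derive_gt0 sH Hhigh).
have IH := int_radial a0 sH Hlow Hhigh.
have dHE (s : R) : 'D_1 H s = annular a b s * s^-1.
  by have dH := wprim_derive a0 ab sw s; rewrite derive_val.
have LHs : L1 area (fun z : P => 'D_1 H (nrm2 (z - p))) by exact: (L1_shift (- p) LH).
have L2 := L1Z (4 / M ^+ 2) LHs.
have I2 : \int[area]_z (4 / M ^+ 2 * 'D_1 H (nrm2 (z - p))) = 4 / M ^+ 2 * (pi * M).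
  by rewrite (intZ _ LHs); congr (_ * _); exact: etrans (int_shift (- p) LH) IH.
apply: (@le_trans _ _ (4 * pi / M)); last first.
  by rewrite ler_wpM2l ?mulr_ge0 ?pi_ge0// lef_pV2.
have -> : 4 * pi / M = 4 / M ^+ 2 * (pi * M) by field; rewrite gt_eqF.
rewrite -I2; apply: int_le => //.
  have tr : test_fun setT (radial_at p G).
    apply: (@test_fun_radial_at _ _ _ _ (del ^+ 2) `|del|) => //.
    - by rewrite real_normK ?num_real.
    - by move=> s /ltW; exact: Ghigh.
  have sx := test_fun_sqint (test_fun_dx tr); have sy := test_fun_sqint (test_fun_dy tr).
  by apply: L1D; [exact: sx.2|exact: sy.2].
have Mn0 : M != 0 by rewrite gt_eqF.
(* With A the smooth indicator and s the squared radius, the squared gradient is 4 A^2 / (M^2 s), at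
   most 4 / M^2 times the derivative A / s of [H], whose integral over the plane is pi M. *)
have K (x y A t : R) : t = x ^+ 2 + y ^+ 2 -> t != 0 ->
    (2 * x * - (M^-1 * (A * t^-1))) ^+ 2 + (2 * y * - (M^-1 * (A * t^-1))) ^+ 2 = 4 / M ^+ 2 * (A ^+ 2 / t).
  move=> tE t0; transitivity (4 / M ^+ 2 * (A ^+ 2 * (x ^+ 2 + y ^+ 2) / t ^+ 2)).
    by field; rewrite t0 Mn0.
  by rewrite -tE; field; rewrite t0 Mn0.
move=> z; rewrite dx_radial_at// dy_radial_at// dG dHE; set s := nrm2 (z - p).
have s0 : 0 <= s by exact: nrm2_ge0.
have /andP[g0 g1] : 0 <= annular a b s <= 1 by rewrite annular_ge0 annular_le1.
have [sz|sz] := eqVneq s 0.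
  by rewrite sz invr0 !mulr0 oppr0 !mulr0 expr0n addr0.
rewrite (K _ _ _ s)//.
apply: ler_wpM2l; first by rewrite divr_ge0// sqr_ge0.
by apply: ler_wpM2r; [rewrite invr_ge0|rewrite expr2 ler_piMl].
Qed.

End LogCutoff.

Section Gradient.
Context {R : realType}.
Local Notation area := (@lebesgue_measure R \x @lebesgue_measure R)%E.
Local Notation P := (measurableTypeR R * measurableTypeR R)%type.
Variables (D : set (R * R)).
Hypotheses (oD : open D) (bD : bounded_set D) (scD : simply_connected D) (lipD : lipschitz_boundary D).

Lemma curl_free_gradient U p0 : D p0 -> L2v D U -> curl_free D U -> exists v, H1_gradient D v U.
Proof.
move=> Dp0 LU cU; have [/L2P S1 /L2P S2] := LU.
have mD : measurable (D : set P) := open_measurable_plane oD.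
have Z1 z : ~ D z -> \1_D z * (U z).1 = 0 by move=> nDz; rewrite indicF// mul0r.
have Z2 z : ~ D z -> \1_D z * (U z).2 = 0 by move=> nDz; rewrite indicF// mul0r.
have orth f g : test_fun D f -> test_fun D g -> (forall z, dx f z + dy g z = 0) ->
    \int[area]_z (\1_D z * (U z).1 * f z + \1_D z * (U z).2 * g z) = 0.
  move=> tf tg dfg; apply: (curl_free_orthogonal oD scD _ tf tg dfg) => phi tphi.
  by have := cU phi tphi; rewrite traceE.
have [v [Sv Hv]] := potential_exists oD bD scD.1 lipD S1 S2 Z1 Z2 Dp0 orth.
have off (g : R * R -> R) phi z : test_fun D phi -> \1_D z * (g z * phi z) = g z * phi z.
  move=> tphi; have [Dz|nDz] := pselect (D z); first by rewrite indicT// mul1r.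
  by rewrite (test_fun_out tphi nDz) !mulr0.
exists v; split => //; first by apply/L2P; exact: sqint_indic.
move=> phi tphi; have [h1 h2] := Hv phi tphi.
split; [rewrite int_in [X in - X]int_in|rewrite int_in [X in - X]int_in].
- transitivity (\int[area]_z (v z * dx phi z)); first by apply: eq_int => z; exact/off/test_fun_dx.
  by rewrite h1; congr (- _); apply: eq_int => z; rewrite mulrA.
- transitivity (\int[area]_z (v z * dy phi z)); first by apply: eq_int => z; exact/off/test_fun_dy.
  by rewrite h2; congr (- _); apply: eq_int => z; rewrite mulrA.
Qed.

Lemma gradient_curl_free U v : H1_gradient D v U -> curl_free D U.
Proof.
move=> [Lv LU Hv] phi tphi.
have [_ hy] := Hv _ (test_fun_dx tphi); have [hx _] := Hv _ (test_fun_dy tphi).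
have [/L2P S1 /L2P S2] := LU.
have L1x := sqint_L1_test S2 (test_fun_dx tphi); have L1y := sqint_L1_test S1 (test_fun_dy tphi).
rewrite traceE (intB L1x L1y).
have E1 : \int[area]_z (\1_D z * (U z).2 * dx phi z) = \int[area]_(z in D) ((U z).2 * dx phi z).
  by rewrite [RHS]int_in; apply: eq_int => z; rewrite mulrA.
have E2 : \int[area]_z (\1_D z * (U z).1 * dy phi z) = \int[area]_(z in D) ((U z).1 * dy phi z).
  by rewrite [RHS]int_in; apply: eq_int => z; rewrite mulrA.
have hxy : \int[area]_(z in D) (v z * dy (dx phi) z) = \int[area]_(z in D) (v z * dx (dy phi) z).
  have E : dx (dy phi) = dy (dx phi).
    by apply/funext => z; exact: (dx_dy z (test_fun_smooth tphi)).
  exact: (congr1 (fun h : R * R -> R => \int[area]_(z in D) (v z * h z)) (esym E)).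
have Z (x y : R) : x = y -> x - y = 0 by move=> ->; rewrite subrr.
rewrite E1 E2 {E1 E2}.
have h1 := etrans hxy hx.
have h2 := etrans (esym hy) h1.
by apply: Z; exact: oppr_inj h2.
Qed.

End Gradient.

Section EnergyInt.
Context {R : realType}.
Local Notation area := (@lebesgue_measure R \x @lebesgue_measure R)%E.
Local Notation P := (measurableTypeR R * measurableTypeR R)%type.
Implicit Types (D : set (R * R)) (F G : R * R -> R * R).

Lemma indicM D z (x y : R) : \1_D z * x * (\1_D z * y) = \1_D z * (x * y).
Proof. by rewrite indicE; case: (z \in D); rewrite ?mul1r ?mul0r. Qed.

Lemma L1_dot D F G : L2v D F -> L2v D G -> L1 area (fun z : P => \1_D z * dot (F z) (G z)).
Proof.
move=> [/L2P F1 /L2P F2] [/L2P G1 /L2P G2].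
apply: eq_L1 (L1D (sqint_mul F1 G1) (sqint_mul F2 G2)) => z.
by rewrite !indicM /dot mulrDr.
Qed.

Variables (Cc Rc Kc : R).

Lemma L1_energy D F G : L2v D F -> L2v D G ->
  L1 area (fun z : P => \1_D z * energy_density Cc Rc Kc (F z) (G z)).
Proof.
move=> LF LG.
apply: eq_L1 (L1Z 2^-1 (L1D (L1D (L1Z Cc (L1_dot LF LF)) (L1Z Kc (L1_dot LG LG)))
  (L1Z (2 * Rc) (L1_dot LF LG)))) => z.
by rewrite /energy_density; ring.
Qed.

Lemma L1_polar D F G F' G' : L2v D F -> L2v D G -> L2v D F' -> L2v D G' ->
  L1 area (fun z : P => \1_D z * polar_density Cc Rc Kc (F z) (G z) (F' z) (G' z)).
Proof.
move=> LF LG LF' LG'.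
apply: eq_L1 (L1D (L1D (L1Z Cc (L1_dot LF LF')) (L1Z Kc (L1_dot LG LG')))
  (L1Z Rc (L1D (L1_dot LF LG') (L1_dot LF' LG)))) => z.
by rewrite /polar_density; ring.
Qed.

Lemma integral_in_EFin D (h : P -> R) : L1 area (fun z : P => \1_D z * h z) ->
  (\int[area]_(z in D) (h z)%:E)%E = (\int[area]_z (\1_D z * h z))%:E.
Proof.
move=> Lh; rewrite -(int_EFin Lh) [LHS]integral_mkcond; apply: eq_integral => z _.
by rewrite patchE indicE; case: (z \in D); rewrite ?mul1r ?mul0r.
Qed.

End EnergyInt.

Lemma cvg_le_bound {R : realType} (T : Type) (F : set_system T) {FF : ProperFilter F} (u : T -> R) (l A : R) :
  (\forall t \near F, u t <= A) -> u t @[t --> F] --> l -> l <= A.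
Proof. by move=> H c; exact: (@closed_cvg _ _ F FF u (fun x => x <= A) (@closed_le R A) H l c). Qed.

Section LowerBound.
Context {R : realType}.
Local Notation area := (@lebesgue_measure R \x @lebesgue_measure R)%E.
Local Notation P := (measurableTypeR R * measurableTypeR R)%type.
Variables (Omega : set (R * R)) (N : nat) (d : 'I_N -> R * R) (eps0 : R).
Hypotheses (oO : open Omega) (eps0_gt0 : 0 < eps0).
Hypothesis disks_disjoint : forall i j, i != j -> disk (d i) eps0 `&` disk (d j) eps0 = set0.
Hypothesis disks_in : forall i, disk (d i) eps0 `<=` Omega.
Variables (bu bw : 'I_N -> R) (Cc Rc Kc : R).
Hypotheses (C0 : 0 < Cc) (CKR : Rc ^+ 2 < Cc * Kc).
Implicit Types (eps r b : R) (z : R * R) (i j : 'I_N).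
Local Notation perf := (perforated Omega d).
Local Notation dens := (energy_density Cc Rc Kc).
Local Notation polar := (polar_density Cc Rc Kc).
Local Notation q i := (Cc * bu i ^+ 2 + Kc * bw i ^+ 2 + 2 * Rc * bu i * bw i).

(** One component of the admissibility condition in [Jeps], with the factor left free. *)
Definition scaled_by eps (lam : R) (b : 'I_N -> R) F := exists f : R * R -> R * R,
  [/\ L2v (perf eps) f, curl_free (perf eps) f,
  forall i, circulation_eq Omega d eps i f (b i) &
  {ae area, forall z, perf eps z -> F z = lam *: f z}].

(** The tangent inequality is applied at (U, W) off the disks of radius [del] and at t (bu i, bw i)
    times the field [kap i] inside them, then integrated. The polar term becomes lam q_i by the
    circulation conditions, the quadratic one t^2 q_i / 2 times a Dirichlet integral bounded by
    [log_cutoff]; t is left free. *)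
Lemma annulus_gain eps lam del t (U W F G : R * R -> R * R) : 0 < eps -> 16 * eps ^+ 2 < del ^+ 2 ->
  0 < del -> del <= eps0 -> L2v Omega U -> L2v Omega W -> L2v Omega F -> L2v Omega G ->
  scaled_by eps lam bu F -> scaled_by eps lam bw G ->
  \int[area]_z (\1_(perf del) z * polar (U z) (W z) (F z) (G z)) -
  \int[area]_z (\1_(perf del) z * dens (U z) (W z)) +
  \sum_(i < N) q i * (t * lam - t ^+ 2 * (2 * pi / (ln (del ^+ 2 / 2) - ln (8 * eps ^+ 2)))) <=
  \int[area]_z (\1_(perf eps) z * dens (F z) (G z)).
Proof.
move=> e0 ed del0 de LU LW LF LG SF SG.
have [H [sH H1 H0 HI]] := log_cutoff e0 ed.
set m := ln _ - ln _ in HI *.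
have q0 i : 0 <= q i := quadratic_ge0 C0 CKR (bu i) (bw i).
pose psi i := radial_at (d i) H.
(* The rotation is oriented so that the integral of kap . F is minus the tangential trace, hence
   plus the scaled circulation. *)
pose kap i z := (dy (psi i) z, - dx (psi i) z) : R * R.
have e0n := ltW eps0_gt0; have dn := ltW del0.
have d2 : del ^+ 2 <= eps0 ^+ 2 by rewrite lerXn2r ?nnegrE.
have Hb s : eps0 ^+ 2 < s -> H s = 0 by move=> h; apply: H0; apply: le_trans d2 (ltW h).
have tpsi i : test_fun Omega (psi i).
  by apply: (test_fun_radial_at (r := eps0) sH _ (lexx _) Hb).
have kap0 i z : ~ disk (d i) del z -> kap i z = 0.
  move=> nd; have h : del ^+ 2 < nrm2 (z - d i).
    by rewrite ltNge; apply/negP => h; apply: nd; apply/diskP.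
  have D0 : 'D_1 H (nrm2 (z - d i)) = 0.
    by apply: (derive_gt0 (b := del ^+ 2) (c := 0)) => // s /ltW; exact: H0.
  by rewrite /kap dx_radial_at// dy_radial_at// D0 !mulr0 oppr0.
have e4 : 4 * eps < del.
  have h : 0 <= 4 * eps by rewrite mulr_ge0// ltW.
  rewrite -(ltr_pXn2r (n := 2)) ?nnegrE//.
  by have -> : (4 * eps) ^+ 2 = 16 * eps ^+ 2 by ring.
have ee : 2 * eps <= eps0 by lra.
have sub : perf eps `<=` Omega by exact: perforated_sub.
have Lp V : L2v Omega V -> L2v (perf eps) V by exact: L2v_perf.
have Lk i : L2v Omega (kap i).
  have mO : measurable (Omega : set P) := open_measurable_plane oO.
  split; apply/L2P; apply: sqint_indic => //; first exact: test_fun_sqint (test_fun_dy (tpsi i)).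
  have := sqintZ (-1) (test_fun_sqint (test_fun_dx (tpsi i))); congr (sqint _ _).
  by apply/funext => z; rewrite mulN1r.
have circ i (b : 'I_N -> R) V : L2v Omega V -> scaled_by eps lam b V ->
    \int[area]_z (\1_(perf eps) z * dot (kap i z) (V z)) = lam * b i.
  move=> LV [f [Lf cf Hf ae]].
  have c1 j z : disk (d j) (2 * eps) z -> psi i z = (j == i)%:R.
    move=> dz; case: (eqVneq j i) dz => [->|ji] dz.
      rewrite /psi /radial_at H1//.
      have e2 : 0 <= 2 * eps by rewrite mulr_ge0// ltW.
      have := (diskP (d i) z e2).1 dz.
      by have -> : (2 * eps) ^+ 2 = 4 * eps ^+ 2 by ring.
    apply: (radial_at_other eps0_gt0 disks_disjoint Hb (j := j)); first by rewrite eq_sym.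
    exact: disk_le dz.
  have er : eps < 2 * eps by lra.
  have := trace_const_near eps0_gt0 disks_disjoint disks_in e0 er ee Lf cf Hf (Lp _ LV) ae (tpsi i) c1.
  rewrite (bigD1 i)//= eqxx mul1r big1 ?addr0 => [|j /negPf ->]; last by rewrite mul0r.
  rewrite traceE => h; rewrite -[RHS]opprK -h -intN; last exact: L1_trace (Lp _ LV) (tpsi i).
  by apply: eq_int => z; rewrite /dot /=; ring.
pose T i z := t * (\1_(perf eps) z * polar (bu i *: kap i z) (bw i *: kap i z) (F z) (G z)) -
  t ^+ 2 * (q i / 2 * (dx (psi i) z ^+ 2 + dy (psi i) z ^+ 2)).
have densk i z : dens (bu i *: kap i z) (bw i *: kap i z) =
    q i / 2 * (dx (psi i) z ^+ 2 + dy (psi i) z ^+ 2).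
  by rewrite /energy_density /dot /= /GRing.scale /=; field.
have point z : \1_(perf del) z * polar (U z) (W z) (F z) (G z) - \1_(perf del) z * dens (U z) (W z) +
    \sum_(i < N) T i z <= \1_(perf eps) z * dens (F z) (G z).
  have ede : eps <= del by lra.
  have T0 i : ~ disk (d i) del z -> T i z = 0.
    move=> nd; rewrite /T -densk kap0// !scaler0.
    have -> : polar 0 0 (F z) (G z) = 0 by rewrite /polar_density /dot /=; ring.
    have -> : dens 0 0 = 0 by rewrite /energy_density /dot /=; ring.
    by rewrite !mulr0 subrr.
  have [zd|nzd] := pselect (perf del z).
    have ze := perforated_le ede zd.
    rewrite big1 => [|i _]; last by apply: T0; move/perforatedP: zd => [_]; exact.
    by rewrite (indicT zd) (indicT ze) !mul1r addr0; exact: energy_density_tangent.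
  rewrite (indicF nzd) !mul0r subrr add0r.
  have [ze|nze] := pselect (perf eps z); last first.
    rewrite (indicF nze) mul0r sumr_le0// => i _; rewrite /T (indicF nze) mul0r mulr0 sub0r oppr_le0.
    by rewrite mulr_ge0 ?sqr_ge0// mulr_ge0 ?divr_ge0// addr_ge0 ?sqr_ge0.
  have [i di] : exists i, disk (d i) del z.
    apply: contrapT => nd; apply: nzd; apply/perforatedP; split; first exact: perforated_sub ze.
    by move=> i di; apply: nd; exists i.
  rewrite (bigD1 i)//= big1 ?addr0 => [|j ji]; last first.
    apply: T0 => dj; move/eqP: ji; apply; apply: (disk_eq disks_disjoint (z := z)).
      exact: disk_le dj.
    exact: disk_le di.
  rewrite (indicT ze) mul1r /T (indicT ze) mul1r -densk.
  have := energy_density_tangent C0 CKR (F z) (G z) (t *: (bu i *: kap i z)) (t *: (bw i *: kap i z)).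
  rewrite energy_density_scale; congr (_ - _ <= _).
  by rewrite /polar_density /dot /= /GRing.scale /=; ring.
have Ld V : L2v Omega V -> L2v (perf del) V by exact: L2v_perf.
have J1 := L1_polar Cc Rc Kc (Ld _ LU) (Ld _ LW) (Ld _ LF) (Ld _ LG).
have J2 := L1_energy Cc Rc Kc (Ld _ LU) (Ld _ LW).
have J3 := L1_energy Cc Rc Kc (Lp _ LF) (Lp _ LG).
have Lbk i (b : R) : L2v (perf eps) (fun z => b *: kap i z).
  have [/L2P k1 /L2P k2] := Lp _ (Lk i); split; apply/L2P.
    have := sqintZ b k1; congr (sqint _ _); apply/funext => z.
    by rewrite /= /GRing.scale /=; ring.
  have := sqintZ b k2; congr (sqint _ _); apply/funext => z.
  by rewrite /= /GRing.scale /=; ring.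
have L4 i := L1_polar Cc Rc Kc (Lbk i (bu i)) (Lbk i (bw i)) (Lp _ LF) (Lp _ LG).
have L6 i : L1 area (fun z : P => dx (psi i) z ^+ 2 + dy (psi i) z ^+ 2).
  apply: L1D; first exact: (test_fun_sqint (test_fun_dx (tpsi i))).2.
  exact: (test_fun_sqint (test_fun_dy (tpsi i))).2.
have L5 i : L1 area (fun z : P => q i / 2 * (dx (psi i) z ^+ 2 + dy (psi i) z ^+ 2)).
  exact: L1Z (L6 i).
have LT i : L1 area (T i : P -> R) by apply: L1B; apply: L1Z; [exact: L4|exact: L5].
have I := int_le (L1D (L1B J1 J2) (L1_sum _ LT)) J3 point.
apply: le_trans _ I.
rewrite (intD (L1B J1 J2) (L1_sum _ LT)) (intB J1 J2) lerD2l (int_sum _ LT).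
apply: ler_sum => i _.
rewrite (intB (L1Z t (L4 i)) (L1Z _ (L5 i))) (intZ _ (L4 i)) (intZ _ (L5 i)) (intZ _ (L6 i)).
have Ipol : \int[area]_z (\1_(perf eps) z * polar (bu i *: kap i z) (bw i *: kap i z) (F z) (G z)) = lam * q i.
  have LF' := L1_dot (Lp _ (Lk i)) (Lp _ LF); have LG' := L1_dot (Lp _ (Lk i)) (Lp _ LG).
  transitivity (\int[area]_z ((Cc * bu i + Rc * bw i) * (\1_(perf eps) z * dot (kap i z) (F z)) +
      (Kc * bw i + Rc * bu i) * (\1_(perf eps) z * dot (kap i z) (G z)))).
    by apply: eq_int => z; rewrite /polar_density /dot /= /GRing.scale /=; ring.
  rewrite (intD (L1Z _ LF') (L1Z _ LG')) (intZ _ LF') (intZ _ LG').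
  rewrite (circ i bu F LF SF) (circ i bw G LG SG); ring.
rewrite Ipol.
have X := HI (d i); rewrite -/(psi i) in X.
have : t ^+ 2 * (q i / 2 * \int[area]_z (dx (psi i) z ^+ 2 + dy (psi i) z ^+ 2)) <=
    t ^+ 2 * (q i / 2 * (4 * pi / m)).
  by apply: ler_wpM2l; [exact: sqr_ge0|apply: ler_wpM2l => //; rewrite divr_ge0].
have -> : 4 * pi / m = 2 * (2 * pi / m) by ring.
move: (\int[area]_z _) => Y; move: (2 * pi / m) => Z; move: (q i) => Q h.
have -> : Q * (t * lam - t ^+ 2 * Z) = t * (lam * Q) - t ^+ 2 * (Q / 2 * (2 * Z)) by field.
by rewrite lerD2l lerN2.
Qed.

Section Sequence.
Variables (eps lam : nat -> R) (F G : nat -> R * R -> R * R) (U W : R * R -> R * R) (A : R).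
Hypotheses (eps01 : forall n, 0 < eps n < 1) (eps_cvg : eps n @[n --> \oo] --> (0 : R)).
Hypotheses (lam2 : forall n, lam n ^+ 2 = `|ln (eps n)|^-1) (lam_cvg : lam n @[n --> \oo] --> (0 : R)).
Hypotheses (LF : forall n, L2v Omega (F n)) (LG : forall n, L2v Omega (G n)).
Hypotheses (LU : L2v Omega U) (LW : L2v Omega W).
Hypothesis wF : forall Phi : R * R -> R * R, L2v Omega Phi ->
  (\int[area]_(z in Omega) dot (F n z) (Phi z))%R @[n --> \oo] --> \int[area]_(z in Omega) dot (U z) (Phi z).
Hypothesis wG : forall Phi : R * R -> R * R, L2v Omega Phi ->
  (\int[area]_(z in Omega) dot (G n z) (Phi z))%R @[n --> \oo] --> \int[area]_(z in Omega) dot (W z) (Phi z).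
Hypothesis SF : forall n, scaled_by (eps n) (lam n) bu (F n).
Hypothesis SG : forall n, scaled_by (eps n) (lam n) bw (G n).
Hypothesis EA : forall n, \int[area]_z (\1_(perf (eps n)) z * dens (F n z) (G n z)) <= A.

Lemma weak_restrict (del : R) (Fn : nat -> R * R -> R * R) (V Phi : R * R -> R * R) : L2v Omega Phi ->
  (forall Phi : R * R -> R * R, L2v Omega Phi ->
  (\int[area]_(z in Omega) dot (Fn n z) (Phi z))%R @[n --> \oo] --> \int[area]_(z in Omega) dot (V z) (Phi z)) ->
  \int[area]_z (\1_(perf del) z * dot (Fn n z) (Phi z)) @[n --> \oo] -->
  \int[area]_z (\1_(perf del) z * dot (V z) (Phi z)).
Proof.
move=> [/L2P p1 /L2P p2] w; pose Psi z := \1_(perf del) z *: Phi z : R * R.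
have mp := perforated_measurable d oO del.
have LPsi : L2v Omega Psi.
  split; apply/L2P; [have := sqint_indic mp p1|have := sqint_indic mp p2]; congr (sqint _ _);
    by apply/funext => z; rewrite /Psi /= /GRing.scale /=; ring.
have E X : \int[area]_z (\1_(perf del) z * dot (X z) (Phi z)) = \int[area]_(z in Omega) dot (X z) (Psi z).
  rewrite [RHS]int_in; apply: eq_int => z.
  have <- := indic_sub z (@perforated_sub _ Omega N d del).
  by rewrite /dot /Psi /= /GRing.scale /=; ring.
rewrite E; have := w _ LPsi; apply: cvg_trans; apply: near_eq_cvg; near=> n.
by rewrite E.
Unshelve. all: by end_near. Qed.

(** Up to a constant the logarithmic width is 2 |ln eps|, and [lam n ^+ 2] is its inverse without
    the factor 2. *)
Lemma log_gain_cvg (del : R) : 0 < del ->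
  lam n ^+ 2 * (ln (del ^+ 2 / 2) - ln (8 * eps n ^+ 2)) @[n --> \oo] --> (2 : R).
Proof.
move=> d0.
have E n : lam n ^+ 2 * (ln (del ^+ 2 / 2) - ln (8 * eps n ^+ 2)) =
    lam n ^+ 2 * (ln (del ^+ 2 / 2) - ln 8) + 2.
  have /andP[e0 e1] := eps01 n.
  have l0 : ln (eps n) < 0 by rewrite ln_lt0// e0.
  have -> : ln (8 * eps n ^+ 2) = ln 8 + 2 * ln (eps n).
    by rewrite lnM ?posrE ?exprn_gt0// lnXn// mulr_natl.
  rewrite lam2 ltr0_norm//.
  by field; rewrite lt_eqF.
have -> : (fun n => lam n ^+ 2 * (ln (del ^+ 2 / 2) - ln (8 * eps n ^+ 2))) =
    fun n => lam n * lam n * (ln (del ^+ 2 / 2) - ln 8) + 2.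
  by apply/funext => n; rewrite E expr2.
have c : lam n * lam n * (ln (del ^+ 2 / 2) - ln 8) + 2 @[n --> \oo] -->
    0 * 0 * (ln (del ^+ 2 / 2) - ln 8) + 2.
  by apply: cvgD; [apply: cvgM; [exact: cvgM|exact: cvg_cst]|exact: cvg_cst].
by rewrite !mul0r add0r in c.
Qed.

(** With [del] fixed and n tending to infinity, the polar term is linear in the sequence and tends
    to twice the energy of (U, W); subtracting that energy leaves it once. *)
Lemma perforated_lower_bound (del : R) : 0 < del -> del <= eps0 ->
  \int[area]_z (\1_(perf del) z * dens (U z) (W z)) + \sum_(i < N) q i / (4 * pi) <= A.
Proof.
move=> d0 de.
pose m n := ln (del ^+ 2 / 2) - ln (8 * eps n ^+ 2).
pose X n := \int[area]_z (\1_(perf del) z * polar (U z) (W z) (F n z) (G n z)).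
pose D := \int[area]_z (\1_(perf del) z * dens (U z) (W z)).
have Lp V : L2v Omega V -> L2v (perf del) V by exact: L2v_perf.
have XE V V' : L2v Omega V -> L2v Omega V' ->
    \int[area]_z (\1_(perf del) z * polar (U z) (W z) (V z) (V' z)) =
    Cc * \int[area]_z (\1_(perf del) z * dot (V z) (U z)) + Kc * \int[area]_z (\1_(perf del) z * dot (V' z) (W z)) +
    Rc * (\int[area]_z (\1_(perf del) z * dot (V' z) (U z)) + \int[area]_z (\1_(perf del) z * dot (V z) (W z))).
  move=> LV LV'.
  have a1 := L1_dot (Lp _ LV) (Lp _ LU); have a2 := L1_dot (Lp _ LV') (Lp _ LW).
  have a3 := L1_dot (Lp _ LV') (Lp _ LU); have a4 := L1_dot (Lp _ LV) (Lp _ LW).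
  have a5 := L1D a3 a4; have a6 := L1Z Rc a5; have a7 := L1D (L1Z Cc a1) (L1Z Kc a2).
  rewrite -(intZ _ a1) -(intZ _ a2) -(intD a3 a4) -(intZ _ a5) -(intD (L1Z Cc a1) (L1Z Kc a2)) -(intD a7 a6).
  by apply: eq_int => z; rewrite /polar_density /dot; ring.
have cX : X n @[n --> \oo] --> 2 * D.
  have -> : 2 * D = Cc * \int[area]_z (\1_(perf del) z * dot (U z) (U z)) + Kc * \int[area]_z (\1_(perf del) z * dot (W z) (W z)) +
    Rc * (\int[area]_z (\1_(perf del) z * dot (W z) (U z)) + \int[area]_z (\1_(perf del) z * dot (U z) (W z))).
    rewrite -(XE _ _ LU LW) -intZ; last exact: L1_energy (Lp _ LU) (Lp _ LW).
    by apply: eq_int => z; rewrite /polar_density /energy_density /dot; field.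
  have -> : X = fun n => Cc * \int[area]_z (\1_(perf del) z * dot (F n z) (U z)) + Kc * \int[area]_z (\1_(perf del) z * dot (G n z) (W z)) +
    Rc * (\int[area]_z (\1_(perf del) z * dot (G n z) (U z)) + \int[area]_z (\1_(perf del) z * dot (F n z) (W z))).
    by apply/funext => n; rewrite /X XE.
  have cc (k : R) : k @[n --> \oo] --> k by exact: cvg_cst.
  have w1 := weak_restrict (del := del) LU wF; have w2 := weak_restrict (del := del) LW wG.
  have w3 := weak_restrict (del := del) LU wG; have w4 := weak_restrict (del := del) LW wF.
  exact: (cvgD (cvgD (cvgM (cc Cc) w1) (cvgM (cc Kc) w2)) (cvgM (cc Rc) (cvgD w3 w4))).
pose Y n := X n - D + \sum_(i < N) q i * (lam n ^+ 2 * m n / (8 * pi)).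
have cY : Y n @[n --> \oo] --> D + \sum_(i < N) q i / (4 * pi).
  have -> : D + \sum_(i < N) q i / (4 * pi) = 2 * D - D + \sum_(i < N) q i * (2 / (8 * pi)).
    congr (_ + _); first by ring.
    have p0 : pi != 0 :> R by rewrite gt_eqF ?pi_gt0.
    apply: eq_bigr => i _; congr (_ * _).
    by move: (pi : R) p0 => c c0; field.
  apply: cvgD; first by apply: cvgB => //; exact: cvg_cst.
  apply: cvg_bigsum => i; apply: cvgM; first exact: cvg_cst.
  by apply: cvgM; [exact: log_gain_cvg|exact: cvg_cst].
apply: (cvg_le_bound _ cY).
near=> n.
have /andP[e0 e1] := eps01 n.
have ed : 16 * eps n ^+ 2 < del ^+ 2.
  have e4 : 4 * eps n < del.
    have : eps n < del / 4 by near: n; apply: (cvgr_lt 0) => //; rewrite divr_gt0.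
    by rewrite ltr_pdivlMr// mulrC.
  have -> : 16 * eps n ^+ 2 = (4 * eps n) ^+ 2 by ring.
  have h0 : 0 <= 4 * eps n by rewrite mulr_ge0// ltW.
  by rewrite ltr_pXn2r ?nnegrE// ltW.
have m0 : 0 < m n.
  rewrite /m subr_gt0 ltr_ln ?posrE ?mulr_gt0 ?divr_gt0 ?exprn_gt0//.
  by move: ed; lra.
(* This t maximises t lam - 2 pi t^2 / m; the maximum lam^2 m / (8 pi) tends to 1/(4 pi) by
   [log_gain_cvg]. *)
have := annulus_gain (lam n * m n / (4 * pi)) e0 ed d0 de LU LW (LF n) (LG n) (SF n) (SG n).
move=> /le_trans/(_ (EA n)); apply: le_trans; rewrite lerD2l.
apply: ler_sum => i _; rewrite le_eqVlt; apply/orP; left; apply/eqP; congr (_ * _).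
have p0 : pi != 0 :> R by rewrite gt_eqF ?pi_gt0.
rewrite -/(m n); have m0' : m n != 0 by rewrite gt_eqF.
by move: (m n) (pi : R) (lam n) m0' p0 => a c l a0 c0; field; rewrite c0 a0.
Unshelve. all: by end_near. Qed.

(** Dominated convergence as the disks of radius [del] shrink. The pointwise limit [h0] omits only
    the centres, a null set whose contribution the functions [s i] account for. *)
Lemma lower_bound :
  \int[area]_z (\1_Omega z * dens (U z) (W z)) + \sum_(i < N) q i / (4 * pi) <= A.
Proof.
pose del n : R := eps0 / n.+2%:R.
have del0 n : 0 < del n by rewrite divr_gt0.
have e0n := ltW eps0_gt0.
have del1 n : del n <= eps0 by rewrite ler_pdivrMr// ler_peMr// ler1n.
have delc : del n @[n --> \oo] --> (0 : R).
  have h : (n.+2%:R^-1 : R) @[n --> \oo] --> (0 : R).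
    rewrite (_ : (fun n => _) = fun n => harmonic (n + 1)%N); last first.
      by apply/funext => n; rewrite /harmonic addn1.
    by rewrite cvg_shiftn; exact: cvg_harmonic.
  by rewrite -[X in _ --> X](mulr0 eps0); apply: cvgM => //; exact: cvg_cst.
have LO := L1_energy Cc Rc Kc LU LW.
pose h n (z : P) := \1_(perf (del n)) z * dens (U z) (W z).
pose h0 (z : P) := \1_[set z | forall i, z != d i] z * (\1_Omega z * dens (U z) (W z)) : R.
have hE n z : h n z = \1_(perf (del n)) z * (\1_Omega z * dens (U z) (W z)).
  by rewrite mulrA indic_sub//; exact: perforated_sub.
have Lh n : L1 area (h n).
  by apply: eq_L1 (L1_indicM (perforated_measurable d oO (del n)) LO) => z; rewrite hE.
have ph z : h n z @[n --> \oo] --> h0 z.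
  have [zd|] := pselect (forall i, z != d i); last first.
    move=> /existsNP[i /negP/negPn/eqP ->].
    rewrite /h0 (indicF (D := [set z | forall i, z != d i])) ?mul0r; last by move=> /(_ i); rewrite eqxx.
    apply: cvg_near_cst; near=> n; rewrite /h indicF ?mul0r// => /perforatedP[_ /(_ i)]; apply.
    by apply: disk_center; exact: ltW.
  rewrite /h0 (indicT (D := [set z | forall i, z != d i]) zd) mul1r.
  have [Oz|nOz] := pselect (Omega z); last first.
    apply: cvg_near_cst; by near=> n; rewrite hE (indicF nOz) mul0r mulr0.
  apply: cvg_near_cst; near=> n; rewrite hE indicT ?mul1r//.
  apply/perforatedP; split => // i di.
  have := (diskP (d i) z (ltW (del0 n))).1 di; apply/negP; rewrite -ltNge.
  move: i {di}; near: n; apply: filter_forall => i.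
  have n0 := nrm2_sub_gt0 (zd i).
  apply: (cvgr_lt 0) => //.
  rewrite -[X in _ --> X](mulr0 (0 : R)); rewrite (_ : (fun n => _) = fun n => del n * del n); last first.
    by apply/funext => n; rewrite expr2.
  exact: cvgM.
have d0 z : 0 <= dens (U z) (W z) := energy_density_ge0 C0 CKR (U z) (W z).
have bh n z : `|h n z| <= \1_Omega z * dens (U z) (W z).
  have /andP[i0 i1] := indic01 (perf (del n)) z; have /andP[j0 j1] := indic01 Omega z.
  have g0 : 0 <= \1_Omega z * dens (U z) (W z) by rewrite mulr_ge0.
  rewrite hE ger0_norm; last exact: mulr_ge0.
  exact: ler_piMl.
have [Lh0 ch] := int_dct (fun n => L1_measurable (Lh n)) ph bh LO.
have I0 : \int[area]_z (\1_Omega z * dens (U z) (W z)) <= \int[area]_z h0 z.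
  pose s i (z : P) := \1_[set d i] z * (\1_Omega z * dens (U z) (W z)) : R.
  have ms i : measurable ([set d i] : set P).
    by apply: closed_measurable_plane; apply: compact_closed_plane; exact: compact_set1.
  have Ls i : L1 area (s i) by exact: L1_indicM.
  have s0 i : \int[area]_z s i z = 0.
    rewrite -[RHS](int0 area); apply: ae_eq_int.
    - exact: L1_measurable (Ls i).
    - exact: measurable_cst.
    exists [set (d i : P)]; split; [exact: ms|exact: area_point|].
    by move=> z /= sz; apply: contrapT => zd; apply: sz; rewrite /s indicF ?mul0r.
  have := int_le LO (L1D Lh0 (L1_sum (index_enum 'I_N) Ls)).
  rewrite (intD Lh0 (L1_sum (index_enum 'I_N) Ls)) int_sum// big1 ?addr0 => [|i _]; last exact: s0.
  apply => z; have /andP[j0 j1] := indic01 Omega z.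
  have g0 : 0 <= \1_Omega z * dens (U z) (W z) by rewrite mulr_ge0.
  have si0 i : 0 <= s i z by rewrite mulr_ge0//; have /andP[] := indic01 [set d i] z.
  have [zd|] := pselect (forall i, z != d i).
    by rewrite /h0 (indicT (D := [set z | forall i, z != d i]) zd) mul1r lerDl sumr_ge0.
  move=> /existsNP[i /negP/negPn/eqP E].
  have h00 : 0 <= h0 z by rewrite mulr_ge0//; have /andP[] := indic01 [set z : P | forall i, z != d i] z.
  rewrite (bigD1 i)//= {1}/s (indicT (D := [set d i]) E) mul1r.
  by rewrite addrCA lerDl addr_ge0// sumr_ge0.
have cl : \int[area]_z h n z + \sum_(i < N) q i / (4 * pi) @[n --> \oo] -->
    \int[area]_z h0 z + \sum_(i < N) q i / (4 * pi) by apply: cvgD => //; exact: cvg_cst.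
apply: (@le_trans _ _ (\int[area]_z h0 z + \sum_(i < N) q i / (4 * pi))); first by rewrite lerD2r.
apply: (cvg_le_bound _ cl).
by near=> n; exact: perforated_lower_bound.
Unshelve. all: by end_near. Qed.

End Sequence.
End LowerBound.

(** * Vortex fields and the recovery sequence *)

Section Vortex.
Context {R : realType}.
Local Notation area := (@lebesgue_measure R \x @lebesgue_measure R)%E.
Local Notation P := (measurableTypeR R * measurableTypeR R)%type.
Implicit Types (p z : R * R).

(* The gradient of the angle about [p], normalised to have circulation 1. *)
Definition vortex p z : R * R := (2 * pi)^-1 *: (pole1 p z, pole2 p z).

Lemma dot_vortex p z : dot (vortex p z) (vortex p z) = (4 * pi ^+ 2)^-1 * (nrm2 (z - p))^-1.
Proof.
have p0 : pi != 0 :> R by rewrite gt_eqF ?pi_gt0.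
have E (x y i k : R) : (k * (- y * i)) * (k * (- y * i)) + (k * (x * i)) * (k * (x * i)) =
    k ^+ 2 * ((x ^+ 2 + y ^+ 2) * i ^+ 2) by ring.
transitivity ((2 * pi)^-1 ^+ 2 * (nrm2 (z - p) * (nrm2 (z - p))^-1 ^+ 2)).
  exact: (E (z.1 - p.1) (z.2 - p.2) (nrm2 (z - p))^-1 (2 * pi)^-1).
(* The convention 0^-1 = 0 makes the identity hold at [p] too. *)
move: (nrm2 _) => s; have -> : s * s^-1 ^+ 2 = s^-1.
  by have [->|s0] := eqVneq s 0; [rewrite invr0 mul0r|field].
by congr (_ * _); rewrite exprVn exprMn; congr ((_ * _)^-1); ring.
Qed.

(** At distance at least [rho] from [p] and inside a box, the field coincides with a smooth function
    of bounded support. *)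
Lemma sqint_vortex_far (p : R * R) (rho c : R) (A : set (R * R)) : 0 < rho -> measurable (A : set P) ->
  A `<=` box c -> (forall z, A z -> rho ^+ 2 <= nrm2 (z - p)) ->
  sqint area (fun z : P => \1_A z * (vortex p z).1) /\ sqint area (fun z : P => \1_A z * (vortex p z).2).
Proof.
move=> r0 mA Ac Ap.
pose H (s : R) := 1 - cutoff (rho ^+ 2 / 2) (rho ^+ 2) s.
have rr : 0 < rho ^+ 2 by rewrite exprn_gt0.
have ab : rho ^+ 2 / 2 < rho ^+ 2 by lra.
have sH : smooth1 H by apply: smoothGB; [exact: smoothG_cst|exact: smooth1_cutoff].
have a0 : 0 < rho ^+ 2 / 2 by rewrite divr_gt0.
have Hlow s : s < rho ^+ 2 / 2 -> H s = 0 by move=> /ltW sa; rewrite /H cutoff1// subrr.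
have Hhigh s : rho ^+ 2 <= s -> H s = 1 by move=> sa; rewrite /H cutoff0// subr0.
have sh := smooth1_div a0 sH Hlow.
have sg : smooth2 (fun z : R * R => H (nrm2 (z - p)) / nrm2 (z - p)) := smooth2_shift p (smooth2_radial sh).
pose c1 := `|c| + 1; have c10 : 0 <= c1 by rewrite addr_ge0.
pose chi := cutbox (0 : R * R) (c1 + 1) c1.
have schi : smooth2 chi := smooth2_cutbox _ _ _.
have bchi : bsupp chi by apply: (@bsupp_cbox _ 0 (c1 + 1)) => z; apply: cutbox_eq0; rewrite ?ltrDl.
have chi1 z : A z -> chi z = 1.
  move=> /Ac [/=]; rewrite !in_itv /= -!ler_norml => z1 z2.
  have cn := ler_norm c.
  by apply: cutbox_eq1; rewrite ?ltrDl//; split; rewrite /ball /= sub0r normrN /c1; lra.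
have gen (k : R * R -> R) : smooth2 k -> sqint area (fun z : P => \1_A z * (k z * (nrm2 (z - p))^-1)).
  move=> sk.
  have S : sqint area (fun z : P => chi z * (k z * (H (nrm2 (z - p)) / nrm2 (z - p)))).
    apply: bsupp_sqint; last exact: bsuppM.
    exact: smoothG_continuous (smoothGM schi (smoothGM sk sg)).
  have := sqint_indic mA S; congr (sqint _ _); apply/funext => z.
  have [Az|nAz] := pselect (A z); last by rewrite !(indicF nAz) !mul0r.
  by rewrite (chi1 z Az) (Hhigh _ (Ap z Az)) !mul1r.
split.
- have sk : smooth2 (fun z : R * R => (2 * pi)^-1 * (p.2 - z.2)).
    by apply: smoothGZ; apply: smoothGB; [exact: smoothG_cst|exact: smooth2_snd].
  have := gen _ sk; congr (sqint _ _); apply/funext => z.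
  by rewrite /vortex /= /GRing.scale /= /pole1; ring.
- have sk : smooth2 (fun z : R * R => (2 * pi)^-1 * (z.1 - p.1)).
    by apply: smoothGZ; apply: smoothGB; [exact: smooth2_fst|exact: smoothG_cst].
  have := gen _ sk; congr (sqint _ _); apply/funext => z.
  by rewrite /vortex /= /GRing.scale /= /pole2; ring.
Qed.

(** [int_flux] translated to [p] and divided by 2 pi. Integrability of the translated integrand
    comes from the set [A], which avoids the disk where [phi] is constant. *)
Lemma vortex_flux p (phi : R * R -> R) (r c : R) : smooth2 phi -> bsupp phi -> 0 < r ->
  (forall z, nrm2 (z - p) < r -> phi z = c) ->
  \int[area]_z ((vortex p z).2 * dx phi z - (vortex p z).1 * dy phi z) = - c.
Proof.
move=> sp bp r0 phic.
have sps : smooth2 (fun z => phi (z + p)).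
  have -> : (fun z => phi (z + p)) = fun z => phi (z - - p) by apply/funext => z; rewrite opprK.
  exact: smooth2_shift.
have bps : bsupp (fun z => phi (z + p)).
  have [k Hc] := bp; exists (k + (`|p.1| + `|p.2|)) => z zb; apply: Hc => zpb; apply: zb.
  move: zpb; rewrite /box => -[/=]; rewrite !in_itv /= -!ler_norml => h1 h2.
  have k1 := lerB_normD z.1 p.1; have k2 := lerB_normD z.2 p.2.
  have n1 := normr_ge0 p.1; have n2 := normr_ge0 p.2.
  by split; lra.
have [[cx bx] [cy by_]] := bsupp_dx bp.
have dsh (v : R * R) z : 'D_v (fun z => phi (z + p)) z = 'D_v phi (z + p).
  rewrite derive_alongE [RHS]derive_alongE.
  have -> : (fun h : R => phi (h *: v + z + p)) = fun h => phi (h *: v + (z + p)).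
    by apply/funext => h; rewrite -addrA.
  by [].
have F := @int_flux _ (fun z => phi (z + p)) r c sps bps r0.
have : \int[area]_z ((z.1 * dx (fun z => phi (z + p)) z + z.2 * dy (fun z => phi (z + p)) z) / nrm2 z) = - (2 * pi * c).
  by apply: F => z h; apply: phic; rewrite addrK.
move=> {}F.
pose f (z : P) := (vortex p z).2 * dx phi z - (vortex p z).1 * dy phi z.
have fE z : f (z + p) = (2 * pi)^-1 * ((z.1 * dx (fun z => phi (z + p)) z + z.2 * dy (fun z => phi (z + p)) z) / nrm2 z).
  rewrite /f /vortex /pole1 /pole2 /dx /dy !dsh (addrK p (z : R * R)) /= /GRing.scale /=.
  by ring.
pose c1 := Num.max cx cy; pose A := box c1 `&` [set z : R * R | r <= nrm2 (z - p)].
have mA : measurable (A : set P).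
  apply: measurableI; first exact: measurable_box.
  apply: closed_measurable_plane.
  have := (continuous_closedP _).1 (nrm2_shift_continuous (p := p)) _ (@closed_ge _ r); exact.
have r0' := ltW r0.
have Ar z : A z -> Num.sqrt r ^+ 2 <= nrm2 (z - p) by move=> [_ /=]; rewrite sqr_sqrtr.
have [v1 v2] := @sqint_vortex_far p (Num.sqrt r) c1 A (etrans (sqrtr_gt0 r) r0) mA (@subIsetl _ _ _) Ar.
have dA z : ~ A z -> dx phi z = 0 /\ dy phi z = 0.
  move=> nA; have [zc|zc] := pselect (box c1 z); last first.
    by split; [apply: bx|apply: by_] => h; apply: zc; apply: box_le h; rewrite le_max lexx ?orbT.
  have zr : nrm2 (z - p) < r by rewrite ltNge; apply/negP => h; apply: nA.
  by apply: (near1_dx (c := c) sp); near=> w; apply: phic; near: w; exact: nrm2_at_near.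
have sqx := bsupp_sqint (smoothG_continuous (smooth2_dx sp)) (bsupp_dx bp).1.
have sqy := bsupp_sqint (smoothG_continuous (smooth2_dy sp)) (bsupp_dx bp).2.
have Lf : L1 area f.
  apply: eq_L1 (L1B (sqint_mul v2 sqx) (sqint_mul v1 sqy)) => z.
  have [Az|nAz] := pselect (A z); first by rewrite (indicT (D := A) Az) !mul1r.
  by have [-> ->] := dA z nAz; rewrite /f (dA z nAz).1 (dA z nAz).2 !mulr0.
have p0 : (2 * pi : R) != 0 by rewrite gt_eqF// mulr_gt0// pi_gt0.
pose g (z : P) := (z.1 * dx (fun z => phi (z + p)) z + z.2 * dy (fun z => phi (z + p)) z) / nrm2 z.
have Lg : L1 area g.
  apply: eq_L1 (L1Z (2 * pi) (L1_shift p Lf)) => z.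
  by rewrite fE mulrA divff// mul1r.
transitivity (\int[area]_z f (z + p)); first by rewrite (int_shift p Lf).
transitivity (\int[area]_z ((2 * pi)^-1 * g z)); first exact: eq_int.
by rewrite (intZ _ Lg) F mulrN mulrA mulVf// mul1r.
Unshelve. all: by end_near. Qed.

Lemma trace_vortex D p phi (c r : R) : smooth2 phi -> bsupp phi -> 0 < r ->
  (forall z, ~ D z -> dx phi z = 0 /\ dy phi z = 0) ->
  (forall z, nrm2 (z - p) < r -> phi z = c) -> tangential_trace D (vortex p) phi = - c.
Proof.
move=> sp bp r0 phiD phic; rewrite -(vortex_flux sp bp r0 phic) traceE.
apply: eq_int => z; have [Dz|nDz] := pselect (D z); first by rewrite (indicT Dz) !mul1r.
by have [-> ->] := phiD z nDz; rewrite !mulr0.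
Qed.

(** The set lies where the smooth annulus with plateau [eps^2, b] is 1, so its integral is at most
    ln(2b) - ln(eps^2/2) = 2 |ln eps| + ln(4b) before normalisation. *)
Lemma vortex_energy p (b : R) : 0 < b -> exists K : R, forall (eps : R) (A : set (R * R)), 0 < eps < 1 ->
  eps ^+ 2 <= b -> measurable (A : set P) -> (forall z, A z -> eps ^+ 2 <= nrm2 (z - p) <= b) ->
  L1 area (fun z : P => \1_A z * dot (vortex p z) (vortex p z)) /\
  \int[area]_z (\1_A z * dot (vortex p z) (vortex p z)) <= (2 * `|ln eps| + K) / (4 * pi).
Proof.
move=> b0; exists (ln (4 * b)) => eps A /andP[e0 e1] eb mA HA.
pose a := eps ^+ 2 / 2.
have a0 : 0 < a by rewrite divr_gt0// exprn_gt0.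
have a2 : 2 * a = eps ^+ 2 by rewrite /a; field.
have ab : 2 * a <= b by rewrite a2.
have sw := @smooth1_annular_inv _ a b a0.
pose H := wprim a b (fun s => s^-1).
have dln (s : R) : 0 < s -> is_derive s 1 (@ln R) s^-1 by exact: is_derive_ln.
have winv (s : R) : 0 < s -> 0 <= s^-1 by move=> s0; rewrite invr_ge0 ltW.
have /andP[_ M1] := wprim_bounds a0 ab sw dln winv.
have sH : smooth1 H := smooth1_wprim a0 ab sw.
have Hlow s : s < a -> H s = 0 by move=> /ltW; exact: wprim_low.
have Hhigh s : 2 * b < s -> H s = H (2 * b) by move=> /ltW; exact: wprim_high.
have LH : L1 area (fun z : P => 'D_1 H (nrm2 z)).
  exact: L1_radial (smooth1_derive sH) (derive_gt0 sH Hhigh).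
have IH := int_radial a0 sH Hlow Hhigh.
have dHE (s : R) : 'D_1 H s = annular a b s * s^-1.
  by have dH := wprim_derive a0 ab sw s; rewrite derive_val.
have LHs : L1 area (fun z : P => 'D_1 H (nrm2 (z - p))) by exact: (L1_shift (- p) LH).
pose k : R := (4 * pi ^+ 2)^-1.
have k0 : 0 <= k by rewrite invr_ge0 mulr_ge0// sqr_ge0.
have LA := L1_indicM mA (L1Z k LHs).
have AE z : \1_A z * dot (vortex p z) (vortex p z) = \1_A z * (k * 'D_1 H (nrm2 (z - p))).
  have [Az|nAz] := pselect (A z); last by rewrite (indicF nAz) !mul0r.
  by rewrite dot_vortex dHE annular_eq1 ?mul1r// a2; exact: HA.
split; first by apply: eq_L1 LA => z; rewrite AE.
have IHs : \int[area]_z (k * 'D_1 H (nrm2 (z - p))) = k * (pi * H (2 * b)).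
  by rewrite (intZ _ LHs); congr (_ * _); exact: etrans (int_shift (- p) LH) IH.
have -> : \int[area]_z (\1_A z * dot (vortex p z) (vortex p z)) = \int[area]_z (\1_A z * (k * 'D_1 H (nrm2 (z - p)))).
  exact: eq_int.
apply: (@le_trans _ _ (k * (pi * H (2 * b)))).
  rewrite -IHs; apply: int_le => //; first exact: L1Z.
  move=> z; have /andP[i0 i1] := indic01 A z.
  apply: ler_piMl => //; apply: mulr_ge0 => //; rewrite dHE mulr_ge0 ?annular_ge0//.
  by rewrite invr_ge0 nrm2_ge0.
have p0 : (pi : R) != 0 by rewrite gt_eqF// pi_gt0.
have pp := pi_gt0 R.
have -> : k * (pi * H (2 * b)) = H (2 * b) / (4 * pi).
  by rewrite /k; move: (pi : R) (H (2 * b)) p0 => c h c0; field.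
apply: ler_wpM2r; first by rewrite invr_ge0 mulr_ge0// ltW.
apply: le_trans M1 _.
have l0 : ln eps < 0 by rewrite ln_lt0// e0.
have -> : ln a = 2 * ln eps - ln 2.
  by rewrite /a ln_div ?posrE ?exprn_gt0// lnXn// mulr_natl.
have -> : 4 * b = (2 * b) * 2 by ring.
rewrite (@lnM _ (2 * b) 2) ?posrE ?mulr_gt0// ltr0_norm//.
by rewrite le_eqVlt; apply/orP; left; apply/eqP; ring.
Qed.

End Vortex.

(** * The scaling factor *)

Section LogScale.
Context {R : realType}.
Implicit Types eps : R.

Definition log_scale eps : R := `|ln eps| `^ (- 2^-1).

Lemma log_scale_gt0 eps : 0 < eps < 1 -> 0 < log_scale eps.
Proof. by move=> e01; rewrite powR_gt0// normr_gt0 lt_eqF// ln_lt0. Qed.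

Lemma log_scale_sqr eps : 0 < eps < 1 -> log_scale eps ^+ 2 = `|ln eps|^-1.
Proof. by move=> e01; rewrite /log_scale powRN powR12_sqrt// exprVn sqr_sqrtr. Qed.

Lemma near_right01 : \forall eps \near (0 : R)^'+, 0 < eps < 1.
Proof.
near=> e; apply/andP; split; first by near: e; exact: nbhs_right_gt.
by near: e; exact: nbhs_right_lt.
Unshelve. all: by end_near. Qed.

Lemma log_scale_cvg : log_scale eps @[eps --> 0^'+] --> (0 : R).
Proof.
apply/cvgr0Pnorm_le => t t0; near=> eps.
have e01 : 0 < eps < 1 by near: eps; exact: near_right01.
have l0 := log_scale_gt0 e01.
have et : eps < expR (- t ^- 2) by near: eps; apply: nbhs_right_lt; exact: expR_gt0.
have /andP[e0 e1] := e01.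
rewrite gtr0_norm// -(ler_pXn2r (n := 2)) ?nnegrE ?ltW// log_scale_sqr//.
have lt : ln eps < - t ^- 2 by rewrite -[ltRHS]expRK ltr_ln// posrE expR_gt0.
have ln0 : ln eps < 0 by rewrite ln_lt0.
have tt : 0 < t ^- 2 by rewrite invr_gt0 exprn_gt0.
rewrite -[ltRHS]invrK ltf_pV2 ?posrE ?normr_gt0 ?lt_eqF// ltr0_norm//.
by rewrite ltrNr.
Unshelve. all: by end_near. Qed.

End LogScale.

Section VortexWeak.
Context {R : realType}.
Local Notation area := (@lebesgue_measure R \x @lebesgue_measure R)%E.
Local Notation P := (measurableTypeR R * measurableTypeR R)%type.
Implicit Types (p z : R * R).

(** Absolute continuity of the integral: the disks decrease to the null set {p}. *)
Lemma small_disk p (g : P -> R) (eta : R) : L1 area g -> 0 < eta ->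
  exists2 del : R, 0 < del & \int[area]_z (\1_(disk p del) z * `|g z|) <= eta.
Proof.
move=> Lg eta0; pose del n : R := n.+1%:R^-1.
have del0 n : 0 < del n by rewrite invr_gt0.
have delc : del n @[n --> \oo] --> (0 : R) by exact: cvg_harmonic.
have md (r : R) : measurable (disk p r : set P) by apply: closed_measurable_plane; exact: disk_closed.
have mp : measurable ([set p] : set P).
  by apply: closed_measurable_plane; apply: compact_closed_plane; exact: compact_set1.
have Ln := L1_norm Lg.
pose h n (z : P) := \1_(disk p (del n)) z * `|g z|.
pose h0 (z : P) := \1_[set p] z * `|g z|.
have Lh n : L1 area (h n) by exact: L1_indicM.
have ph z : h n z @[n --> \oo] --> h0 z.
  have [->|zp] := eqVneq z p.
    apply: cvg_near_cst; near=> n.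
    by rewrite /h /h0 (indicT (D := [set p]))// indicT//; apply: disk_center; exact: ltW.
  have n0 := nrm2_sub_gt0 zp.
  rewrite /h0 (indicF (D := [set p])) ?mul0r; last exact/eqP.
  apply: cvg_near_cst; near=> n; rewrite /h indicF ?mul0r//.
  move=> /(diskP _ _ (ltW (del0 n))); apply/negP; rewrite -ltNge; near: n.
  apply: (cvgr_lt 0) => //.
  rewrite -[X in _ --> X](mulr0 (0 : R)); rewrite (_ : (fun n => _) = fun n => del n * del n); last first.
    by apply/funext => n; rewrite expr2.
  exact: cvgM.
have bh n z : `|h n z| <= `|g z|.
  have /andP[i0 i1] := indic01 (disk p (del n)) z.
  by rewrite ger0_norm ?mulr_ge0// ler_piMl.
have [Lh0 ch] := int_dct (fun n => L1_measurable (Lh n)) ph bh Ln.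
have I0 : \int[area]_z h0 z = 0.
  rewrite -[RHS](int0 area); apply: ae_eq_int.
  - exact: L1_measurable Lh0.
  - exact: measurable_cst.
  exists [set (p : P)]; split; [exact: mp|exact: area_point|].
  by move=> z /= sz; apply: contrapT => zd; apply: sz; rewrite /h0 indicF ?mul0r.
rewrite I0 in ch.
have [n Hn] : exists n, \int[area]_z h n z <= eta.
  have [n _ Hn] := cvgr_le 0 ch eta eta0.
  by exists n; apply: Hn => /=.
by exists (del n).
Unshelve. all: by end_near. Qed.

Lemma dot_amgm (a b : R * R) (t : R) : 0 < t -> `|dot a b| <= t * dot a a + t^-1 * dot b b.
Proof.
move=> t0.
have H (x y : R) : `|x * y| <= t * (x * x) + t^-1 * (y * y).
  have s0 : 0 <= (t * `|x| - `|y|) ^+ 2 by rewrite sqr_ge0.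
  have xx : x * x = `|x| ^+ 2 by rewrite real_normK ?num_real.
  have yy : y * y = `|y| ^+ 2 by rewrite real_normK ?num_real.
  rewrite xx yy normrM -subr_ge0.
  have -> : t * `|x| ^+ 2 + t^-1 * `|y| ^+ 2 - `|x| * `|y| = t^-1 * ((t * `|x| - `|y|) ^+ 2 + t * `|x| * `|y|).
    by field; rewrite gt_eqF.
  by apply: mulr_ge0; [rewrite invr_ge0 ltW|apply: addr_ge0 => //; rewrite !mulr_ge0// ltW].
have h1 := H a.1 b.1; have h2 := H a.2 b.2.
apply: le_trans (ler_normD _ _) _; rewrite /dot !mulrDr; lra.
Qed.

End VortexWeak.

(** * Energy and weak convergence of scaled vortices *)

Section Recovery.
Context {R : realType}.
Local Notation area := (@lebesgue_measure R \x @lebesgue_measure R)%E.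
Local Notation P := (measurableTypeR R * measurableTypeR R)%type.
Variables (Omega : set (R * R)) (N : nat) (d : 'I_N -> R * R) (eps0 : R).
Hypotheses (oO : open Omega) (bO : bounded_set Omega) (eps0_gt0 : 0 < eps0).
Hypothesis disks_disjoint : forall i j, i != j -> disk (d i) eps0 `&` disk (d j) eps0 = set0.
Hypothesis disks_in : forall i, disk (d i) eps0 `<=` Omega.
Local Notation perf := (perforated Omega d).
Local Notation V i := (vortex (d i)).

Lemma nrm2_bounded p : exists2 b : R, 1 <= b & forall z, Omega z -> nrm2 (z - p) <= b.
Proof.
have [c Hc'] := bounded_box bO; have Hc := subset_trans (@subset_closure _ Omega) Hc'.
exists (1 + (`|c| + `|p.1|) ^+ 2 + (`|c| + `|p.2|) ^+ 2).
  by rewrite -addrA lerDl addr_ge0// sqr_ge0.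
move=> z /Hc[/=]; rewrite !in_itv /= -!ler_norml => z1 z2.
have H (x y : R) : `|x| <= c -> (x - y) ^+ 2 <= (`|c| + `|y|) ^+ 2.
  move=> xc; rewrite -[leLHS]real_normK ?num_real// ler_pXn2r ?nnegrE ?addr_ge0//.
  by apply: le_trans (ler_normB _ _) _; rewrite lerD2r; exact: le_trans xc (ler_norm c).
have := lerD (H _ p.1 z1) (H _ p.2 z2); rewrite /nrm2 /=; lra.
Qed.

Lemma L2v_vortex p (rho : R) (A : set (R * R)) : 0 < rho -> measurable (A : set P) -> A `<=` Omega ->
  (forall z, A z -> ~ disk p rho z) -> L2v A (vortex p).
Proof.
move=> r0 mA AO Ad; have [c Hc'] := bounded_box bO; have Hc := subset_trans (@subset_closure _ Omega) Hc'.
have far z : A z -> rho ^+ 2 <= nrm2 (z - p).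
  move=> Az; rewrite leNgt; apply/negP => h; apply: (Ad z Az).
  by apply/(diskP _ _ (ltW r0)); exact: ltW.
have [v1 v2] := sqint_vortex_far r0 mA (subset_trans AO Hc) far.
by split; apply/L2P.
Qed.

Lemma L2v_vortex_perf i eps : 0 < eps -> L2v (perf eps) (V i).
Proof.
move=> e0; apply: (L2v_vortex (rho := eps)) => //.
- exact: perforated_measurable d oO eps.
- exact: perforated_sub.
- by move=> z /perforatedP[_]; exact.
Qed.

Lemma vortex_energy_perf i : exists M : R, 0 <= M /\
  forall eps, 0 < eps < 1 -> L1 area (fun z : P => \1_(perf eps) z * dot (V i z) (V i z)) /\
    log_scale eps ^+ 2 * \int[area]_z (\1_(perf eps) z * dot (V i z) (V i z)) <=
    1 / (2 * pi) + M * log_scale eps ^+ 2.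
Proof.
have [b b1 Hb] := nrm2_bounded (d i).
have b0 : 0 < b by exact: lt_le_trans b1.
have [K HK] := vortex_energy (d i) b0.
have pp := pi_gt0 R.
have p0 : (4 * pi : R) != 0 by rewrite gt_eqF// mulr_gt0.
exists (`|K| / (4 * pi)); split; first by rewrite divr_ge0// mulr_ge0// ltW.
move=> eps e01; have /andP[e0 e1] := e01.
have e2 : eps ^+ 2 <= b.
  by apply: le_trans b1; rewrite expr_le1// ltW.
have [|L I] := HK eps (perf eps) e01 e2 (perforated_measurable d oO eps).
  move=> z /perforatedP[Oz /(_ i) nd]; rewrite Hb// andbT leNgt; apply/negP => h; apply: nd.
  by apply/(diskP _ _ (ltW e0)); exact: ltW.
split=> //; rewrite log_scale_sqr//.
have l0 : 0 < `|ln eps| by rewrite normr_gt0 lt_eqF// ln_lt0.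
have li : 0 <= `|ln eps|^-1 by rewrite invr_ge0 ltW.
apply: le_trans (ler_wpM2l li I) _.
have l1 : `|ln eps| != 0 by rewrite gt_eqF.
have -> : 1 / (2 * pi) + `|K| / (4 * pi) * `|ln eps|^-1 = `|ln eps|^-1 * ((2 * `|ln eps| + `|K|) / (4 * pi)) :> R.
  have pn : (pi : R) != 0 by rewrite gt_eqF.
  by move: (pi : R) `|ln eps| `|K| l1 pn => c l k l1 c0; field; rewrite l1 c0.
apply: ler_wpM2l => //; apply: ler_wpM2r; first by rewrite invr_ge0 mulr_ge0// ltW.
by rewrite lerD2l ler_norm.
Qed.

(** Off a small disk about [d i] the vortex is a fixed square-integrable field and the factor
    [log_scale eps] sends its pairing to 0. On the disk the scaled vortex has bounded energy, and
    [Phi] has little mass there. *)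
Lemma vortex_weak i Phi : L2v Omega Phi ->
  log_scale eps * \int[area]_z (\1_(perf eps) z * dot (V i z) (Phi z)) @[eps --> 0^'+] --> (0 : R).
Proof.
move=> LPhi; have [M [M0 HM]] := vortex_energy_perf i.
have pp := pi_gt0 R.
apply/cvgr0Pnorm_le => eta eta0.
pose M1 : R := 1 / (2 * pi) + M.
have M10 : 0 < M1 by rewrite ltr_pwDl// divr_gt0// mulr_gt0.
(* This weight makes the energy part of [dot_amgm] at most eta/3; [del] is then chosen so small that
   the part with t^-1 is at most eta/3 as well. *)
pose t : R := eta / (3 * M1).
have t0 : 0 < t by rewrite divr_gt0// mulr_gt0.
have tM : t * M1 = eta / 3 by rewrite /t; field; rewrite gt_eqF.
have LPP := L1_dot LPhi LPhi.
have te : 0 < t * (eta / 3) by rewrite mulr_gt0// divr_gt0.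
have [del del0 Hdel] := small_disk (d i) LPP te.
pose B := Omega `\` disk (d i) del.
have md : measurable (disk (d i) del : set P) by apply: closed_measurable_plane; exact: disk_closed.
have mB : measurable (B : set P) by apply: measurableD => //; exact: open_measurable_plane.
have LB : L2v B (V i) by apply: (L2v_vortex del0 mB) => z [].
have LBP : L2v B Phi by case: LPhi => h1 h2; split; exact: (L2_subset mB (@subDsetl _ _ _)).
have L3 := L1_norm (L1_dot LB LBP).
pose J : R := \int[area]_z `|\1_B z * dot (V i z) (Phi z)|.
have J0 : 0 <= J by apply: int_ge0.
have c3 : log_scale eps * J @[eps --> 0^'+] --> (0 : R).
  by rewrite -[X in _ --> X](mul0r J); apply: cvgM; [exact: log_scale_cvg|exact: cvg_cst].
near=> eps.
have e01 : 0 < eps < 1 by near: eps; exact: near_right01.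
have /andP[e0 e1] := e01.
have l0 := log_scale_gt0 e01.
have l1 : log_scale eps <= 1 by near: eps; apply: (cvgr_le 0 log_scale_cvg).
have [L1e I1e] := HM eps e01.
have Jl : log_scale eps * J <= eta / 3.
  by near: eps; apply: (cvgr_le 0 c3); rewrite divr_gt0.
set l := log_scale eps in l0 l1 I1e Jl *.
have LpP : L2v (perf eps) Phi by exact: L2v_perf.
have Lv := L2v_vortex_perf i e0.
have LvP := L1_dot Lv LpP.
have L2 := L1_indicM md (L1_norm LPP).
rewrite -(intZ _ LvP); apply: le_trans (int_norm (L1Z _ LvP)) _.
have LR := L1D (L1D (L1Z t (L1Z (l ^+ 2) L1e)) (L1Z t^-1 L2)) (L1Z l L3).
have le := int_le (L1_norm (L1Z l LvP)) LR.
apply: le_trans (le _) _; last first.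
  rewrite (intD (L1D (L1Z t (L1Z (l ^+ 2) L1e)) (L1Z t^-1 L2)) (L1Z l L3)).
  rewrite (intD (L1Z t (L1Z (l ^+ 2) L1e)) (L1Z t^-1 L2)).
  rewrite (intZ _ L3) (intZ _ L2) (intZ _ (L1Z (l ^+ 2) L1e)) (intZ _ L1e) -/J.
  have h1 : t * (l ^+ 2 * \int[area]_z (\1_(perf eps) z * dot (V i z) (V i z))) <= eta / 3.
    rewrite -tM; apply: ler_wpM2l; first exact: ltW.
    apply: le_trans I1e _; rewrite lerD2l; apply: ler_piMr => //.
    by rewrite expr_le1// ltW.
  have h2 : t^-1 * \int[area]_z (\1_(disk (d i) del) z * `|\1_Omega z * dot (Phi z) (Phi z)|) <= eta / 3.
    rewrite mulrC ler_pdivrMr// mulrC; exact: Hdel.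
  by move: h1 h2 Jl; lra.
move=> z.
have dd (a : R * R) : 0 <= dot a a by rewrite /dot -!expr2 addr_ge0// sqr_ge0.
have /andP[k0 k1] := indic01 (disk (d i) del) z.
have r2 : 0 <= t^-1 * (\1_(disk (d i) del) z * `|\1_Omega z * dot (Phi z) (Phi z)|).
  by apply: mulr_ge0; [rewrite invr_ge0 ltW|exact: mulr_ge0].
have r3 : 0 <= l * `|\1_B z * dot (V i z) (Phi z)| by rewrite mulr_ge0// ltW.
have [pz|npz] := pselect (perf eps z); last first.
  by rewrite (indicF npz) !mul0r !mulr0 normr0 add0r addr_ge0.
have Oz : Omega z := perforated_sub pz.
have r1 : 0 <= t * (l ^+ 2 * (\1_(perf eps) z * dot (V i z) (V i z))).
  by rewrite (indicT pz) mul1r; apply: mulr_ge0; [exact: ltW|apply: mulr_ge0; [exact: sqr_ge0|exact: dd]].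
have [nd|nd] := pselect (disk (d i) del z).
  apply: ler_wpDr => //; rewrite (indicT pz) (indicT nd) (indicT Oz) !mul1r (ger0_norm (dd _)).
  have := dot_amgm (l *: V i z) (Phi z) t0; congr (`|_| <= t * _ + _); rewrite /dot /= /GRing.scale /=; ring.
apply: ler_wpDl; first exact: addr_ge0.
by rewrite (indicT pz) (indicT (D := B) (conj Oz nd)) !mul1r normrM gtr0_norm.
Unshelve. all: by end_near. Qed.

(** On the disk about [d i] the field about [d j] is a fixed square-integrable field, and off it the
    field about [d i] is. Both halves are thus instances of [vortex_weak], with one factor
    [log_scale eps] to spare. *)
Lemma vortex_cross i j : i != j ->
  log_scale eps ^+ 2 * \int[area]_z (\1_(perf eps) z * dot (V i z) (V j z)) @[eps --> 0^'+] --> (0 : R).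
Proof.
move=> ij; pose D := disk (d i) eps0.
have mO : measurable (Omega : set P) by exact: open_measurable_plane.
have mD : measurable (D : set P) by apply: closed_measurable_plane; exact: disk_closed.
have mB : measurable (Omega `\` D : set P) by exact: measurableD.
pose Phi1 z := \1_D z *: V j z : R * R.
pose Phi2 z := \1_(Omega `\` D) z *: V i z : R * R.
have ext A Phi : measurable (A : set P) -> A `<=` Omega -> L2v A Phi -> L2v Omega (fun z => \1_A z *: Phi z : R * R).
  move=> mA AO [/L2P p1 /L2P p2]; split; apply/L2P; [move: p1|move: p2]; congr (sqint _ _); apply/funext => z;
    by rewrite /= /GRing.scale /= mulrA [\1_Omega z * _]mulrC indic_sub.
have L1 : L2v Omega Phi1.
  apply: ext => //; first exact: disks_in.
  apply: (L2v_vortex eps0_gt0 mD); first exact: disks_in.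
  move=> z dz dj; have := disks_disjoint ij.
  by move/seteqP => [/(_ z) h _]; apply: h.
have L2 : L2v Omega Phi2.
  apply: ext => //.
  by apply: (L2v_vortex eps0_gt0 mB) => z [].
have w1 := vortex_weak i L1; have w2 := vortex_weak j L2.
have c : log_scale eps * (log_scale eps * \int[area]_z (\1_(perf eps) z * dot (V i z) (Phi1 z))
   + log_scale eps * \int[area]_z (\1_(perf eps) z * dot (V j z) (Phi2 z))) @[eps --> 0^'+] --> (0 * (0 + 0) : R).
  by apply: cvgM; [exact: log_scale_cvg|exact: cvgD].
rewrite mul0r in c; apply: cvg_trans c; apply: near_eq_cvg; near=> eps.
have e01 : 0 < eps < 1 by near: eps; exact: near_right01.
have /andP[e0 e1] := e01.
have P1 : L2v (perf eps) Phi1 by exact: L2v_perf.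
have P2 : L2v (perf eps) Phi2 by exact: L2v_perf.
have I1 := L1_dot (L2v_vortex_perf i e0) P1.
have I2 := L1_dot (L2v_vortex_perf j e0) P2.
rewrite -mulrDr -(intD I1 I2) mulrA -expr2; congr (_ * _); apply: eq_int => z.
have [pz|npz] := pselect (perf eps z); last by rewrite (indicF npz) !mul0r addr0.
rewrite (indicT pz) !mul1r /Phi1 /Phi2 /dot /= /GRing.scale /=.
have Oz : Omega z := perforated_sub pz.
have [Dz|nDz] := pselect (D z).
  by rewrite (indicT (D := D) Dz) (indicF (D := Omega `\` D)) => [|[_]//]; ring.
by rewrite (indicF (D := D) nDz) (indicT (D := Omega `\` D) (conj Oz nDz)); ring.
Unshelve. all: by end_near. Qed.

End Recovery.

Section DotSum.
Context {R : realType}.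
Implicit Types p q : R * R.

Lemma sum_pair1 (I : Type) (s : seq I) (F : I -> R * R) : (\sum_(i <- s) F i).1 = \sum_(i <- s) (F i).1.
Proof. by elim: s => [|i s IH]; rewrite ?big_nil// !big_cons /= IH. Qed.

Lemma sum_pair2 (I : Type) (s : seq I) (F : I -> R * R) : (\sum_(i <- s) F i).2 = \sum_(i <- s) (F i).2.
Proof. by elim: s => [|i s IH]; rewrite ?big_nil// !big_cons /= IH. Qed.

Lemma dot_suml (I : Type) (s : seq I) (a : I -> R) (F : I -> R * R) q :
  dot (\sum_(i <- s) a i *: F i) q = \sum_(i <- s) a i * dot (F i) q.
Proof.
rewrite /dot sum_pair1 sum_pair2 !mulr_suml -big_split; apply: eq_bigr => i _.
by rewrite /= /GRing.scale /=; ring.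
Qed.

Lemma dot_sumr (I : Type) (s : seq I) (a : I -> R) (F : I -> R * R) q :
  dot q (\sum_(i <- s) a i *: F i) = \sum_(i <- s) a i * dot (F i) q.
Proof. by rewrite dotC dot_suml. Qed.

Lemma polar_density_sum (Cc Rc Kc : R) (I : Type) (s : seq I) (a b : I -> R) (F : I -> R * R) p q :
  polar_density Cc Rc Kc p q (\sum_(i <- s) a i *: F i) (\sum_(i <- s) b i *: F i) =
  \sum_(i <- s) ((Cc * a i + Rc * b i) * dot (F i) p + (Kc * b i + Rc * a i) * dot (F i) q).
Proof.
rewrite /polar_density !dot_sumr [dot _ q]dot_suml -big_split !mulr_sumr -!big_split.
by apply: eq_bigr => i _ /=; ring.
Qed.

Lemma energy_density_sum (Cc Rc Kc : R) (I : Type) (s : seq I) (a b : I -> R) (F : I -> R * R) :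
  energy_density Cc Rc Kc (\sum_(i <- s) a i *: F i) (\sum_(i <- s) b i *: F i) =
  \sum_(i <- s) \sum_(j <- s) 2^-1 * (Cc * a i * a j + Kc * b i * b j + 2 * Rc * a i * b j) * dot (F i) (F j).
Proof.
have E (u v : I -> R) : dot (\sum_(i <- s) u i *: F i) (\sum_(i <- s) v i *: F i) =
    \sum_(i <- s) \sum_(j <- s) u i * v j * dot (F i) (F j).
  rewrite dot_suml; apply: eq_bigr => i _; rewrite dot_sumr mulr_sumr.
  by apply: eq_bigr => j _; rewrite [dot (F j) _]dotC mulrA.
rewrite /energy_density !E !mulr_sumr -!big_split mulr_sumr; apply: eq_bigr => i _.
rewrite !mulr_sumr -!big_split mulr_sumr; apply: eq_bigr => j _ /=; ring.
Qed.

Lemma limf_esup_le_cvg (f : R -> \bar R) (B : R -> R) (l : R) :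
  (\forall eps \near 0^'+, (f eps <= (B eps)%:E)%E) -> B eps @[eps --> 0^'+] --> l ->
  (limf_esup f 0^'+ <= l%:E)%E.
Proof.
move=> fB Bl; apply/lee_addgt0Pr => e e0; rewrite limf_esupE.
apply: (@le_trans _ _ (ereal_sup [set f x | x in [set eps | (f eps <= (l + e)%:E)%E]])).
  apply: ereal_inf_lbound; exists [set eps | (f eps <= (l + e)%:E)%E] => //.
  rewrite /=; near=> eps.
  apply: (@le_trans _ _ (B eps)%:E); first by near: eps.
  rewrite lee_fin; near: eps.
  by apply: (cvgr_le l Bl); rewrite ltrDl.
by apply: ge_ereal_sup => _ [x /= h <-]; rewrite -EFinD.
Unshelve. all: by end_near. Qed.

End DotSum.

(** * The recovery sequence: admissibility and energy *)

Section RecoverySequence.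
Context {R : realType}.
Local Notation area := (@lebesgue_measure R \x @lebesgue_measure R)%E.
Local Notation P := (measurableTypeR R * measurableTypeR R)%type.
Variables (Omega : set (R * R)) (N : nat) (d : 'I_N -> R * R) (eps0 : R).
Hypotheses (oO : open Omega) (bO : bounded_set Omega) (eps0_gt0 : 0 < eps0) (eps0_lt1 : eps0 < 1).
Hypothesis disks_disjoint : forall i j, i != j -> disk (d i) eps0 `&` disk (d j) eps0 = set0.
Hypothesis disks_in : forall i, disk (d i) eps0 `<=` Omega.
Local Notation perf := (perforated Omega d).
Local Notation V i := (vortex (d i)).
Implicit Types (U W : R * R -> R * R) (b : 'I_N -> R).

Definition vortices b z : R * R := \sum_(i < N) b i *: V i z.

(** Inside the holes the vortices are switched off: they are not square-integrable at their centres,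
    and [Jeps] looks only at the perforated domain. *)
Definition recovery U b eps z : R * R :=
  U z + (log_scale eps * \1_(perf eps) z) *: vortices b z.

Lemma L2v_vortices b eps : 0 < eps -> L2v (perf eps) (vortices b).
Proof.
move=> e0; split; apply/L2P.
  have h i : sqint area (fun z : P => b i * (\1_(perf eps) z * (V i z).1)).
    have [/L2P v1 _] := L2v_vortex_perf d oO bO i e0; exact: sqintZ.
  have := sqint_sum (index_enum 'I_N) h; congr (sqint _ _); apply/funext => z.
  rewrite /vortices /= sum_pair1 mulr_sumr; apply: eq_bigr => i _.
  by rewrite /= /GRing.scale /=; ring.
have h i : sqint area (fun z : P => b i * (\1_(perf eps) z * (V i z).2)).
  have [_ /L2P v1] := L2v_vortex_perf d oO bO i e0; exact: sqintZ.
have := sqint_sum (index_enum 'I_N) h; congr (sqint _ _); apply/funext => z.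
rewrite /vortices /= sum_pair2 mulr_sumr; apply: eq_bigr => i _.
by rewrite /= /GRing.scale /=; ring.
Qed.

Lemma L2v_recovery U b eps : 0 < eps -> L2v Omega U -> L2v Omega (recovery U b eps).
Proof.
move=> e0 [/L2P u1 /L2P u2]; have [/L2P v1 /L2P v2] := L2v_vortices b e0.
have S z : \1_Omega z * \1_(perf eps) z = \1_(perf eps) z :> R.
  by rewrite mulrC indic_sub//; exact: perforated_sub.
split; apply/L2P.
  have := sqintD u1 (sqintZ (log_scale eps) v1); congr (sqint _ _); apply/funext => z.
  by rewrite /recovery /= /GRing.scale /= mulrDr -{1}S; ring.
have := sqintD u2 (sqintZ (log_scale eps) v2); congr (sqint _ _); apply/funext => z.
by rewrite /recovery /= /GRing.scale /= mulrDr -{1}S; ring.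
Qed.

Lemma weak_recovery U b : L2v Omega U -> weak_cvg Omega (recovery U b) U.
Proof.
move=> LU Phi LPhi.
have c : \int[area]_z (\1_Omega z * dot (U z) (Phi z)) + \sum_(i < N) b i *
    (log_scale eps * \int[area]_z (\1_(perf eps) z * dot (V i z) (Phi z))) @[eps --> 0^'+] -->
    \int[area]_z (\1_Omega z * dot (U z) (Phi z)) + \sum_(i < N) b i * 0.
  apply: cvgD; first exact: cvg_cst.
  apply: cvg_bigsum => i; apply: cvgM; first exact: cvg_cst.
  exact: vortex_weak.
rewrite big1 ?addr0 in c; last by move=> i _; rewrite mulr0.
rewrite [X in _ --> X]int_in; apply: cvg_trans c; apply: near_eq_cvg; near=> eps.
have e0 : 0 < eps by near: eps; exact: nbhs_right_gt.
have LpP : L2v (perf eps) Phi by exact: L2v_perf.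
have Li i := L1_dot (L2v_vortex_perf d oO bO i e0) LpP.
have LZ i := L1Z (b i) (L1Z (log_scale eps) (Li i)).
rewrite [RHS]int_in.
transitivity (\int[area]_z (\1_Omega z * dot (U z) (Phi z) + \sum_(i < N)
   b i * (log_scale eps * (\1_(perf eps) z * dot (V i z) (Phi z))))).
  rewrite (intD (L1_dot LU LPhi) (L1_sum (index_enum 'I_N) LZ)) (int_sum (index_enum 'I_N) LZ).
  congr (_ + _); apply: eq_bigr => i _.
  by rewrite (intZ (b i) (L1Z _ (Li i))) (intZ _ (Li i)).
apply: eq_int => z; have S := indic_sub z (@perforated_sub _ Omega N d eps).
have S' : \1_Omega z * (log_scale eps * \1_(perf eps) z) = log_scale eps * \1_(perf eps) z.
  by rewrite mulrCA [_ * \1_(perf eps) z]mulrC S.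
have E (p q r : R * R) (k : R) : dot (p + k *: q) r = dot p r + k * dot q r.
  by rewrite /dot /= /GRing.scale /=; ring.
transitivity (\1_Omega z * dot (U z) (Phi z) +
    \1_Omega z * (log_scale eps * \1_(perf eps) z) * dot (vortices b z) (Phi z)); last first.
  by rewrite /recovery E; ring.
rewrite S' /vortices dot_suml mulr_sumr; congr (_ + _).
by apply: eq_bigr => i _; ring.
Unshelve. all: by end_near. Qed.

(** The hypotheses on [phi] cover both conditions to be checked: test functions of the perforated
    domain, with [c] zero, and the cutoffs of [circulation_eq], with [c] an indicator. *)
Lemma trace_vortices U b eps phi (k : R) (c : 'I_N -> R) : 0 < eps -> L2v Omega U -> curl_free Omega U ->
  test_fun Omega phi -> (forall z, ~ perf eps z -> dx phi z = 0 /\ dy phi z = 0) ->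
  (forall i, exists2 r : R, 0 < r & forall z, nrm2 (z - d i) < r -> phi z = c i) ->
  tangential_trace (perf eps) (fun z => k *: U z + vortices b z) phi = - \sum_(i < N) c i * b i.
Proof.
move=> e0 LU cU tphi gphi cphi.
have LpU : L2v (perf eps) U by exact: L2v_perf.
have L1U := L1_trace LpU tphi.
have Li i := L1_trace (L2v_vortex_perf d oO bO i e0) tphi.
have LZ i := L1Z (b i) (Li i).
have TU : tangential_trace (perf eps) U phi = 0.
  rewrite -(cU phi tphi) traceE [RHS]traceE; apply: eq_int => z.
  have [pz|npz] := pselect (perf eps z).
    by rewrite (indicT pz) (indicT (perforated_sub pz)).
  by have [-> ->] := gphi z npz; rewrite !mulr0.
have TV i : tangential_trace (perf eps) (V i) phi = - c i.
  have [r r0 Hr] := cphi i.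
  exact: trace_vortex (test_fun_smooth tphi) (test_fun_bsupp tphi) r0 gphi Hr.
transitivity (k * tangential_trace (perf eps) U phi + \sum_(i < N) b i * tangential_trace (perf eps) (V i) phi).
  rewrite traceE [in RHS]traceE -(intZ _ L1U).
  rewrite (eq_bigr (fun i => \int[area]_z (b i * (\1_(perf eps) z * (V i z).2 * dx phi z - \1_(perf eps) z * (V i z).1 * dy phi z)))); last first.
    by move=> i _; rewrite traceE (intZ _ (Li i)).
  rewrite -(int_sum (index_enum 'I_N) LZ) -(intD (L1Z k L1U) (L1_sum (index_enum 'I_N) LZ)).
  apply: eq_int => z; rewrite /vortices /= sum_pair1 sum_pair2 /GRing.scale /= !mulrDr !mulrDl.
  rewrite !mulr_sumr !mulr_suml opprD addrACA; congr (_ + _); first by ring.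
  by rewrite -sumrB; apply: eq_bigr => i _ /=; rewrite /GRing.scale /=; ring.
rewrite TU mulr0 add0r -sumrN; apply: eq_bigr => i _.
by rewrite TV mulrN mulrC.
Qed.

Lemma scaled_recovery U b eps : 0 < eps < eps0 -> L2v Omega U -> curl_free Omega U ->
  scaled_by Omega d eps (log_scale eps) b (recovery U b eps).
Proof.
move=> /andP[e0 ee] LU cU.
have e1 : 0 < eps < 1 by rewrite e0 (lt_trans ee).
have l0 : log_scale eps != 0 by rewrite gt_eqF// log_scale_gt0.
have [/L2P u1 /L2P u2] : L2v (perf eps) U by exact: L2v_perf.
have [/L2P v1 /L2P v2] := L2v_vortices b e0.
exists (fun z => (log_scale eps)^-1 *: U z + vortices b z); split.
- split; apply/L2P.
    have := sqintD (sqintZ (log_scale eps)^-1 u1) v1; congr (sqint _ _); apply/funext => z.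
    by rewrite /= /GRing.scale /=; ring.
  have := sqintD (sqintZ (log_scale eps)^-1 u2) v2; congr (sqint _ _); apply/funext => z.
  by rewrite /= /GRing.scale /=; ring.
- move=> phi tphi.
  have tphiO := test_fun_subset (@perforated_sub _ Omega N d eps) tphi.
  rewrite (trace_vortices _ _ (c := fun=> 0) e0 LU cU tphiO).
  + by rewrite big1 ?oppr0// => i _; rewrite mul0r.
  + by move=> z nz; split; [exact: test_fun_out (test_fun_dx tphi) nz|exact: test_fun_out (test_fun_dy tphi) nz].
  + move=> i; have [_ _ H] := (test_funP _ _).1 tphi.
    have nd : ~ perf eps (d i) by move=> /perforatedP[_ /(_ i)]; apply; apply: disk_center; exact: ltW.
    have /nbhs_ballP[r /= r0 Hr] := H _ nd.
    by have [e e0' He] := nrm2_ball (d i) r0; exists e => // z /He/Hr.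
- move=> i phi tphi [r er cphi].
  have r0 : 0 < r by exact: lt_trans er.
  rewrite (trace_vortices _ _ (c := fun j => (j == i)%:R) e0 LU cU tphi).
  + rewrite opprK (bigD1 i)//= eqxx mul1r big1 ?addr0// => j /negPf ->.
    by rewrite mul0r.
  + move=> z nz; have [Oz|nOz] := pselect (Omega z); last first.
      by split; [exact: test_fun_out (test_fun_dx tphi) nOz|exact: test_fun_out (test_fun_dy tphi) nOz].
    have [j dj] : exists j, disk (d j) eps z.
      by apply: contrapT => h; apply: nz; apply/perforatedP; split=> // j dj; apply: h; exists j.
    exact: near1_dx (test_fun_smooth tphi) (const_near_disk (ltW e0) er dj (cphi j)).
  + move=> j; exists (r ^+ 2); first by rewrite exprn_gt0.
    by move=> z h; apply: cphi; apply/(diskP _ _ (ltW r0)); exact: ltW.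
- apply: aeW => z pz; rewrite /recovery (indicT pz) mulr1 scalerDr scalerA divff// scale1r.
  by [].
Qed.

Section Energy.
Variables (bu bw : 'I_N -> R) (Cc Rc Kc : R) (U W : R * R -> R * R).
Hypotheses (C0 : 0 < Cc) (CKR : Rc ^+ 2 < Cc * Kc) (LU : L2v Omega U) (LW : L2v Omega W).
Local Notation dens := (energy_density Cc Rc Kc).
Local Notation q i := (Cc * bu i ^+ 2 + Kc * bw i ^+ 2 + 2 * Rc * bu i * bw i).
Local Notation c i j := (2^-1 * (Cc * bu i * bu j + Kc * bw i * bw j + 2 * Rc * bu i * bw j)).

Lemma recovery_energy eps : 0 < eps < 1 ->
  \int[area]_z (\1_(perf eps) z * dens (recovery U bu eps z) (recovery W bw eps z)) =
  \int[area]_z (\1_(perf eps) z * dens (U z) (W z)) +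
  \sum_(i < N) ((Cc * bu i + Rc * bw i) * (log_scale eps * \int[area]_z (\1_(perf eps) z * dot (V i z) (U z))) +
     (Kc * bw i + Rc * bu i) * (log_scale eps * \int[area]_z (\1_(perf eps) z * dot (V i z) (W z)))) +
  \sum_(i < N) \sum_(j < N) c i j * (log_scale eps ^+ 2 * \int[area]_z (\1_(perf eps) z * dot (V i z) (V j z))).
Proof.
move=> /andP[e0 e1]; set l := log_scale eps.
have pU : L2v (perf eps) U by exact: L2v_perf.
have pW : L2v (perf eps) W by exact: L2v_perf.
have Lv i := L2v_vortex_perf d oO bO i e0.
have LiU i := L1_dot (Lv i) pU; have LiW i := L1_dot (Lv i) pW; have Lij i j := L1_dot (Lv i) (Lv j).
have LE := L1_energy Cc Rc Kc pU pW.
have Z1 i := L1Z (Cc * bu i + Rc * bw i) (L1Z l (LiU i)).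
have Z2 i := L1Z (Kc * bw i + Rc * bu i) (L1Z l (LiW i)).
have Z12 i := L1D (Z1 i) (Z2 i).
have Z3 i j := L1Z (c i j) (L1Z (l ^+ 2) (Lij i j)).
have Z4 i := L1_sum (index_enum 'I_N) (Z3 i).
have S1 := L1_sum (index_enum 'I_N) Z12; have S2 := L1_sum (index_enum 'I_N) Z4.
transitivity (\int[area]_z (\1_(perf eps) z * dens (U z) (W z) +
   \sum_(i < N) ((Cc * bu i + Rc * bw i) * (l * (\1_(perf eps) z * dot (V i z) (U z))) +
     (Kc * bw i + Rc * bu i) * (l * (\1_(perf eps) z * dot (V i z) (W z)))) +
   \sum_(i < N) \sum_(j < N) c i j * (l ^+ 2 * (\1_(perf eps) z * dot (V i z) (V j z))))); last first.
  rewrite (intD (L1D LE S1) S2) (intD LE S1) (int_sum (index_enum 'I_N) Z12) (int_sum (index_enum 'I_N) Z4).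
  congr (_ + _ + _); apply: eq_bigr => i _.
    by rewrite (intD (Z1 i) (Z2 i)) (intZ _ (L1Z l (LiU i))) (intZ _ (L1Z l (LiW i))) (intZ _ (LiU i)) (intZ _ (LiW i)).
  rewrite (int_sum (index_enum 'I_N) (Z3 i)); apply: eq_bigr => j _.
  by rewrite (intZ _ (L1Z (l ^+ 2) (Lij i j))) (intZ _ (Lij i j)).
apply: eq_int => z; have [pz|npz] := pselect (perf eps z); last first.
  rewrite (indicF npz) !mul0r add0r !big1 ?addr0// => [i _|i _].
    by rewrite big1// => j _; rewrite mul0r !mulr0.
  by rewrite !mul0r !mulr0 addr0.
rewrite /recovery (indicT pz) mulr1 !mul1r energy_densityD -/l polar_density_sum energy_density_sum.
rewrite !mulr_sumr; congr (_ + _ + _); apply: eq_bigr => i _; first by rewrite mul1r; ring.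
by rewrite mulr_sumr; apply: eq_bigr => j _; rewrite mul1r; ring.
Qed.

(** Only the diagonal vortex terms survive, with limit q_i / 2 times 1 / (2 pi); the terms mixing
    vortices with U or W vanish by [vortex_weak], the others by [vortex_cross]. *)
Lemma recovery_bound : exists B : R -> R,
  (forall eps, 0 < eps < 1 ->
    \int[area]_z (\1_(perf eps) z * dens (recovery U bu eps z) (recovery W bw eps z)) <= B eps) /\
  B eps @[eps --> 0^'+] --> \int[area]_z (\1_Omega z * dens (U z) (W z)) + \sum_(i < N) q i / (4 * pi).
Proof.
have /choice[M HM] := vortex_energy_perf d oO bO.
(* Diagonal terms are replaced by their upper bound, which is legitimate because q_i >= 0;
   off-diagonal coefficients have no sign, so those terms are kept exactly. *)
pose T i j eps := if i == j then q i / 2 * (1 / (2 * pi) + M i * (log_scale eps * log_scale eps)) else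
  c i j * (log_scale eps ^+ 2 * \int[area]_z (\1_(perf eps) z * dot (V i z) (V j z))).
exists (fun eps => \int[area]_z (\1_Omega z * dens (U z) (W z)) +
  \sum_(i < N) ((Cc * bu i + Rc * bw i) * (log_scale eps * \int[area]_z (\1_(perf eps) z * dot (V i z) (U z))) +
     (Kc * bw i + Rc * bu i) * (log_scale eps * \int[area]_z (\1_(perf eps) z * dot (V i z) (W z)))) +
  \sum_(i < N) \sum_(j < N) T i j eps); split.
  move=> eps e01; rewrite recovery_energy//.
  have pU : L2v (perf eps) U by exact: L2v_perf.
  have pW : L2v (perf eps) W by exact: L2v_perf.
  apply: lerD; first rewrite lerD2r.
    apply: int_le; [exact: L1_energy|exact: L1_energy|] => z.
    have h := energy_density_ge0 C0 CKR (U z) (W z).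
    have [pz|npz] := pselect (perf eps z); last by rewrite (indicF npz) mul0r mulr_ge0//; case/andP: (indic01 Omega z).
    by rewrite (indicT pz) (indicT (perforated_sub pz)).
  apply: ler_sum => i _; apply: ler_sum => j _; rewrite /T; case: eqVneq => [<-|//].
  have -> : c i i = q i / 2 by ring.
  apply: ler_wpM2l; first by rewrite divr_ge0//; exact: quadratic_ge0.
  by rewrite -(expr2 (log_scale eps)); exact: ((HM i).2 eps e01).2.
have cc (k : R) : k @[eps --> (0 : R)^'+] --> k by exact: cvg_cst.
have -> : \int[area]_z (\1_Omega z * dens (U z) (W z)) + \sum_(i < N) q i / (4 * pi) =
   \int[area]_z (\1_Omega z * dens (U z) (W z)) + \sum_(i < N) ((Cc * bu i + Rc * bw i) * 0 + (Kc * bw i + Rc * bu i) * 0) +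
   \sum_(i < N) \sum_(j < N) if i == j then q i / 2 * (1 / (2 * pi) + M i * (0 * 0)) else c i j * 0.
  rewrite [in RHS]big1 ?addr0 => [|i _]; last by rewrite !mulr0 addr0.
  congr (_ + _); apply: eq_bigr => i _; rewrite (bigD1 i)//= eqxx big1 ?addr0 => [|j /negPf]; last first.
    by rewrite eq_sym => ->; rewrite mulr0.
  have p0 : pi != 0 :> R by rewrite gt_eqF ?pi_gt0.
  by move: (pi : R) p0 => k k0; field.
apply: cvgD; first apply: cvgD => //.
  apply: cvg_bigsum => i; apply: cvgD; apply: cvgM => //; exact: vortex_weak.
apply: cvg_bigsum => i; apply: cvg_bigsum => j; rewrite /T; case: eqVneq => [_|ij].
  apply: cvgM => //; apply: cvgD => //; apply: cvgM => //; apply: cvgM; exact: log_scale_cvg.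
by apply: cvgM => //; exact: (vortex_cross oO bO eps0_gt0 disks_disjoint disks_in).
Qed.

End Energy.
End RecoverySequence.

(** * Gamma-convergence *)

Lemma ae_and2 dd (T : measurableType dd) (R : realType) (mu : {measure set T -> \bar R})
  (Q1 Q2 Q : T -> Prop) : {ae mu, forall z, Q1 z} -> {ae mu, forall z, Q2 z} ->
  (forall z, Q1 z -> Q2 z -> Q z) -> {ae mu, forall z, Q z}.
Proof. by move=> h1 h2 H; apply: filterS2 H h1 h2. Qed.

Section GammaLimit.
Context {R : realType}.
Local Notation area := (@lebesgue_measure R \x @lebesgue_measure R)%E.
Local Notation P := (measurableTypeR R * measurableTypeR R)%type.

Lemma cvg_right_seq (f : R -> R) (l : R) (u : nat -> R) : f x @[x --> 0^'+] --> l ->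
  (forall n, 0 < u n) -> u n @[n --> \oo] --> (0 : R) -> f (u n) @[n --> \oo] --> l.
Proof. by move=> /cvg_at_rightP h u0 uc; exact: h. Qed.

(** If the lower limit is below A, then every interval (0, min(r, 1/(n+1))) contains a point where f
    < A. Testing with real levels A also covers infinite values of [J] and of the lower limit. *)
Lemma le_limf_einf (f : R -> \bar R) (J : \bar R) (r : R) : 0 < r ->
  (forall (A : R) (eps : nat -> R), (forall n, 0 < eps n < r) -> eps n @[n --> \oo] --> (0 : R) ->
     (forall n, f (eps n) < A%:E)%E -> (J <= A%:E)%E) -> (J <= limf_einf f 0^'+)%E.
Proof.
move=> r0 H.
have HA (A : R) : (limf_einf f 0^'+ < A%:E)%E -> (J <= A%:E)%E.
  move=> lA; pose del n : R := Num.min r n.+1%:R^-1.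
  have del0 n : 0 < del n by rewrite lt_min r0 invr_gt0 ltr0Sn.
  have /choice[eps Heps] : forall n, exists eps, 0 < eps < del n /\ (f eps < A%:E)%E.
    move=> n; pose Vn := [set x : R | 0 < x < del n].
    have nV : (0 : R)^'+ Vn.
      rewrite /Vn /=; near=> x; apply/andP; split; near: x; [exact: nbhs_right_gt|exact: nbhs_right_lt].
    have [|y [x Vx <-] fx] := @ereal_inf_lt _ [set f x | x in Vn] A%:E; last by exists x.
    apply: le_lt_trans lA; rewrite limf_einfE; apply: ereal_sup_ubound; by exists Vn.
  apply: (H A eps) => [n|| n]; last exact: (Heps n).2.
    have [/andP[e0 ed] _] := Heps n; rewrite e0 (lt_le_trans ed)// ge_min lexx //.
  apply: (@squeeze_cvgr _ _ _ _ (fun=> 0) (fun n => n.+1%:R^-1)); [|exact: cvg_cst|exact: cvg_harmonic].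
  near=> n; have [/andP[e0 ed] _] := Heps n; rewrite (ltW e0)/=.
  by apply: ltW; apply: lt_le_trans ed _; rewrite ge_min lexx orbT.
move: HA; case: (limf_einf f _) => [x| |] HA.
- by apply/lee_addgt0Pr => e e0; rewrite -EFinD; apply: HA; rewrite lte_fin ltrDl.
- exact: leey.
- suff -> : J = -oo%E by [].
  case: J H HA => [y| |] _ HA //.
    by have := HA (y - 1) (ltNyr _); rewrite lee_fin lerBrDr gerDl ler10.
  by have := HA 0 (ltNyr _); rewrite leye_eq.
Unshelve. all: by end_near. Qed.

Section Functionals.
Variables (Omega : set (R * R)) (N : nat) (d : 'I_N -> R * R) (bu bw : 'I_N -> R) (Cc Rc Kc : R).
Hypothesis oO : open Omega.
Local Notation perf := (perforated Omega d).
Local Notation dens := (energy_density Cc Rc Kc).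
Local Notation q i := (Cc * bu i ^+ 2 + Kc * bw i ^+ 2 + 2 * Rc * bu i * bw i).

(** A value below a real number excludes the infinite branch of [Jeps], so the constraint holds
    along with the energy bound. *)
Lemma Jeps_scaled eps F G (A : R) : L2v Omega F -> L2v Omega G ->
  (Jeps Omega d bu bw Cc Rc Kc eps F G < A%:E)%E ->
  [/\ scaled_by Omega d eps (log_scale eps) bu F, scaled_by Omega d eps (log_scale eps) bw G &
    \int[area]_z (\1_(perf eps) z * dens (F z) (G z)) <= A].
Proof.
move=> LF LG; rewrite /Jeps; case: asboolP => [[f [g [[[Lf Lg] [cf cg] H] ae]]]|_]; last by rewrite ltNge leey.
have pF : L2v (perf eps) F by exact: L2v_perf.
have pG : L2v (perf eps) G by exact: L2v_perf.
rewrite (integral_in_EFin (L1_energy Cc Rc Kc pF pG)) lte_fin => /ltW h; split => //.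
  exists f; split => // [i|]; first exact: (H i).1.
  by case: ae => B [mB B0 sB]; exists B; split=> // z h'; apply: sB => h''; apply: h' => /h''[].
exists g; split => // [i|]; first exact: (H i).2.
by case: ae => B [mB B0 sB]; exists B; split=> // z h'; apply: sB => h''; apply: h' => /h''[].
Qed.

Lemma scaled_Jeps eps F G : L2v Omega F -> L2v Omega G ->
  scaled_by Omega d eps (log_scale eps) bu F -> scaled_by Omega d eps (log_scale eps) bw G ->
  Jeps Omega d bu bw Cc Rc Kc eps F G = (\int[area]_z (\1_(perf eps) z * dens (F z) (G z)))%:E.
Proof.
move=> LF LG [f [Lf cf Hf aef]] [g [Lg cg Hg aeg]]; rewrite /Jeps asboolT.
  have pF : L2v (perf eps) F by exact: L2v_perf.
  have pG : L2v (perf eps) G by exact: L2v_perf.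
  exact: integral_in_EFin (L1_energy Cc Rc Kc pF pG).
exists f, g; split; first by split => // i; split.
apply: ae_and2 aef aeg _ => z h1 h2 pz; split; [exact: h1|exact: h2].
Qed.

Lemma J0_gradient vu vw U W : L2v Omega U -> L2v Omega W -> H1_gradient Omega vu U -> H1_gradient Omega vw W ->
  J0 Omega bu bw Cc Rc Kc U W =
  (\int[area]_z (\1_Omega z * dens (U z) (W z)) + \sum_(i < N) q i / (4 * pi))%:E.
Proof.
move=> LU LW Hu Hw; rewrite /J0 asboolT; last by exists vu, vw.
by rewrite (integral_in_EFin (L1_energy Cc Rc Kc LU LW)) EFinD.
Qed.

End Functionals.
End GammaLimit.

Theorem theorem1p2 (R : realType) (Omega : set (R * R))
    (Omega_bounded : bounded_set Omega) (Omega_open : open Omega)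
    (Omega_sc : simply_connected Omega)
    (Omega_lip : lipschitz_boundary Omega)
    (N : nat) (N_ge1 : (1 <= N)%N) (d : 'I_N -> R * R)
    (d_inj : injective d) (d_in : forall i, Omega (d i))
    (bu bw : 'I_N -> R) (Cc Rc Kc : R)
    (Cc_gt0 : 0 < Cc) (Kc_gt0 : 0 < Kc) (CKR : Rc ^+ 2 < Cc * Kc)
    (eps0 : R) (eps0_gt0 : 0 < eps0) (eps0_lt1 : eps0 < 1)
    (disks_disjoint : forall i j, i != j ->
       disk (d i) eps0 `&` disk (d j) eps0 = set0)
    (disks_in : forall i, disk (d i) eps0 `<=` Omega)
    (U W : R * R -> R * R) (U_L2 : L2v Omega U) (W_L2 : L2v Omega W) :
  (forall Ue We : R -> R * R -> R * R,
     (forall eps, 0 < eps < eps0 ->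
        L2v Omega (Ue eps) /\ L2v Omega (We eps)) ->
     weak_cvg Omega Ue U -> weak_cvg Omega We W ->
     (J0 Omega bu bw Cc Rc Kc U W
        <= limf_einf (fun eps =>
             Jeps Omega d bu bw Cc Rc Kc eps (Ue eps) (We eps)) 0^'+)%E)
  /\
  (exists Ue We : R -> R * R -> R * R,
     [/\ forall eps, 0 < eps < eps0 ->
           L2v Omega (Ue eps) /\ L2v Omega (We eps),
         weak_cvg Omega Ue U, weak_cvg Omega We W
       & (limf_esup (fun eps =>
             Jeps Omega d bu bw Cc Rc Kc eps (Ue eps) (We eps)) 0^'+
          <= J0 Omega bu bw Cc Rc Kc U W)%E]).
Proof.
(* One dislocation point serves as the base point for the construction of potentials. *)
have D0 : Omega (d (Ordinal N_ge1)) by exact: d_in.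
split=> [Ue We LUW wU wW|].
  apply: (le_limf_einf eps0_gt0) => A eps eps_lt eps_cvg JA.
  have eps0' n : 0 < eps n by case/andP: (eps_lt n).
  have eps01 n : 0 < eps n < 1 by rewrite eps0' (lt_trans _ eps0_lt1)//; case/andP: (eps_lt n).
  have LF n : L2v Omega (Ue (eps n)) by exact: (LUW _ (eps_lt n)).1.
  have LG n : L2v Omega (We (eps n)) by exact: (LUW _ (eps_lt n)).2.
  have S n := Jeps_scaled Omega_open (LF n) (LG n) (JA n).
  have lam_cvg := cvg_right_seq log_scale_cvg eps0' eps_cvg.
  have lam2 n := log_scale_sqr (eps01 n).
  have wF Phi LPhi := cvg_right_seq (wU Phi LPhi) eps0' eps_cvg.
  have wG Phi LPhi := cvg_right_seq (wW Phi LPhi) eps0' eps_cvg.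
  have SF n : scaled_by Omega d (eps n) (log_scale (eps n)) bu (Ue (eps n)) by case: (S n).
  have SG n : scaled_by Omega d (eps n) (log_scale (eps n)) bw (We (eps n)) by case: (S n).
  have EA n : \int[(@lebesgue_measure R \x @lebesgue_measure R)%E]_z (\1_(perforated Omega d (eps n)) z *
     energy_density Cc Rc Kc (Ue (eps n) z) (We (eps n) z)) <= A by case: (S n).
  (* A sequence of bounded energy forces both limits to be curl-free, hence gradients, so that [J0]
     takes its finite form. *)
  have cU := curl_free_limit Omega_open eps0_gt0 disks_disjoint disks_in eps0' eps_cvg lam_cvg LF U_L2 wF SF.
  have cW := curl_free_limit Omega_open eps0_gt0 disks_disjoint disks_in eps0' eps_cvg lam_cvg LG W_L2 wG SG.
  have [vu Hu] := curl_free_gradient Omega_open Omega_bounded Omega_sc Omega_lip D0 U_L2 cU.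
  have [vw Hw] := curl_free_gradient Omega_open Omega_bounded Omega_sc Omega_lip D0 W_L2 cW.
  rewrite (J0_gradient _ _ _ _ _ U_L2 W_L2 Hu Hw) lee_fin.
  exact: (lower_bound Omega_open eps0_gt0 disks_disjoint disks_in Cc_gt0 CKR eps01 eps_cvg lam2 lam_cvg
    LF LG U_L2 W_L2 wF wG SF SG EA).
have [[vu [vw [Hu Hw]]]|nH] := pselect (exists vu vw : R * R -> R,
    H1_gradient Omega vu U /\ H1_gradient Omega vw W); last first.
  (* When (U, W) is not a pair of gradients the bound is +oo, and the constant family will do. *)
  exists (fun=> U), (fun=> W); split => //.
  - by move=> Phi _; exact: cvg_cst.
  - by move=> Phi _; exact: cvg_cst.
  - by rewrite /J0 asboolF// leey.
exists (recovery Omega d U bu), (recovery Omega d W bw).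
have L V b eps : 0 < eps -> L2v Omega V -> L2v Omega (recovery Omega d V b eps).
  by move=> e0; exact: L2v_recovery.
split.
- by move=> eps /andP[e0 _]; split; exact: L.
- exact: weak_recovery.
- exact: weak_recovery.
have [B [HB cB]] := recovery_bound Omega_open Omega_bounded eps0_gt0 disks_disjoint disks_in bu bw
  Cc_gt0 CKR U_L2 W_L2.
rewrite (J0_gradient _ _ _ _ _ U_L2 W_L2 Hu Hw).
apply: (limf_esup_le_cvg _ cB); near=> eps.
have e01 : 0 < eps < eps0.
  by apply/andP; split; near: eps; [exact: nbhs_right_gt|exact: nbhs_right_lt].
have /andP[e0 e1] := e01.
have S V b : L2v Omega V -> curl_free Omega V ->
    scaled_by Omega d eps (log_scale eps) b (recovery Omega d V b eps).
  exact: (scaled_recovery _ Omega_open Omega_bounded eps0_lt1).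
rewrite (scaled_Jeps _ _ _ Omega_open (L _ _ _ e0 U_L2) (L _ _ _ e0 W_L2)
  (S _ _ U_L2 (gradient_curl_free Hu)) (S _ _ W_L2 (gradient_curl_free Hw))).
by rewrite lee_fin; apply: HB; rewrite e0 (lt_trans e1).
Unshelve. all: by end_near. Qed.
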